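(* Let $T>0$ and let $f\ge 0$ be a solution on $[0,T]$ (in the sense defined in the context) of the spatially homogeneous binary-ternary Boltzmann equation $\partial_t f=Q_2(f,f)+Q_3(f,f,f)$ with initial data $f_0\in L^1_2$, $f_0\ge 0$. Write $m_0=m_0[f_0]$ and $m_2=m_2[f_0]$. (1) (Generation) Let $i\in\{2,3\}$ be such that $\gamma_i>0$. For every $q>2$, $$m_q[f](t)\le K_{q,i}\max\{1,\,t^{\frac{2-q}{\gamma_i}}\},\qquad \forall t\in(0,T],$$ for a constant $K_{q,i}>0$ depending on $q,\gamma_i,m_0,m_2$ and independent of $T$. If $\gamma_2>0$ and $\gamma_3>0$, then for every $q>2$ $$m_q[f](t)\le K_q\max\Big\{1,\min\{t^{\frac{2-q}{\gamma_2}},t^{\frac{2-q}{\gamma_3}}\}\Big\},\qquad\forall t\in(0,T],$$ where $K_q=\max\{K_{q,2},K_{q,3}\}>0$ depends on $q,\gamma_2,\gamma_3,m_0,m_2$ and is independent of $T$. (2) (Propagation) Let $q>2$ and suppose $m_q[f_0]<\infty$. Then $$\sup_{t\in[0,T]}m_q[f](t)\le M_q$$ for some constant $M_q>0$ depending on $q,\gamma_2,\gamma_3,m_0,m_2,m_q[f_0]$ and independent of $T$.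
   Context: Let $d\ge2$, $\langle v\rangle=\sqrt{1+|v|^2}$ for $v\in\mathbb R^d$. For $q\ge0$, $L^1_q$ is the Banach space of measurable $f:\mathbb R^d\to\mathbb R$ with $\|f\|_{L^1_q}=\int_{\mathbb R^d}|f(v)|\langle v\rangle^q\,dv<\infty$. For measurable $f(t,v)\ge0$, $m_k[f](t)=\int_{\mathbb R^d}f(t,v)\langle v\rangle^k\,dv$ (similarly for functions of $v$ only). Binary operator. For $v,v_1\in\mathbb R^d$, $\omega\in\mathbb S^{d-1}$ put $u=v_1-v$, $\hat u=u/|u|$, $v'=v+(\omega\cdot u)\omega$, $v_1'=v_1-(\omega\cdot u)\omega$. The cross-section is $B_2(u,\omega)=|u|^{\gamma_2}b_2(\hat u\cdot\omega)$ with $\gamma_2\in[0,2]$ and $b_2:[-1,1]\to[0,\infty)$ even with $b_2(z)(1-z^2)^{\frac{d-3}{2}}\in L^1([-1,1])$; $\|b_2\|:=\int_{\mathbb S^{d-1}}b_2(\hat u\cdot\omega)\,d\omega<\infty$, independent of $\hat u$. Then $$Q_2(f,f)(v)=\int_{\mathbb S^{d-1}\times\mathbb R^d}B_2(u,\omega)\big(f(v')f(v_1')-f(v)f(v_1)\big)\,d\omega\,dv_1 .$$ Ternary operator. For $v,v_1,v_2\in\mathbb R^d$ and $\bm\omega=(\omega_1,\omega_2)\in\mathbb S^{2d-1}\subset\mathbb R^{2d}$ put $\bm u=(v_1-v,v_2-v)$, $\bm u_1=(v-v_1,v_2-v_1)$, $|\tilde{\bm u}|=(|v-v_1|^2+|v-v_2|^2+|v_1-v_2|^2)^{1/2}$.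 With $c=\frac{\bm u\cdot\bm\omega}{1+\omega_1\cdot\omega_2}$ set $v^*=v+c(\omega_1+\omega_2)$, $v_1^*=v_1-c\,\omega_1$, $v_2^*=v_2-c\,\omega_2$. With $c_1=\frac{\bm u_1\cdot\bm\omega}{1+\omega_1\cdot\omega_2}$ set $v^{1*}=v-c_1\omega_1$, $v_1^{1*}=v_1+c_1(\omega_1+\omega_2)$, $v_2^{1*}=v_2-c_1\omega_2$. The cross-section is, for $\bm w\in\{\bm u,\bm u_1\}$ and $\hat{\bm w}=\bm w/|\bm w|$, $$B_3(\bm w,\bm\omega)=|\tilde{\bm u}|^{\gamma_3-\theta_3}|\bm w|^{\theta_3}\,b_3(\hat{\bm w}\cdot\bm\omega,\omega_1\cdot\omega_2),\qquad \gamma_3\in[0,2],\ \theta_3\ge0,$$ where $b_3:[-1,1]\times[-\tfrac12,\tfrac12]\to[0,\infty)$, $b_3(x,y)=|x|^{\theta_3}\phi(y)$, $\phi\in L^\infty([-\tfrac12,\tfrac12])$. Set $\|b_3\|:=\int_{\mathbb S^{2d-1}}b_3(\hat{\bm u}\cdot\bm\omega,\omega_1\cdot\omega_2)\,d\bm\omega<\infty$, which is taken as a standing property to be independent of the direction $\hat{\bm u}\in\mathbb S^{2d-1}$. Then $$Q_3(f,f,f)(v)=\int_{\mathbb S^{2d-1}\times\mathbb R^{2d}}B_3(\bm u,\bm\omega)\big(f(v^* )f(v_1^* )f(v_2^* )-f(v)f(v_1)f(v_2)\big)d\bm\omega\,dv_1dv_2$$ $$\qquad+2\int_{\mathbb S^{2d-1}\times\mathbb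 R^{2d}}B_3(\bm u_1,\bm\omega)\big(f(v^{1*})f(v_1^{1*})f(v_2^{1*})-f(v)f(v_1)f(v_2)\big)d\bm\omega\,dv_1dv_2 .$$ Put $Q[f]=Q_2(f,f)+Q_3(f,f,f)$. Standing assumptions: $\gamma:=\max\{\gamma_2,\gamma_3\}>0$; $\|b_2\|>0$, $\|b_3\|>0$; the initial data satisfy $\int f_0\,dv>0$. The kernels $b_2,b_3$ (and $d,\theta_3$) are fixed, and constants may depend on them. Definition of solution. Let $T>0$, $f_0\in L^1_2$, $f_0\ge0$. A nonnegative $f\in C([0,T],L^1_2)\cap C^1((0,T],L^1_2)\cap L^1_{loc}((0,T),L^1_{2+\gamma})$ is a solution with initial data $f_0$ on $[0,T]$ if $\frac{df}{dt}=Q[f]$ for $t\in(0,T]$, $f(0)=f_0$, and mass, momentum and energy are conserved: $\int f(t,v)\,dv=\int f_0\,dv$, $\int f(t,v)v\,dv=\int f_0 v\,dv$, $\int f(t,v)|v|^2dv=\int f_0|v|^2dv$ for all $t\in[0,T]$. *)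

(* Defs.v *)
From HB Require Import structures.
From mathcomp Require Import all_boot all_order all_algebra.
From mathcomp Require Import all_classical all_reals all_analysis.
From mathcomp Require Import measurable_realfun.

Set Implicit Arguments.
Unset Strict Implicit.
Unset Printing Implicit Defensive.

Import Order.TTheory GRing.Theory Num.Def Num.Theory.
Import numFieldNormedType.Exports.

Local Open Scope classical_set_scope.
Local Open Scope ring_scope.

Section measurable_row_vectors.
Context {R : realType} (n : nat).

Let coord (i : 'I_n) (v : 'rV[R]_n) : R := v ord0 i.

Let rV_set0 : g_sigma_preimage coord set0.
Proof. exact: sigma_algebra0. Qed.

Let rV_setC A : g_sigma_preimage coord A -> g_sigma_preimage coord (~` A).
Proof. exact: sigma_algebraC. Qed.

Let rV_bigcup (F : (set 'rV[R]_n)^nat) :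
  (forall i, g_sigma_preimage coord (F i)) ->
  g_sigma_preimage coord (\bigcup_i (F i)).
Proof. exact: sigma_algebra_bigcup. Qed.

(* The Borel sigma-algebra of R^n. *)
HB.instance Definition _ := @isMeasurable.Build default_measure_display
  'rV[R]_n (g_sigma_preimage coord) rV_set0 rV_setC rV_bigcup.

Lemma measurable_coord (i : 'I_n) :
  measurable_fun [set: 'rV[R]_n] (fun v : 'rV[R]_n => v ord0 i).
Proof.
move=> _ Y mY; rewrite setTI; apply: sub_sigma_algebra => /=.
rewrite -bigcup_seq/=; exists i => /=; first by rewrite mem_index_enum.
by exists Y => //; rewrite setTI.
Qed.

Lemma measurable_fun_rVP d (T : measurableType d) (f : T -> 'rV[R]_n) :
  measurable_fun setT f <->
  forall i, measurable_fun setT (fun x => f x ord0 i).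
Proof.
split=> [mf i|mf].
  exact: (measurableT_comp (measurable_coord i)).
apply: (@measurability _ _ T 'rV[R]_n setT f
  (\big[setU/set0]_(i < n) preimage_set_system setT (coord i) measurable)) => //.
move=> _ /= -[B + <-]; rewrite -bigcup_seq/= => -[i _] /= [A mA <-].
rewrite setTI; exact: mf.
Qed.

End measurable_row_vectors.

Section cons_rV.
Context {R : realType} (n : nat).

Definition cons_rV (p : measurableTypeR R * 'rV[R]_n) : 'rV[R]_n.+1 :=
  \row_i (if unlift ord0 i is Some j then p.2 ord0 j else p.1).

Definition uncons_rV (v : 'rV[R]_n.+1) : measurableTypeR R * 'rV[R]_n :=
  (v ord0 ord0, \row_j v ord0 (lift ord0 j)).

Lemma cons_rVK : cancel cons_rV uncons_rV.
Proof.
case=> x v; rewrite /uncons_rV mxE unlift_none; congr pair.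
by apply/rowP => j; rewrite !mxE liftK.
Qed.

Lemma measurable_cons_rV : measurable_fun setT cons_rV.
Proof.
apply/measurable_fun_rVP => i; under eq_fun do rewrite mxE.
case: (unlift ord0 i) => [j|]; last exact: measurable_fst.
by apply: (measurableT_comp (measurable_coord j)); exact: measurable_snd.
Qed.

Lemma measurable_uncons_rV : measurable_fun setT uncons_rV.
Proof.
apply/measurable_fun_pairP; split; first exact: measurable_coord.
apply/measurable_fun_rVP => i.
by under eq_fun do rewrite mxE; exact: measurable_coord.
Qed.

End cons_rV.

Section product_sfm.
Context {d1 d2 : measure_display} {T1 : measurableType d1}
  {T2 : measurableType d2} {R : realType}.

(* The library proves that m1 \x m2 is sigma-finite but does not register the
   bundled structure needed to iterate the product. *)
Definition product_sfm (m1 : {sigma_finite_measure set T1 -> \bar R})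
    (m2 : {sigma_finite_measure set T2 -> \bar R}) :
    {sigma_finite_measure set (T1 * T2)%type -> \bar R} :=
  HB.pack_for {sigma_finite_measure set (T1 * T2)%type -> \bar R}
    (m1 \x m2)%E
    (lebesgue_integral_fubini.measure_function_Measure_isSigmaFinite__to__measure_function_isSFinite m1 m2)
    (lebesgue_integral_fubini.measure_function_Measure_isSigmaFinite__to__measure_function_isSigmaFinite m1 m2).

End product_sfm.

Section lebesgue_rV.
Context {R : realType}.

Section step.
Context (n : nat).
Variable mu : {sigma_finite_measure set 'rV[R]_n -> \bar R}.

Definition lebesgue_rV_step : set 'rV[R]_n.+1 -> \bar R :=
  pushforward (@lebesgue_measure R \x mu)%E (@cons_rV R n).

Let pf : {measure set 'rV[R]_n.+1 -> \bar R} :=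
  measure_function_pushforward__canonical__measure_function_Measure
    (@lebesgue_measure R \x mu)%E (@measurable_cons_rV R n).

HB.instance Definition _ := isMeasure.Build _ _ _ lebesgue_rV_step
  (measure0 pf) (measure_ge0 pf) (@measure_semi_sigma_additive _ _ _ pf).

Let step_sigma_finite : sigma_finite setT lebesgue_rV_step.
Proof.
have [F TF Foo] := sigma_finiteT (product_sfm (@lebesgue_measure R) mu).
exists (fun k => @uncons_rV R n @^-1` F k).
  by rewrite -preimage_bigcup -TF preimage_setT.
move=> k; have [mF Fk] := Foo k; split.
  by rewrite -[X in measurable X]setTI; exact: measurable_uncons_rV.
rewrite /lebesgue_rV_step /pushforward -comp_preimage.
by rewrite (_ : _ \o _ = id) ?preimage_id//; apply/funext; exact: cons_rVK.
Qed.

HB.instance Definition _ := @Measure_isSigmaFinite.Build _ _ _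
  lebesgue_rV_step step_sigma_finite.

End step.

Fixpoint lebesgue_rV (n : nat) : {sigma_finite_measure set 'rV[R]_n -> \bar R} :=
  if n is m.+1 then lebesgue_rV_step (lebesgue_rV m) else \d_(0 : 'rV[R]_0).

(* Values on boxes, which characterize Lebesgue measure on R^n. *)
Lemma lebesgue_rV_box n (A : 'I_n -> set R) : (forall i, measurable (A i)) ->
  lebesgue_rV n [set v | forall i, A i (v ord0 i)] =
  (\prod_(i < n) lebesgue_measure (A i))%E.
Proof.
elim: n A => [|n IH] A mA /=.
  rewrite big_ord0 diracE mem_set// => -[]//.
rewrite /lebesgue_rV_step /pushforward big_ord_recl -IH => [|i]; last exact: mA.
set B : set 'rV[R]_n := [set v | forall i, A (lift ord0 i) (v ord0 i)].
have mB : measurable B.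
  rewrite (_ : B = \bigcap_i
    ((fun v : 'rV[R]_n => v ord0 i) @^-1` A (lift ord0 i))); last first.
    by apply/seteqP; split=> v Bv i; [move=> _; exact: Bv|exact: Bv].
  apply: fin_bigcap_measurable => // i _.
  by rewrite -[X in measurable X]setTI; exact: measurable_coord.
rewrite (_ : _ @^-1` _ = A ord0 `*` B).
  by rewrite product_measure1E//; exact: (mA ord0).
apply/seteqP; split=> -[x v] /=.
  move=> h; split; first by have := h ord0; rewrite mxE unlift_none.
  by move=> i; have := h (lift ord0 i); rewrite mxE liftK.
by move=> [Ax Bv] i; rewrite mxE; case: unliftP => [j|] ->.
Qed.

End lebesgue_rV.
Arguments lebesgue_rV {R} n.

Section euclidean_space.
Context {R : realType} {n : nat}.
Implicit Types u v : 'rV[R]_n.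

Definition dot u v : R := \sum_(i < n) u ord0 i * v ord0 i.

(* Not `|v|, which is the sup norm on row vectors. *)
Definition enorm v : R := Num.sqrt (dot v v).

(* At v = 0, the value is 0. *)
Definition direction v : 'rV[R]_n := (enorm v)^-1 *: v.

Definition bracket v : R := Num.sqrt (1 + enorm v ^+ 2).

Lemma measurable_enorm : measurable_fun setT enorm.
Proof.
apply: (@measurableT_comp _ _ _ _ _ _ (@Num.sqrt R)).
  by apply: continuous_measurable_fun; exact: sqrt_continuous.
by apply: measurable_sum => i; apply: measurable_funM; exact: measurable_coord.
Qed.

Lemma measurable_direction : measurable_fun setT direction.
Proof.
apply/measurable_fun_rVP => i; under eq_fun do rewrite mxE.
apply: measurable_funM; last exact: measurable_coord.
under eq_fun do rewrite -powR_inv1 ?sqrtr_ge0//.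
by apply: (measurableT_comp (measurable_powR _)); exact: measurable_enorm.
Qed.

Definition punctured_ball : set 'rV[R]_n := [set v | enorm v \in `]0, 1]].

Lemma measurable_punctured_ball : measurable punctured_ball.
Proof.
rewrite (_ : punctured_ball = setT `&` enorm @^-1` `]0, 1]%classic).
  by apply: measurable_enorm => //; exact: measurable_itv.
by rewrite setTI.
Qed.

(* Surface measure dω on the unit sphere, as a measure on R^n carried by the
   sphere: σ(A) = n λ({v | 0 < |v| <= 1, v/|v| ∈ A}). *)
Definition sphere_measure : {measure set 'rV[R]_n -> \bar R} :=
  mscale (n%:R)%:nng
    (measure_function_pushforward__canonical__measure_function_Measure
       (mrestr (lebesgue_rV n) measurable_punctured_ball)
       measurable_direction).

Lemma sphere_measureE A : sphere_measure A =
  (n%:R%:E * lebesgue_rV n ((direction @^-1` A) `&` punctured_ball))%E.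
Proof. by []. Qed.

End euclidean_space.
Arguments sphere_measure {R} n.

Section lebesgue_spaces.
Context {R : realType} {d : nat}.
Local Notation V := 'rV[R]_d.
Local Open Scope ereal_scope.

Definition moment (k : R) (h : V -> R) : \bar R :=
  \int[lebesgue_rV d]_v (h v * bracket v `^ k)%:E.

Definition L1norm (q : R) (h : V -> R) : \bar R :=
  moment q (fun v => `|h v|%R).

Definition L1 (q : R) : set (V -> R) :=
  [set h | measurable_fun setT h /\ L1norm q h < +oo].

(* Curves t |-> f t with values in L^1_q; the elements of L^1_q are functions
   up to equality almost everywhere. *)
Implicit Types (A U : set R) (f g : R -> V -> R).

Definition L1_continuous q A f :=
  forall t, A t -> L1 q (f t) /\
    L1norm q (fun v => f s v - f t v)%R @[s --> within A (nbhs t)] --> 0.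

(* g is the derivative of f : A -> L^1_q; at an endpoint of A the derivative
   is one-sided. *)
Definition L1_derivative q A f g :=
  forall t, A t -> [/\ L1 q (f t), L1 q (g t) &
    L1norm q (fun v => (s - t)^-1 * (f s v - f t v) - g t v)%R
      @[s --> within A t^'] --> 0].

Definition L1_simple q (s : R -> V -> R) :=
  exists (k : nat) (A : 'I_k -> set R) (h : 'I_k -> V -> R),
    [/\ forall i, measurable (A i), forall i, L1 q (h i) &
      forall t v, s t v = (\sum_(i < k) \1_(A i) t * h i v)%R].

Definition L1_strongly_measurable q U f :=
  exists s : nat -> R -> V -> R, (forall n, L1_simple q (s n)) /\
    {ae @lebesgue_measure R, forall t, U t -> L1 q (f t) /\
      L1norm q (fun v => s n t v - f t v)%R @[n --> \oo] --> 0}.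

(* The space L^1_loc(U, L^1_q) of Bochner locally integrable curves. *)
Definition L1_locally_integrable q U f :=
  L1_strongly_measurable q U f /\
  forall K : set R, compact K -> K `<=` U ->
    \int[@lebesgue_measure R]_(t in K) L1norm q (f t) < +oo.

End lebesgue_spaces.

Section cross_sections.
Context {R : realType}.

Definition b2_norm d (b2 : R -> R) (e : 'rV[R]_d) : \bar R :=
  (\int[sphere_measure d]_w (b2 (dot e w))%:E)%E.

(* Finiteness of b2_norm b2 e and its independence of the unit vector e follow
   from b2_integrable and the rotation invariance of the sphere. *)
Record binary_kernel d (b2 : R -> R) : Prop := {
  b2_ge0 : forall z, z \in `[-1, 1] -> 0 <= b2 z;
  b2_even : forall z, z \in `[-1, 1] -> b2 (- z) = b2 z;
  b2_integrable : (@lebesgue_measure R).-integrable `[-1, 1]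
    (fun z => (b2 z * (1 - z ^+ 2) `^ ((d%:R - 3) / 2))%:E);
  b2_norm_gt0 : forall e : 'rV[R]_d, enorm e = 1 -> (0 < b2_norm b2 e)%E }.

Definition b3 (theta3 : R) (phi : R -> R) (x y : R) : R :=
  `|x| `^ theta3 * phi y.

Definition b3_norm d (theta3 : R) (phi : R -> R) (e : 'rV[R]_(d + d)) :
    \bar R :=
  (\int[sphere_measure (d + d)]_w
    (b3 theta3 phi (dot e w) (dot (lsubmx w) (rsubmx w)))%:E)%E.

Record ternary_kernel d (theta3 : R) (phi : R -> R) : Prop := {
  phi_measurable : measurable_fun (`[- 2^-1, 2^-1] : set R) phi;
  phi_ge0 : forall y, y \in `[- 2^-1, 2^-1] -> 0 <= phi y;
  phi_bounded : exists M : R, {ae @lebesgue_measure R,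
    forall y, y \in `[- 2^-1, 2^-1] -> `|phi y| <= M};
  b3_norm_lty : forall e : 'rV[R]_(d + d),
    enorm e = 1 -> (b3_norm theta3 phi e < +oo)%E;
  b3_norm_cst : forall e e' : 'rV[R]_(d + d), enorm e = 1 -> enorm e' = 1 ->
    b3_norm theta3 phi e = b3_norm theta3 phi e';
  b3_norm_gt0 : forall e : 'rV[R]_(d + d),
    enorm e = 1 -> (0 < b3_norm theta3 phi e)%E }.

End cross_sections.

Section collision_operators.
Context {R : realType} {d : nat}.
Local Notation V := 'rV[R]_d.
Implicit Types (f : V -> R) (v : V) (w : 'rV[R]_(d + d)).

Definition B2 (gamma2 : R) (b2 : R -> R) (u omega : V) : R :=
  enorm u `^ gamma2 * b2 (dot (direction u) omega).

Definition Q2 gamma2 b2 f v : R :=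
  \int[(sphere_measure d \x lebesgue_rV d)%E]_p
    (let omega := p.1 in let v1 := p.2 in
     let u := v1 - v in
     let v' := v + dot omega u *: omega in
     let v1' := v1 - dot omega u *: omega in
     B2 gamma2 b2 u omega * (f v' * f v1' - f v * f v1)).

Definition triple_norm v v1 v2 : R :=
  Num.sqrt (enorm (v - v1) ^+ 2 + enorm (v - v2) ^+ 2 + enorm (v1 - v2) ^+ 2).

Definition B3 (gamma3 theta3 : R) (phi : R -> R) v v1 v2 w
    (omega : 'rV[R]_(d + d)) : R :=
  triple_norm v v1 v2 `^ (gamma3 - theta3) * enorm w `^ theta3 *
  b3 theta3 phi (dot (direction w) omega) (dot (lsubmx omega) (rsubmx omega)).

Definition Q3 gamma3 theta3 phi f v : R :=
  \int[(sphere_measure (d + d) \x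
        product_sfm (lebesgue_rV d) (lebesgue_rV d))%E]_p
    (let omega := p.1 in let v1 := p.2.1 in let v2 := p.2.2 in
     let omega1 := lsubmx omega in let omega2 := rsubmx omega in
     let u := row_mx (v1 - v) (v2 - v) in
     let c := dot u omega / (1 + dot omega1 omega2) in
     B3 gamma3 theta3 phi v v1 v2 u omega *
       (f (v + c *: (omega1 + omega2)) * f (v1 - c *: omega1) *
          f (v2 - c *: omega2)
        - f v * f v1 * f v2)) +
  2 * \int[(sphere_measure (d + d) \x
            product_sfm (lebesgue_rV d) (lebesgue_rV d))%E]_p
    (let omega := p.1 in let v1 := p.2.1 in let v2 := p.2.2 in
     let omega1 := lsubmx omega in let omega2 := rsubmx omega in
     let u1 := row_mx (v - v1) (v2 - v1) in
     let c1 := dot u1 omega / (1 + dot omega1 omega2) in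
     B3 gamma3 theta3 phi v v1 v2 u1 omega *
       (f (v - c1 *: omega1) * f (v1 + c1 *: (omega1 + omega2)) *
          f (v2 - c1 *: omega2)
        - f v * f v1 * f v2)).

Definition Q gamma2 b2 gamma3 theta3 phi f v : R :=
  Q2 gamma2 b2 f v + Q3 gamma3 theta3 phi f v.

End collision_operators.

Section solutions.
Context {R : realType} {d : nat}.
Variables (gamma2 : R) (b2 : R -> R) (gamma3 theta3 : R) (phi : R -> R).
Local Notation V := 'rV[R]_d.
Local Notation lambda := (lebesgue_rV d).

Record initial_datum (f0 : V -> R) : Prop := {
  initial_L1 : L1 2 f0;
  initial_ge0 : {ae lambda, forall v, 0 <= f0 v};
  initial_mass_gt0 : 0 < \int[lambda]_v f0 v }.

Record is_solution (T : R) (f0 : V -> R) (f : R -> V -> R) : Prop := {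
  solution_ge0 :
    forall t, t \in `[0, T] -> {ae lambda, forall v, 0 <= f t v};
  solution_continuous : L1_continuous 2 `[0, T] f;
  solution_equation : exists f' : R -> V -> R,
    [/\ L1_derivative 2 `]0, T] f f', L1_continuous 2 `]0, T] f' &
      forall t, t \in `]0, T] ->
        {ae lambda, forall v, f' t v = Q gamma2 b2 gamma3 theta3 phi (f t) v}];
  solution_locally_integrable :
    L1_locally_integrable (2 + Num.max gamma2 gamma3) `]0, T[ f;
  solution_initial : {ae lambda, forall v, f 0 v = f0 v};
  solution_mass : forall t, t \in `[0, T] ->
    \int[lambda]_v f t v = \int[lambda]_v f0 v;
  solution_momentum : forall t, t \in `[0, T] -> forall i : 'I_d,
    \int[lambda]_v (f t v * v ord0 i) = \int[lambda]_v (f0 v * v ord0 i);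
  solution_energy : forall t, t \in `[0, T] ->
    \int[lambda]_v (f t v * enorm v ^+ 2) =
    \int[lambda]_v (f0 v * enorm v ^+ 2) }.

End solutions.

(* Main.v *)
Require Import Defs.
From HB Require Import structures.
From mathcomp Require Import all_boot all_order all_algebra.
From mathcomp Require Import all_classical all_reals all_analysis.
From mathcomp Require Import measurable_realfun ring lra.

Set Implicit Arguments.
Unset Strict Implicit.
Unset Printing Implicit Defensive.

Import Order.TTheory GRing.Theory Num.Def Num.Theory.
Import numFieldNormedType.Exports.

Local Open Scope classical_set_scope.
Local Open Scope ring_scope.

(** The moment of order [q] is bounded by testing the equation against weights
   that grow only like the energy. Write [E] for the square of the bracket of a
   velocity. Let [gamma] be a positive one of the two exponents,
   [eps = gamma / 2] and [beta = (q - 2) / gamma]. For [kappa > 0] put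
   [g E = E ^ eps / (1 + kappa * E ^ eps)] and [Phi E = E * g E ^ beta]. As [Phi]
   grows linearly, the truncated moment [y t], the integral of [f t] against
   [Phi E], is finite and differentiable in time. As [kappa] tends to 0, [Phi E]
   increases to the [q]-th power of the bracket, so that by
   [moment_le_truncated] it suffices to bound [y] independently of [kappa].

   Collisions redistribute the total energy of the particles involved. On the
   one hand [Phi E / E] is nondecreasing, so [Phi] is superadditive and the
   outgoing weights are at most the weight of the total energy. This exceeds
   the incoming weights by cross terms only, even after multiplication by the
   collision rate, because the exponents are at most 2 ([weight_excess]). On the
   other hand, when one particle is much faster than its partners, a set of
   impact directions of positive measure leaves every outgoing particle with at
   most a fixed fraction of the energy ([collide2_shares], [collide3_shares]);
   then a fixed multiple of [Phi E * g E] is lost ([weight_gap]). Averaging over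
   all collisions, [binary_dissipation] and [ternary_dissipation] give
   [y' <= A * y - c * z], where [z] is the integral of [f] against [Phi E * g E].
   One operator is enough to provide the negative term, the other one may have
   the exponent 0.

   By [weight_gain_young], [z >= l * y - l ^ (beta + 1) * m2] for every
   [l >= 0], where [m2] is the conserved moment of order 2. So
   [y' <= (A - c * l) * y + c * l ^ (beta + 1) * m2], with [A] and [c] depending
   on [q], [gamma] and the conserved moments but not on [kappa]. A constant [l]
   gives propagation, and [l] of the order of the inverse of the elapsed time
   gives generation.

   Pairing the collision operators with a weight ([weak_form]) rests on the
   invariance of Lebesgue measure under collisions, which are reflections of
   the space of all velocities ([collide2_preserves], [collide3_preserves]), and
   on gain and loss being separately integrable. The latter holds at times when
   the moment of order [2 + max gamma2 gamma3] is finite, hence almost always;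
   the differential inequality extends to all times by continuity. *)


(** * Measure-preserving maps *)
Section null_sets.
Local Open Scope ereal_scope.
Context {d} {X : measurableType d} {R : realType}.
Variable mu : {measure set X -> \bar R}.
Implicit Types (N : set X) (f g : X -> \bar R).
Import HBNNSimple.

Let ge0_le_integral_off_null N f g : measurable N -> mu N = 0 ->
  (forall x, 0 <= f x) -> (forall x, 0 <= g x) -> (forall x, ~ N x -> f x = g x) ->
  \int[mu]_x f x <= \int[mu]_x g x.
Proof.
move=> mN N0 f0 g0 fg; rewrite !ge0_integralTE//; apply: ge_ereal_sup => _ [h hf <-].
have mC : measurable (~` N) by exact: measurableC.
apply: le_ereal_sup_tmp; exists (sintegral mu (proj_nnsfun h mC)).
  exists (proj_nnsfun h mC) => // x /=.
  rewrite mindicE; case: (boolP (x \in _)) => [|_]; last by rewrite mulr0 g0.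
  by rewrite inE => Nx; rewrite mulr1 -fg.
rewrite -!integralT_nnsfun//=.
have -> : \int[mu]_x (h x)%:E = \int[mu]_(x in setT `\` N) (h x)%:E.
  apply: ge0_negligible_integral => //.
    by apply/measurable_EFinP; exact: measurable_funPT.
  by move=> x _; rewrite lee_fin.
rewrite setTD [in leLHS]integral_mkcond.
apply: ge0_le_integral => //=.
- by move=> x _; rewrite /patch; case: ifP => // _; rewrite lee_fin.
- apply/(measurable_restrictT _ mC); apply/measurable_EFinP.
  exact: measurable_funS (@measurable_funPT _ _ _ _ _).
- by apply/measurable_EFinP; exact: (@measurable_funPT _ _ _ _ (proj_nnsfun h mC)).
move=> x _; rewrite /patch mindicE; case: ifP => _ //=; first by rewrite mulr1.
by rewrite mulr0.
Qed.

(** An integral is a supremum over simple functions, and a simple function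
   loses nothing when it is cut off on [N]. So neither function has to be
   measurable, as is needed for collision integrands, whose cross-sections are
   arbitrary away from the unit sphere. *)
Lemma eq_integral_off_null N f g : measurable N -> mu N = 0 ->
  (forall x, ~ N x -> f x = g x) -> \int[mu]_x f x = \int[mu]_x g x.
Proof.
move=> mN N0 fg; rewrite integralE [RHS]integralE.
by congr (_ - _); apply/eqP; rewrite eq_le; apply/andP; split;
  apply: (ge0_le_integral_off_null mN N0) => // x Nx;
  rewrite ?funeposE ?funenegE fg.
Qed.

End null_sets.

Lemma measurable_fun_comp2 d1 d2 d3 d4 (W : measurableType d1)
    (X : measurableType d2) (Y : measurableType d3) (Z : measurableType d4)
    (F : X -> Y -> Z) (f : W -> X) (g : W -> Y) :
  measurable_fun setT (fun p : X * Y => F p.1 p.2) -> measurable_fun setT f ->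
  measurable_fun setT g -> measurable_fun setT (fun w => F (f w) (g w)).
Proof.
move=> mF mf mg.
exact: (measurableT_comp mF (measurable_fun_pair mf mg)).
Qed.

Section measure_preserving.
Local Open Scope ereal_scope.
Context {R : realType}.

Definition preserves d (X : measurableType d) (mu : set X -> \bar R) (T : X -> X) :=
  measurable_fun setT T /\ forall A, measurable A -> mu (T @^-1` A) = mu A.

Lemma preserves_integral d (X : measurableType d) (mu : {measure set X -> \bar R})
    (T : X -> X) (F : X -> \bar R) :
  preserves mu T -> measurable_fun setT F -> (forall x, 0 <= F x) ->
  \int[mu]_x F (T x) = \int[mu]_x F x.
Proof.
move=> [mT muT] mF F0; have := ge0_integral_pushforward mT mu measurableT mF.
rewrite preimage_setT => <- //.
by apply: eq_measure_integral => A mA _; exact: muT.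
Qed.

Lemma preserves_comp d (X : measurableType d) (mu : set X -> \bar R) S T :
  preserves mu S -> preserves mu T -> preserves mu (S \o T).
Proof.
move=> [mS muS] [mT muT]; split; first exact: measurableT_comp.
move=> A mA; rewrite comp_preimage muT ?muS//.
by rewrite -[X in measurable X]setTI; exact: mS.
Qed.

Lemma preserves_skew d1 d2 (X : measurableType d1) (Y : measurableType d2)
    (m1 : {measure set X -> \bar R}) (m2 : {sigma_finite_measure set Y -> \bar R})
    (S : X -> X) (T : X -> Y -> Y) :
  preserves m1 S -> (forall x, preserves m2 (T x)) ->
  measurable_fun setT (fun p : X * Y => T p.1 p.2) ->
  preserves (m1 \x m2) (fun p => (S p.1, T p.1 p.2)).
Proof.
move=> [mS m1S] m2T mT.
have mST : measurable_fun setT (fun p : X * Y => (S p.1, T p.1 p.2)).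
  by apply: measurable_fun_pair => //; exact: measurableT_comp mS measurable_fst.
split=> // A mA; rewrite /product_measure1/=.
transitivity (\int[m1]_x (m2 \o xsection A) (S x)).
  apply: eq_integral => x _ /=; rewrite -((m2T x).2 _ (measurable_xsection _ mA)).
  by congr (m2 _); apply/seteqP; split=> y; rewrite /xsection/= !inE.
apply: preserves_integral => //; exact: measurable_fun_xsection.
Qed.

Lemma preserves_id d (X : measurableType d) (mu : set X -> \bar R) :
  preserves mu id.
Proof. by split=> [|A mA]; [exact: measurable_id|rewrite preimage_id]. Qed.

Lemma lebesgue_measure_translation (a : R) :
  preserves (@lebesgue_measure R) (fun x : measurableTypeR R => x + a)%R.
Proof.
have mT : measurable_fun setT (fun x : measurableTypeR R => x + a : measurableTypeR R)%R.
  by apply: measurable_funD => //; exact: measurable_cst.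
split=> // A mA.
pose nu : {measure set (measurableTypeR R) -> \bar R} :=
  measure_function_pushforward__canonical__measure_function_Measure
    (@lebesgue_measure R) mT.
rewrite -[LHS]/(nu A); apply/esym/lebesgue_measure_unique => //= _ [[b c]] _ <-.
rewrite /pushforward/=.
rewrite (_ : _ @^-1` _ = `](b - a)%R, (c - a)%R]%classic).
  rewrite !lebesgue_measure_itv/= !lte_fin ltrD2r; case: ifP => // _.
  by rewrite -!EFinD; congr (_%:E); ring.
by apply/seteqP; split=> x /=; rewrite !in_itv/= ltrBlDr lerBrDr.
Qed.

Lemma sigma_finite_tonelli_swap d1 d2 (X : measurableType d1) (Y : measurableType d2)
    (m1 : {sigma_finite_measure set X -> \bar R})
    (m2 : {sigma_finite_measure set Y -> \bar R}) (F : X -> Y -> \bar R) :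
  measurable_fun setT (fun p : X * Y => F p.1 p.2) -> (forall x y, 0 <= F x y) ->
  \int[m1]_x \int[m2]_y F x y = \int[m2]_y \int[m1]_x F x y.
Proof.
move=> mF F0.
have := @fubini_tonelli _ _ _ _ R m1 m2 (fun p => F p.1 p.2) mF.
by move=> -> // p; exact: F0.
Qed.

End measure_preserving.


(** Uniqueness of the Haar measure: Tonelli and translations turn
   [mu (T^-1 A) * mu B] into [mu (T^-1 B) * mu (- A)], and then a ball [B]
   that [T] maps to itself cancels. *)
Section isometries.
Local Open Scope ereal_scope.
Context {d} {X : measurableType d} {R : realType}.
Variable mu : {sigma_finite_measure set X -> \bar R}.
Variables (add : X -> X -> X) (opp : X -> X).
Hypothesis addBK : forall x z, add x (add z (opp x)) = z.
Hypothesis oppB : forall x c, opp (add x (opp c)) = add c (opp x).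
Hypothesis measurable_add : measurable_fun setT (fun p : X * X => add p.1 p.2).
Hypothesis measurable_opp : measurable_fun setT opp.
Hypothesis translation : forall a, preserves mu (add ^~ a).

Let product_flip (T : X -> X) (A B : set X) : measurable_fun setT T ->
  (forall x y, T (add y (opp (T x))) = add (T y) (opp x)) ->
  measurable A -> measurable B ->
  mu (T @^-1` A) * mu B = mu (T @^-1` B) * mu (opp @^-1` A).
Proof.
move=> mT TB mA mB.
have mind (C : set X) (f : X * X -> X) : measurable C -> measurable_fun setT f ->
    measurable_fun setT (fun p => (\1_C (f p))%:E : \bar R).
  move=> mC mf; apply/measurable_EFinP.
  by apply: (measurableT_comp _ mf); exact: measurable_indic.
have mind1 (C : set X) (f : X -> X) : measurable C -> measurable_fun setT f ->
    measurable_fun setT (fun p => (\1_C (f p))%:E : \bar R).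
  move=> mC mf; apply/measurable_EFinP.
  by apply: (measurableT_comp _ mf); exact: measurable_indic.
have muE (C : set X) (f : X -> X) : measurable C -> measurable_fun setT f ->
    mu (f @^-1` C) = \int[mu]_x (\1_C (f x))%:E.
  move=> mC mf; transitivity (\int[mu]_x (\1_(f @^-1` C) x)%:E) => //.
  rewrite integral_indic ?setIT//.
  by rewrite -[X in measurable X]setTI; exact: mf.
have madd d' (Z : measurableType d') (f g : Z -> X) : measurable_fun setT f -> measurable_fun setT g ->
    measurable_fun setT (fun p => add (f p) (g p)).
  by move=> mf mg; exact: (measurableT_comp measurable_add (measurable_fun_pair mf mg)).
have ind0 (C : set X) x : 0 <= (\1_C x)%:E :> \bar R by rewrite lee_fin.
transitivity (\int[mu]_y \int[mu]_x ((\1_A (T y))%:E * (\1_B (add x (T y)))%:E)).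
  rewrite muE// -ge0_integralZr//; last first.
    exact: mind1.
  apply: eq_integral => y _; rewrite ge0_integralZl//; last first.
    by apply: mind1 => //; exact: (translation (T y)).1.
  rewrite (@preserves_integral _ _ _ mu (add^~ (T y)) (fun x => (\1_B x)%:E))//.
    by rewrite integral_indic// setIT.
  exact: mind1.
rewrite sigma_finite_tonelli_swap//; last first.
  apply: emeasurable_funM; apply: mind => //.
    by apply: measurableT_comp mT _.
  by apply: madd => //; apply: measurableT_comp mT _.
transitivity (\int[mu]_x \int[mu]_y ((\1_A (add (T y) (opp x)))%:E * (\1_B (T y))%:E)).
  apply: eq_integral => x _.
  rewrite -(@preserves_integral _ _ _ mu (add^~ (opp (T x))) (fun y =>
      (\1_A (T y))%:E * (\1_B (add x (T y)))%:E))//; last first.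
    by apply: emeasurable_funM; apply: mind1 => //; exact: madd.
  by apply: eq_integral => y _; rewrite TB addBK.
rewrite sigma_finite_tonelli_swap//; last first.
  apply: emeasurable_funM; apply: mind => //; last first.
    by apply: measurableT_comp mT _.
  apply: madd; first by apply: measurableT_comp mT _.
  by apply: measurableT_comp measurable_opp _.
rewrite (muE B)// -ge0_integralZr//; last first.
  exact: mind1.
apply: eq_integral => y _.
under eq_integral do rewrite muleC -oppB.
have mA' : measurable_fun setT (fun x => (\1_A (opp x))%:E : \bar R) by exact: mind1.
rewrite ge0_integralZl//; last first.
  by apply: (measurableT_comp mA'); exact: (translation (opp (T y))).1.
rewrite (@preserves_integral _ _ _ mu (add^~ (opp (T y))) (fun x => (\1_A (opp x))%:E))//.
by rewrite muE.
Qed.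

Lemma isometry_preserves (T : X -> X) (B : set X) : measurable_fun setT T ->
  (forall x y, T (add y (opp (T x))) = add (T y) (opp x)) ->
  measurable B -> 0 < mu B -> mu B < +oo -> T @^-1` B = B ->
  preserves mu T.
Proof.
move=> mT TB mB B0 Boo TBB; split=> // A mA.
have := product_flip mT TB mA mB.
rewrite TBB -(product_flip (@measurable_id _ _ setT) (fun _ _ => erefl) mA mB).
rewrite preimage_id => /eqP; rewrite muleC [X in _ == X]muleC => /eqP E.
have Bfin : mu B \is a fin_num by rewrite ge0_fin_numE.
by apply/eqP; rewrite eq_le -(lee_pmul2l Bfin)// -[X in _ && X](lee_pmul2l Bfin)// E lexx.
Qed.

End isometries.


Section euclidean_measures.
Local Open Scope ereal_scope.
Context {R : realType}.

(** What the uniqueness of the Haar measure requires of a space, in a form that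
   is stable under products. Of [N] only the balls matter, so that a squared
   norm will do. *)
Record euclidean d (X : measurableType d)
    (mu : {sigma_finite_measure set X -> \bar R}) (add : X -> X -> X)
    (opp : X -> X) (N : X -> R) : Prop := {
  euclidean_addBK : forall x z, add x (add z (opp x)) = z;
  euclidean_oppB : forall x c, opp (add x (opp c)) = add c (opp x);
  euclidean_measurable_add : measurable_fun setT (fun p : X * X => add p.1 p.2);
  euclidean_measurable_opp : measurable_fun setT opp;
  euclidean_translation : forall a, preserves mu (add ^~ a);
  euclidean_norm_ge0 : forall x, (0 <= N x)%R;
  euclidean_measurable_norm : measurable_fun setT N;
  euclidean_ball : forall r : R, (0 < r)%R ->
    0 < mu [set x | (N x <= r)%R] < +oo }.

Lemma measurable_le_set d (X : measurableType d) (N : X -> R) (r : R) :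
  measurable_fun setT N -> measurable [set x | (N x <= r)%R].
Proof.
move=> mN; rewrite -[X in measurable X]setTI.
by apply: (measurable_fun_ler mN (@measurable_cst _ _ _ _ _ r)).
Qed.

(** The unit ball of [N] is the set of positive finite measure that [T] maps to
   itself. *)
Lemma euclidean_isometry d (X : measurableType d)
    (mu : {sigma_finite_measure set X -> \bar R}) add opp N (T : X -> X) :
  euclidean mu add opp N -> measurable_fun setT T ->
  (forall x y, T (add x y) = add (T x) (T y)) ->
  (forall x, T (opp x) = opp (T x)) -> (forall x, T (T x) = x) ->
  (forall x, N (T x) = N x) -> preserves mu T.
Proof.
move=> E mT TD TN TT TNN.
have /andP[b0 boo] := euclidean_ball E (@ltr01 R).
apply: (isometry_preserves (euclidean_addBK E) (euclidean_oppB E)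
  (euclidean_measurable_add E) (euclidean_measurable_opp E)
  (euclidean_translation E) mT _ _ b0 boo).
- by move=> x y; rewrite TD TN TT.
- exact: measurable_le_set (euclidean_measurable_norm E).
- by apply/seteqP; split=> x /=; rewrite TNN.
Qed.

Lemma euclidean_prod d1 d2 (X : measurableType d1) (Y : measurableType d2)
    (m1 : {sigma_finite_measure set X -> \bar R})
    (m2 : {sigma_finite_measure set Y -> \bar R}) add1 opp1 N1 add2 opp2 N2 :
  euclidean m1 add1 opp1 N1 -> euclidean m2 add2 opp2 N2 ->
  euclidean (product_sfm m1 m2) (fun p q => (add1 p.1 q.1, add2 p.2 q.2))
    (fun p => (opp1 p.1, opp2 p.2)) (fun p => N1 p.1 + N2 p.2)%R.
Proof.
move=> E1 E2; split.
- by move=> [x y] [z w] /=; rewrite (euclidean_addBK E1) (euclidean_addBK E2).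
- by move=> [x y] [z w] /=; rewrite (euclidean_oppB E1) (euclidean_oppB E2).
- apply: measurable_fun_pair.
    by apply: (measurable_fun_comp2 (euclidean_measurable_add E1));
      apply: measurableT_comp measurable_fst _.
  by apply: (measurable_fun_comp2 (euclidean_measurable_add E2));
    apply: measurableT_comp measurable_snd _.
- apply: measurable_fun_pair.
    exact: measurableT_comp (euclidean_measurable_opp E1) measurable_fst.
  exact: measurableT_comp (euclidean_measurable_opp E2) measurable_snd.
- move=> [a b]; apply: (preserves_skew (euclidean_translation E1 a)
    (fun _ => euclidean_translation E2 b)).
  exact: measurableT_comp (euclidean_translation E2 b).1 measurable_snd.
- by move=> x; rewrite addr_ge0 ?(euclidean_norm_ge0 E1) ?(euclidean_norm_ge0 E2).
- apply: measurable_funD.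
    exact: measurableT_comp (euclidean_measurable_norm E1) measurable_fst.
  exact: measurableT_comp (euclidean_measurable_norm E2) measurable_snd.
move=> r r0; have r20 : (0 < r / 2)%R by rewrite divr_gt0.
have mB1 s := measurable_le_set s (euclidean_measurable_norm E1).
have mB2 s := measurable_le_set s (euclidean_measurable_norm E2).
have /andP[a0 aoo] := euclidean_ball E1 r0.
have /andP[b0 boo] := euclidean_ball E2 r0.
have /andP[c0 coo] := euclidean_ball E1 r20.
have /andP[e0 eoo] := euclidean_ball E2 r20.
have mB : measurable [set x : X * Y | (N1 x.1 + N2 x.2 <= r)%R].
  apply: measurable_le_set; apply: measurable_funD.
    exact: measurableT_comp (euclidean_measurable_norm E1) measurable_fst.
  exact: measurableT_comp (euclidean_measurable_norm E2) measurable_snd.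
apply/andP; split.
  apply: (@lt_le_trans _ _
      ((m1 \x m2) ([set x | (N1 x <= r / 2)%R] `*` [set x | (N2 x <= r / 2)%R]))).
    by rewrite product_measure1E//; apply: mule_gt0.
  apply: le_measure; rewrite ?inE//; first exact: measurableX.
  by move=> [x y] /= [] xr yr; rewrite (splitr r) lerD.
apply: (@le_lt_trans _ _
    ((m1 \x m2) ([set x | (N1 x <= r)%R] `*` [set x | (N2 x <= r)%R]))).
  apply: le_measure; rewrite ?inE//; first exact: measurableX.
  move=> [x y] /= xy; split; apply: le_trans xy.
    by rewrite lerDl (euclidean_norm_ge0 E2).
  by rewrite lerDr (euclidean_norm_ge0 E1).
by rewrite product_measure1E//; apply: lte_mul_pinfty => //; rewrite ?ge0_fin_numE ?ltW.
Qed.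

End euclidean_measures.

Section euclidean_rV.
Context {R : realType}.

Lemma measurable_rVD n : measurable_fun setT (fun p : 'rV[R]_n * 'rV[R]_n => p.1 + p.2).
Proof.
apply/measurable_fun_rVP => i; under eq_fun do rewrite mxE.
by apply: measurable_funD; apply: measurableT_comp (measurable_coord i) _.
Qed.

Lemma measurable_rVN n : measurable_fun setT (fun v : 'rV[R]_n => - v).
Proof.
apply/measurable_fun_rVP => i; under eq_fun do rewrite mxE.
by apply: measurableT_comp; [exact: oppr_measurable|exact: measurable_coord].
Qed.

Lemma measurable_dot d (X : measurableType d) n (f g : X -> 'rV[R]_n) :
  measurable_fun setT f -> measurable_fun setT g ->
  measurable_fun setT (fun x => dot (f x) (g x)).
Proof.
move=> mf mg; apply: measurable_sum => i.
by apply: measurable_funM; apply: measurableT_comp (measurable_coord i) _.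
Qed.

Lemma lebesgue_rV_translation n (a : 'rV[R]_n) :
  preserves (lebesgue_rV n) (fun v => v + a).
Proof.
have mD m (b : 'rV[R]_m) : measurable_fun setT (fun v : 'rV[R]_m => v + b).
  exact: (measurable_fun_comp2 (@measurable_rVD m)).
elim: n a => [a|n IH a]; (split; first exact: mD); move=> A mA; rewrite /preimage/=.
  by rewrite (thinmx0 a); under eq_set do rewrite addr0.
rewrite /lebesgue_rV_step /pushforward.
have [_] := preserves_skew (lebesgue_measure_translation (a ord0 ord0))
  (fun _ => IH (\row_j a ord0 (lift ord0 j)))
  (measurableT_comp (mD _ _) measurable_snd).
have mcA : measurable (@cons_rV R n @^-1` A).
  by rewrite -[X in measurable X]setTI; exact: measurable_cons_rV.
move=> /(_ _ mcA); apply: etrans; congr ((_ \x _)%E _).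
apply/seteqP; split=> -[x v] /=; congr A; apply/rowP => i;
  by rewrite !mxE; case: unliftP => [j|] ->; rewrite ?mxE.
Qed.

Lemma dot_ge0 n (v : 'rV[R]_n) : 0 <= dot v v.
Proof. by apply: sumr_ge0 => i _; rewrite -expr2 sqr_ge0. Qed.

Lemma euclidean_rV n :
  euclidean (lebesgue_rV n) (fun x y : 'rV[R]_n => x + y) (fun x => - x) (fun v => dot v v).
Proof.
split.
- by move=> x z; rewrite addrC subrK.
- by move=> x c; rewrite opprB.
- exact: measurable_rVD.
- exact: measurable_rVN.
- exact: lebesgue_rV_translation.
- exact: dot_ge0.
- exact: measurable_dot.
move=> r r0.
have mB : measurable [set v : 'rV[R]_n | dot v v <= r].
  by apply: measurable_le_set; exact: measurable_dot.
have mbox (A : set R) : measurable A ->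
    measurable [set v : 'rV[R]_n | forall i, A (v ord0 i)].
  move=> mA; rewrite (_ : mkset _ = \bigcap_i
    ((fun v : 'rV[R]_n => v ord0 i) @^-1` A)); last first.
    by apply/seteqP; split=> v Bv i; [move=> _; exact: Bv|exact: Bv].
  apply: fin_bigcap_measurable => // i _.
  by rewrite -[X in measurable X]setTI; exact: measurable_coord.
have box_measure (a b : R) : a < b ->
    (0 < lebesgue_rV n [set v : 'rV[R]_n | forall i, `[a, b]%classic (v ord0 i)] < +oo)%E.
  move=> ab; rewrite (@lebesgue_rV_box R n (fun=> `[a, b]%classic))//.
  apply: (big_ind (fun x => (0 < x < +oo)%E)).
  - by rewrite lte01 ltry.
  - move=> x y /andP[x0 xy] /andP[y0 yy]; rewrite mule_gt0//=.
    by apply: lte_mul_pinfty => //; rewrite ?ge0_fin_numE ?ltW.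
  - move=> i _; rewrite lebesgue_measure_itv/= lte_fin ab -EFinB.
    by rewrite lte_fin subr_gt0 ab ltry.
pose c := Num.sqrt (r / n.+1%:R).
have c0 : 0 < c by rewrite sqrtr_gt0 divr_gt0.
have s0 : 0 < Num.sqrt r by rewrite sqrtr_gt0.
apply/andP; split.
  have /andP[+ _] := box_measure _ _ c0.
  move/lt_le_trans; apply; apply: le_measure; rewrite ?inE//; first exact: mbox.
  move=> v /= vc; apply: (@le_trans _ _ (\sum_(i < n) r / n.+1%:R)).
    apply: ler_sum => i _; have := vc i; rewrite in_itv/= => /andP[v0 vi].
    rewrite -expr2 -[leRHS]sqr_sqrtr; last by rewrite divr_ge0// ltW.
    by rewrite ler_pXn2r// nnegrE ltW.
  rewrite sumr_const card_ord -[leLHS]mulr_natr -mulrA ler_piMr ?(ltW r0)//.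
  by rewrite mulrC ler_pdivrMr// mul1r ler_nat.
have ns0 : - Num.sqrt r < Num.sqrt r by rewrite gtrN.
have /andP[_] := box_measure _ _ ns0.
apply: le_lt_trans.
apply: le_measure; rewrite ?inE//; first exact: mbox.
move=> v /= vr i; rewrite in_itv/= -ler_norml -sqrtr_sqr ler_sqrt ?(ltW r0)//.
apply: le_trans vr; rewrite /dot (bigD1 i)//= -expr2 lerDl.
by apply: sumr_ge0 => j _; rewrite -expr2 sqr_ge0.
Qed.

End euclidean_rV.


(** * Euclidean geometry and the unit sphere *)
Section euclidean_geometry.
Context {R : realType}.

Section fixed_dimension.
Context {n : nat}.
Implicit Types (u v w : 'rV[R]_n) (c : R).

Lemma dotC u v : dot u v = dot v u.
Proof. by apply: eq_bigr => i _; rewrite mulrC. Qed.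

Lemma dotDl u v w : dot (u + v) w = dot u w + dot v w.
Proof. by rewrite -big_split; apply: eq_bigr => i _; rewrite mxE mulrDl. Qed.

Lemma dotZl c u v : dot (c *: u) v = c * dot u v.
Proof. by rewrite /dot mulr_sumr; apply: eq_bigr => i _; rewrite mxE mulrA. Qed.

Lemma dotNl u v : dot (- u) v = - dot u v.
Proof. by rewrite -scaleN1r dotZl mulN1r. Qed.

Lemma dotDr u v w : dot u (v + w) = dot u v + dot u w.
Proof. by rewrite dotC dotDl !(dotC u). Qed.

Lemma dotZr c u v : dot u (c *: v) = c * dot u v.
Proof. by rewrite dotC dotZl dotC. Qed.

Lemma dotNr u v : dot u (- v) = - dot u v.
Proof. by rewrite dotC dotNl dotC. Qed.

Lemma dotBl u v w : dot (u - v) w = dot u w - dot v w.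
Proof. by rewrite dotDl dotNl. Qed.

Lemma dotBr u v w : dot u (v - w) = dot u v - dot u w.
Proof. by rewrite dotDr dotNr. Qed.

Lemma dot0l v : dot 0 v = 0.
Proof. by rewrite -(scale0r v) dotZl mul0r. Qed.

Lemma dot_eq0 v : dot v v = 0 -> v = 0.
Proof.
move=> /eqP; rewrite psumr_eq0; last by move=> i _; rewrite -expr2 sqr_ge0.
move=> /allP v0; apply/rowP => i; rewrite mxE; apply/eqP.
by have := v0 i (mem_index_enum i); rewrite /= -expr2 sqrf_eq0.
Qed.

Lemma enorm_ge0 v : 0 <= enorm v.
Proof. exact: sqrtr_ge0. Qed.

Lemma enorm_sqr v : enorm v ^+ 2 = dot v v.
Proof. by rewrite sqr_sqrtr// dot_ge0. Qed.

Lemma enorm_eq0 v : enorm v = 0 -> v = 0.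
Proof. by move=> v0; apply: dot_eq0; rewrite -enorm_sqr v0 expr0n. Qed.

Lemma enorm0 : enorm (0 : 'rV[R]_n) = 0.
Proof. by rewrite /enorm dot0l sqrtr0. Qed.

Lemma enormZ c v : enorm (c *: v) = `|c| * enorm v.
Proof.
by rewrite /enorm dotZl dotZr mulrA -expr2 sqrtrM ?sqr_ge0// sqrtr_sqr.
Qed.

Lemma enormN v : enorm (- v) = enorm v.
Proof. by rewrite /enorm dotNl dotNr opprK. Qed.

Lemma enorm_direction v : v != 0 -> enorm (direction v) = 1.
Proof.
move=> v0; have nv0 : enorm v != 0 by apply: contra_neq v0; exact: enorm_eq0.
by rewrite enormZ ger0_norm ?invr_ge0 ?enorm_ge0// mulVf.
Qed.

Lemma direction0 : direction (0 : 'rV[R]_n) = 0.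
Proof. by rewrite /direction scaler0. Qed.

Lemma enorm_direction_le1 v : enorm (direction v) <= 1.
Proof.
by have [->|v0] := eqVneq v 0; rewrite ?direction0 ?enorm0// enorm_direction.
Qed.

Lemma enorm_directionK v : enorm v *: direction v = v.
Proof.
have [->|v0] := eqVneq v 0; first by rewrite direction0 scaler0.
have nv0 : enorm v != 0 by apply: contra_neq v0; exact: enorm_eq0.
by rewrite scalerA divff// scale1r.
Qed.

Lemma cauchy_schwarz u v : `|dot u v| <= enorm u * enorm v.
Proof.
have [->|v0] := eqVneq v 0; first by rewrite dotC dot0l normr0 mulr_ge0 ?enorm_ge0.
rewrite -[leLHS]sqrtr_sqr -[leRHS]ger0_norm ?mulr_ge0 ?enorm_ge0// -sqrtr_sqr.
rewrite ler_wsqrtr// exprMn !enorm_sqr.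
have vv : 0 < dot v v.
  by rewrite lt_neqAle dot_ge0 andbT eq_sym; apply: contra_neq v0; exact: dot_eq0.
have := dot_ge0 (dot v v *: u - dot u v *: v).
rewrite dotBl !dotBr !dotZl !dotZr (dotC v u) => H.
by rewrite -subr_ge0 -(pmulr_lge0 _ vv); move: H; congr (is_true (0 <= _)); ring.
Qed.

Lemma enormD u v : enorm (u + v) <= enorm u + enorm v.
Proof.
rewrite -ler_sqr ?nnegrE ?addr_ge0 ?enorm_ge0// sqrrD !enorm_sqr.
rewrite dotDl !dotDr (dotC v u).
have := le_trans (ler_norm _) (cauchy_schwarz u v); lra.
Qed.

Lemma enormB u v : enorm (u - v) <= enorm u + enorm v.
Proof. by rewrite -(enormN v) enormD. Qed.

Lemma lerB_enorm u v : enorm u - enorm v <= enorm (u - v).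
Proof. by rewrite lerBlDr -{1}(subrK v u) enormD. Qed.

(** Reflections and exchanges of coordinates are the only isometries that
   collisions involve; they are their own inverses. *)
Record isometric_involution (T : 'rV[R]_n -> 'rV[R]_n) : Prop := {
  isometric_measurable : measurable_fun setT T;
  isometric_add : forall u v, T (u + v) = T u + T v;
  isometric_scale : forall c v, T (c *: v) = c *: T v;
  isometric_involutive : forall v, T (T v) = v;
  isometric_dot : forall v, dot (T v) (T v) = dot v v }.

Lemma isometric_dot2 T u v : isometric_involution T -> dot (T u) (T v) = dot u v.
Proof.
move=> I; have := isometric_dot I (u + v).
rewrite (isometric_add I) !dotDl !dotDr !(isometric_dot I) (dotC (T v)) (dotC v u).
lra.
Qed.

Lemma isometric_enorm T v : isometric_involution T -> enorm (T v) = enorm v.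
Proof. by move=> I; rewrite /enorm (isometric_dot I). Qed.

Lemma isometric_direction T v : isometric_involution T ->
  direction (T v) = T (direction v).
Proof. by move=> I; rewrite /direction (isometric_enorm _ I) (isometric_scale I). Qed.

Lemma isometric_lebesgue T : isometric_involution T -> preserves (lebesgue_rV n) T.
Proof.
move=> I; apply: (euclidean_isometry (euclidean_rV n) (isometric_measurable I)
  (isometric_add I) _ (isometric_involutive I) (isometric_dot I)).
by move=> v; rewrite -scaleN1r (isometric_scale I) scaleN1r.
Qed.

Lemma isometric_sphere T : isometric_involution T -> preserves (sphere_measure n) T.
Proof.
move=> I; split; first exact: isometric_measurable I.
move=> A mA; rewrite !sphere_measureE; congr (_ * _)%E.
rewrite -[RHS](isometric_lebesgue I).2; last first.
  apply: measurableI; last exact: measurable_punctured_ball.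
  by rewrite -[X in measurable X]setTI; exact: measurable_direction.
congr (lebesgue_rV n _); apply/seteqP.
by split=> v /=; rewrite /punctured_ball/= (isometric_direction _ I) (isometric_enorm _ I).
Qed.

(** At [w = 0] this is the identity, so that [reflection (u - v)] exchanges [u]
   and [v] also when they coincide. *)
Definition reflection w v := v - (2 * dot v w / dot w w) *: w.

Lemma reflection_isometric w : isometric_involution (reflection w).
Proof.
have [->|w0] := eqVneq w 0.
  have -> : reflection 0 = id by apply/funext => v; rewrite /reflection scaler0 subr0.
  by split=> //; exact: measurable_id.
have ww : dot w w != 0 by apply: contra_neq w0; exact: dot_eq0.
have D u v : dot (reflection w u) v = dot u v - 2 * dot u w / dot w w * dot v w.
  by rewrite dotBl dotZl (dotC w).
split.
- apply: measurable_fun_comp2 (@measurable_rVD R n) _ _ => //.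
  apply: measurableT_comp (@measurable_rVN R n) _.
  apply/measurable_fun_rVP => i; under eq_fun do rewrite mxE.
  apply: measurable_funM => //; apply: measurable_funM => //.
  by apply: measurable_funM => //; exact: measurable_dot.
- move=> u v; rewrite /reflection dotDl mulrDr mulrDl scalerDl.
  by rewrite opprD addrACA.
- move=> c v; rewrite /reflection dotZl scalerBr scalerA; congr (_ - _ *: _); ring.
- move=> v; rewrite {1}/reflection D /reflection -addrA -opprD -scalerDl.
  set c := (X in X *: w); suff -> : c = 0 by rewrite scale0r subr0.
  by rewrite /c; field.
- by move=> v; rewrite D (dotC v (reflection w v)) !D; field.
Qed.

Lemma reflection_swap u v : dot u u = dot v v -> reflection (u - v) u = v.
Proof.
move=> uv; have [w0|w0] := eqVneq (u - v) 0.
  by rewrite /reflection w0 scaler0 subr0; apply/eqP; rewrite -subr_eq0 w0.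
have ww : dot (u - v) (u - v) != 0 by apply: contra_neq w0; exact: dot_eq0.
rewrite /reflection (_ : _ / _ = 1) ?scale1r ?subKr//.
apply: (mulIf ww); rewrite divfK// mul1r !dotBl !dotBr uv (dotC v u); ring.
Qed.

End fixed_dimension.


Lemma dot_row_mx m n (a : 'rV[R]_m) (b : 'rV[R]_n) (w : 'rV[R]_(m + n)) :
  dot (row_mx a b) w = dot a (lsubmx w) + dot b (rsubmx w).
Proof.
rewrite /dot big_split_ord/=; congr (_ + _); apply: eq_bigr => i _.
  by rewrite row_mxEl mxE.
by rewrite row_mxEr mxE.
Qed.

Lemma dot_row_mx2 m n (a c : 'rV[R]_m) (b e : 'rV[R]_n) :
  dot (row_mx a b) (row_mx c e) = dot a c + dot b e.
Proof. by rewrite dot_row_mx row_mxKl row_mxKr. Qed.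

Lemma dot_submx m n (w : 'rV[R]_(m + n)) :
  dot w w = dot (lsubmx w) (lsubmx w) + dot (rsubmx w) (rsubmx w).
Proof. by rewrite -{1}(hsubmxK w) dot_row_mx. Qed.

Definition coord_vector n (i : 'I_n) : 'rV[R]_n := delta_mx ord0 i.

Lemma dot_coord_vector n (i : 'I_n) v : dot (coord_vector i) v = v ord0 i.
Proof.
rewrite /dot (bigD1 i)//= big1 ?addr0 ?mxE ?eqxx ?mul1r// => j /negbTE ji.
by rewrite mxE eqxx ji mul0r.
Qed.

Lemma enorm_coord_vector n (i : 'I_n) : enorm (coord_vector i) = 1.
Proof. by rewrite /enorm dot_coord_vector mxE !eqxx sqrtr1. Qed.

End euclidean_geometry.

Lemma measurable_eq_set d (X : measurableType d) (R : realType) (f g : X -> R) :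
  measurable_fun setT f -> measurable_fun setT g -> measurable [set x | f x = g x].
Proof.
move=> mf mg.
rewrite (_ : mkset _ = setT `&` (fun x => f x - g x) @^-1` [set 0]).
  exact: (measurable_funB mf mg measurableT (measurable_set1 0)).
by rewrite setTI; apply/seteqP; split=> x /= => [->|/eqP]; rewrite ?subrr// subr_eq0 => /eqP.
Qed.

Section sphere.
Context {R : realType}.
Local Open Scope ereal_scope.

Lemma lebesgue_rV_coord0 n (i : 'I_n) :
  lebesgue_rV n [set v : 'rV[R]_n | v ord0 i = 0%R] = 0.
Proof.
pose A (j : 'I_n) : set R := if j == i then [set 0%R] else setT.
rewrite (_ : mkset _ = [set v : 'rV[R]_n | forall j, A j (v ord0 j)]).
  rewrite lebesgue_rV_box; last by move=> j; rewrite /A; case: ifP.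
  by rewrite (bigD1 i)//= /A eqxx lebesgue_measure_set1 mul0e.
apply/seteqP; split=> v /=; last by move=> /(_ i); rewrite /A eqxx.
by move=> vi j; rewrite /A; case: eqP => // ->.
Qed.

Lemma measurable_coord0 n (i : 'I_n) :
  measurable [set v : 'rV[R]_n | v ord0 i = 0%R].
Proof.
rewrite -[X in measurable X]setTI.
exact: (measurable_coord i measurableT (measurable_set1 0%R)).
Qed.

Lemma reflect_to_coord n (e : 'rV[R]_n) (i : 'I_n) :
  exists2 T, isometric_involution T &
    forall v, dot e v = (enorm e * (T v) ord0 i)%R.
Proof.
pose f := (enorm e *: coord_vector i)%R.
have ef : dot e e = dot f f.
  by rewrite -!enorm_sqr enormZ enorm_coord_vector mulr1 ger0_norm ?enorm_ge0.
exists (reflection (e - f)); first exact: reflection_isometric.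
move=> v; rewrite -(isometric_dot2 _ _ (reflection_isometric (e - f))).
by rewrite (reflection_swap ef) dotZl dot_coord_vector.
Qed.

Lemma measurable_dotr n (e : 'rV[R]_n) : measurable_fun setT (dot e).
Proof. by apply: measurable_dot; [exact: measurable_cst|exact: measurable_id]. Qed.

Lemma lebesgue_rV_hyperplane n (e : 'rV[R]_n) : e != 0%R ->
  lebesgue_rV n [set v : 'rV[R]_n | dot e v = 0%R] = 0.
Proof.
move=> e0; case: n e e0 => [e|n e e0]; first by rewrite (thinmx0 e) eqxx.
have [T I eT] := reflect_to_coord e ord0.
have ne0 : enorm e != 0%R by apply: contra_neq e0; exact: enorm_eq0.
rewrite -(lebesgue_rV_coord0 (@ord0 n)).
rewrite -[RHS](isometric_lebesgue I).2; last exact: measurable_coord0.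
congr (lebesgue_rV n.+1 _); apply/seteqP; split=> v /=; rewrite eT.
  by move/eqP; rewrite mulf_eq0 (negbTE ne0)/= => /eqP.
by move=> ->; rewrite mulr0.
Qed.

(** Equality in the Cauchy-Schwarz inequality makes the coordinates of [v]
   orthogonal to [e] vanish, and there are some since [2 <= n]. *)
Lemma lebesgue_rV_line n (e : 'rV[R]_n) : (2 <= n)%N -> enorm e = 1%R ->
  lebesgue_rV n [set v : 'rV[R]_n | `|dot e v|%R = enorm v] = 0.
Proof.
case: n e => // -[//|n] e _ e1.
have [T I eT] := reflect_to_coord e ord0.
apply/eqP; rewrite -measure_le0 -(lebesgue_rV_coord0 (lift ord0 (@ord0 n))).
rewrite -(isometric_lebesgue I).2; last exact: measurable_coord0.
apply: le_measure; rewrite ?inE.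
- apply: measurable_eq_set.
    by apply: measurableT_comp => //; exact: measurable_dotr.
  exact: measurable_enorm.
- rewrite -[X in measurable X]setTI; apply: (isometric_measurable I) => //.
  exact: measurable_coord0.
move=> v /=; rewrite eT e1 mul1r -(isometric_enorm _ I) => /(congr1 (fun x => x ^+ 2)%R).
rewrite real_normK ?num_real// enorm_sqr /dot big_ord_recl -expr2 => /eqP.
rewrite -subr_eq0 opprD addNKr oppr_eq0 psumr_eq0; last first.
  by move=> i _; rewrite -expr2 sqr_ge0.
move=> /allP/(_ ord0 (mem_index_enum _)) /=.
by rewrite -expr2 sqrf_eq0 => /eqP.
Qed.

Lemma sphere_finite n : sphere_measure n [set: 'rV[R]_n] < +oo.
Proof.
rewrite sphere_measureE preimage_setT setTI; apply: lte_mul_pinfty => //.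
have /andP[_] := euclidean_ball (euclidean_rV n) (@ltr01 R).
apply: le_lt_trans; apply: le_measure; rewrite ?inE.
- exact: measurable_punctured_ball.
- by apply: measurable_le_set; exact: measurable_dot.
move=> v; rewrite /punctured_ball/= in_itv/= => /andP[_ v1].
by rewrite -enorm_sqr expr_le1// enorm_ge0.
Qed.

Lemma sphere_sigma_finite n : sigma_finite [set: 'rV[R]_n] (sphere_measure n).
Proof.
exists (fun=> setT); first by rewrite bigcup_const.
by move=> _; split=> //; exact: sphere_finite.
Qed.

Definition sphere_sfm n : {sigma_finite_measure set 'rV[R]_n -> \bar R} :=
  HB.pack_for {sigma_finite_measure set 'rV[R]_n -> \bar R}
    (Measure.sort (sphere_measure n))
    (Measure_isSigmaFinite.Build _ _ _ (sphere_measure n) (@sphere_sigma_finite n)).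

Lemma sphere_le n (A B : set 'rV[R]_n) : measurable A -> measurable B ->
  direction @^-1` A `&` punctured_ball `<=` B -> lebesgue_rV n B = 0 ->
  sphere_measure n A = 0.
Proof.
move=> mA mB AB B0; rewrite sphere_measureE.
apply/eqP; rewrite mule_eq0; apply/orP; right; rewrite -measure_le0 -B0.
apply: le_measure; rewrite ?inE//.
apply: measurableI; last exact: measurable_punctured_ball.
by rewrite -[X in measurable X]setTI; exact: measurable_direction.
Qed.

Definition unit_sphere n : set 'rV[R]_n := [set w | enorm w = 1%R].

Lemma measurable_unit_sphere n : measurable (@unit_sphere n).
Proof.
rewrite -[X in measurable X]setTI.
exact: (measurable_enorm measurableT (measurable_set1 1%R)).
Qed.

Lemma punctured_ball_neq0 n (v : 'rV[R]_n) : punctured_ball v -> v != 0%R.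
Proof.
rewrite /punctured_ball/= in_itv/= => /andP[v0 _].
by apply: contraTneq v0 => ->; rewrite enorm0 ltxx.
Qed.

Lemma sphere_carrier n : sphere_measure n (~` @unit_sphere n) = 0.
Proof.
apply: (@sphere_le _ _ set0) => //.
  by apply: measurableC; exact: measurable_unit_sphere.
by move=> v [/= v1 /punctured_ball_neq0 v0]; apply: v1; exact: enorm_direction.
Qed.

Lemma sphere_hyperplane n (e : 'rV[R]_n) : e != 0%R ->
  sphere_measure n [set w | dot e w = 0%R] = 0.
Proof.
move=> e0.
have mH : measurable [set w | dot e w = 0%R].
  rewrite -[X in measurable X]setTI.
  exact: (measurable_dotr e measurableT (measurable_set1 0%R)).
apply: (sphere_le mH mH) (lebesgue_rV_hyperplane e0) => v [/= + _].
rewrite -{2}(enorm_directionK v) dotZr => ->.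
by rewrite mulr0.
Qed.

Lemma sphere_poles n (e : 'rV[R]_n) : (2 <= n)%N -> enorm e = 1%R ->
  sphere_measure n [set w | `|dot e w|%R = enorm w] = 0.
Proof.
move=> n2 e1.
have mH : measurable [set w | `|dot e w|%R = enorm w].
  apply: measurable_eq_set.
    by apply: measurableT_comp => //; exact: measurable_dotr.
  exact: measurable_enorm.
apply: (sphere_le mH mH) (lebesgue_rV_line n2 e1) => v [/=].
rewrite dotZr enormZ normrM => + /punctured_ball_neq0 v0.
have nv0 : enorm v != 0%R by apply: contra_neq v0; exact: enorm_eq0.
by apply: mulfI; rewrite normr_eq0 invr_eq0.
Qed.

End sphere.


(** * Slicing the sphere by a direction *)
Section integrals_on_the_sphere.
Local Open Scope ereal_scope.
Context {R : realType}.

Lemma integral_mrestr d (X : measurableType d) (mu : {measure set X -> \bar R})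
    (D : set X) (mD : measurable D) (F : X -> \bar R) :
  measurable_fun setT F -> (forall x, 0 <= F x) ->
  \int[mrestr mu mD]_x F x = \int[mu]_(x in D) F x.
Proof.
move=> mF F0; have mDC : measurable (~` D) by exact: measurableC.
have r0 : mrestr mu mD (~` D) = 0 by rewrite /mrestr setICl measure0.
have rC0 : mrestr mu mDC D = 0 by rewrite /mrestr setICr measure0.
have mFD : measurable_fun setT (F \_ D).
  by apply/(measurable_restrictT _ mD); exact: measurable_funTS.
have FD0 x : 0 <= (F \_ D) x by rewrite patchE; case: ifP.
rewrite [RHS]integral_mkcond.
rewrite (eq_measure_integral (measure_add (mrestr mu mD) (mrestr mu mDC))); last first.
  move=> A mA _; rewrite /measure_add/= /msum 2!big_ord_recl big_ord0 adde0/=.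
  rewrite /mrestr -measureU//.
  - by rewrite -setIUr setUCr setIT.
  - exact: measurableI.
  - exact: measurableI.
  - by rewrite setIACA setICr setI0.
rewrite ge0_integral_measure_add//.
rewrite [X in _ = _ + X](@eq_integral_off_null _ _ _ _ D _ (cst 0))//; last first.
  by move=> x nDx; rewrite patchE memNset.
rewrite integral0 adde0; apply: (eq_integral_off_null (N := ~` D)) => // x.
by move=> /contrapT Dx; rewrite patchE mem_set.
Qed.

Lemma integral_sphere n (F : 'rV[R]_n -> \bar R) :
  measurable_fun setT F -> (forall x, 0 <= F x) ->
  \int[sphere_measure n]_w F w =
  n%:R%:E * \int[lebesgue_rV n]_(v in punctured_ball) F (direction v).
Proof.
move=> mF F0; rewrite ge0_integral_mscale//; congr (_ * _).
rewrite (ge0_integral_pushforward (@measurable_direction R n))//.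
rewrite preimage_setT integral_mrestr//.
  exact: measurableT_comp mF (@measurable_direction R n).
by move=> v; exact: F0.
Qed.

Lemma measurable_invr : measurable_fun setT (fun x : R => x^-1)%R.
Proof.
rewrite (_ : (fun x => _) = (fun x : R => x * (x ^+ 2) `^ (-1))%R).
  apply: measurable_funM => //.
  exact: (measurableT_comp (measurable_powR (-1)%R)).
apply/funext => x; rewrite powR_inv1 ?sqr_ge0//.
have [->|x0] := eqVneq x 0%R; first by rewrite invr0 mul0r.
by rewrite expr2 invfM mulrA divff// mul1r.
Qed.

(** A change of variables [r = F z] with Jacobian [rho] needs to be checked on
   intervals only: the area of the region under the graph of [rho] and above
   the preimage of a set under [F] is a measure in that set, which agrees with
   Lebesgue measure on intervals. *)
Lemma lebesgue_density (F rho : R -> R) :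
  measurable_fun setT F -> measurable_fun setT rho -> (forall z, 0 <= rho z)%R ->
  (forall b c, (b < c)%R ->
    \int[@lebesgue_measure R]_z (\1_(`]b, c]%classic) (F z) * rho z)%:E = (c - b)%:E) ->
  forall H : R -> \bar R, measurable_fun setT H -> (forall r, 0 <= H r) ->
  \int[@lebesgue_measure R]_r H r = \int[@lebesgue_measure R]_z (H (F z) * (rho z)%:E).
Proof.
move=> mF mrho rho0 Frho H mH H0.
pose U : set (measurableTypeR R * measurableTypeR R) :=
  [set p | p.2 \in `]0%R, rho p.1[].
have mU : measurable U.
  rewrite -[U]setTI (_ : U = [set p | (0 < p.2)%R] `&` [set p | (p.2 < rho p.1)%R]).
    rewrite setTI; apply: measurableI.
      rewrite -[X in measurable X]setTI; apply: measurable_fun_ltr => //.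
    rewrite -[X in measurable X]setTI; apply: measurable_fun_ltr => //.
    exact: measurableT_comp mrho measurable_fst.
  by apply/seteqP; split=> p; rewrite /U/= in_itv/= => /andP.
pose f := F \o (@fst (measurableTypeR R) (measurableTypeR R)).
have mf : measurable_fun setT (f : _ -> measurableTypeR R) by exact: measurableT_comp mF measurable_fst.
pose m : {measure set (measurableTypeR R) -> \bar R} :=
  measure_function_pushforward__canonical__measure_function_Measure
    (mrestr (@lebesgue_measure R \x @lebesgue_measure R) mU) mf.
have intE G : measurable_fun setT G -> (forall r, 0 <= G r) ->
    \int[m]_r G r = \int[@lebesgue_measure R]_z (G (F z) * (rho z)%:E).
  move=> mG G0; rewrite (ge0_integral_pushforward mf)// preimage_setT.
  have mGf : measurable_fun setT (G \o f) by exact: measurableT_comp mG mf.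
  rewrite integral_mrestr//; last by move=> x; exact: G0.
  rewrite integral_mkcond fubini_tonelli1//; last 2 first.
  - by apply/(measurable_restrictT _ mU); exact: measurable_funTS.
  - by move=> x; rewrite patchE; case: ifP => // _; exact: G0.
  apply: eq_integral => z _; rewrite /fubini_F.
  transitivity (\int[@lebesgue_measure R]_(s in `]0%R, rho z[) (G (F z))).
    rewrite [RHS]integral_mkcond; apply: eq_integral => s _.
    by rewrite !patchE /f/= (_ : ((z, s) \in U) = (s \in `]0%R, rho z[%classic)).
  rewrite integral_cst//= lebesgue_measure_itv/= lte_fin.
  case: ltP => rz; first by rewrite sube0.
  by rewrite (_ : rho z = 0%R)//; apply/eqP; rewrite eq_le rz rho0.
rewrite -intE//; apply: eq_measure_integral => A mA _.
apply: lebesgue_measure_unique => // _ [[b c] _ <-]/=.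
have [bc|cb] := ltP b c; last first.
  by rewrite set_itv_ge ?measure0// -leNgt/= bnd_simp.
rewrite lebesgue_measure_itv/= lte_fin bc -EFinB -Frho//.
have mbc : measurable (`]b, c]%classic : set (measurableTypeR R)) by exact: measurable_itv.
transitivity (\int[m]_r (\1_(`]b, c]%classic) r)%:E); last first.
  by rewrite integral_indic ?setIT.
rewrite intE//; last first.
  exact/measurable_EFinP/measurable_indic.
Qed.

End integrals_on_the_sphere.

Section slicing.
Context {R : realType}.
Variable a : R.
Hypothesis a0 : 0 < a.

(** If [a] is the length of [w], then [F z] is the [r] for which the vector with
   first coordinate [r] and other coordinates [w] has a direction whose first
   coordinate is [z]; [rho] is the derivative of [F]. *)
Let F (z : R) : R := a * (z * (1 - z ^+ 2) `^ (- 2^-1)).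
Let rho (z : R) : R := (a * (1 - z ^+ 2) `^ (- (3 / 2))) * \1_(`]-1, 1[%classic) z.

Let pos (z : R) : z \in `]-1, 1[ -> 0 < 1 - z ^+ 2.
Proof.
rewrite in_itv/= => /andP[z1 z2].
by rewrite (_ : 1 - z ^+ 2 = (1 - z) * (1 + z)); [rewrite mulr_gt0//; lra|ring].
Qed.

Let dF (z : R) : z \in `]-1, 1[ -> is_derive z 1 F (a * (1 - z ^+ 2) `^ (- (3 / 2))).
Proof.
move=> z1; have z0 := pos z1.
have D1 : is_derive z 1 (fun y : R => (1 - y ^+ 2) `^ (- 2^-1))
    (z * (1 - z ^+ 2) `^ (- (3 / 2))).
  have Di : is_derive z 1 (fun y : R => 1 - y ^+ 2) (- (2 * z)).
    by apply: is_derive_eq; rewrite /GRing.scale/=; ring.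
  have Dp : is_derive (1 - z ^+ 2) 1 (@powR R ^~ (- 2^-1))
      (- 2^-1 * (1 - z ^+ 2) `^ (- 2^-1 - 1)) by exact: is_derive1_powR.
  move: (@is_derive1_comp R (@powR R ^~ (- 2^-1)) (fun y : R => 1 - y ^+ 2) z _ _ Dp Di).
  congr (is_derive _ _ _ _); rewrite (_ : - 2^-1 - 1 = - (3 / 2)); [by field|lra].
have -> : F = a \*: ((@idfun R) * (fun y : R => (1 - y ^+ 2) `^ (- 2^-1))).
  by apply/funext.
apply: is_derive_eq; rewrite /GRing.scale/= mulr1; congr (_ * _).
rewrite (_ : (1 - z ^+ 2) `^ (- 2^-1) = (1 - z ^+ 2) * (1 - z ^+ 2) `^ (- (3 / 2))).
  ring.
have E : - 2^-1 = 1 - 3 / 2 :> R by lra.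
rewrite E powRD.
by rewrite powRr1// ltW.
by rewrite (gt_eqF z0) implybT.
Qed.

Let F_mono : {in `]-1, 1[ &, {homo F : x y / x < y}}.
Proof.
move=> x y x1 y1 xy; apply: (@gtr0_derive1_lt_oo R F (-1) 1) => //.
- by move=> z z1; have [] := dF z1.
- move=> z z1; rewrite derive1E; have [_ ->] := dF z1.
  by rewrite mulr_gt0// powR_gt0// pos.
- by move=> z; rewrite inE => z1; apply: differentiable_continuous; apply/derivable1_diffP; have [] := dF z1.
Qed.

Let F_le : {in `]-1, 1[ &, {mono F : x y / x <= y}}.
Proof. exact: le_mono_in F_mono. Qed.

Let F_lt : {in `]-1, 1[ &, {mono F : x y / x < y}}.
Proof. exact: leW_mono_in F_le. Qed.

Let G (r : R) : R := r / Num.sqrt (r ^+ 2 + a ^+ 2).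

Let Gpos r : 0 < r ^+ 2 + a ^+ 2.
Proof. by rewrite ltr_wpDl ?sqr_ge0// exprn_gt0. Qed.

Let G_itv r : G r \in `]-1, 1[.
Proof.
have s0 : 0 < Num.sqrt (r ^+ 2 + a ^+ 2) by rewrite sqrtr_gt0.
rewrite in_itv/= -ltr_norml normrM (gtr0_norm (_ : 0 < _^-1)) ?invr_gt0//.
rewrite ltr_pdivrMr// mul1r -sqrtr_sqr ltr_sqrt//.
by rewrite ltrDl exprn_gt0.
Qed.

Let G_sqr r : 1 - G r ^+ 2 = a ^+ 2 / (r ^+ 2 + a ^+ 2).
Proof.
rewrite /G exprMn exprVn sqr_sqrtr ?(ltW (Gpos r))//.
by field; rewrite gt_eqF.
Qed.

Let FGK r : F (G r) = r.
Proof.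
rewrite /F G_sqr powRN powR12_sqrt; last by rewrite divr_ge0 ?sqr_ge0 ?(ltW (Gpos r)).
rewrite sqrtrM ?sqr_ge0// sqrtr_sqr gtr0_norm// sqrtrV ?(ltW (Gpos r))// /G.
have s0 : Num.sqrt (r ^+ 2 + a ^+ 2) != 0 by rewrite gt_eqF ?sqrtr_gt0.
by field; rewrite s0 gt_eqF.
Qed.

Let mF : measurable_fun setT F.
Proof.
apply: measurable_funM => //; apply: measurable_funM => //.
apply: (measurableT_comp (measurable_powR _)).
by apply: measurable_funB.
Qed.

Let mrho : measurable_fun setT rho.
Proof.
apply: measurable_funM; last exact: measurable_indic.
apply: measurable_funM => //; apply: (measurableT_comp (measurable_powR _)).
by apply: measurable_funB.
Qed.

Lemma slice_substitution (H : R -> \bar R) :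
  measurable_fun setT H -> (forall r, 0 <= H r)%E ->
  (\int[@lebesgue_measure R]_r H r =
   \int[@lebesgue_measure R]_z (H (F z) * (rho z)%:E))%E.
Proof.
apply: lebesgue_density => //.
  by move=> z; rewrite mulr_ge0// mulr_ge0 ?(ltW a0)// powR_ge0.
move=> b c bc; have Gbc : G b < G c.
  by rewrite -(F_lt (G_itv _) (G_itv _)) !FGK.
pose f z := a * (1 - z ^+ 2) `^ (- (3 / 2)).
have Gsub z : z \in `[G b, G c] -> z \in `]-1, 1[.
  have := G_itv b; have := G_itv c; rewrite !in_itv/=; lra.
transitivity (\int[@lebesgue_measure R]_(z in `]G b, G c]) (f z)%:E)%E.
  rewrite [RHS]integral_mkcond; apply: eq_integral => z _; rewrite patchE /rho.
  case: (boolP (z \in `]-1, 1[)) => z1; last first.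
    rewrite [in X in _ * X]indicE memNset ?mulr0 ?mulr0/=; last exact/negP.
    rewrite ifF//; apply/negP; rewrite inE/= => zbc; move/negP: z1; apply.
    by apply: Gsub; move: zbc; rewrite !in_itv/=; lra.
  rewrite [in X in _ * X]indicE mem_set// mulr1 indicE.
  rewrite (_ : (F z \in _) = (z \in `]G b, G c]%classic)); last first.
    by apply/idP/idP; rewrite !inE/= !in_itv/= -(F_lt (G_itv _) z1) -(F_le z1 (G_itv _)) !FGK.
  by case: ifP => _; rewrite ?mul1r ?mul0r.
have cf z : z \in `]-1, 1[ -> {for z, continuous f}.
  move=> z1; apply: cvgM; first exact: cvg_cst.
  apply: (@continuous_comp _ _ _ (fun z : R => 1 - z ^+ 2) (@powR R ^~ _)).
    by apply: cvgB; [exact: cvg_cst|exact: exprn_continuous].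
  apply: differentiable_continuous; apply/derivable1_diffP.
  by have [] := @is_derive1_powR R (- (3 / 2)) _ (pos z1).
have cF z : z \in `]-1, 1[ -> {for z, continuous F}.
  by move=> z1; apply: differentiable_continuous; apply/derivable1_diffP; have [] := dF z1.
have Gsub' z : z \in `]G b, G c[ -> z \in `]-1, 1[.
  by move=> zbc; apply: Gsub; move: zbc; rewrite !in_itv/=; lra.
rewrite integral_itv_obnd_cbnd; last first.
  apply/measurable_EFinP; apply: measurable_funTS.
  apply: measurable_funM => //; apply: (measurableT_comp (measurable_powR _)).
  by apply: measurable_funB.
rewrite (@continuous_FTC2 _ f F) ?FGK//.
- apply: continuous_in_subspaceT => z; rewrite inE/= => /Gsub.
  exact: cf.
- split.
  + by move=> z /Gsub' z1; have [] := dF z1.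
  + by apply: cvg_at_right_filter; apply: cF; exact: G_itv.
  + by apply: cvg_at_left_filter; apply: cF; exact: G_itv.
- by move=> z /Gsub' z1; rewrite derive1E; have [_ ->] := dF z1.
Qed.

End slicing.

Section sphere_slicing.
Context {R : realType}.
Local Open Scope ereal_scope.

Lemma enorm_cons_rV n (p : R * 'rV[R]_n) :
  (enorm (cons_rV p) ^+ 2 = p.1 ^+ 2 + enorm p.2 ^+ 2)%R.
Proof.
rewrite !enorm_sqr /dot big_ord_recl !mxE unlift_none expr2; congr (_ + _)%R.
by apply: eq_bigr => i _; rewrite !mxE liftK.
Qed.

Lemma lebesgue_rV_ball_le n (s : R) : (0 < s)%R ->
  lebesgue_rV n [set w : 'rV[R]_n | (enorm w ^+ 2 <= s ^+ 2)%R] <= ((2 * s) ^+ n)%:E.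
Proof.
move=> s0.
rewrite (_ : ((2 * s) ^+ n)%R%:E =
    lebesgue_rV n [set w : 'rV[R]_n | forall i, `[(- s)%R, s]%classic (w ord0 i)]).
  apply: le_measure; rewrite ?inE.
  - apply: measurable_le_set; apply: measurable_funX; exact: measurable_enorm.
  - rewrite (_ : mkset _ = \bigcap_i
      ((fun v : 'rV[R]_n => v ord0 i) @^-1` `[(- s)%R, s]%classic)); last first.
      by apply/seteqP; split=> v Bv i; [move=> _; exact: Bv|exact: Bv].
    apply: fin_bigcap_measurable => // i _.
    by rewrite -[X in measurable X]setTI; exact: measurable_coord.
  move=> w /= ws i; rewrite in_itv/= -ler_norml.
  rewrite -ler_sqr ?nnegrE ?(ltW s0)// real_normK ?num_real//.
  apply: le_trans ws; rewrite enorm_sqr /dot (bigD1 i)//= -expr2 lerDl.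
  by apply: sumr_ge0 => j _; rewrite -expr2 sqr_ge0.
rewrite (@lebesgue_rV_box R n (fun=> `[(- s)%R, s]%classic))//.
have -> : lebesgue_measure `[(- s)%R, s]%classic = (2 * s)%:E :> \bar R.
  rewrite lebesgue_measure_itv/= lte_fin gtrN// -EFinB; congr (_%:E); ring.
by elim: n => [|n IH]; rewrite ?big_ord0// big_ord_recl -IH exprS EFinM.
Qed.

Variable beta : R -> R.
Hypothesis mbeta : measurable_fun setT beta.
Hypothesis beta0 : forall z, (0 <= beta z)%R.

Let slice n (w : 'rV[R]_n) (z : R) : R :=
  (\1_(`](-1)%R, 1%R[%classic) z * beta z * (1 - z ^+ 2) `^ (- (3 / 2)) *
   (enorm w * \1_[set s : R | (s <= 1 - z ^+ 2)%R] (enorm w ^+ 2)))%R.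

Let slice_ge0 n (w : 'rV[R]_n) z : (0 <= slice w z)%R.
Proof. by rewrite /slice !mulr_ge0 ?powR_ge0 ?enorm_ge0. Qed.

Let measurable_1mx2 : measurable_fun setT (fun z : R => 1 - z ^+ 2)%R.
Proof. by apply: measurable_funB. Qed.

Let measurable_slice n :
  measurable_fun setT (fun p : R * 'rV[R]_n => slice p.2 p.1).
Proof.
have mR (f : R -> R) : measurable_fun setT f ->
    measurable_fun setT (fun p : R * 'rV[R]_n => f p.1).
  by move=> mf; exact: measurableT_comp mf measurable_fst.
have mE : measurable_fun setT (fun p : R * 'rV[R]_n => enorm p.2).
  exact: measurableT_comp (@measurable_enorm R n) measurable_snd.
apply: measurable_funM.
  apply: (mR (fun z => \1_(`](-1)%R, 1%R[%classic) z * beta z * (1 - z ^+ 2) `^ (- (3 / 2)))%R).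
  apply: measurable_funM; last exact: (measurableT_comp (measurable_powR _)).
  by apply: measurable_funM => //; exact: measurable_indic.
apply: measurable_funM => //.
rewrite (_ : (fun p => _) = \1_[set p : R * 'rV[R]_n | (enorm p.2 ^+ 2 <= 1 - p.1 ^+ 2)%R]).
  apply: measurable_indic; rewrite -[X in measurable X]setTI.
  apply: measurable_fun_ler => //; first exact: measurable_funX.
  exact: (mR (fun z => 1 - z ^+ 2)%R).
by apply/funext => p; rewrite !indicE; congr (_%:R); apply/idP/idP; rewrite !inE.
Qed.

Let slice_point n (w : 'rV[R]_n) (z : R) : enorm w != 0%R ->
  (\1_punctured_ball (cons_rV (enorm w * (z * (1 - z ^+ 2) `^ (- 2^-1)), w)) *
   beta (direction (cons_rV (enorm w * (z * (1 - z ^+ 2) `^ (- 2^-1)), w)) ord0 ord0) *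
   (enorm w * (1 - z ^+ 2) `^ (- (3 / 2)) * \1_(`](-1)%R, 1%R[%classic) z) =
   slice w z)%R.
Proof.
move=> w0.
have iz : \1_(`](-1)%R, 1%R[%classic) z = (z \in `](-1)%R, 1%R[)%:R :> R.
  by rewrite indicE mem_setE.
rewrite /slice !iz; case: (boolP (z \in `](-1)%R, 1%R[)) => z1; last first.
  by rewrite mulr0 !mul0r mulr0.
rewrite mulr1 mul1r.
have p0 : (0 < 1 - z ^+ 2)%R.
  move: z1; rewrite in_itv/= => /andP[z1 z2].
  by rewrite (_ : 1 - z ^+ 2 = (1 - z) * (1 + z))%R; [rewrite mulr_gt0//; lra|ring].
set r := (enorm w * (z * _))%R; set x := cons_rV (r, w).
have x2 : (enorm x ^+ 2 = enorm w ^+ 2 / (1 - z ^+ 2))%R.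
  rewrite enorm_cons_rV/= /r 2!exprMn powRN powR12_sqrt ?(ltW p0)// exprVn.
  rewrite (_ : Num.sqrt (1 - z ^+ 2) ^+ 2 = 1 - z ^+ 2)%R; last by rewrite sqr_sqrtr ?ltW.
  by field; rewrite gt_eqF.
have s0 : (0 < Num.sqrt (1 - z ^+ 2))%R by rewrite sqrtr_gt0.
have xE : (enorm x = enorm w / Num.sqrt (1 - z ^+ 2))%R.
  rewrite -[LHS]ger0_norm ?enorm_ge0// -sqrtr_sqr x2 sqrtrM ?sqr_ge0//.
  by rewrite sqrtr_sqr ger0_norm ?enorm_ge0// sqrtrV ?(ltW p0).
have -> : direction x ord0 ord0 = z.
  rewrite mxE xE mxE unlift_none /r powRN powR12_sqrt ?(ltW p0)//.
  by rewrite /=; field; rewrite w0 gt_eqF.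
rewrite (_ : \1_punctured_ball x = \1_[set s : R | (s <= 1 - z ^+ 2)%R] (enorm w ^+ 2)%R :> R).
  by ring.
rewrite !indicE; congr ((nat_of_bool _)%:R)%R; apply/idP/idP; rewrite !inE/= /punctured_ball/= in_itv/= => H.
  case/andP: H => _; rewrite -(@expr_le1 _ 2) ?enorm_ge0// x2.
  by rewrite ler_pdivrMr// mul1r.
rewrite -(@expr_le1 _ 2) ?enorm_ge0// x2 ler_pdivrMr// mul1r H andbT.
by rewrite xE divr_gt0// lt_neqAle eq_sym w0 enorm_ge0.
Qed.

Let line_integral n (w : 'rV[R]_n) : enorm w != 0%R ->
  \int[@lebesgue_measure R]_r
    (\1_punctured_ball (cons_rV (r, w)) * beta (direction (cons_rV (r, w)) ord0 ord0))%:E =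
  \int[@lebesgue_measure R]_z (slice w z)%:E.
Proof.
move=> w0; have a0 : (0 < enorm w)%R by rewrite lt_neqAle eq_sym w0 enorm_ge0.
have mcons : measurable_fun setT (fun r : R => cons_rV (r, w)).
  exact: measurableT_comp (@measurable_cons_rV R n) (pair2_measurable w).
rewrite (@slice_substitution R _ a0 (fun r => (\1_punctured_ball (cons_rV (r, w)) *
    beta (direction (cons_rV (r, w)) ord0 ord0))%:E)); last 2 first.
- apply/measurable_EFinP; apply: measurable_funM.
    apply: (measurableT_comp _ mcons); apply: measurable_indic.
    exact: measurable_punctured_ball.
  apply: measurableT_comp mbeta _; apply: (measurableT_comp (measurable_coord ord0)).
  exact: measurableT_comp (@measurable_direction R _) mcons.
- by move=> r; rewrite lee_fin mulr_ge0.
by apply: eq_integral => z _; rewrite -EFinM slice_point.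
Qed.

Let section_integral n (z : R) :
  \int[lebesgue_rV n]_w (slice w z)%:E <=
  ((2 ^+ n * (\1_(`](-1)%R, 1%R[%classic) z * (beta z * (1 - z ^+ 2) `^ ((n%:R - 2) / 2))))%R)%:E.
Proof.
rewrite /slice indicE; case: (boolP (z \in _)) => [|_]; last first.
  by under eq_integral do rewrite !mul0r; rewrite integral0 !mul0r mulr0.
rewrite inE/= in_itv/= => /andP[z1 z2].
have p0 : (0 < 1 - z ^+ 2)%R.
  by rewrite (_ : 1 - z ^+ 2 = (1 - z) * (1 + z))%R; [rewrite mulr_gt0//; lra|ring].
have s0 : (0 < Num.sqrt (1 - z ^+ 2))%R by rewrite sqrtr_gt0.
have sE : (Num.sqrt (1 - z ^+ 2) ^+ 2 = 1 - z ^+ 2)%R by rewrite sqr_sqrtr ?(ltW p0).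
set B := [set w : 'rV[R]_n | (enorm w ^+ 2 <= Num.sqrt (1 - z ^+ 2) ^+ 2)%R].
have mB : measurable B.
  by apply: measurable_le_set; apply: measurable_funX; exact: measurable_enorm.
set c := (beta z * (1 - z ^+ 2) `^ (- (3 / 2)))%R.
have c0 : (0 <= c)%R by rewrite mulr_ge0 ?powR_ge0.
apply: (@le_trans _ _ (\int[lebesgue_rV n]_w
    ((c * Num.sqrt (1 - z ^+ 2))%:E * (\1_B w)%:E))).
  apply: ge0_le_integral => //.
  - by move=> w _; rewrite lee_fin !mulr_ge0 ?powR_ge0 ?enorm_ge0.
  - apply/measurable_EFinP.
    have : measurable_fun setT (fun w : 'rV[R]_n => slice w z).
      exact: (measurableT_comp (@measurable_slice n) (pair1_measurable z)).
    by rewrite /slice/= indicE mem_set//= in_itv/= z1.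
  - by apply: measurable_funeM; apply/measurable_EFinP; exact: measurable_indic.
  move=> w _; rewrite -EFinM lee_fin mul1r -[leRHS]mulrA; apply: ler_wpM2l => //.
  rewrite !indicE (_ : ((enorm w ^+ 2)%R \in [set s : R | (s <= 1 - z ^+ 2)%R]) = (w \in B)); last first.
    by rewrite /B sE; apply/idP/idP; rewrite !inE.
  case: (boolP (w \in B)) => [|_]; last by rewrite !mulr0.
  rewrite inE /B/= => wB; rewrite !mulr1.
  by rewrite -ler_sqr ?nnegrE ?enorm_ge0 ?(ltW s0).
rewrite ge0_integralZl//; last 2 first.
- by first [by apply/measurable_EFinP; exact: measurable_indic | by rewrite lee_fin mulr_ge0// ltW | by move=> w _; rewrite lee_fin].
- by first [by apply/measurable_EFinP; exact: measurable_indic | by rewrite lee_fin mulr_ge0// ltW | by move=> w _; rewrite lee_fin].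
rewrite integral_indic// setIT.
apply: (@le_trans _ _ ((c * Num.sqrt (1 - z ^+ 2))%:E * ((2 * Num.sqrt (1 - z ^+ 2)) ^+ n)%:E)).
  apply: lee_wpmul2l; first by rewrite lee_fin mulr_ge0// ltW.
  exact: lebesgue_rV_ball_le.
rewrite -EFinM lee_fin mul1r exprMn /c.
rewrite -powR12_sqrt ?(ltW p0)// -(powR_mulrn n (powR_ge0 (1 - z ^+ 2)%R 2^-1)) -powRrM.
rewrite mulrCA -!mulrA; do 2 (apply: ler_wpM2l; first by rewrite ?exprn_ge0).
rewrite -!powRD ?(gt_eqF p0) ?implybT//.
by rewrite (_ : - (3 / 2) + (2^-1 + 2^-1 * n%:R) = (n%:R - 2) / 2 :> R)%R//; field.
Qed.

(** The right-hand side has the weight of the integrability hypothesis on [b2].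
   An upper bound is enough, so that the volume of a section of the unit ball
   can be replaced with that of a cube. *)
Lemma sphere_slicing n :
  \int[sphere_measure n.+2]_w (beta (w ord0 ord0))%:E <=
  (n.+2%:R * 2 ^+ n.+1)%:E *
  \int[@lebesgue_measure R]_(z in `](-1)%R, 1%R[)
     (beta z * (1 - z ^+ 2) `^ ((n.+2%:R - 3) / 2))%:E.
Proof.
rewrite integral_sphere; last 2 first.
- by apply/measurable_EFinP; exact: measurableT_comp mbeta (measurable_coord ord0).
- by move=> w; rewrite lee_fin.
rewrite EFinM -muleA; apply: lee_wpmul2l => //.
pose K (v : 'rV[R]_n.+2) := (\1_punctured_ball v * beta (direction v ord0 ord0))%R.
have mK : measurable_fun setT K.
  apply: measurable_funM; first by apply: measurable_indic; exact: measurable_punctured_ball.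
  apply: measurableT_comp mbeta _; apply: (measurableT_comp (measurable_coord ord0)).
  exact: measurable_direction.
have K0 v : (0 <= K v)%R by rewrite mulr_ge0.
have -> : \int[lebesgue_rV n.+2]_(v in punctured_ball) (beta (direction v ord0 ord0))%:E =
    \int[lebesgue_rV n.+2]_v (K v)%:E.
  rewrite integral_mkcond; apply: eq_integral => v _.
  by rewrite patchE /K indicE; case: ifP; rewrite ?mul1r ?mul0r.
have mKc : measurable_fun setT (fun p : measurableTypeR R * 'rV[R]_n.+1 => (K (cons_rV p))%:E).
  by apply/measurable_EFinP; exact: measurableT_comp mK (@measurable_cons_rV R _).
have -> : \int[lebesgue_rV n.+2]_v (K v)%:E =
    \int[@lebesgue_measure R \x lebesgue_rV n.+1]_p (K (cons_rV p))%:E.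
  rewrite (ge0_integral_pushforward (@measurable_cons_rV R n.+1)) ?preimage_setT//.
    by apply/measurable_EFinP.
  by move=> v _; rewrite lee_fin.
rewrite fubini_tonelli2//; last by move=> p; rewrite lee_fin.
rewrite (@eq_integral_off_null _ _ _ _ [set w : 'rV[R]_n.+1 | w ord0 ord0 = 0%R] _
    (fun w => \int[@lebesgue_measure R]_z (slice w z)%:E)); last 3 first.
- exact: measurable_coord0.
- exact: lebesgue_rV_coord0.
- move=> w /= w0; rewrite /fubini_G line_integral//; apply: contra_not_neq w0.
  by move=> /enorm_eq0 ->; rewrite mxE.
rewrite sigma_finite_tonelli_swap//; last 2 first.
- apply/measurable_EFinP.
  exact: (measurable_fun_comp2 (F := fun z w => slice w z) (@measurable_slice n.+1)
    measurable_snd measurable_fst).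
- by move=> w z; rewrite lee_fin slice_ge0.
have mint : measurable_fun setT (fun z : R => (\1_(`](-1)%R, 1%R[%classic) z *
    (beta z * (1 - z ^+ 2) `^ ((n.+1%:R - 2) / 2)))%:E : \bar R).
  apply/measurable_EFinP; apply: measurable_funM; first exact: measurable_indic.
  by apply: measurable_funM => //; apply: (measurableT_comp (measurable_powR _)).
apply: (@le_trans _ _ (\int[@lebesgue_measure R]_z ((2 ^+ n.+1)%:E *
    (\1_(`](-1)%R, 1%R[%classic) z * (beta z * (1 - z ^+ 2) `^ ((n.+1%:R - 2) / 2)))%:E))).
  apply: ge0_le_integral => //.
  - by move=> z _; apply: integral_ge0 => w _; rewrite lee_fin.
  - apply: (@measurable_fun_fubini_tonelli_F _ _ _ _ _ (lebesgue_rV n.+1)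
      (fun p : measurableTypeR R * 'rV[R]_n.+1 => (slice p.2 p.1)%:E)).
      by apply/measurable_EFinP; exact: measurable_slice.
    by move=> p; rewrite lee_fin.
  - exact: measurable_funeM.
rewrite ge0_integralZl//; last first.
  by move=> z _; rewrite lee_fin !mulr_ge0// powR_ge0.
apply: lee_wpmul2l; first by rewrite lee_fin exprn_ge0.
rewrite [leRHS]integral_mkcond le_eqVlt; apply/orP; left; apply/eqP.
apply: eq_integral => z _; rewrite patchE indicE.
rewrite (_ : n.+2%:R - 3 = n.+1%:R - 2 :> R)%R; last by rewrite -(@natr1 R n.+1); ring.
by case: ifP; rewrite ?mul1r ?mul0r.
Qed.

End sphere_slicing.


(** * Angular averages of the cross-sections *)
Section angular_averages.
Context {R : realType}.

Lemma sphere_dot_integral n (e : 'rV[R]_n) (i : 'I_n) (F : R -> \bar R) :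
  enorm e = 1 -> measurable_fun setT F -> (forall z, 0 <= F z)%E ->
  (\int[sphere_measure n]_w F (dot e w) = \int[sphere_measure n]_w F (w ord0 i))%E.
Proof.
move=> e1 mF F0; have [T I eT] := reflect_to_coord e i.
under eq_integral do rewrite eT e1 mul1r.
have := @preserves_integral R _ _ (sphere_measure n) T (fun w => F (w ord0 i))
  (isometric_sphere I); apply => //.
exact: measurableT_comp mF (measurable_coord i).
Qed.

Lemma ge0_integral0_ae d (X : measurableType d) (mu : {measure set X -> \bar R})
    (F : X -> R) : measurable_fun setT F -> (forall x, 0 <= F x) ->
  (\int[mu]_x (F x)%:E = 0)%E -> {ae mu, forall x, F x = 0}.
Proof.
move=> mF F0 I0.
have : (\int[mu]_x `|(F x)%:E| = 0)%E.
  by rewrite -I0; apply: eq_integral => x _; rewrite gee0_abs ?lee_fin.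
move/ae_eq_integral_abs => /(_ measurableT) H.
have : ae_eq mu setT (EFin \o F) (cst 0%E) by apply: H; exact/measurable_EFinP.
by apply: filterS => x /(_ Logic.I) /= [].
Qed.

Lemma ae_integral0 d (X : measurableType d) (mu : {measure set X -> \bar R})
    (F : X -> R) : {ae mu, forall x, F x = 0} -> (\int[mu]_x (F x)%:E = 0)%E.
Proof.
move=> [N [mN N0 FN]]; rewrite -(integral0 mu setT).
apply: (eq_integral_off_null mN N0) => x Nx.
by apply: contrapT => Fx; apply: Nx; apply: FN => /= F0; apply: Fx; rewrite F0.
Qed.

Lemma null_setU2 d (X : measurableType d) (mu : {measure set X -> \bar R})
    (A B : set X) : measurable A -> measurable B -> mu A = 0%E -> mu B = 0%E ->
  mu (A `|` B) = 0%E.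
Proof.
move=> mA mB A0 B0; apply/negligibleP; first exact: measurableU.
by apply: negligibleU; apply/negligibleP.
Qed.

Section exhaustion.
Context {d : measure_display} {X : measurableType d}.
Variable mu : {measure set X -> \bar R}.
Variables (F : X -> R) (A : R -> set X).
Hypothesis mF : measurable_fun setT F.
Hypothesis F0 : forall x, 0 <= F x.
Hypothesis mA : forall eta, measurable (A eta).
Hypothesis A_exhausts : {ae mu, forall x, exists2 eta, 0 < eta &
  forall eta', 0 < eta' <= eta -> A eta' x}.
Hypothesis F_pos : (0 < \int[mu]_x (F x)%:E)%E.

(** As [eta] decreases, the sets [A eta] fill almost the whole space, so one of
   them carries a part of the positive integral. *)
Lemma exhaustion_gt0 : exists2 eta, 0 < eta < 1 &
  (0 < \int[mu]_x (F x * \1_(A eta) x)%:E)%E.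
Proof.
apply: contrapT => /forall2NP H.
have H0 eta : 0 < eta < 1 -> {ae mu, forall x, F x * \1_(A eta) x = 0}.
  move=> eta1; apply: ge0_integral0_ae.
  - by apply: measurable_funM => //; exact: measurable_indic.
  - by move=> x; rewrite mulr_ge0.
  have [|/negP] := H eta; first by [].
  rewrite -leNgt => ?; apply/eqP; rewrite eq_le; apply/andP; split => //.
  by apply: integral_ge0 => x _; rewrite lee_fin mulr_ge0.
have /ae_foralln Hk k : {ae mu, forall x, F x * \1_(A k.+2%:R^-1) x = 0}.
  by apply: H0; rewrite invr_gt0 ltr0n invf_lt1 ?ltr0n// ltr1n.
have : {ae mu, forall x, F x = 0}.
  apply: filterS2 Hk A_exhausts => x Fk [eta eta0 etaA].
  have [k keta] : exists k, k.+2%:R^-1 <= eta.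
    exists (truncn eta^-1); rewrite -[leRHS]invrK lef_pV2 ?posrE ?invr_gt0 ?ltr0n//.
    by rewrite (le_trans (ltW (truncnS_gt _)))// ler_nat.
  have := Fk k; rewrite indicE mem_set ?mulr1//.
  by apply: etaA; rewrite keta invr_gt0 ltr0n.
by move/ae_integral0 => I0; move: F_pos; rewrite I0 ltxx.
Qed.

End exhaustion.

End angular_averages.

Section binary_angles.
Context {R : realType} (d : nat) (b2 : R -> R).
Hypothesis hd : (2 <= d)%N.
Hypothesis hb2 : binary_kernel d b2.

(** Hypotheses on [b2] concern [-1, 1] only; the cutoff is measurable and
   nonnegative everywhere. *)
Definition b2_trunc (z : R) : R := if z \in `[-1, 1] then b2 z else 0.

Lemma b2_truncE z : z \in `[-1, 1] -> b2_trunc z = b2 z.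
Proof. by rewrite /b2_trunc => ->. Qed.

Lemma b2_trunc_ge0 z : 0 <= b2_trunc z.
Proof. by rewrite /b2_trunc; case: ifP => // z1; exact: b2_ge0 hb2 _ z1. Qed.

Lemma b2_trunc_even z : b2_trunc (- z) = b2_trunc z.
Proof.
rewrite /b2_trunc; have -> : (- z \in `[-1, 1]) = (z \in `[-1, 1]).
  by rewrite !in_itv/=; apply/idP/idP; lra.
by case: ifP => // z1; exact: b2_even hb2 _ z1.
Qed.

(** The measurability of [b2] is contained in the integrability of its product
   with a power of [1 - z ^+ 2], a factor that can be divided out except at the
   two end points. *)
Lemma measurable_b2_trunc : measurable_fun setT b2_trunc.
Proof.
pose a : R := (d%:R - 3) / 2.
pose g z := b2 z * (1 - z ^+ 2) `^ a.
have mg : measurable_fun (`[-1, 1]%classic : set R) g.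
  by have := measurable_int _ (b2_integrable hb2) => /measurable_EFinP.
have mgD : measurable_fun setT (g \_ `[-1, 1]).
  exact/(measurable_restrictT _ (measurable_itv _)).
have mI (s : set R) : measurable s -> measurable_fun setT (\1_s : R -> R).
  exact: measurable_indic.
rewrite (_ : b2_trunc = fun z => (g \_ `[-1, 1]) z * (1 - z ^+ 2) `^ (- a) *
    \1_(`]-1, 1[%classic) z + b2 1 * \1_[set 1] z + b2 (-1) * \1_[set -1] z).
  apply: measurable_funD; last by apply: measurable_funM => //; exact: mI.
  apply: measurable_funD; last by apply: measurable_funM => //; exact: mI.
  apply: measurable_funM; last exact: mI (measurable_itv _).
  apply: measurable_funM => //; apply: (measurableT_comp (measurable_powR _)).
  by apply: measurable_funB.
apply/funext => z; rewrite /b2_trunc patchE !indicE.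
have -> : (z \in `[-1, 1]%classic) = (z \in `[-1, 1]) by rewrite mem_setE.
have -> : (z \in `]-1, 1[%classic) = (z \in `]-1, 1[) by rewrite mem_setE.
have -> : (z \in [set (1 : R)]) = (z == 1) by apply/idP/eqP; rewrite inE.
have -> : (z \in [set (-1 : R)]) = (z == -1) by apply/idP/eqP; rewrite inE.
have m11 : ((1 : R) == -1) = false by apply/negbTE; rewrite gt_eqF//; lra.
have [->|z1] := eqVneq z 1.
  have -> : ((1 : R) \in `[-1, 1]) = true by rewrite in_itv/= lexx andbT; lra.
  have -> : ((1 : R) \in `]-1, 1[) = false by rewrite in_itv/= ltxx andbF.
  by rewrite m11 /=; ring.
have [->|z2] := eqVneq z (-1).
  have -> : ((-1 : R) \in `[-1, 1]) = true by rewrite in_itv/= lexx /=; lra.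
  have -> : ((-1 : R) \in `]-1, 1[) = false by rewrite in_itv/= ltxx.
  by rewrite /=; ring.
have -> : (z \in `[-1, 1]) = (z \in `]-1, 1[).
  rewrite !in_itv/= !lt_neqAle eq_sym z1.
  by rewrite z2.
case: ifP => z12; last by rewrite /=; ring.
have p0 : 0 < 1 - z ^+ 2.
  move: z12; rewrite in_itv/= => /andP[h1 h2].
  by rewrite (_ : 1 - z ^+ 2 = (1 - z) * (1 + z)); [rewrite mulr_gt0//; lra|ring].
rewrite /= /g powRN !mulr0 !addr0 mulr1 mulfK//.
by rewrite gt_eqF// powR_gt0.
Qed.

Lemma b2_trunc_average_lty :
  exists C : R, forall e : 'rV[R]_d,
    (\int[sphere_measure d]_w (b2_trunc (dot (direction e) w))%:E <= C%:E)%E.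
Proof.
case: d hd hb2 measurable_b2_trunc b2_trunc_ge0 => // -[//|n] _ hb mb b0.
have mbE : measurable_fun setT (fun z => (b2_trunc z)%:E) by exact/measurable_EFinP.
have fin1 : (\int[sphere_measure n.+2]_w (b2_trunc (w ord0 ord0))%:E < +oo)%E.
  apply: le_lt_trans (sphere_slicing mb b0 n) _.
  apply: lte_mul_pinfty => //.
  have /integrableP[mi] := b2_integrable hb; apply: le_lt_trans.
  pose f z := (b2_trunc z * (1 - z ^+ 2) `^ ((n.+2%:R - 3) / 2))%:E.
  apply: (@le_trans _ _ (\int[@lebesgue_measure R]_(z in `[(-1)%R, 1%R]) f z)%E).
    apply: ge0_subset_integral => //.
    - apply/measurable_funTS/measurable_EFinP; apply: measurable_funM => //.
      by apply: (measurableT_comp (measurable_powR _)); apply: measurable_funB.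
    - by move=> z _; rewrite lee_fin mulr_ge0// powR_ge0.
    - by move=> z /=; rewrite !in_itv/= => /andP[/ltW -> /ltW ->].
  rewrite le_eqVlt; apply/orP; left; apply/eqP; apply: eq_integral => z.
  rewrite inE/= => z1; rewrite /f b2_truncE//= ger0_norm// mulr_ge0 ?powR_ge0//.
  exact: b2_ge0 hb _ z1.
pose C1 := fine (\int[sphere_measure n.+2]_w (b2_trunc (w ord0 ord0))%:E)%E.
pose C0 := fine (\int[sphere_measure n.+2]_w (b2_trunc 0)%:E)%E.
have fin0 : (\int[sphere_measure n.+2]_w (b2_trunc 0)%:E < +oo)%E.
  rewrite integral_cst//; apply: lte_mul_pinfty => //; first by rewrite lee_fin.
  exact: sphere_finite.
have I0 F : (forall w, 0 <= F w) -> (\int[sphere_measure n.+2]_w (F w)%:E < +oo)%E ->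
    (\int[sphere_measure n.+2]_w (F w)%:E)%E =
    (fine (\int[sphere_measure n.+2]_w (F w)%:E)%E)%:E.
  move=> F0 Foo; rewrite fineK// ge0_fin_numE//.
  by apply: integral_ge0 => w _; rewrite lee_fin.
(* [C0] accounts for [e = 0], whose direction is 0. *)
exists (Num.max C0 C1) => e; have [->|e0] := eqVneq e 0.
  rewrite direction0; under eq_integral do rewrite dot0l.
  by rewrite I0// lee_fin le_max lexx.
rewrite (sphere_dot_integral ord0 (F := fun z => (b2_trunc z)%:E) (enorm_direction e0))//.
by rewrite I0// lee_fin le_max lexx orbT.
Qed.

(** Angles at which both the component of the relative velocity along the
   impact direction and the component orthogonal to it are substantial. *)
Definition b2_angles (eta : R) (z : R) : R :=
  \1_[set z : R | eta <= `|z| /\ eta ^+ 2 <= 1 - z ^+ 2] z.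

Let measurable_angle_set (eta : R) :
  measurable [set z : R | eta <= `|z| /\ eta ^+ 2 <= 1 - z ^+ 2].
Proof.
apply: measurableI.
  by rewrite -[X in measurable X]setTI; apply: measurable_fun_ler.
rewrite -[X in measurable X]setTI; apply: measurable_fun_ler => //.
by apply: measurable_funB.
Qed.

Lemma measurable_b2_angles eta : measurable_fun setT (b2_angles eta).
Proof. exact: measurable_indic. Qed.

(** The angles left out shrink, as [eta] tends to 0, to the equator and the poles
   of the sphere, which are null sets. *)
Lemma b2_trunc_average_gt0 : exists2 eta : R, 0 < eta < 1 &
  exists2 p : R, 0 < p & forall e : 'rV[R]_d, enorm e = 1 ->
    (p%:E <= \int[sphere_measure d]_w
       (b2_trunc (dot e w) * b2_angles eta (dot e w))%:E)%E.
Proof.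
have d0 : (0 < d)%N by apply: leq_trans hd.
pose i0 := Ordinal d0; pose e0 : 'rV[R]_d := coord_vector i0.
have e01 : enorm e0 = 1 by exact: enorm_coord_vector.
have e0n0 : e0 != 0 by apply/eqP => e00; move/eqP: e01; rewrite e00 enorm0 eq_sym oner_eq0.
have mdot : measurable_fun setT (dot e0) := measurable_dotr e0.
pose A (eta : R) := [set w : 'rV[R]_d |
  eta <= `|dot e0 w| /\ eta ^+ 2 <= 1 - dot e0 w ^+ 2].
have AE eta w : \1_(A eta) w = b2_angles eta (dot e0 w) :> R by rewrite /b2_angles !indicE.
have mA eta : measurable (A eta).
  rewrite -[X in measurable X]setTI.
  exact: (mdot measurableT _ (measurable_angle_set eta)).
have mF : measurable_fun setT (fun w => b2_trunc (dot e0 w)).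
  exact: measurableT_comp measurable_b2_trunc mdot.
have F0 w : 0 <= b2_trunc (dot e0 w) by exact: b2_trunc_ge0.
have [eta eta1 Ieta] : exists2 eta, 0 < eta < 1 & (0 < \int[sphere_measure d]_w
    (b2_trunc (dot e0 w) * \1_(A eta) w)%:E)%E.
  apply: exhaustion_gt0 => //.
    pose N := ~` @unit_sphere R d `|` [set w | dot e0 w = 0]
      `|` [set w | `|dot e0 w| = enorm w].
    have mN1 : measurable (~` @unit_sphere R d).
      by apply: measurableC; exact: measurable_unit_sphere.
    have mN2 : measurable [set w | dot e0 w = 0] by exact: measurable_eq_set.
    have mN3 : measurable [set w | `|dot e0 w| = enorm w].
      apply: measurable_eq_set; last exact: measurable_enorm.
      exact: measurableT_comp.
    exists N; split.
    - by do 2 (apply: measurableU => //).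
    - apply: null_setU2 => //; [apply: measurableU => //| |exact: sphere_poles].
      by apply: null_setU2 => //; [exact: sphere_carrier|exact: sphere_hyperplane].
    - move=> w /=; apply: contra_notP => /not_orP[/not_orP[]].
      rewrite /unit_sphere/= => /contrapT w1 w0 wp.
      have zw : `|dot e0 w| <= 1.
        by have := cauchy_schwarz e0 w; rewrite e01 w1 mulr1.
      have z0 : 0 < `|dot e0 w| by rewrite normr_gt0; apply/eqP.
      have z1 : `|dot e0 w| < 1 by rewrite lt_neqAle zw andbT -w1; apply/eqP.
      have z2 : 0 < 1 - dot e0 w ^+ 2.
        by rewrite subr_gt0 -real_normK ?num_real// expr_lt1.
      have s0 : 0 < Num.sqrt (1 - dot e0 w ^+ 2) by rewrite sqrtr_gt0.
      exists (Num.min `|dot e0 w| (Num.sqrt (1 - dot e0 w ^+ 2))).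
        by rewrite lt_min z0 s0.
      move=> eta /andP[eta0]; rewrite le_min => /andP[h1 h2]; split=> //.
      by rewrite -[leRHS]sqr_sqrtr ?(ltW z2)// ler_sqr// nnegrE ltW.
  have <- : (b2_norm b2 e0 = \int[sphere_measure d]_w (b2_trunc (dot e0 w))%:E)%E.
    apply: (@eq_integral_off_null _ _ _ _ (~` @unit_sphere R d)).
    - by apply: measurableC; exact: measurable_unit_sphere.
    - exact: sphere_carrier.
    move=> w /contrapT w1; rewrite b2_truncE// in_itv/= -ler_norml.
    by have := cauchy_schwarz e0 w; rewrite e01 w1 mulr1.
  exact: b2_norm_gt0 hb2 _ e01.
exists eta => //.
have [C HC] := b2_trunc_average_lty.
pose G (z : R) := (b2_trunc z * b2_angles eta z)%:E.
have mG : measurable_fun setT G.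
  apply/measurable_EFinP; apply: measurable_funM; first exact: measurable_b2_trunc.
  exact: measurable_b2_angles.
have G0 z : (0 <= G z)%E by rewrite lee_fin mulr_ge0 ?b2_trunc_ge0// /b2_angles.
have GE e : enorm e = 1 -> (\int[sphere_measure d]_w G (dot e w) =
    \int[sphere_measure d]_w (b2_trunc (dot e0 w) * \1_(A eta) w)%:E)%E.
  move=> e1; rewrite (sphere_dot_integral i0 e1 mG G0).
  rewrite -(sphere_dot_integral i0 e01 mG G0).
  by apply: eq_integral => w _; rewrite /G AE.
set I := (\int[_]_w _)%E in Ieta GE.
have Ifin : I \is a fin_num.
  rewrite ge0_fin_numE ?ltW//; apply: le_lt_trans (ltry C); apply: le_trans (HC e0).
  apply: ge0_le_integral => //.
  - by move=> w _; rewrite lee_fin mulr_ge0.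
  - by apply/measurable_EFinP; apply: measurable_funM => //; exact: measurable_indic.
  - apply/measurable_EFinP; apply: measurableT_comp measurable_b2_trunc _.
    exact: measurable_dotr.
  move=> w _; rewrite lee_fin /direction e01 invr1 scale1r.
  by rewrite ler_piMr// indicE; case: (_ \in _).
exists (fine I); first by rewrite fine_gt0// Ieta ltey_eq Ifin.
by move=> e e1; rewrite fineK// -(GE e e1).
Qed.

End binary_angles.

Section ternary_angles.
Context {R : realType} (d : nat) (theta3 : R) (phi : R -> R).
Hypothesis hd : (2 <= d)%N.
Hypothesis theta3_ge0 : 0 <= theta3.
Hypothesis hb3 : ternary_kernel d theta3 phi.

Definition phi_trunc (y : R) : R := if y \in `[- 2^-1, 2^-1] then phi y else 0.

Lemma phi_trunc_ge0 y : 0 <= phi_trunc y.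
Proof. by rewrite /phi_trunc; case: ifP => // y1; exact: phi_ge0 hb3 _ y1. Qed.

Lemma measurable_phi_trunc : measurable_fun setT phi_trunc.
Proof.
rewrite (_ : phi_trunc = phi \_ `[- 2^-1, 2^-1]).
  apply/(measurable_restrictT _ (measurable_itv _)); exact: phi_measurable hb3.
by apply/funext => y; rewrite /phi_trunc patchE mem_setE.
Qed.

Lemma measurable_lsubmx m n :
  measurable_fun setT (fun w : 'rV[R]_(m + n) => lsubmx w).
Proof.
apply/measurable_fun_rVP => i; under eq_fun do rewrite mxE.
exact: measurable_coord.
Qed.

Lemma measurable_rsubmx m n :
  measurable_fun setT (fun w : 'rV[R]_(m + n) => rsubmx w).
Proof.
apply/measurable_fun_rVP => i; under eq_fun do rewrite mxE.
exact: measurable_coord.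
Qed.

Definition cross_dot (w : 'rV[R]_(d + d)) : R := dot (lsubmx w) (rsubmx w).

Lemma measurable_cross_dot : measurable_fun setT cross_dot.
Proof. by apply: measurable_dot; [exact: measurable_lsubmx|exact: measurable_rsubmx]. Qed.

Lemma cross_dot_itv w : enorm w = 1 -> cross_dot w \in `[- 2^-1, 2^-1].
Proof.
move=> /(congr1 (fun x => x ^+ 2)); rewrite enorm_sqr expr1n dot_submx => w1.
have := dot_ge0 (lsubmx w + rsubmx w); have := dot_ge0 (lsubmx w - rsubmx w).
rewrite !(dotDl, dotDr, dotNl, dotNr) (dotC (rsubmx w)) in_itv/= /cross_dot; lra.
Qed.

Lemma phi_truncE w : enorm w = 1 -> phi_trunc (cross_dot w) = phi (cross_dot w).
Proof. by move=> w1; rewrite /phi_trunc cross_dot_itv. Qed.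

Let mP : measurable_fun setT (fun w => phi_trunc (cross_dot w)).
Proof. exact: measurableT_comp measurable_phi_trunc measurable_cross_dot. Qed.

Let mS : measurable (~` @unit_sphere R (d + d)).
Proof. by apply: measurableC; exact: measurable_unit_sphere. Qed.

Let b3t (e w : 'rV[R]_(d + d)) : R := `|dot e w| `^ theta3 * phi_trunc (cross_dot w).

Let mb3t e : measurable_fun setT (b3t e).
Proof.
apply: measurable_funM => //; apply: (measurableT_comp (measurable_powR _)).
by apply: measurableT_comp => //; exact: measurable_dotr.
Qed.

Let b3t_ge0 e w : 0 <= b3t e w.
Proof. by rewrite mulr_ge0 ?powR_ge0 ?phi_trunc_ge0. Qed.

Let b3_normE e : (b3_norm theta3 phi e =
  \int[sphere_measure (d + d)]_w (b3t e w)%:E)%E.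
Proof.
apply: (eq_integral_off_null mS (sphere_carrier _)) => w /contrapT w1.
by rewrite /b3t phi_truncE.
Qed.

(** Some coordinate of a unit vector is at least [1 / sqrt (d + d)] in size. This
   removes the factor [|x| ^ theta3] from the cross-section [b3]. *)
Let some_coord_large (w : 'rV[R]_(d + d)) : enorm w = 1 ->
  1 <= (d + d)%:R `^ (theta3 / 2) * \sum_(i < d + d) `|dot (coord_vector i) w| `^ theta3.
Proof.
move=> w1; have N0 : (0 < d + d)%N by rewrite addn_gt0 (leq_trans _ hd).
have N0R : 0 < (d + d)%:R :> R by rewrite ltr0n.
have [i wi] : exists i : 'I_(d + d), (d + d)%:R^-1 <= w ord0 i ^+ 2.
  apply: contrapT => /forallNP H.
  have : dot w w < \sum_(i < d + d) (d + d)%:R^-1.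
    apply: ltr_sum; first by apply/hasP; exists (Ordinal N0); rewrite ?mem_index_enum.
    by move=> i _; rewrite -expr2 ltNge; apply/negP; exact: H.
  rewrite sumr_const card_ord -[X in _ < X]mulr_natr mulVf ?gt_eqF//.
  by rewrite -enorm_sqr w1 expr1n ltxx.
rewrite (bigD1 i)//= mulrDr.
apply: (@le_trans _ _ ((d + d)%:R `^ (theta3 / 2) * `|dot (coord_vector i) w| `^ theta3)).
  rewrite dot_coord_vector.
  have -> : `|w ord0 i| `^ theta3 = (w ord0 i ^+ 2) `^ (theta3 / 2).
    rewrite -[in RHS]real_normK ?num_real// -powR_mulrn// -powRrM.
    by congr (_ `^ _); field.
  rewrite -powRM ?sqr_ge0 ?ler0n//.
  have {1}-> : 1 = 1 `^ (theta3 / 2) :> R by rewrite powR1.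
  apply: ge0_ler_powR.
  - by rewrite divr_ge0.
  - by rewrite nnegrE.
  - by rewrite nnegrE mulr_ge0// sqr_ge0.
  by rewrite -ler_pdivrMl// mulr1.
rewrite lerDl mulr_ge0 ?powR_ge0// sumr_ge0// => j _; exact: powR_ge0.
Qed.

(** The average of [phi] alone is dominated by the sum of the norms of [b3] at
   the coordinate directions. *)
Lemma phi_trunc_average_lty :
  exists C : R, (\int[sphere_measure (d + d)]_w (phi_trunc (cross_dot w))%:E <= C%:E)%E.
Proof.
have I0 : (0 <= \int[sphere_measure (d + d)]_w (phi_trunc (cross_dot w))%:E)%E.
  by apply: integral_ge0 => w _; rewrite lee_fin phi_trunc_ge0.
suff Ioo : (\int[sphere_measure (d + d)]_w (phi_trunc (cross_dot w))%:E < +oo)%E.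
  by exists (fine (\int[sphere_measure (d + d)]_w (phi_trunc (cross_dot w))%:E)%E);
    rewrite fineK// ge0_fin_numE.
pose c := (d + d)%:R `^ (theta3 / 2) : R.
have c0 : 0 <= c by exact: powR_ge0.
apply: (@le_lt_trans _ _ (\int[sphere_measure (d + d)]_w
    (c%:E * \sum_(i < d + d) (b3t (coord_vector i) w)%:E))%E).
  apply: ae_ge0_le_integral => //.
  - by move=> w _; rewrite lee_fin phi_trunc_ge0.
  - exact/measurable_EFinP.
  - by move=> w _; rewrite mule_ge0 ?lee_fin// sume_ge0// => i _; rewrite lee_fin.
  - apply: measurable_funeM; apply: emeasurable_sum => i.
    exact/measurable_EFinP.
  exists (~` @unit_sphere R (d + d)); split=> //; first exact: sphere_carrier.
  move=> w /=; apply: contra_notP => /contrapT w1 _.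
  rewrite sumEFin -EFinM lee_fin /b3t -mulr_suml mulrA.
  by rewrite ler_peMl ?phi_trunc_ge0// some_coord_large.
rewrite ge0_integralZl//; last first.
- by move=> w _; rewrite sume_ge0// => i _; rewrite lee_fin.
- by apply: emeasurable_sum => i; exact/measurable_EFinP.
rewrite ge0_integral_sum//; last 2 first.
- by move=> i; exact/measurable_EFinP.
- by move=> i w _; rewrite lee_fin.
apply: lte_mul_pinfty => //.
apply: lte_sum_pinfty => i _; rewrite -b3_normE.
by apply: (b3_norm_lty hb3); exact: enorm_coord_vector.
Qed.

(** Impact directions at which a fast particle moving along [e] transfers a
   substantial momentum to both of its partners. *)
Definition ternary_angles (eta : R) (e : 'rV[R]_d) : set 'rV[R]_(d + d) :=
  [set w | [/\ eta <= enorm (lsubmx w), eta <= enorm (rsubmx w) &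
    eta <= `|dot e (lsubmx w + rsubmx w)|]].

Lemma measurable_ternary_angles eta e : measurable (ternary_angles eta e).
Proof.
have -> : ternary_angles eta e = [set w | eta <= enorm (lsubmx w)] `&`
    ([set w | eta <= enorm (rsubmx w)] `&` [set w | eta <= `|dot e (lsubmx w + rsubmx w)|]).
  by apply/seteqP; split=> w /= => [[]|[? []]].
have mle (f : 'rV[R]_(d + d) -> R) : measurable_fun setT f ->
    measurable [set w | eta <= f w].
  by move=> mf; rewrite -[X in measurable X]setTI; apply: measurable_fun_ler.
apply: measurableI; last apply: measurableI; apply: mle.
- exact: measurableT_comp (@measurable_enorm R d) (@measurable_lsubmx d d).
- exact: measurableT_comp (@measurable_enorm R d) (@measurable_rsubmx d d).
apply: measurableT_comp => //; apply: measurable_dot => //.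
apply: measurable_fun_comp2 (@measurable_rVD R d) _ _.
  exact: measurable_lsubmx.
exact: measurable_rsubmx.
Qed.

Let diagonal_isometry (T : 'rV[R]_d -> 'rV[R]_d) : isometric_involution T ->
  isometric_involution (fun w : 'rV[R]_(d + d) => row_mx (T (lsubmx w)) (T (rsubmx w))).
Proof.
move=> I; split.
- apply/measurable_fun_rVP => i; case: (split_ordP i) => j ->.
    under eq_fun do rewrite row_mxEl.
    apply: (measurableT_comp (measurable_coord j)).
    exact: measurableT_comp (isometric_measurable I) (@measurable_lsubmx d d).
  under eq_fun do rewrite row_mxEr.
  apply: (measurableT_comp (measurable_coord j)).
  exact: measurableT_comp (isometric_measurable I) (@measurable_rsubmx d d).
- by move=> u v; rewrite !linearD/= !(isometric_add I) add_row_mx.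
- by move=> c v; rewrite !linearZ/= !(isometric_scale I) scale_row_mx.
- by move=> v; rewrite row_mxKl row_mxKr !(isometric_involutive I) hsubmxK.
- by move=> v; rewrite dot_row_mx2 !(isometric_dot I) -dot_submx.
Qed.

(** The reflection exchanging [e] and [e'], applied to both impact directions,
   leaves their inner product unchanged. *)
Lemma ternary_angles_average eta e e' : enorm e = 1 -> enorm e' = 1 ->
  (\int[sphere_measure (d + d)]_w
    (phi_trunc (cross_dot w) * \1_(ternary_angles eta e) w)%:E =
   \int[sphere_measure (d + d)]_w
    (phi_trunc (cross_dot w) * \1_(ternary_angles eta e') w)%:E)%E.
Proof.
move=> e1 e1'; have I := reflection_isometric (e - e').
have Te : reflection (e - e') e = e' by apply: reflection_swap; rewrite -!enorm_sqr e1 e1'.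
set T := reflection (e - e') in I Te.
have J := diagonal_isometry I; rewrite [RHS]/=.
pose F w := (phi_trunc (cross_dot w) * \1_(ternary_angles eta e') w)%:E.
have mF : measurable_fun setT F.
  apply/measurable_EFinP; apply: measurable_funM => //.
  by apply: measurable_indic; exact: measurable_ternary_angles.
have F0 w : (0 <= F w)%E by rewrite lee_fin mulr_ge0// phi_trunc_ge0.
have := @preserves_integral R _ _ (sphere_measure (d + d)) _ F (isometric_sphere J) mF F0.
move=> <-; apply: eq_integral => w _; rewrite /F /cross_dot row_mxKl row_mxKr.
rewrite (isometric_dot2 _ _ I); congr (_ * _)%:E.
rewrite !indicE; congr ((nat_of_bool _)%:R).
have E : ternary_angles eta e w <->
    ternary_angles eta e' (row_mx (T (lsubmx w)) (T (rsubmx w))).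
  rewrite /ternary_angles/= row_mxKl row_mxKr !(isometric_enorm _ I).
  by rewrite -Te -(isometric_add I) (isometric_dot2 _ _ I).
by apply/idP/idP; rewrite !inE => /E.
Qed.

Lemma phi_trunc_average_gt0 : exists2 eta : R, 0 < eta < 1 &
  exists2 p : R, 0 < p & forall e : 'rV[R]_d, enorm e = 1 ->
    (p%:E <= \int[sphere_measure (d + d)]_w
       (phi_trunc (cross_dot w) * \1_(ternary_angles eta e) w)%:E)%E.
Proof.
have d0 : (0 < d)%N by apply: leq_trans hd.
pose e0 : 'rV[R]_d := coord_vector (Ordinal d0).
have e01 : enorm e0 = 1 by exact: enorm_coord_vector.
have e0n0 : e0 != 0 by apply/eqP => e00; move/eqP: e01; rewrite e00 enorm0 eq_sym oner_eq0.
have P0 w : 0 <= phi_trunc (cross_dot w) by exact: phi_trunc_ge0.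
have [eta eta1 Ieta] : exists2 eta, 0 < eta < 1 & (0 < \int[sphere_measure (d + d)]_w
    (phi_trunc (cross_dot w) * \1_(ternary_angles eta e0) w)%:E)%E.
  apply: exhaustion_gt0 => //; first by move=> eta; exact: measurable_ternary_angles.
    have hyper (e : 'rV[R]_(d + d)) : e != 0 ->
        measurable [set w | dot e w = 0] /\ sphere_measure (d + d) [set w | dot e w = 0] = 0%E.
      move=> en0; split; last exact: sphere_hyperplane.
      by apply: measurable_eq_set => //; exact: measurable_dotr.
    have row0 (a b : 'rV[R]_d) : a != 0 \/ b != 0 -> row_mx a b != 0.
      move=> ab; apply/eqP => ab0; move: ab.
      by rewrite -(row_mxKl a b) -[X in _ \/ X != _](row_mxKr a b) ab0 !linear0 eqxx => -[].
    have [m1 n1] := hyper (row_mx e0 0) (row0 _ _ (or_introl e0n0)).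
    have [m2 n2] := hyper (row_mx 0 e0) (row0 _ _ (or_intror e0n0)).
    have [m3 n3] := hyper (row_mx e0 e0) (row0 _ _ (or_introl e0n0)).
    exists ([set w | dot (row_mx e0 0) w = 0] `|` [set w | dot (row_mx 0 e0) w = 0]
      `|` [set w | dot (row_mx e0 e0) w = 0]); split.
    - by do 2 (apply: measurableU => //).
    - by apply: null_setU2 => //; [exact: measurableU|exact: null_setU2].
    move=> w /=; apply: contra_notP => /not_orP[/not_orP[]].
    rewrite !dot_row_mx !dot0l addr0 add0r -dotDr => h1 h2 h3.
    have nz (x : 'rV[R]_d) : dot e0 x <> 0 -> 0 < enorm x.
      move=> ex; rewrite lt_neqAle enorm_ge0 andbT eq_sym; apply/eqP => /enorm_eq0 x0.
      by apply: ex; rewrite x0 dotC dot0l.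
    exists (Num.min (Num.min (enorm (lsubmx w)) (enorm (rsubmx w)))
        `|dot e0 (lsubmx w + rsubmx w)|).
      by rewrite !lt_min !nz//= normr_gt0; exact/eqP.
    by move=> eta /andP[_]; rewrite !le_min => /andP[/andP[]].
  rewrite lt_neqAle; apply/andP; split; last first.
    by apply: integral_ge0 => w _; rewrite lee_fin.
  apply/eqP => /esym I0.
  have := b3_norm_gt0 hb3 (enorm_coord_vector (lshift d (Ordinal d0))).
  rewrite b3_normE ae_integral0 ?ltxx//.
  by apply: filterS (ge0_integral0_ae mP P0 I0) => w w0; rewrite /b3t w0 mulr0.
exists eta => //; have [C HC] := phi_trunc_average_lty.
set I := (\int[_]_w _)%E in Ieta.
have Ifin : I \is a fin_num.
  rewrite ge0_fin_numE ?ltW//; apply: le_lt_trans (ltry C); apply: le_trans HC.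
  apply: ge0_le_integral => //.
  - by move=> w _; rewrite lee_fin mulr_ge0.
  - apply/measurable_EFinP; apply: measurable_funM => //; apply: measurable_indic.
    exact: measurable_ternary_angles.
  - exact/measurable_EFinP.
  by move=> w _; rewrite lee_fin ler_piMr// indicE; case: (_ \in _).
exists (fine I); first by rewrite fine_gt0// Ieta ltey_eq Ifin.
by move=> e e1; rewrite fineK// (ternary_angles_average _ e1 e01).
Qed.

End ternary_angles.


(** * Truncated power weights *)

(** With [s] the energy of a particle and [eps = gamma / 2], the rate [s ^ eps]
   is of the order of the collision frequency; it is saturated at [1 / kappa].
   Then [weight] grows linearly at infinity, and increases to
   [s ^ (1 + eps * beta)] as [kappa] tends to 0. *)
HB.lock Definition gain_rate {R : realType} (eps kappa s : R) : R :=
  s `^ eps / (1 + kappa * s `^ eps).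
HB.lock Definition weight_ratio {R : realType} (eps beta kappa s : R) : R :=
  gain_rate eps kappa s `^ beta.
HB.lock Definition weight {R : realType} (eps beta kappa s : R) : R :=
  s * weight_ratio eps beta kappa s.

Section truncated_weight.
Context {R : realType}.
Variables (eps beta kappa : R).
Hypothesis eps_gt0 : 0 < eps.
Hypothesis beta_gt0 : 0 < beta.
Hypothesis kappa_gt0 : 0 < kappa.
Implicit Types s x y E : R.

Local Notation gain_rate := (gain_rate eps kappa).
Local Notation weight_ratio := (weight_ratio eps beta kappa).
Local Notation weight := (weight eps beta kappa).

Let den_gt0 s : 0 < 1 + kappa * s `^ eps.
Proof. by rewrite ltr_pwDl// mulr_ge0 ?powR_ge0 ?ltW. Qed.

Lemma gain_rate_ge0 s : 0 <= gain_rate s.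
Proof. by rewrite gain_rate.unlock divr_ge0 ?powR_ge0 ?ltW. Qed.

Lemma gain_rate_le_powR s : gain_rate s <= s `^ eps.
Proof. by rewrite gain_rate.unlock ler_pdivrMr// ler_peMr ?powR_ge0// lerDl mulr_ge0 ?powR_ge0 ?ltW. Qed.

Lemma gain_rate_le s : gain_rate s <= kappa^-1.
Proof. by rewrite gain_rate.unlock ler_pdivrMr// mulrDr mulr1 mulKf ?gt_eqF// lerDr invr_ge0 ltW. Qed.

Lemma gain_rate_homo x y : 0 <= x -> x <= y -> gain_rate x <= gain_rate y.
Proof.
move=> x0 xy; have y0 := le_trans x0 xy.
have pxy : x `^ eps <= y `^ eps by apply: ge0_ler_powR => //; rewrite ltW.
rewrite !gain_rate.unlock ler_pdivrMr// mulrAC ler_pdivlMr// !mulrDr !mulr1.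
by rewrite mulrCA [X in _ <= _ + X]mulrCA [X in _ <= _ + _ * X]mulrC lerD2r.
Qed.

Lemma weight_ratio_ge0 s : 0 <= weight_ratio s.
Proof. by rewrite weight_ratio.unlock powR_ge0. Qed.

Lemma weight_ratio_homo x y : 0 <= x -> x <= y -> weight_ratio x <= weight_ratio y.
Proof.
move=> x0 xy; rewrite weight_ratio.unlock.
apply: ge0_ler_powR; rewrite ?nnegrE ?gain_rate_ge0 ?(ltW beta_gt0)//.
exact: gain_rate_homo.
Qed.

Lemma weight_ge0 s : 0 <= s -> 0 <= weight s.
Proof. by move=> s0; rewrite weight.unlock mulr_ge0 ?weight_ratio_ge0. Qed.

Lemma weight_gt0 s : 0 < s -> 0 < weight s.
Proof. move=> s0; rewrite weight.unlock weight_ratio.unlock gain_rate.unlock.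
by rewrite mulr_gt0 ?powR_gt0 ?divr_gt0 ?powR_gt0. Qed.

Lemma weight_le_linear s : 0 <= s -> weight s <= kappa^-1 `^ beta * s.
Proof.
move=> s0; rewrite !weight.unlock weight_ratio.unlock mulrC ler_wpM2r//; have := gain_rate_le s.
by apply: ge0_ler_powR; rewrite ?nnegrE ?gain_rate_ge0 ?invr_ge0 ?(ltW beta_gt0) ?(ltW kappa_gt0).
Qed.

Lemma weight_le_powR s : 0 < s -> weight s <= s `^ (1 + eps * beta).
Proof.
move=> s0; rewrite weight.unlock weight_ratio.unlock powRD ?(gt_eqF s0) ?implybT// powRr1 ?(ltW s0)// powRrM.
rewrite ler_wpM2l ?(ltW s0)//; have := gain_rate_le_powR s.
by apply: ge0_ler_powR; rewrite ?nnegrE ?powR_ge0 ?gain_rate_ge0 ?(ltW beta_gt0).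
Qed.

Lemma weight_homo x y : 0 <= x -> x <= y -> weight x <= weight y.
Proof.
move=> x0 xy; rewrite !weight.unlock; exact: (ler_pM x0 (weight_ratio_ge0 x) xy (weight_ratio_homo x0 xy)).
Qed.

(** If [gain_rate s] is at least [lam], the first term on the right is enough;
   otherwise [weight_ratio s] is at most [lam ^ beta]. *)
Lemma weight_gain_young s lam : 0 <= s -> 0 <= lam ->
  lam * weight s <= weight s * gain_rate s + lam `^ (beta + 1) * s.
Proof.
move=> s0 l0; have w0 := weight_ge0 s0.
have [gl|lg] := leP lam (gain_rate s).
  by rewrite mulrC ler_wpDr ?mulr_ge0 ?powR_ge0// ler_wpM2l.
apply: ler_wpDl; first by rewrite mulr_ge0 ?gain_rate_ge0.
have lp : lam `^ (beta + 1) = lam * lam `^ beta.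
  have lamgt0 : 0 < lam := le_lt_trans (gain_rate_ge0 s) lg.
  by rewrite powRD ?(gt_eqF lamgt0) ?implybT// powRr1// mulrC.
rewrite lp weight.unlock weight_ratio.unlock [_ * s]mulrC mulrCA; apply: ler_wpM2l => //; apply: ler_wpM2l => //.
have := ltW lg.
by apply: ge0_ler_powR; rewrite ?nnegrE ?gain_rate_ge0 ?(ltW beta_gt0) ?(ltW lg).
Qed.

(** The saturated rate grows no faster under dilations than [s ^ eps] does, and
   this uniformly in [kappa]. *)
Lemma weight_ratio_dilation x E : 0 < x -> x <= E ->
  weight_ratio E <= (E / x) `^ (eps * beta) * weight_ratio x.
Proof.
move=> x0 xE; have E0 := lt_le_trans x0 xE.
have Ex0 : 0 <= E / x by rewrite divr_ge0 ?ltW.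
rewrite weight_ratio.unlock powRrM -powRM ?powR_ge0 ?gain_rate_ge0//.
apply: ge0_ler_powR.
- exact: ltW.
- by rewrite nnegrE gain_rate_ge0.
- by rewrite nnegrE mulr_ge0 ?powR_ge0 ?gain_rate_ge0.
rewrite !gain_rate.unlock mulrA -powRM ?(ltW x0)// divfK ?(gt_eqF x0)//.
apply: ler_wpM2l; first exact: powR_ge0.
rewrite lef_pV2 ?posrE// lerD2l; apply: ler_wpM2l; first exact: ltW.
by move: xE; apply: ge0_ler_powR; rewrite ?nnegrE ?(ltW x0) ?(ltW E0) ?(ltW eps_gt0).
Qed.

End truncated_weight.

Section superadditivity.
Context {R : realType}.

(** The constant is uniform in the exponent, because the inequalities for [b]
   follow from those for an integer above [a]. *)
Lemma powR_le_linear (a : R) : exists2 C : R, 0 < C &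
  forall b t, 0 <= b <= a -> 1 <= t <= 3 -> t `^ b <= 1 + C * (t - 1) /\ t `^ b <= C.
Proof.
have [n an] : exists n : nat, a <= n%:R.
  by exists (truncn a).+1; exact/ltW/truncnS_gt.
have key m : exists2 C : R, 0 < C & forall t : R, 1 <= t <= 3 -> t ^+ m <= 1 + C * (t - 1).
  elim: m => [|m [C C0 IH]].
    by exists 1 => // t /andP[t1 _]; rewrite expr0 mul1r; lra.
  exists (3 * C + 1); first by lra.
  move=> t /[dup] /IH H /andP[t1 t3]; rewrite exprS.
  apply: (@le_trans _ _ (t * (1 + C * (t - 1)))); first by rewrite ler_wpM2l//; lra.
  rewrite -subr_ge0 (_ : _ - _ = C * (t - 1) * (3 - t)); last by ring.
  by rewrite !mulr_ge0//; lra.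
have [C C0 HC] := key n; exists (1 + 2 * C); first by lra.
move=> b t /andP[b0 ba] /[dup] t13 /andP[t1 t3].
have tb : t `^ b <= t ^+ n.
  rewrite -powR_mulrn; last by lra.
  by apply: ler_powR => //; exact: le_trans an.
have {}HC := HC _ t13; split.
  by apply: (le_trans tb); apply: (le_trans HC); rewrite lerD2l ler_wpM2r//; lra.
apply: (le_trans tb); apply: (le_trans HC); rewrite lerD2l mulrC ler_wpM2r//; lra.
Qed.

(** The constant is uniform in [kappa]: by [weight_ratio_dilation] the quotient
   of the weight ratios at [E] and [M] is at most [(E / M) ^ (eps * beta)], and
   [E / M] stays between 1 and 3. *)
Lemma weight_excess (a : R) : 0 <= a -> exists2 C : R, 0 < C &
  forall eps beta kappa : R, 0 < eps -> 0 < beta -> 0 < kappa -> eps * beta <= a ->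
  forall M E, 0 < M -> M <= E <= 3 * M ->
  weight eps beta kappa E - weight eps beta kappa M <=
    C * (E - M) * weight_ratio eps beta kappa M.
Proof.
move=> a0; have [C C0 HC] := powR_le_linear a; exists (2 * C); first by lra.
move=> eps beta kappa e0 b0 k0 eba M E M0 /andP[ME E3M].
have H : weight_ratio eps beta kappa E <=
    (E / M) `^ (eps * beta) * weight_ratio eps beta kappa M.
  exact: weight_ratio_dilation.
have h0 := weight_ratio_ge0 eps beta kappa M.
have t13 : 1 <= E / M <= 3 by rewrite ler_pdivlMr// mul1r ME ler_pdivrMr.
have eba0 : 0 <= eps * beta <= a by rewrite eba mulr_ge0// ltW.
have [H1 H2] := HC (eps * beta) (E / M) eba0 t13.
rewrite !weight.unlock; move: (weight_ratio eps beta kappa E) (weight_ratio eps beta kappa M) H h0 => hE hM H h0.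
have -> : E * hE - M * hM = M * (hE - hM) + (E - M) * hE by ring.
have EM0 : 0 <= E - M by rewrite subr_ge0.
have -> : 2 * C * (E - M) * hM = M * (C * (E / M - 1) * hM) + (E - M) * (C * hM).
  by field; rewrite gt_eqF.
move: (E / M) H1 H2 H => t H1 H2 H.
apply: lerD; apply: ler_wpM2l => //; first exact: ltW.
  rewrite lerBlDr; apply: (le_trans H).
  by rewrite -[X in _ <= _ + X]mul1r -mulrDl addrC ler_wpM2r.
by apply: (le_trans H); rewrite ler_wpM2r.
Qed.

(** [(1 - w) ^ b] is at most [exp (- b w)], hence at most [1 / (1 + b w)]. *)
Lemma onem_powR_le (b w : R) : 0 < b -> 0 <= w <= 1 ->
  (1 - w) `^ b <= 1 - b / (1 + b) * w.
Proof.
move=> b0 /andP[w0 w1]; have bw0 : 0 <= b * w by rewrite mulr_ge0// ltW.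
apply: (@le_trans _ _ (expR (- (b * w)))).
  apply: (@le_trans _ _ (expR (- w) `^ b)).
    apply: ge0_ler_powR; rewrite ?nnegrE ?(ltW b0) ?subr_ge0 ?expR_ge0//.
    by have := expR_ge1Dx (- w).
  by rewrite /powR gt_eqF ?expR_gt0// expRK mulrN.
rewrite expRN; apply: (@le_trans _ _ (1 + b * w)^-1).
  by rewrite lef_pV2 ?posrE ?expR_gt0 ?expR_ge1Dx//; lra.
have b1 : 0 < 1 + b by lra.
have bw1 : 0 < 1 + b * w by lra.
rewrite -subr_ge0 (_ : _ - _ = b ^+ 2 * w * (1 - w) / ((1 + b) * (1 + b * w))).
  rewrite divr_ge0//; last by rewrite mulr_ge0// ltW.
  by rewrite !mulr_ge0 ?exprn_ge0 ?subr_ge0 ?(ltW b0).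
by field; rewrite (gt_eqF b1) (gt_eqF bw1).
Qed.

(** A particle with at most [(1 - eta) * E] of the energy has a smaller weight
   ratio than [E]. Saturation makes the difference small for large energies;
   the factor [1 / (1 + kappa * E ^ eps)] tells how much of it is left. *)
Lemma weight_gap (eps beta eta : R) : 0 < eps -> 0 < beta -> 0 < eta < 1 ->
  exists2 c : R, 0 < c & forall kappa : R, 0 < kappa ->
  forall x E, 0 < E -> 0 <= x <= (1 - eta) * E ->
  c * weight_ratio eps beta kappa E / (1 + kappa * E `^ eps) <=
  weight_ratio eps beta kappa E - weight_ratio eps beta kappa x.
Proof.
move=> e0 b0 /andP[n0 n1]; set l := 1 - eta.
have l0 : 0 < l by rewrite subr_gt0.
have l1 : l < 1 by rewrite ltrBlDr ltrDl.
have le0 : 0 < l `^ eps by exact: powR_gt0.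
have le1 : l `^ eps < 1.
  have := gt0_ltr_powR e0 _ _ l1; rewrite powR1; apply; rewrite nnegrE// ltW//.
have bb : 0 < beta / (1 + beta) by rewrite divr_gt0// addr_gt0.
exists (beta / (1 + beta) * (1 - l `^ eps)); first by rewrite mulr_gt0 ?subr_gt0.
move=> kappa k0 x E E0 /andP[x0 xlE].
have rho0 : 0 < E `^ eps by exact: powR_gt0.
have den : 0 < 1 + kappa * E `^ eps by rewrite ltr_pwDl// mulr_ge0// ltW.
have den' : 0 < 1 + kappa * (l `^ eps * E `^ eps).
  by rewrite ltr_pwDl// mulr_ge0 ?mulr_ge0 ?(ltW k0) ?(ltW le0) ?(ltW rho0).
have hx : weight_ratio eps beta kappa x <= weight_ratio eps beta kappa (l * E).
  exact: weight_ratio_homo.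
pose w := (1 - l `^ eps) / (1 + kappa * (l `^ eps * E `^ eps)).
have gl : gain_rate eps kappa (l * E) = (1 - w) * gain_rate eps kappa E.
  rewrite gain_rate.unlock powRM ?(ltW l0) ?(ltW E0)// /w.
  move: (l `^ eps) (E `^ eps) le0 le1 rho0 den den' => L r L0 L1 r0 D D'.
  by field; rewrite (gt_eqF D) (gt_eqF D').
have w1 : (1 - l `^ eps) / (1 + kappa * E `^ eps) <= w.
  apply: ler_wpM2l; first by rewrite subr_ge0 ltW.
  rewrite lef_pV2 ?posrE// lerD2l; apply: ler_wpM2l; first exact: ltW.
  by rewrite ler_piMl ?(ltW rho0) ?(ltW le1).
have w0 : 0 <= (1 - l `^ eps) / (1 + kappa * E `^ eps) by rewrite divr_ge0 ?subr_ge0 ?ltW.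
have w01 : 0 <= w <= 1.
  rewrite (le_trans w0 w1)/= ler_pdivrMr// mul1r.
  apply: (@le_trans _ _ 1); first by rewrite gerBl ltW.
  by rewrite lerDl mulr_ge0 ?mulr_ge0 ?(ltW k0) ?(ltW le0) ?(ltW rho0).
have hl : weight_ratio eps beta kappa (l * E) <=
    (1 - beta / (1 + beta) * w) * weight_ratio eps beta kappa E.
  rewrite !weight_ratio.unlock gl powRM ?gain_rate_ge0//; last first.
    by rewrite subr_ge0; case/andP: w01.
  apply: ler_wpM2r; first exact: powR_ge0.
  exact: onem_powR_le.
have h0 := weight_ratio_ge0 eps beta kappa E.
apply: (@le_trans _ _ (weight_ratio eps beta kappa E - weight_ratio eps beta kappa (l * E))).
  move: (weight_ratio eps beta kappa E) (weight_ratio eps beta kappa (l * E)) hl h0 => hE hlE hl h0.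
  apply: (@le_trans _ _ (beta / (1 + beta) * w * hE)).
    rewrite mulrAC; apply: ler_wpM2r => //; rewrite -mulrA.
    rewrite mulrA -(mulrA (beta / (1 + beta))); exact: (ler_wpM2l (ltW bb) w1).
  by move: (beta / (1 + beta) * w) hl => c; rewrite mulrBl mul1r; lra.
by rewrite lerD2l lerN2.
Qed.


Section sharing.
Variables (eps beta kappa : R).
Hypothesis eps_gt0 : 0 < eps.
Hypothesis beta_gt0 : 0 < beta.
Hypothesis kappa_gt0 : 0 < kappa.
Local Notation Phi := (weight eps beta kappa).
Local Notation h := (weight_ratio eps beta kappa).
Local Notation g := (gain_rate eps kappa).

Let hle x E : 0 <= x -> x <= E -> 0 <= x * (h E - h x).
Proof. by move=> x0 xE; rewrite mulr_ge0// subr_ge0 weight_ratio_homo. Qed.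

Lemma weight_superadd2 x y : 0 <= x -> 0 <= y -> Phi x + Phi y <= Phi (x + y).
Proof.
move=> x0 y0; rewrite -subr_ge0.
have -> : Phi (x + y) - (Phi x + Phi y) =
    x * (h (x + y) - h x) + y * (h (x + y) - h y).
  by rewrite !weight.unlock; move: (h (x + y)) (h x) (h y) => a b c; ring.
by rewrite addr_ge0// hle ?lerDl ?lerDr.
Qed.

Lemma weight_superadd3 x y z : 0 <= x -> 0 <= y -> 0 <= z ->
  Phi x + Phi y + Phi z <= Phi (x + y + z).
Proof.
move=> x0 y0 z0; apply: le_trans (weight_superadd2 (addr_ge0 x0 y0) z0).
by rewrite lerD2r weight_superadd2.
Qed.

(** The factor [E ^ eps] in the collision rate [U] and the saturation factor of
   the gap combine to [gain_rate E]. *)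
Lemma gain_at_energy c u0 U x E D : 0 < c -> 0 < u0 -> 0 < x -> x <= E ->
  u0 * E `^ eps <= U -> c * h E / (1 + kappa * E `^ eps) <= D ->
  c * u0 * (Phi x * g x) <= U * (E * D).
Proof.
move=> c0 u00 x0 xE UE cD; have E0 := lt_le_trans x0 xE.
have h0 : 0 <= h E := weight_ratio_ge0 _ _ _ _.
have den : 0 < 1 + kappa * E `^ eps by rewrite ltr_pwDl// mulr_ge0 ?powR_ge0// ltW.
apply: (@le_trans _ _ (c * u0 * (Phi E * g E))).
  apply: ler_wpM2l; first by rewrite mulr_ge0// ltW.
  apply: (ler_pM (weight_ge0 _ _ _ (ltW x0)) (gain_rate_ge0 _ kappa_gt0 _)).
    exact: weight_homo (ltW x0) xE.
  exact: gain_rate_homo (ltW x0) xE.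
apply: (@le_trans _ _ (u0 * E `^ eps * (E * (c * h E / (1 + kappa * E `^ eps))))).
  rewrite !weight.unlock gain_rate.unlock; move: (h E) (E `^ eps) den => a r den.
  by rewrite le_eqVlt; apply/orP; left; apply/eqP; field; rewrite gt_eqF.
have D0 : 0 <= c * h E / (1 + kappa * E `^ eps).
  by rewrite divr_ge0 ?mulr_ge0 ?(ltW c0) ?(ltW den).
apply: ler_pM => //; first by rewrite mulr_ge0 ?powR_ge0// ltW.
  by rewrite mulr_ge0// ltW.
by apply: ler_wpM2l => //; exact: ltW.
Qed.

Section gap.
Variables (c eta : R).
Hypothesis c_gt0 : 0 < c.
Hypothesis gapP : forall x E, 0 < E -> 0 <= x <= (1 - eta) * E ->
  c * h E / (1 + kappa * E `^ eps) <= h E - h x.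

Let share E x : 0 < E -> 0 <= x <= (1 - eta) * E ->
  Phi x <= x * (h E - c * h E / (1 + kappa * E `^ eps)).
Proof.
move=> E0 /[dup] /andP[x0 _] xE; rewrite !weight.unlock ler_wpM2l//.
have := gapP E0 xE; rewrite lerBrDl -lerBrDr.
by apply: le_trans; rewrite lexx.
Qed.

Lemma weight_gap2 u0 U x x' y' E : 0 < u0 -> 0 < x -> x <= E -> x' + y' = E ->
  0 <= x' <= (1 - eta) * E -> 0 <= y' <= (1 - eta) * E -> u0 * E `^ eps <= U ->
  U * (Phi x' + Phi y') + c * u0 * (Phi x * g x) <= U * Phi E.
Proof.
move=> u00 x0 xE E' x'E y'E UE; have E0 := lt_le_trans x0 xE.
have U0 : 0 <= U by apply: le_trans UE; rewrite mulr_ge0 ?powR_ge0// ltW.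
have := gain_at_energy c_gt0 u00 x0 xE UE (lexx _).
have := share E0 x'E; have := share E0 y'E.
set D := c * h E / (1 + kappa * E `^ eps) => H1 H2 H3.
have H : Phi x' + Phi y' <= Phi E - E * D.
  apply: le_trans (lerD H2 H1) _; rewrite -mulrDl E' weight.unlock.
  by rewrite mulrBr.
have := ler_wpM2l U0 H; rewrite (mulrBr U) => H4.
by rewrite -lerBrDr; apply: (le_trans H4); rewrite lerD2l lerN2.
Qed.

Lemma weight_gap3 u0 U x x' y' z' E : 0 < u0 -> 0 < x -> x <= E -> x' + y' + z' = E ->
  0 <= x' <= (1 - eta) * E -> 0 <= y' <= (1 - eta) * E -> 0 <= z' <= (1 - eta) * E ->
  u0 * E `^ eps <= U ->
  U * (Phi x' + Phi y' + Phi z') + c * u0 * (Phi x * g x) <= U * Phi E.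
Proof.
move=> u00 x0 xE E' x'E y'E z'E UE; have E0 := lt_le_trans x0 xE.
have U0 : 0 <= U by apply: le_trans UE; rewrite mulr_ge0 ?powR_ge0// ltW.
have := gain_at_energy c_gt0 u00 x0 xE UE (lexx _).
have := share E0 x'E; have := share E0 y'E; have := share E0 z'E.
set D := c * h E / (1 + kappa * E `^ eps) => H0 H1 H2 H3.
have H : Phi x' + Phi y' + Phi z' <= Phi E - E * D.
  apply: le_trans (lerD (lerD H2 H1) H0) _; rewrite -!mulrDl E' weight.unlock.
  by rewrite mulrBr.
have := ler_wpM2l U0 H; rewrite (mulrBr U) => H4.
by rewrite -lerBrDr; apply: (le_trans H4); rewrite lerD2l lerN2.
Qed.

End gap.

Section excess.
Variable C : R.
Hypothesis C_gt0 : 0 < C.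
Hypothesis excessP : forall M E, 0 < M -> M <= E <= 3 * M ->
  Phi E - Phi M <= C * (E - M) * h M.

(** The rate [U] is at most [12 * M], and [M] times the weight ratio at [M] is
   the weight of [M]. *)
Let excess_max U M E : 0 < M -> M <= E <= 3 * M -> 0 <= U <= 4 * E ->
  U * (Phi E - Phi M) <= 12 * C * ((E - M) * Phi M).
Proof.
move=> M0 /[dup] ME /andP[ME1 ME2] /andP[U0 UE].
have h0 : 0 <= h M := weight_ratio_ge0 _ _ _ _.
have EM : 0 <= E - M by rewrite subr_ge0.
apply: (le_trans (ler_wpM2l U0 (excessP M0 ME))).
have CE : 0 <= C * (E - M) * h M by rewrite !mulr_ge0// ltW.
apply: (@le_trans _ _ (12 * M * (C * (E - M) * h M))).
  by apply: ler_wpM2r => //; lra.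
by rewrite !weight.unlock le_eqVlt; apply/orP; left; apply/eqP; ring.
Qed.

(** The excess of the weight of the total energy over the incoming weights has
   only cross terms: it is estimated around the largest of the energies. *)
Lemma weight_excess2 U x y : 0 < x -> 0 < y -> 0 <= U <= 4 * (x + y) ->
  U * Phi (x + y) <= U * (Phi x + Phi y) + 12 * C * (x * Phi y + y * Phi x).
Proof.
wlog yx : x y / y <= x.
  move=> H x0 y0; have [/H|/ltW/H] := leP y x; first exact.
  by rewrite (addrC y x) (addrC (Phi y) (Phi x)) (addrC (y * Phi x) (x * Phi y)); apply.
move=> x0 y0 UE; have /andP[U0 _] := UE.
have xE : x <= x + y <= 3 * x by lra.
have := excess_max x0 xE UE; rewrite (addrC x y) (addrK x y) (addrC y x); have := weight_ge0 eps beta kappa (ltW y0).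
have := weight_ge0 eps beta kappa (ltW x0).
move: (Phi (x + y)) (Phi x) (Phi y) => a b e b0 e0.
have : 0 <= U * e by exact: mulr_ge0.
have : 0 <= 12 * C * (x * e) by rewrite !mulr_ge0// ltW.
rewrite mulrBr !mulrDr; lra.
Qed.

Lemma weight_excess3 U x y z : 0 < x -> 0 < y -> 0 < z -> 0 <= U <= 4 * (x + y + z) ->
  U * Phi (x + y + z) <= U * (Phi x + Phi y + Phi z) +
    12 * C * ((y + z) * Phi x + (x + z) * Phi y + (x + y) * Phi z).
Proof.
move=> x0 y0 z0 UE; have /andP[U0 _] := UE.
have a0 := weight_ge0 eps beta kappa (ltW x0).
have b0 := weight_ge0 eps beta kappa (ltW y0).
have e0 := weight_ge0 eps beta kappa (ltW z0).
have c0 (s t : R) : 0 <= s -> 0 <= t -> 0 <= 12 * C * (s * t).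
  by move=> s0 t0; rewrite !mulr_ge0// ltW.
have := c0 (y + z) _ (addr_ge0 (ltW y0) (ltW z0)) a0.
have := c0 (x + z) _ (addr_ge0 (ltW x0) (ltW z0)) b0.
have := c0 (x + y) _ (addr_ge0 (ltW x0) (ltW y0)) e0.
have := mulr_ge0 U0 a0; have := mulr_ge0 U0 b0; have := mulr_ge0 U0 e0.
have [N ME] : exists M, [/\ M = x \/ M = y \/ M = z, x <= M, y <= M & z <= M].
  have [xy|/ltW yx] := leP x y.
    have [yz|/ltW zy] := leP y z.
      by exists z; split; [right; right| exact: le_trans yz| |].
    by exists y; split; [right; left| | |].
  have [xz|/ltW zx] := leP x z.
    by exists z; split; [right; right| | exact: le_trans xz|].
  by exists x; split; [left| | |].
have big (M rest : R) : 0 < M -> x + y + z = M + rest -> x + y + z <= 3 * M -> 0 <= rest ->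
    U * Phi (x + y + z) <= U * Phi M + 12 * C * (rest * Phi M).
  move=> Mgt0 Er E3 r0.
  have ME' : M <= x + y + z <= 3 * M by rewrite E3 Er lerDl r0.
  have := excess_max Mgt0 ME' UE; rewrite (mulrBr U) (_ : x + y + z - M = rest).
    by rewrite lerBlDl.
  by rewrite Er addrAC subrr add0r.
case: ME => + xM yM zM; case=> [|[]] MM; subst N;
  [have := big x (y + z) x0 _ _ (addr_ge0 (ltW y0) (ltW z0))
  |have := big y (x + z) y0 _ _ (addr_ge0 (ltW x0) (ltW z0))
  |have := big z (x + y) z0 _ _ (addr_ge0 (ltW x0) (ltW y0))];
  (move=> H1; have {}H1 := H1 ltac:(ring) ltac:(lra); move: H1);
  move: (Phi (x + y + z)) (Phi x) (Phi y) (Phi z) => E a b e;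
  rewrite !(mulrDr U) !(mulrDr (12 * C));
  move: (U * E) (U * a) (U * b) (U * e) (12 * C * ((y + z) * a)) (12 * C * ((x + z) * b))
    (12 * C * ((x + y) * e)) => ? ? ? ? ? ? ?; lra.
Qed.

End excess.

End sharing.

End superadditivity.


(** * The weak form of a collision operator *)

Section iterated_integrals.
Context {d1 d2} {S : measurableType d1} {X : measurableType d2} {R : realType}.
Variables (sigma : {sigma_finite_measure set S -> \bar R})
  (mu : {sigma_finite_measure set X -> \bar R}).

Lemma measurable_snd_fun (f : X -> R) : measurable_fun setT f -> measurable_fun setT (fun z : S * X => f z.2).
Proof. by move=> mf; exact: measurableT_comp mf measurable_snd. Qed.

Definition iterated_integral (f : S -> X -> R) := (\int[sigma]_s \int[mu]_x (f s x)%:E)%E.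

Lemma iterated_integralE (h : S -> X -> R) : measurable_fun setT (fun z : S * X => h z.1 z.2) ->
  (forall s x, 0 <= h s x) ->
  iterated_integral h = (\int[(sigma \x mu)%E]_z (h z.1 z.2)%:E)%E.
Proof.
move=> mh h0; rewrite fubini_tonelli1//; last by move=> z; rewrite lee_fin.
exact/measurable_EFinP.
Qed.

Lemma iterated_integralD (f g : S -> X -> R) : measurable_fun setT (fun z : S * X => f z.1 z.2) ->
  measurable_fun setT (fun z : S * X => g z.1 z.2) ->
  (forall s x, 0 <= f s x) -> (forall s x, 0 <= g s x) ->
  iterated_integral (fun s x => f s x + g s x) = (iterated_integral f + iterated_integral g)%E.
Proof.
move=> mf mg f0 g0.
rewrite !iterated_integralE//.
- rewrite -ge0_integralD//; try by move=> z _; rewrite lee_fin.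
    exact/measurable_EFinP.
  exact/measurable_EFinP.
- exact: measurable_funD.
by move=> s x; rewrite addr_ge0.
Qed.

Lemma le_iterated_integral (f g : S -> X -> R) : measurable_fun setT (fun z : S * X => f z.1 z.2) ->
  measurable_fun setT (fun z : S * X => g z.1 z.2) ->
  (forall s x, 0 <= f s x) -> (forall s x, f s x <= g s x) -> (iterated_integral f <= iterated_integral g)%E.
Proof.
move=> mf mg f0 fg.
rewrite !iterated_integralE//; last by move=> s x; apply: le_trans (fg s x).
apply: ge0_le_integral => //=; try by (move=> z _; rewrite lee_fin//).
- exact/measurable_EFinP.
- by apply/measurable_EFinP.
Qed.

Lemma iterated_integral_prod (a : S -> X -> R) (g : X -> R) : measurable_fun setT (fun z : S * X => a z.1 z.2) ->
  measurable_fun setT g -> (forall s x, 0 <= a s x) -> (forall x, 0 <= g x) ->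
  iterated_integral (fun s x => a s x * g x) = (\int[mu]_x ((\int[sigma]_s (a s x)%:E) * (g x)%:E))%E.
Proof.
move=> ma mg a0 g0; rewrite /iterated_integral sigma_finite_tonelli_swap//.
- apply: eq_integral => x _; under eq_integral do rewrite EFinM.
  rewrite ge0_integralZr ?lee_fin//; last by move=> s _; rewrite lee_fin.
  apply/measurable_EFinP; exact: (measurableT_comp ma (pair2_measurable x)).
- apply/measurable_EFinP; apply: measurable_funM => //; exact: measurable_snd_fun.
by move=> s x; rewrite lee_fin mulr_ge0.
Qed.

End iterated_integrals.

Section weak_form.
Context {d1 d2 d3} {S : measurableType d1} {V : measurableType d2}
  {W : measurableType d3} {R : realType}.
Variables (sigma : {sigma_finite_measure set S -> \bar R})
  (lambda : {sigma_finite_measure set V -> \bar R})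
  (nu : {sigma_finite_measure set W -> \bar R}).
Local Notation X := (V * W)%type.
Local Notation lambda_nu := (product_sfm lambda nu).

Let regroup (p : V * (S * W)) : S * X := (p.2.1, (p.1, p.2.2)).

Let measurable_regroup : measurable_fun setT regroup.
Proof.
apply: measurable_fun_pair; first exact: measurableT_comp measurable_fst measurable_snd.
apply: measurable_fun_pair => //.
exact: measurableT_comp measurable_snd measurable_snd.
Qed.

Lemma tonelli_regroup (H : S * X -> \bar R) : measurable_fun setT H ->
  (forall z, 0 <= H z)%E ->
  (\int[(lambda \x product_sfm sigma nu)%E]_p H (regroup p) =
   \int[sigma]_s \int[lambda_nu]_x H (s, x))%E.
Proof.
move=> mH H0; rewrite fubini_tonelli1 => //; last exact: measurableT_comp.
have mH' : measurable_fun setT (fun p : V * S * W => H (p.1.2, (p.1.1, p.2))).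
  apply: measurableT_comp => //; apply: measurable_fun_pair.
    exact: measurableT_comp measurable_snd measurable_fst.
  apply: measurable_fun_pair => //.
  exact: measurableT_comp measurable_fst measurable_fst.
transitivity (\int[lambda]_v \int[sigma]_s \int[nu]_w H (s, (v, w)))%E.
  apply: eq_integral => v _; rewrite /fubini_F [LHS]fubini_tonelli1//.
  apply: measurableT_comp => //=; apply: measurable_fun_pair => /=; first exact: measurable_fst.
  by apply: measurable_fun_pair => //; exact: measurable_cst.
rewrite (sigma_finite_tonelli_swap lambda sigma) //; last 2 first.
- exact: (measurable_fun_fubini_tonelli_F (m2 := nu) _ mH' (fun=> H0 _)).
- by move=> v s; apply: integral_ge0.
apply: eq_integral => s _; rewrite [RHS]fubini_tonelli1//.
by apply: measurableT_comp => //; apply: measurable_fun_pair.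
Qed.

Variables (T T' : S -> X -> X) (k k' : S -> X -> R) (F F' : X -> R) (Psi : V -> R).
Variables (S0 : set S) (N : set X).
Hypothesis mT : measurable_fun setT (fun p : S * X => T p.1 p.2).
Hypothesis mk : measurable_fun setT (fun p : S * X => k p.1 p.2).
Hypothesis mF : measurable_fun setT F.
Hypothesis mPsi : measurable_fun setT Psi.
Hypothesis T_preserves : forall s, preserves lambda_nu (T s).
Hypothesis TK : forall s x, T s (T s x) = x.
Hypothesis kT : forall s x, k s (T s x) = k s x.
Hypothesis k_ge0 : forall s x, 0 <= k s x.
Hypothesis F_ge0 : forall x, 0 <= F x.
Hypothesis Psi_gt0 : forall v, 0 < Psi v.
Hypothesis mS0 : measurable S0.
Hypothesis S0_null : sigma S0 = 0%E.
Hypothesis mN : measurable N.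
Hypothesis N_null : lambda_nu N = 0%E.
Hypothesis T'E : forall s x, ~ S0 s -> T' s x = T s x.
Hypothesis k'E : forall s x, ~ S0 s -> k' s x = k s x.
Hypothesis F'E : forall x, ~ N x -> F' x = F x.

Let bad : set (S * X) := [set z | S0 z.1] `|` ([set z | N z.2] `|` [set z | N (T z.1 z.2)]).

Let mbad : measurable bad.
Proof.
apply: measurableU; last apply: measurableU.
- by rewrite -[X in measurable X]setTI; exact: measurable_fst.
- by rewrite -[X in measurable X]setTI; exact: measurable_snd.
by rewrite -[X in measurable X]setTI; exact: mT.
Qed.

Let bad_null : {ae lambda, forall v,
  (sigma \x nu)%E [set p : S * W | bad (p.1, (v, p.2))] = 0%E}.
Proof.
pose A : set (V * (S * W)) := regroup @^-1` bad.
have mA : measurable A.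
  by rewrite -[X in measurable X]setTI; exact: measurable_regroup.
have A0 : (lambda \x product_sfm sigma nu)%E A = 0%E.
  transitivity (\int[(lambda \x product_sfm sigma nu)%E]_p (\1_bad (regroup p))%:E)%E.
    transitivity (\int[(lambda \x product_sfm sigma nu)%E]_p (\1_A p)%:E)%E => //.
    by rewrite (integral_indic (lambda \x product_sfm sigma nu)%E measurableT mA) setIT.
  rewrite (tonelli_regroup (H := fun z => (\1_bad z)%:E)) //; last first.
    by apply/measurable_EFinP; exact: measurable_indic.
  rewrite -(integral0 sigma setT).
  apply: (eq_integral_off_null mS0 S0_null) => s Ss.
  have mNT : measurable (T s @^-1` N).
    by rewrite -[X in measurable X]setTI; apply: (T_preserves s).1.
  have mU : measurable (N `|` T s @^-1` N) by exact: measurableU.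
  transitivity (\int[lambda_nu]_x (\1_(N `|` T s @^-1` N) x)%:E)%E.
    apply: eq_integral => x _; congr ((nat_of_bool _)%:R%:E).
    apply/idP/idP; rewrite !inE /bad/=; first by case.
    by right.
  rewrite integral_indic// setIT; apply: null_setU2 => //.
  exact: etrans ((T_preserves s).2 _ mN) N_null.
have mx : measurable_fun setT (product_sfm sigma nu \o xsection A) by exact: measurable_fun_xsection.
have /(ae_eq_integral_abs _ measurableT mx).1 :
    (\int[lambda]_x `|(product_sfm sigma nu \o xsection A) x|)%E = 0%E.
  by rewrite -A0; apply: eq_integral => v _; rewrite gee0_abs//; exact: measure_ge0.
apply: filterS => v /(_ Logic.I) /= <-; congr (_ _).
by apply/seteqP; split=> p; rewrite /xsection/= inE.
Qed.

Let J1 (p : V * (S * W)) : R :=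
  let x := (p.1, p.2.2) in k p.2.1 x * F (T p.2.1 x) * Psi p.1.
Let J2 (p : V * (S * W)) : R :=
  let x := (p.1, p.2.2) in k p.2.1 x * F x * Psi p.1.

Let mx : measurable_fun setT (fun p : V * (S * W) => (p.1, p.2.2)).
Proof.
apply: measurable_fun_pair => //; exact: measurableT_comp measurable_snd measurable_snd.
Qed.

Let mkJ : measurable_fun setT (fun p : V * (S * W) => k p.2.1 (p.1, p.2.2)).
Proof. exact: (measurableT_comp mk measurable_regroup). Qed.

Let mJ1 : measurable_fun setT J1.
Proof.
apply: measurable_funM; last exact: measurableT_comp mPsi measurable_fst.
apply: measurable_funM => //; apply: measurableT_comp mF _.
exact: (measurableT_comp mT measurable_regroup).
Qed.

Let mJ2 : measurable_fun setT J2.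
Proof.
apply: measurable_funM; last exact: measurableT_comp mPsi measurable_fst.
by apply: measurable_funM => //; exact: measurableT_comp mF _.
Qed.

Let J1_ge0 p : 0 <= J1 p.
Proof. by rewrite !mulr_ge0// ltW. Qed.

Let J2_ge0 p : 0 <= J2 p.
Proof. by rewrite !mulr_ge0// ltW. Qed.

Let gain := iterated_integral sigma lambda_nu (fun s x => k s x * F x * Psi (T s x).1).
Let loss := iterated_integral sigma lambda_nu (fun s x => k s x * F x * Psi x.1).

Let mPT : measurable_fun setT (fun z : S * X => k z.1 z.2 * F z.2 * Psi (T z.1 z.2).1).
Proof.
apply: measurable_funM; last first.
  by apply: measurableT_comp mPsi _; exact: measurableT_comp measurable_fst mT.
by apply: measurable_funM => //; exact: measurableT_comp mF measurable_snd.
Qed.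

Let J1E : (\int[(lambda \x product_sfm sigma nu)%E]_p (J1 p)%:E = gain)%E.
Proof.
rewrite (tonelli_regroup (H := fun z => (k z.1 z.2 * F (T z.1 z.2) * Psi z.2.1)%:E)).
- apply: eq_integral => s _ /=.
  rewrite -[RHS](preserves_integral (T_preserves s)).
  - by apply: eq_integral => x _; rewrite TK kT.
  - apply/measurable_EFinP; exact: (measurableT_comp mPT (pair1_measurable s)).
  - by move=> x; rewrite lee_fin !mulr_ge0// ltW.
- apply/measurable_EFinP; apply: measurable_funM; last first.
    by apply: measurableT_comp mPsi _; exact: measurableT_comp measurable_fst measurable_snd.
  by apply: measurable_funM => //; exact: measurableT_comp mF mT.
by move=> z; rewrite lee_fin !mulr_ge0// ltW.
Qed.

Let J2E : (\int[(lambda \x product_sfm sigma nu)%E]_p (J2 p)%:E = loss)%E.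
Proof.
rewrite (tonelli_regroup (H := fun z => (k z.1 z.2 * F z.2 * Psi z.2.1)%:E)) //.
  apply/measurable_EFinP; apply: measurable_funM; last first.
    by apply: measurableT_comp mPsi _; exact: measurableT_comp measurable_fst measurable_snd.
  by apply: measurable_funM => //; exact: measurableT_comp mF measurable_snd.
by move=> z; rewrite lee_fin !mulr_ge0// ltW.
Qed.

(** Each of the gain and loss parts is integrable, and the measure-preserving
   involution [T s] turns the weight of the gain part into the weight of an
   outgoing velocity. The primed data stand for the formulas that define a
   collision operator, which agree with the regular data [T], [k], [F] off the
   null sets [S0] and [N] only. *)
Lemma weak_form (G L : \bar R) : gain = G -> loss = L -> (G < +oo)%E -> (L < +oo)%E ->
  exists J : V -> \bar R,
  [/\ lambda.-integrable setT J, (\int[lambda]_v J v = G - L)%E &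
    {ae lambda, forall v, (Rintegral (sigma \x nu)%E setT (fun p : S * W =>
       k' p.1 (v, p.2) * (F' (T' p.1 (v, p.2)) - F' (v, p.2))) * Psi v)%:E = J v}].
Proof.
move=> <- <- goo loo.
have I1 : (lambda \x product_sfm sigma nu)%E.-integrable setT (EFin \o J1).
  apply/integrableP; split; first exact/measurable_EFinP.
  by under eq_integral do rewrite /= ger0_norm//; rewrite J1E.
have I2 : (lambda \x product_sfm sigma nu)%E.-integrable setT (EFin \o J2).
  apply/integrableP; split; first exact/measurable_EFinP.
  by under eq_integral do rewrite /= ger0_norm//; rewrite J2E.
have I := integrableB measurableT I1 I2.
exists (fubini_F (product_sfm sigma nu) ((EFin \o J1) \- (EFin \o J2))%E); split.
- exact: integrable_fubini_F I.
- by rewrite (integral12_prod_meas1 I) integralB// J1E J2E.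
apply: filterS3 bad_null (ae_integrable1 I1) (ae_integrable1 I2) => v bv i1 i2.
have mbv : measurable [set p : S * W | bad (p.1, (v, p.2))].
  rewrite -[X in measurable X]setTI.
  exact: (measurableT_comp measurable_regroup (pair1_measurable v) measurableT mbad).
have Ev : (\int[product_sfm sigma nu]_p (k' p.1 (v, p.2) * (F' (T' p.1 (v, p.2)) - F' (v, p.2)))%:E =
    \int[product_sfm sigma nu]_p ((Psi v)^-1%:E * ((J1 (v, p))%:E - (J2 (v, p))%:E)))%E.
  apply: (eq_integral_off_null mbv bv) => -[s w] /= nb.
  have nS : ~ S0 s by move=> ?; apply: nb; left.
  have nN : ~ N (v, w) by move=> ?; apply: nb; right; left.
  have nT : ~ N (T s (v, w)) by move=> ?; apply: nb; right; right.
  rewrite T'E// k'E// !F'E// /J1 /J2/= -EFinB -EFinM; congr (_%:E).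
  by field; rewrite gt_eqF.
have fin : (\int[product_sfm sigma nu]_p ((J1 (v, p))%:E - (J2 (v, p))%:E))%E \is a fin_num.
  by apply: integrable_fin_num => //; exact: (integrableB measurableT i1 i2).
rewrite {1}/Rintegral Ev integralZl//; last exact: (integrableB measurableT i1 i2).
rewrite fineM// [fine _%:E]/= mulrAC mulVf ?gt_eqF// mul1r.
by rewrite fineK.
Qed.

End weak_form.

Section integrated_povzner.
Context {d1 d2} {S : measurableType d1} {X : measurableType d2} {R : realType}.
Variables (sigma : {sigma_finite_measure set S -> \bar R})
  (mu : {sigma_finite_measure set X -> \bar R}).
Variables (k b l : S -> X -> R) (P : X -> R) (P' : S -> X -> R) (Y Z F : X -> R).
Variables (A : set X) (C c p B : R).
Hypothesis mk : measurable_fun setT (fun z : S * X => k z.1 z.2).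
Hypothesis mb : measurable_fun setT (fun z : S * X => b z.1 z.2).
Hypothesis ml : measurable_fun setT (fun z : S * X => l z.1 z.2).
Hypothesis mP : measurable_fun setT P.
Hypothesis mP' : measurable_fun setT (fun z : S * X => P' z.1 z.2).
Hypothesis mY : measurable_fun setT Y.
Hypothesis mZ : measurable_fun setT Z.
Hypothesis mF : measurable_fun setT F.
Hypothesis mA : measurable A.
Hypothesis k_ge0 : forall s x, 0 <= k s x.
Hypothesis b_ge0 : forall s x, 0 <= b s x.
Hypothesis l_ge0 : forall s x, 0 <= l s x.
Hypothesis P_ge0 : forall x, 0 <= P x.
Hypothesis P'_ge0 : forall s x, 0 <= P' s x.
Hypothesis Y_ge0 : forall x, 0 <= Y x.
Hypothesis Z_ge0 : forall x, 0 <= Z x.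
Hypothesis F_ge0 : forall x, 0 <= F x.
Hypothesis c_ge0 : 0 <= c.
Hypothesis C_ge0 : 0 <= C.
Hypothesis p_ge0 : 0 <= p.
Hypothesis B_ge0 : 0 <= B.
Hypothesis b_average : forall x, (\int[sigma]_s (b s x)%:E <= B%:E)%E.
Hypothesis l_average : forall x, A x -> (p%:E <= \int[sigma]_s (l s x)%:E)%E.
Hypothesis pointwise : forall s x,
  k s x * P' s x + c * l s x * (\1_A x * Z x) <= k s x * P x + C * b s x * Y x.

(** Of [b], which bounds the kernel, and of [l], which selects the collisions
   that dissipate, only the averages over the impact directions remain. *)
Lemma integrated_povzner :
  (iterated_integral sigma mu (fun s x => (k s x * F x) * P' s x)%R +
     (c * p)%:E * \int[mu]_x (F x * (\1_A x * Z x))%:E <=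
   iterated_integral sigma mu (fun s x => (k s x * F x) * P x)%R + (C * B)%:E * \int[mu]_x (F x * Y x)%:E)%E.
Proof.
have m1 : measurable_fun setT (fun x => \1_A x * Z x).
  by apply: measurable_funM => //; exact: measurable_indic.
have ind0 x : 0 <= \1_A x * Z x by rewrite mulr_ge0.
have mkF : measurable_fun setT (fun z : S * X => k z.1 z.2 * F z.2).
  by apply: measurable_funM => //; exact: measurable_snd_fun.
apply: (@le_trans _ _ (iterated_integral sigma mu (fun s x => (k s x * F x) * P' s x)%R +
    iterated_integral sigma mu (fun s x => c * l s x * (F x * (\1_A x * Z x)))%R)%E).
  apply: leeD2l; rewrite iterated_integral_prod//; last 4 first.
  - exact: measurable_funM.
  - exact: measurable_funM.
  - by move=> s x; rewrite mulr_ge0.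
  - by move=> x; rewrite mulr_ge0.
  rewrite -ge0_integralZl ?lee_fin ?mulr_ge0//; last 2 first.
  - by apply/measurable_EFinP; exact: measurable_funM.
  - by move=> x _; rewrite lee_fin mulr_ge0.
  have ml1 x : measurable_fun setT (l ^~ x).
    exact: (measurableT_comp ml (pair2_measurable x)).
  apply: ge0_le_integral => //.
  - by move=> x _; rewrite mule_ge0// lee_fin !mulr_ge0.
  - by apply: measurable_funeM; apply/measurable_EFinP; exact: measurable_funM.
  - apply: emeasurable_funM; last by apply/measurable_EFinP; exact: measurable_funM.
    apply: (measurable_fun_fubini_tonelli_G (m1 := sigma) (fun z : S * X => (c * l z.1 z.2)%:E)).
      by apply/measurable_EFinP; exact: measurable_funM.
    by move=> z; rewrite lee_fin mulr_ge0.
  move=> x _; under eq_integral do rewrite EFinM.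
  rewrite ge0_integralZl ?lee_fin//; last 2 first.
  - by apply/measurable_EFinP.
  - by move=> s _; rewrite lee_fin.
  have [Ax|Ax] := pselect (A x).
    rewrite EFinM; apply: lee_wpmul2r; first by rewrite lee_fin mulr_ge0.
    by apply: lee_wpmul2l; rewrite ?lee_fin// l_average.
  rewrite indicE memNset//= mul0r mulr0 !mule0//.
rewrite -iterated_integralD//; last 4 first.
- by apply: measurable_funM.
- apply: measurable_funM; first exact: measurable_funM.
  exact: (measurable_snd_fun (measurable_funM mF m1)).
- by move=> s x; rewrite !mulr_ge0.
- by move=> s x; rewrite !mulr_ge0.
apply: (@le_trans _ _ (iterated_integral sigma mu (fun s x => (k s x * F x) * P x + C * b s x * (F x * Y x)))).
  apply: le_iterated_integral.
  - apply: measurable_funD; first exact: measurable_funM.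
    apply: measurable_funM; first exact: measurable_funM.
    exact: (measurable_snd_fun (measurable_funM mF m1)).
  - apply: measurable_funD; first by apply: measurable_funM => //; exact: measurable_snd_fun.
    apply: measurable_funM; first exact: measurable_funM.
    by apply: measurable_funM; exact: measurable_snd_fun.
  - by move=> s x; rewrite addr_ge0 ?mulr_ge0.
  move=> s x; have := ler_wpM2l (F_ge0 x) (pointwise s x); rewrite !mulrDr.
  move: (\1_A x * Z x) => u; congr (is_true (_ <= _)); ring.
rewrite iterated_integralD//; last 4 first.
- by apply: measurable_funM => //; exact: measurable_snd_fun.
- apply: measurable_funM; first exact: measurable_funM.
  by apply: measurable_funM; exact: measurable_snd_fun.
- by move=> s x; rewrite !mulr_ge0.
- by move=> s x; rewrite !mulr_ge0.
apply: leeD2l; rewrite iterated_integral_prod//; last 4 first.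
- exact: measurable_funM.
- exact: measurable_funM.
- by move=> s x; rewrite mulr_ge0.
- by move=> x; rewrite mulr_ge0.
have mb1 x : measurable_fun setT (b ^~ x).
  exact: (measurableT_comp mb (pair2_measurable x)).
rewrite -ge0_integralZl ?lee_fin ?mulr_ge0//; last 2 first.
- by apply/measurable_EFinP; exact: measurable_funM.
- by move=> x _; rewrite lee_fin mulr_ge0.
apply: ge0_le_integral => //.
- move=> x _; rewrite mule_ge0 ?lee_fin ?mulr_ge0//.
  by apply: integral_ge0 => s _; rewrite lee_fin mulr_ge0.
- apply: emeasurable_funM; last by apply/measurable_EFinP; exact: measurable_funM.
  apply: (measurable_fun_fubini_tonelli_G (m1 := sigma) (fun z : S * X => (C * b z.1 z.2)%:E)).
    by apply/measurable_EFinP; exact: measurable_funM.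
  by move=> z; rewrite lee_fin mulr_ge0.
- by apply: measurable_funeM; apply/measurable_EFinP; exact: measurable_funM.
move=> x _; under eq_integral do rewrite EFinM.
rewrite ge0_integralZl ?lee_fin//; last 2 first.
- by apply/measurable_EFinP.
- by move=> s _; rewrite lee_fin.
rewrite EFinM; apply: lee_wpmul2r; first by rewrite lee_fin mulr_ge0.
by rewrite EFinM; apply: lee_wpmul2l; rewrite ?lee_fin.
Qed.

End integrated_povzner.


(** * Collision maps *)

Section packed_isometries.
Context {R : realType}.

(** A product of copies of [R^d] is identified with the space of concatenated
   vectors, in which the collision map is a linear isometry. *)
Lemma packed_isometry_preserves d (X : measurableType d)
    (mu : {sigma_finite_measure set X -> \bar R}) add opp N n
    (pack : X -> 'rV[R]_n) (unpack : 'rV[R]_n -> X) J :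
  euclidean mu add opp N ->
  measurable_fun setT pack -> measurable_fun setT unpack ->
  cancel pack unpack -> cancel unpack pack ->
  (forall x y, pack (add x y) = pack x + pack y) ->
  (forall x, pack (opp x) = - pack x) -> (forall x, N x = dot (pack x) (pack x)) ->
  isometric_involution J -> preserves mu (unpack \o J \o pack).
Proof.
move=> E mp mu' pK uK pD pN NE I; apply: (euclidean_isometry E).
- apply: (measurableT_comp mu'); exact: (measurableT_comp (isometric_measurable I)).
- by move=> x y /=; apply: (can_inj pK); rewrite !pD !uK (isometric_add I).
- move=> x /=; apply: (can_inj pK); rewrite !(pN, uK) -scaleN1r (isometric_scale I).
  by rewrite scaleN1r.
- by move=> x /=; rewrite uK (isometric_involutive I) pK.
by move=> x; rewrite !NE /= uK (isometric_dot I).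
Qed.

Lemma measurable_rVZ d (X : measurableType d) n (c : X -> R) (f : X -> 'rV[R]_n) :
  measurable_fun setT c -> measurable_fun setT f -> measurable_fun setT (fun x => c x *: f x).
Proof.
move=> mc mf; apply/measurable_fun_rVP => i; under eq_fun do rewrite mxE.
by apply: measurable_funM => //; exact: measurableT_comp (measurable_coord i) mf.
Qed.

Lemma measurable_reflection d (X : measurableType d) n (f g : X -> 'rV[R]_n) :
  measurable_fun setT f -> measurable_fun setT g ->
  measurable_fun setT (fun x => reflection (f x) (g x)).
Proof.
move=> mf mg; apply: measurable_fun_comp2 (@measurable_rVD R n) _ _ => //.
apply: measurableT_comp (@measurable_rVN R n) _; apply: measurable_rVZ => //.
apply: measurable_funM.
  by apply: measurable_funM => //; exact: measurable_dot.
by apply: measurableT_comp measurable_invr _; exact: measurable_dot.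
Qed.

Lemma measurable_row_mx d (X : measurableType d) m n (f : X -> 'rV[R]_m) (g : X -> 'rV[R]_n) :
  measurable_fun setT f -> measurable_fun setT g ->
  measurable_fun setT (fun x => row_mx (f x) (g x)).
Proof.
move=> mf mg; apply/measurable_fun_rVP => i; case: (split_ordP i) => j ->.
  under eq_fun do rewrite row_mxEl; exact: (measurableT_comp (measurable_coord j)).
under eq_fun do rewrite row_mxEr; exact: (measurableT_comp (measurable_coord j)).
Qed.

Lemma dot_reflection n (w v : 'rV[R]_n) : dot (reflection w v) w = - dot v w.
Proof.
have [->|w0] := eqVneq w 0.
  by rewrite dotC dot0l dotC dot0l oppr0.
have ww : dot w w != 0 by apply: contra_neq w0; exact: dot_eq0.
by rewrite dotBl dotZl; field.
Qed.

End packed_isometries.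

Section collision_maps.
Context {R : realType} {d : nat}.
Local Notation V := 'rV[R]_d.
Local Notation lambda := (lebesgue_rV d).
Local Notation lambda2 := (product_sfm lambda lambda).
Local Notation lambda3 := (product_sfm lambda lambda2).

Definition pack2 (x : V * V) : 'rV[R]_(d + d) := row_mx x.1 x.2.
Definition unpack2 (p : 'rV[R]_(d + d)) : V * V := (lsubmx p, rsubmx p).
Definition pack3 (x : V * (V * V)) : 'rV[R]_(d + (d + d)) := row_mx x.1 (pack2 x.2).
Definition unpack3 (p : 'rV[R]_(d + (d + d))) : V * (V * V) :=
  (lsubmx p, unpack2 (rsubmx p)).

Lemma pack2K : cancel pack2 unpack2.
Proof. by case=> a b; rewrite /unpack2 row_mxKl row_mxKr. Qed.

Lemma unpack2K : cancel unpack2 pack2.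
Proof. by move=> p; rewrite /pack2 hsubmxK. Qed.

Lemma pack3K : cancel pack3 unpack3.
Proof. by case=> a b; rewrite /unpack3 row_mxKl row_mxKr pack2K. Qed.

Lemma unpack3K : cancel unpack3 pack3.
Proof. by move=> p; rewrite /pack3 unpack2K hsubmxK. Qed.

Let measurable_pack2 : measurable_fun setT pack2.
Proof. by apply: measurable_row_mx. Qed.

Let measurable_pack3 : measurable_fun setT pack3.
Proof.
by apply: measurable_row_mx => //; exact: measurableT_comp measurable_pack2 measurable_snd.
Qed.

Let measurable_unpack2 : measurable_fun setT unpack2.
Proof. by apply: measurable_fun_pair; [exact: measurable_lsubmx|exact: measurable_rsubmx]. Qed.

Let measurable_unpack3 : measurable_fun setT unpack3.
Proof.
apply: measurable_fun_pair; first exact: measurable_lsubmx.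
exact: measurableT_comp measurable_unpack2 (@measurable_rsubmx R _ _).
Qed.

(** A collision reflects the vector of all velocities in the hyperplane
   orthogonal to [(w, - w)], respectively to [(w1 + w2, - w1, - w2)]. This is why
   it is an involution and preserves energy, momentum and Lebesgue measure. *)
Definition normal2 (w : V) : 'rV[R]_(d + d) := pack2 (w, - w).
Definition normal3 (w : 'rV[R]_(d + d)) : 'rV[R]_(d + (d + d)) :=
  pack3 (lsubmx w + rsubmx w, (- lsubmx w, - rsubmx w)).

Definition collide2 (w : V) (x : V * V) : V * V :=
  unpack2 (reflection (normal2 w) (pack2 x)).
Definition collide3 (w : 'rV[R]_(d + d)) (x : V * (V * V)) : V * (V * V) :=
  unpack3 (reflection (normal3 w) (pack3 x)).

Lemma collide2K w : involutive (collide2 w).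
Proof.
move=> x; rewrite /collide2 unpack2K.
by rewrite (isometric_involutive (reflection_isometric _)) pack2K.
Qed.

Lemma collide3K w : involutive (collide3 w).
Proof.
move=> x; rewrite /collide3 unpack3K.
by rewrite (isometric_involutive (reflection_isometric _)) pack3K.
Qed.

Lemma collide2_preserves w : preserves lambda2 (collide2 w).
Proof.
apply: (packed_isometry_preserves (euclidean_prod (euclidean_rV d) (euclidean_rV d))
  measurable_pack2 measurable_unpack2 pack2K unpack2K) (reflection_isometric _).
- by move=> x y; rewrite /pack2 add_row_mx.
- by move=> x; rewrite /pack2 opp_row_mx.
by move=> x; rewrite dot_row_mx2.
Qed.

Lemma collide3_preserves w : preserves lambda3 (collide3 w).
Proof.
apply: (packed_isometry_preserves (euclidean_prod (euclidean_rV d)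
    (euclidean_prod (euclidean_rV d) (euclidean_rV d)))
  measurable_pack3 measurable_unpack3 pack3K unpack3K) (reflection_isometric _).
- by move=> x y; rewrite /pack3 /pack2 !add_row_mx.
- by move=> x; rewrite /pack3 /pack2 !opp_row_mx.
by move=> x; rewrite !dot_row_mx2.
Qed.

Lemma measurable_collide2 : measurable_fun setT (fun p : V * (V * V) => collide2 p.1 p.2).
Proof.
apply: (measurableT_comp measurable_unpack2); apply: measurable_reflection; last first.
  exact: measurableT_comp measurable_pack2 measurable_snd.
apply: measurable_row_mx; first exact: measurable_fst.
exact: measurableT_comp (@measurable_rVN R d) measurable_fst.
Qed.

Lemma measurable_collide3 :
  measurable_fun setT (fun p : 'rV[R]_(d + d) * (V * (V * V)) => collide3 p.1 p.2).
Proof.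
have ml := measurableT_comp (@measurable_lsubmx R d d) (@measurable_fst _ _ 'rV[R]_(d + d) (V * (V * V))%type).
have mr := measurableT_comp (@measurable_rsubmx R d d) (@measurable_fst _ _ 'rV[R]_(d + d) (V * (V * V))%type).
apply: (measurableT_comp measurable_unpack3); apply: measurable_reflection; last first.
  exact: measurableT_comp measurable_pack3 measurable_snd.
apply: measurable_row_mx; first exact: measurable_fun_comp2 (@measurable_rVD R d) ml mr.
by apply: measurable_row_mx; apply: measurableT_comp (@measurable_rVN R d) _.
Qed.

Definition relative3 (x : V * (V * V)) : 'rV[R]_(d + d) :=
  row_mx (x.2.1 - x.1) (x.2.2 - x.1).

Lemma dot_normal2 w x : dot (pack2 x) (normal2 w) = - dot w (x.2 - x.1).
Proof. by rewrite dot_row_mx2 dotNr dotBr !(dotC w) opprB. Qed.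

Lemma dot_normal3 w x : dot (pack3 x) (normal3 w) = - dot (relative3 x) w.
Proof.
rewrite dot_row_mx2 dot_row_mx2 dot_row_mx !dotNr dotDr !dotBl; ring.
Qed.

Lemma collide2E w x : enorm w = 1 -> collide2 w x =
  (x.1 + dot w (x.2 - x.1) *: w, x.2 - dot w (x.2 - x.1) *: w).
Proof.
move=> w1; rewrite /collide2 /reflection dot_normal2.
have -> : dot (normal2 w) (normal2 w) = 2.
  by rewrite dot_row_mx2 dotNl dotNr opprK -enorm_sqr w1 expr1n.
rewrite mulrAC divff ?mul1r// scaleNr opprK /unpack2.
rewrite scale_row_mx add_row_mx row_mxKl row_mxKr/=.
by rewrite scalerN.
Qed.

Lemma pack2_along w x c : pack2 x + c *: normal2 w = pack2 (x.1 + c *: w, x.2 - c *: w).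
Proof. by rewrite /normal2 /pack2/= !scale_row_mx !add_row_mx !scalerN. Qed.

Lemma pack3_along w x c : pack3 x + c *: normal3 w =
  pack3 (x.1 + c *: (lsubmx w + rsubmx w), (x.2.1 - c *: lsubmx w, x.2.2 - c *: rsubmx w)).
Proof. by rewrite /normal3 /pack3 /pack2/= !scale_row_mx !add_row_mx !scalerN. Qed.

Lemma collide3E w x : enorm w = 1 ->
  let c := dot (relative3 x) w / (1 + dot (lsubmx w) (rsubmx w)) in
  collide3 w x = (x.1 + c *: (lsubmx w + rsubmx w),
    (x.2.1 - c *: lsubmx w, x.2.2 - c *: rsubmx w)).
Proof.
move=> w1 c; rewrite /collide3 /reflection dot_normal3.
have w11 : dot (lsubmx w) (lsubmx w) + dot (rsubmx w) (rsubmx w) = 1.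
  by rewrite -dot_submx -enorm_sqr w1 expr1n.
have -> : dot (normal3 w) (normal3 w) = 2 * (1 + dot (lsubmx w) (rsubmx w)).
  rewrite dot_row_mx2 dot_row_mx2 !dotNl !dotNr !opprK dotDl !dotDr (dotC (rsubmx w)).
  rewrite w11; move: (dot (lsubmx w) (rsubmx w)) w11 => e.
  move: (dot (lsubmx w) (lsubmx w)) (dot (rsubmx w) (rsubmx w)) => a b ab.
  lra.
have -> : 2 * - dot (relative3 x) w / (2 * (1 + dot (lsubmx w) (rsubmx w))) = - c.
  by rewrite invfM mulrACA divff// mul1r mulNr.
by rewrite scaleNr opprK pack3_along pack3K.
Qed.

Lemma collide2_energy w x :
  dot (collide2 w x).1 (collide2 w x).1 + dot (collide2 w x).2 (collide2 w x).2 =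
  dot x.1 x.1 + dot x.2 x.2.
Proof.
have := isometric_dot (reflection_isometric (normal2 w)) (pack2 x).
by rewrite -[X in dot X X]unpack2K !dot_row_mx2.
Qed.

Lemma collide3_energy w x :
  dot (collide3 w x).1 (collide3 w x).1 + (dot (collide3 w x).2.1 (collide3 w x).2.1 +
    dot (collide3 w x).2.2 (collide3 w x).2.2) =
  dot x.1 x.1 + (dot x.2.1 x.2.1 + dot x.2.2 x.2.2).
Proof.
have := isometric_dot (reflection_isometric (normal3 w)) (pack3 x).
by rewrite -[X in dot X X]unpack3K !dot_row_mx2.
Qed.

Lemma collide3_momentum w x :
  (collide3 w x).1 + ((collide3 w x).2.1 + (collide3 w x).2.2) =
  x.1 + (x.2.1 + x.2.2).
Proof.
rewrite /collide3 /reflection -scaleNr pack3_along pack3K/=; move: (- _) => c.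
by apply/rowP => i; rewrite !mxE; ring.
Qed.

Lemma collide2_relative w x :
  (collide2 w x).2 - (collide2 w x).1 = reflection w (x.2 - x.1).
Proof.
have [->|w0] := eqVneq w 0.
  rewrite /collide2 /normal2 oppr0 /pack2/= row_mx0 /reflection !scaler0 !subr0.
  by rewrite /unpack2 row_mxKl row_mxKr.
have ww : dot w w != 0 by apply: contra_neq w0; exact: dot_eq0.
rewrite /collide2 /reflection dot_normal2.
have -> : dot (normal2 w) (normal2 w) = 2 * dot w w.
  by rewrite dot_row_mx2 dotNl dotNr opprK; ring.
rewrite (dotC w) invfM mulrACA divff// mul1r mulNr scaleNr opprK.
rewrite /unpack2 /pack2/= scale_row_mx add_row_mx row_mxKl row_mxKr.
apply/rowP => i; rewrite !mxE; ring.
Qed.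

Lemma collide3_relative w x : dot (relative3 (collide3 w x)) w = - dot (relative3 x) w.
Proof.
apply: oppr_inj; rewrite -!dot_normal3 /collide3 unpack3K.
exact: dot_reflection.
Qed.

End collision_maps.


(** * Collision kernels *)

Section energy.
Context {R : realType} {d : nat}.
Local Notation V := 'rV[R]_d.
Implicit Types u v w : V.

(** The square of [bracket v]. *)
Definition energy v : R := 1 + dot v v.

Lemma energy_ge1 v : 1 <= energy v.
Proof. by rewrite lerDl dot_ge0. Qed.

Lemma energy_gt0 v : 0 < energy v.
Proof. exact: lt_le_trans (energy_ge1 v). Qed.

Lemma measurable_energy : measurable_fun setT energy.
Proof. by apply: measurable_funD => //; exact: measurable_dot. Qed.

Lemma energyE v : energy v = 1 + enorm v ^+ 2.
Proof. by rewrite enorm_sqr. Qed.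

Lemma powR_le_energy (r gamma E : R) : 0 <= r -> r ^+ 2 <= 4 * (E - 1) ->
  gamma \in `[0, 2] -> 1 <= E -> r `^ gamma <= 4 * E.
Proof.
move=> r0 rE; rewrite in_itv/= => /andP[g0 g2] E1.
apply: (@le_trans _ _ (1 + r ^+ 2)); last lra.
have [r1|r1] := leP r 1.
  apply: (@le_trans _ _ 1); last by rewrite lerDl sqr_ge0.
  by have := ge0_ler_powR g0 _ _ r1; rewrite powR1; apply; rewrite nnegrE.
rewrite -powR_mulrn//; apply: (@le_trans _ _ (r `^ 2)); last by rewrite lerDr.
by apply: ler_powR => //; exact: ltW.
Qed.

Lemma powR_le_energy_powR (r gamma g' E : R) : 0 <= r -> r ^+ 2 <= 4 * E -> 1 <= E ->
  gamma \in `[0, 2] -> gamma <= g' -> r `^ gamma <= 4 * E `^ (g' / 2).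
Proof.
move=> r0 rE E1; rewrite in_itv/= => /andP[g0 g2] gg.
have -> : r `^ gamma = (r ^+ 2) `^ (gamma / 2).
  by rewrite -powR_mulrn// -powRrM; congr (_ `^ _); field.
apply: (@le_trans _ _ ((4 * E) `^ (gamma / 2))).
  by apply: ge0_ler_powR; rewrite ?nnegrE ?divr_ge0 ?sqr_ge0//; lra.
rewrite powRM//; last by lra.
apply: ler_pM; rewrite ?powR_ge0//; last by apply: ler_powR => //; lra.
by rewrite -[leRHS]powRr1//; apply: ler_powR; lra.
Qed.

Lemma powR_speed_low (gamma r X E : R) : gamma \in `[0, 2] -> 0 < X -> 0 <= E ->
  E <= 2 * X ^+ 2 -> X / 2 <= r -> 8^-1 * E `^ (gamma / 2) <= r `^ gamma.
Proof.
rewrite in_itv/= => /andP[g0 g2] X0 E0 EX Xr.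
have r0 : 0 <= r by apply: le_trans Xr; rewrite divr_ge0 ?ltW.
apply: (@le_trans _ _ (8^-1 * (2 * X `^ gamma))).
  rewrite ler_wpM2l//.
  have -> : X `^ gamma = (X ^+ 2) `^ (gamma / 2).
    by rewrite -powR_mulrn ?(ltW X0)// -powRrM; congr (_ `^ _); field.
  apply: (@le_trans _ _ ((2 * X ^+ 2) `^ (gamma / 2))).
    apply: ge0_ler_powR => //; first exact: divr_ge0.
    by rewrite nnegrE mulr_ge0 ?sqr_ge0.
  rewrite powRM ?sqr_ge0// ler_wpM2r ?powR_ge0//.
  by rewrite -[leRHS]powRr1//; apply: ler_powR; lra.
apply: (@le_trans _ _ ((X / 2) `^ gamma)); last first.
  by apply: ge0_ler_powR; rewrite ?nnegrE ?divr_ge0 ?(ltW X0).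
rewrite powRM ?(ltW X0)// [leRHS]mulrC mulrA ler_wpM2r ?powR_ge0//.
rewrite -[2^-1]powR_inv1// -powRrM.
have -> : 8^-1 * 2 = 2 `^ (- 2) :> R by rewrite powRN powR_mulrn//; field.
by apply: ler_powR; lra.
Qed.

Lemma relative_sqr_le u v : enorm (u - v) ^+ 2 <= 2 * (dot u u + dot v v).
Proof.
rewrite enorm_sqr; have := dot_ge0 (u + v).
by rewrite !(dotBl, dotBr, dotDl, dotDr) (dotC v u); lra.
Qed.

Lemma energy_share (e E a b : R) : 0 <= a -> a + b = E -> e * E <= b ->
  0 <= a <= (1 - e) * E.
Proof. by move=> a0 ab L; rewrite a0 mulrBl mul1r; lra. Qed.

Lemma energy_share3 (e E a b c : R) : 1 <= a -> 1 <= b -> 1 <= c -> a + b + c = E ->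
  e * E <= b -> e * E <= c ->
  0 <= a <= (1 - e) * E /\ 0 <= b <= (1 - e) * E /\ 0 <= c <= (1 - e) * E.
Proof.
move=> a1 b1 c1 abc Lb Lc; rewrite !mulrBl !mul1r.
by move: (e * E) Lb Lc => eE; split; [|split]; apply/andP; split; lra.
Qed.

(** The case of one velocity [v] much faster than another one. All sizes are
   compared with [X], the bracket of [v]. *)
Lemma energy_dominates (delta : R) v v1 : 0 < delta -> delta <= 64^-1 ->
  energy v1 <= delta * energy v ->
  let X := Num.sqrt (energy v) in
  [/\ 0 < X, X ^+ 2 = energy v, enorm v1 ^+ 2 <= delta * X ^+ 2, 7 / 8 * X <= enorm v &
    energy v1 <= 64^-1 * X ^+ 2].
Proof.
move=> d0 d1 H X; have X0 : 0 < X by rewrite sqrtr_gt0 energy_gt0.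
have X2 : X ^+ 2 = energy v by rewrite sqr_sqrtr ?ltW ?energy_gt0.
have H' : energy v1 <= 64^-1 * X ^+ 2.
  by rewrite X2; apply: (le_trans H); rewrite ler_wpM2r// ltW// energy_gt0.
split=> //; first by rewrite X2; apply: le_trans H; rewrite energyE lerDr.
rewrite -ler_sqr ?nnegrE ?enorm_ge0 ?mulr_ge0 ?(ltW X0)//.
have := energy_ge1 v1; move: X2 H'; rewrite energyE exprMn; lra.
Qed.

End energy.

Section binary_kernel.
Context {R : realType} {d : nat}.
Local Notation V := 'rV[R]_d.
Variables (gamma : R) (b2 : R -> R).
Hypothesis gamma02 : gamma \in `[0, 2].
Hypothesis hd : (2 <= d)%N.
Hypothesis hb2 : binary_kernel d b2.
Implicit Types (w : V) (x : V * V).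

Definition deflection2 w x : R := dot (direction (x.2 - x.1)) w.

(** The cross-section cut off outside the unit sphere, where it is measurable,
   nonnegative and invariant under collisions. *)
Definition kernel2 w x : R := \1_(@unit_sphere R d) w *
  (enorm (x.2 - x.1) `^ gamma * b2_trunc b2 (deflection2 w x)).

Lemma kernel2_ge0 w x : 0 <= kernel2 w x.
Proof. by rewrite !mulr_ge0 ?powR_ge0 ?(b2_trunc_ge0 hb2). Qed.

Let measurable_relative : measurable_fun setT (fun p : V * (V * V) => p.2.2 - p.2.1).
Proof.
apply: (measurable_fun_comp2 (@measurable_rVD R d)).
  exact: measurableT_comp measurable_snd measurable_snd.
apply: (measurableT_comp (@measurable_rVN R d)).
exact: measurableT_comp measurable_fst measurable_snd.
Qed.

Let measurable_dot_relative :
  measurable_fun setT (fun p : V * (V * V) => deflection2 p.1 p.2).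
Proof.
by apply: measurable_dot => //; exact: measurableT_comp (@measurable_direction R d) _.
Qed.

Lemma measurable_b2_deflection :
  measurable_fun setT (fun p : V * (V * V) => b2_trunc b2 (deflection2 p.1 p.2)).
Proof. exact: measurableT_comp (measurable_b2_trunc hb2) _. Qed.

Lemma measurable_sphere_indic d' (X : measurableType d') n :
  measurable_fun setT (fun p : 'rV[R]_n * X => \1_(@unit_sphere R n) p.1 : R).
Proof.
have mI : measurable_fun setT (\1_(@unit_sphere R n) : 'rV[R]_n -> R).
  by apply: measurable_indic; exact: measurable_unit_sphere.
exact: measurableT_comp mI measurable_fst.
Qed.

Lemma measurable_kernel2 : measurable_fun setT (fun p : V * (V * V) => kernel2 p.1 p.2).
Proof.
apply: measurable_funM; first exact: measurable_sphere_indic.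
apply: measurable_funM; last exact: measurable_b2_deflection.
apply: (measurableT_comp (measurable_powR _)).
exact: measurableT_comp (@measurable_enorm R d) _.
Qed.

Lemma kernel2_collide w x : kernel2 w (collide2 w x) = kernel2 w x.
Proof.
have I := reflection_isometric w.
rewrite /kernel2 /deflection2 collide2_relative (isometric_enorm _ I).
by rewrite (isometric_direction _ I) dot_reflection (b2_trunc_even hb2).
Qed.

Lemma kernel2_swap w x : kernel2 w (x.2, x.1) = kernel2 w x.
Proof.
rewrite /kernel2 /deflection2/= -opprB enormN /direction enormN scalerN dotNl.
by rewrite (b2_trunc_even hb2).
Qed.

Let kinetic x : energy x.1 + energy x.2 = 2 + (dot x.1 x.1 + dot x.2 x.2).
Proof. rewrite /energy; lra. Qed.

Let speed_sqr x : enorm (x.2 - x.1) ^+ 2 <= 2 * (energy x.1 + energy x.2 - 2).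
Proof. by have := relative_sqr_le x.2 x.1; rewrite kinetic; lra. Qed.

Lemma speed2_le x : enorm (x.2 - x.1) `^ gamma <= 4 * (energy x.1 + energy x.2).
Proof.
have := speed_sqr x; have := energy_ge1 x.1; have := energy_ge1 x.2 => e1 e2 s.
by apply: powR_le_energy; rewrite ?enorm_ge0//; lra.
Qed.

Lemma speed2_le_powR g' x : gamma <= g' ->
  enorm (x.2 - x.1) `^ gamma <= 4 * (energy x.1 + energy x.2) `^ (g' / 2).
Proof.
have := speed_sqr x; have := energy_ge1 x.1; have := energy_ge1 x.2 => e1 e2 s.
by apply: powR_le_energy_powR; rewrite ?enorm_ge0//; lra.
Qed.

Lemma collide2_energy_sum w x :
  energy (collide2 w x).1 + energy (collide2 w x).2 = energy x.1 + energy x.2.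
Proof. by rewrite !kinetic collide2_energy. Qed.

(** The slow velocity [x.2] differs from the second outgoing velocity by the
   component of the relative velocity along [w], and from the first one by the
   component orthogonal to [w]. Both have a length of order [eta * X], and the
   slow velocity is at most [eta / 8 * X]. *)
Lemma collide2_shares eta w x : 0 < eta < 1 -> enorm w = 1 ->
  energy x.2 <= eta ^+ 2 / 64 * energy x.1 ->
  eta <= `|deflection2 w x| -> eta ^+ 2 <= 1 - deflection2 w x ^+ 2 ->
  let E := energy x.1 + energy x.2 in
  [/\ 0 <= energy (collide2 w x).1 <= (1 - eta ^+ 2 / 8) * E,
      0 <= energy (collide2 w x).2 <= (1 - eta ^+ 2 / 8) * E &
      8^-1 * E `^ (gamma / 2) <= enorm (x.2 - x.1) `^ gamma].
Proof.
move=> /andP[n0 n1] w1 xy z1 z2 E.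
have n2 : 0 < eta ^+ 2 <= 1 by rewrite exprn_gt0//= exprn_ile1// ltW.
have [||X0 X2 v1X vX yX] := @energy_dominates _ _ (eta ^+ 2 / 64) x.1 x.2 _ _ xy.
- by rewrite divr_gt0//; case/andP: n2.
- by rewrite ler_piMl//; case/andP: n2.
move: X0 X2 v1X vX yX; set X := Num.sqrt _ => X0 X2 v1X vX yX.
have v1X' : enorm x.2 <= eta / 8 * X.
  rewrite -ler_sqr ?nnegrE ?enorm_ge0 ?mulr_ge0 ?divr_ge0 ?(ltW n0) ?(ltW X0)//.
  by apply: (le_trans v1X); rewrite exprMn expr_div_n; lra.
have nX : eta * X <= X by rewrite ler_piMl ?ltW.
have nX0 : 0 < eta * X by rewrite mulr_gt0.
have uX : 3 / 4 * X <= enorm (x.2 - x.1).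
  have := lerB_enorm x.1 x.2; rewrite -(enormN (x.2 - x.1)) opprB; lra.
have E2X : E <= 2 * X ^+ 2 by rewrite /E -X2; move: (exprn_ge0 2 (ltW X0)); lra.
set u := x.2 - x.1 in z1 z2 uX *; set z := deflection2 w x in z1 z2.
have uw : dot w u = enorm u * z by rewrite /z /deflection2 -dotZl enorm_directionK dotC.
have large (p : V) : eta * (3 / 4 * X) <= enorm p + enorm x.2 -> (eta ^+ 2 / 8) * E <= energy p.
  move=> H; have H' : eta * X / 2 <= enorm p by lra.
  apply: (@le_trans _ _ ((eta * X / 2) ^+ 2)).
    rewrite expr_div_n exprMn.
    apply: (@le_trans _ _ (eta ^+ 2 / 8 * (2 * X ^+ 2))); last by lra.
    by rewrite ler_wpM2l// divr_ge0// sqr_ge0.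
  rewrite energyE ler_wpDl// ler_sqr ?nnegrE ?enorm_ge0//.
  by rewrite divr_ge0// ltW.
have nu : eta * (3 / 4 * X) <= eta * enorm u by rewrite ler_wpM2l// ltW.
have L2 : eta ^+ 2 / 8 * E <= energy (collide2 w x).2.
  apply: large; rewrite collide2E//= -/u uw.
  have := enormB x.2 (x.2 - (enorm u * z) *: w); rewrite opprB addrC subrK.
  rewrite enormZ w1 mulr1 normrM ger0_norm ?enorm_ge0// => H.
  have : eta * enorm u <= enorm u * `|z| by rewrite mulrC ler_wpM2l ?enorm_ge0.
  lra.
have L1 : eta ^+ 2 / 8 * E <= energy (collide2 w x).1.
  apply: large; rewrite collide2E//= -/u uw.
  have -> : x.1 + (enorm u * z) *: w = x.2 - (u - (enorm u * z) *: w).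
    by apply/rowP => i; rewrite /u !mxE; ring.
  set q := u - _; have := enormB x.2 (x.2 - q); rewrite opprB addrC subrK => H.
  suff : eta * enorm u <= enorm q by lra.
  rewrite -ler_sqr ?nnegrE ?enorm_ge0 ?mulr_ge0 ?enorm_ge0 ?(ltW n0)//.
  have -> : enorm q ^+ 2 = enorm u ^+ 2 * (1 - z ^+ 2).
    have sqr_proj (y : V) s : dot w y = s -> enorm (y - s *: w) ^+ 2 = enorm y ^+ 2 - s ^+ 2.
      move=> ys; rewrite !enorm_sqr dotBl !dotBr !dotZl !dotZr (dotC y w) ys.
      by rewrite -(enorm_sqr w) w1; ring.
    by rewrite (sqr_proj _ _ uw); ring.
  by rewrite exprMn mulrC ler_wpM2l ?sqr_ge0.
have EE : _ = E := collide2_energy_sum w x.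
have P1 := energy_ge1 (collide2 w x).1; have P2 := energy_ge1 (collide2 w x).2.
split; first exact: (energy_share (le_trans ler01 P1) EE L2).
  by rewrite addrC in EE; exact: (energy_share (le_trans ler01 P2) EE L1).
move: gamma02; rewrite in_itv/= => /andP[g0 g2].
have E0 : 0 < E by rewrite addr_gt0 ?energy_gt0.
by apply: (powR_speed_low gamma02 X0 (ltW E0) E2X); lra.
Qed.

Section pointwise.
Variables (eps beta kappa C c eta : R).
Hypothesis eps_gt0 : 0 < eps.
Hypothesis beta_gt0 : 0 < beta.
Hypothesis kappa_gt0 : 0 < kappa.
Local Notation Phi := (weight eps beta kappa).
Local Notation h := (weight_ratio eps beta kappa).
Local Notation g := (gain_rate eps kappa).
Hypothesis C_gt0 : 0 < C.
Hypothesis excessP : forall M E, 0 < M -> M <= E <= 3 * M ->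
  Phi E - Phi M <= C * (E - M) * h M.
Hypothesis eta01 : 0 < eta < 1.
Hypothesis c_ge0 : 0 <= c.
Hypothesis gapP : 0 < c -> eps = gamma / 2 /\
  forall s E : R, 0 < E -> 0 <= s <= (1 - eta ^+ 2 / 8) * E ->
    8 * c * h E / (1 + kappa * E `^ eps) <= h E - h s.

Definition slow_partner2 : set (V * V) :=
  [set x | energy x.2 <= eta ^+ 2 / 64 * energy x.1].

(** The collisions that dissipate if the partner is slow. *)
Definition effective2 w x : R := \1_(@unit_sphere R d) w *
  (b2_trunc b2 (deflection2 w x) * b2_angles eta (deflection2 w x)).

Let speed_weight2 w x : enorm w = 1 ->
  enorm (x.2 - x.1) `^ gamma * (Phi (energy (collide2 w x).1) + Phi (energy (collide2 w x).2)) +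
    c * (b2_angles eta (deflection2 w x) *
      (\1_slow_partner2 x * (Phi (energy x.1) * g (energy x.1)))) <=
  enorm (x.2 - x.1) `^ gamma * Phi (energy x.1 + energy x.2).
Proof.
move=> w1; have U0 : 0 <= enorm (x.2 - x.1) `^ gamma by exact: powR_ge0.
have e0 (v : V) : 0 <= energy v by exact/ltW/energy_gt0.
have noloss : enorm (x.2 - x.1) `^ gamma * (Phi (energy (collide2 w x).1) + Phi (energy (collide2 w x).2)) <=
    enorm (x.2 - x.1) `^ gamma * Phi (energy x.1 + energy x.2).
  by rewrite ler_wpM2l// -(collide2_energy_sum w) weight_superadd2.
rewrite /b2_angles !indicE.
case: (boolP (_ \in _)) => [|_]; last by rewrite mul0r mulr0 addr0.
rewrite inE/= => -[z1 z2]; rewrite mul1r.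
case: (boolP (_ \in _)) => [|_]; last by rewrite mul0r mulr0 addr0.
rewrite inE/= => xy; rewrite mul1r.
move: c_ge0; rewrite le_eqVlt => /predU1P[<-|c0]; first by rewrite mul0r addr0.
have [epsE gap] := gapP c0.
have [s1 s2 s3] := collide2_shares eta01 w1 xy z1 z2.
have c8 : 0 < 8 * c by rewrite mulr_gt0.
have -> : c * (Phi (energy x.1) * g (energy x.1)) =
    8 * c * 8^-1 * (Phi (energy x.1) * g (energy x.1)) by field.
apply: (weight_gap2 eps_gt0 beta_gt0 kappa_gt0 c8 gap _ _ _ _ s1 s2); rewrite ?invr_gt0//.
- exact: energy_gt0.
- by rewrite lerDl.
- exact: collide2_energy_sum.
by rewrite epsE.
Qed.

(** Since [Phi] is superadditive, the outgoing weights are at most the weight of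
   the total energy, and less by [weight_gap2] if [x.2] is slow;
   [weight_excess2] then compares the total with the incoming weights. *)
Lemma pointwise2 w x :
  kernel2 w x * (Phi (energy (collide2 w x).1) + Phi (energy (collide2 w x).2)) +
    c * effective2 w x * (\1_slow_partner2 x * (Phi (energy x.1) * g (energy x.1))) <=
  kernel2 w x * (Phi (energy x.1) + Phi (energy x.2)) +
    12 * C * b2_trunc b2 (deflection2 w x) *
    (energy x.1 * Phi (energy x.2) + energy x.2 * Phi (energy x.1)).
Proof.
have e0 (v : V) : 0 < energy v by exact: energy_gt0.
have P0 (v : V) : 0 <= Phi (energy v) by apply: weight_ge0; exact: ltW.
have b0 := b2_trunc_ge0 hb2 (deflection2 w x).
rewrite /kernel2 /effective2 indicE.
case: (boolP (_ \in _)) => [|_]; last first.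
  by rewrite !mul0r mulr0 mul0r !add0r !mulr_ge0 ?addr_ge0 ?mulr_ge0 ?(ltW C_gt0)// ltW.
rewrite inE => w1; rewrite !mul1r.
have H1 := ler_wpM2l b0 (speed_weight2 x w1).
have UE : 0 <= enorm (x.2 - x.1) `^ gamma <= 4 * (energy x.1 + energy x.2).
  by rewrite powR_ge0 speed2_le.
have H2 := ler_wpM2l b0 (weight_excess2 C_gt0 excessP (e0 x.1) (e0 x.2) UE).
have := le_trans H1 H2; rewrite !mulrDr.
by congr (is_true (_ <= _)); ring.
Qed.

End pointwise.

End binary_kernel.

Section ternary_kernel.
Context {R : realType} {d : nat}.
Local Notation V := 'rV[R]_d.
Variables (gamma theta : R) (phi : R -> R).
Hypothesis gamma02 : gamma \in `[0, 2].
Hypothesis hd : (2 <= d)%N.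
Hypothesis theta_ge0 : 0 <= theta.
Hypothesis hb3 : ternary_kernel d theta phi.
Implicit Types (w : 'rV[R]_(d + d)) (x : V * (V * V)).

Definition spread3 x : R := triple_norm x.1 x.2.1 x.2.2.
(** At unit [w] the powers of the length of the relative velocity in the kernel
   [B3] and in [b3] combine to [speed3]. *)
Definition speed3 w x : R :=
  spread3 x `^ (gamma - theta) * `|dot (relative3 x) w| `^ theta.
Definition kernel3 w x : R := \1_(@unit_sphere R (d + d)) w *
  (speed3 w x * phi_trunc phi (cross_dot w)).

Lemma speed3_ge0 w x : 0 <= speed3 w x.
Proof. by rewrite mulr_ge0 ?powR_ge0. Qed.

Lemma kernel3_ge0 w x : 0 <= kernel3 w x.
Proof. by rewrite !mulr_ge0 ?powR_ge0 ?(phi_trunc_ge0 hb3). Qed.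

Lemma spread3_sqr x : spread3 x ^+ 2 =
  3 * (dot x.1 x.1 + (dot x.2.1 x.2.1 + dot x.2.2 x.2.2)) -
  dot (x.1 + (x.2.1 + x.2.2)) (x.1 + (x.2.1 + x.2.2)).
Proof.
rewrite sqr_sqrtr ?addr_ge0 ?sqr_ge0// !enorm_sqr !(dotBl, dotBr, dotDl, dotDr).
by rewrite (dotC x.2.1 x.1) (dotC x.2.2 x.1) (dotC x.2.2 x.2.1); ring.
Qed.

Lemma relative3_sqr x : dot (relative3 x) (relative3 x) <= spread3 x ^+ 2.
Proof.
rewrite sqr_sqrtr ?addr_ge0 ?sqr_ge0// dot_row_mx2 -!enorm_sqr.
by rewrite -(enormN (x.2.1 - x.1)) -(enormN (x.2.2 - x.1)) !opprB lerDl sqr_ge0.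
Qed.

Lemma measurable_relative3 : measurable_fun setT (@relative3 R d).
Proof.
have mB (f : V * (V * V) -> V) : measurable_fun setT f ->
    measurable_fun setT (fun x => f x - x.1).
  move=> mf; apply: (measurable_fun_comp2 (@measurable_rVD R d)) => //.
  exact: measurableT_comp (@measurable_rVN R d) measurable_fst.
apply: measurable_row_mx; apply: mB.
  exact: measurableT_comp measurable_fst measurable_snd.
exact: measurableT_comp measurable_snd measurable_snd.
Qed.

Lemma measurable_spread3 : measurable_fun setT spread3.
Proof.
apply: (@measurableT_comp _ _ _ _ _ _ (@Num.sqrt R)).
  by apply: continuous_measurable_fun; exact: sqrt_continuous.
have m1 := measurableT_comp (@measurable_fst _ _ V V) (@measurable_snd _ _ V (V * V)%type).
have m2 := measurableT_comp (@measurable_snd _ _ V V) (@measurable_snd _ _ V (V * V)%type).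
have mB (f g : V * (V * V) -> V) : measurable_fun setT f -> measurable_fun setT g ->
    measurable_fun setT (fun x => enorm (f x - g x) ^+ 2).
  move=> mf mg; apply: (@measurable_funX _ _ R _ _ 2).
  apply: (measurableT_comp (@measurable_enorm R d)).
  apply: (measurable_fun_comp2 (@measurable_rVD R d)) => //.
  exact: measurableT_comp (@measurable_rVN R d) _.
apply: measurable_funD; last exact: mB.
by apply: measurable_funD; exact: mB.
Qed.

Lemma measurable_phi_cross d' (X : measurableType d') :
  measurable_fun setT (fun p : 'rV[R]_(d + d) * X => phi_trunc phi (cross_dot p.1)).
Proof.
apply: (measurableT_comp (measurable_phi_trunc hb3)).
exact: measurableT_comp (@measurable_cross_dot R d) measurable_fst.
Qed.

Lemma measurable_kernel3 :
  measurable_fun setT (fun p : 'rV[R]_(d + d) * (V * (V * V)) => kernel3 p.1 p.2).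
Proof.
apply: measurable_funM; first exact: measurable_sphere_indic.
apply: measurable_funM; last exact: measurable_phi_cross.
apply: measurable_funM; apply: (measurableT_comp (measurable_powR _)).
  exact: measurableT_comp measurable_spread3 measurable_snd.
apply: measurableT_comp => //; apply: measurable_dot => //.
exact: measurableT_comp measurable_relative3 measurable_snd.
Qed.

Lemma spread3_collide w x : spread3 (collide3 w x) = spread3 x.
Proof.
apply/eqP; rewrite -(eqrXn2 (n := 2)) ?sqrtr_ge0// !spread3_sqr.
by rewrite collide3_energy collide3_momentum.
Qed.

Lemma kernel3_collide w x : kernel3 w (collide3 w x) = kernel3 w x.
Proof. by rewrite /kernel3 /speed3 spread3_collide collide3_relative normrN. Qed.

Lemma speed3_le_spread w x : enorm w = 1 -> speed3 w x <= spread3 x `^ gamma.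
Proof.
move=> w1; have s0 : 0 <= spread3 x by exact: sqrtr_ge0.
have us : `|dot (relative3 x) w| <= spread3 x.
  apply: (le_trans (cauchy_schwarz _ _)); rewrite w1 mulr1.
  by rewrite -ler_sqr ?nnegrE ?enorm_ge0// enorm_sqr relative3_sqr.
apply: (@le_trans _ _ (spread3 x `^ (gamma - theta) * spread3 x `^ theta)).
  by rewrite ler_wpM2l ?powR_ge0//; apply: ge0_ler_powR.
move: s0; rewrite le_eqVlt => /predU1P[<-|s0]; last first.
  by rewrite -powRD ?(gt_eqF s0) ?implybT// subrK.
rewrite /powR eqxx -natrM ler_nat mulnb.
by case: eqP => // + /=; case: eqP => // ->; rewrite subr0 => ->; rewrite eqxx.
Qed.

Let kinetic x : energy x.1 + energy x.2.1 + energy x.2.2 =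
  3 + (dot x.1 x.1 + (dot x.2.1 x.2.1 + dot x.2.2 x.2.2)).
Proof. rewrite /energy; lra. Qed.

Let spread_sqr_le x : spread3 x ^+ 2 <= 3 * (energy x.1 + energy x.2.1 + energy x.2.2 - 3).
Proof.
rewrite spread3_sqr kinetic; have := dot_ge0 (x.1 + (x.2.1 + x.2.2)); lra.
Qed.

Lemma spread3_le x : spread3 x `^ gamma <= 4 * (energy x.1 + energy x.2.1 + energy x.2.2).
Proof.
have := spread_sqr_le x; have := energy_ge1 x.1; have := energy_ge1 x.2.1.
have := energy_ge1 x.2.2 => e1 e2 e3 s.
by apply: powR_le_energy; rewrite ?sqrtr_ge0//; lra.
Qed.

Lemma spread3_le_powR g' x : gamma <= g' ->
  spread3 x `^ gamma <= 4 * (energy x.1 + energy x.2.1 + energy x.2.2) `^ (g' / 2).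
Proof.
have := spread_sqr_le x; have := energy_ge1 x.1; have := energy_ge1 x.2.1.
have := energy_ge1 x.2.2 => e1 e2 e3 s.
by apply: powR_le_energy_powR; rewrite ?sqrtr_ge0//; lra.
Qed.

Lemma collide3_energy_sum w x :
  energy (collide3 w x).1 + energy (collide3 w x).2.1 + energy (collide3 w x).2.2 =
  energy x.1 + energy x.2.1 + energy x.2.2.
Proof. by rewrite !kinetic collide3_energy. Qed.

(** The direction of the fast velocity is not nearly orthogonal to [w1 + w2], so
   the coefficient [c] of the collision is of order [eta * X]. Each slow partner
   moves by [c * w_i], of order [eta ^+ 2 * X], which exceeds its own speed. *)
Lemma collide3_shares eta w x : 0 < eta < 1 -> enorm w = 1 ->
  energy x.2.1 <= eta ^+ 4 / 256 * energy x.1 ->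
  energy x.2.2 <= eta ^+ 4 / 256 * energy x.1 ->
  ternary_angles eta (direction x.1) w ->
  let E := energy x.1 + energy x.2.1 + energy x.2.2 in
  [/\ 0 <= energy (collide3 w x).1 <= (1 - eta ^+ 4 / 32) * E,
      0 <= energy (collide3 w x).2.1 <= (1 - eta ^+ 4 / 32) * E,
      0 <= energy (collide3 w x).2.2 <= (1 - eta ^+ 4 / 32) * E &
      8^-1 * (eta / 4) `^ theta * E `^ (gamma / 2) <= speed3 w x].
Proof.
move=> /andP[n0 n1] w1 xy xz [A1 A2 A3] E.
have n2 : 0 < eta ^+ 2 <= 1 by rewrite exprn_gt0//= exprn_ile1// ltW.
have n4 : 0 < eta ^+ 4 <= 1 by rewrite exprn_gt0//= exprn_ile1// ltW.
have d0 : 0 < eta ^+ 4 / 256 by rewrite divr_gt0 ?ltr0n ?exprn_gt0.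
have d1 : eta ^+ 4 / 256 <= 64^-1 by case/andP: n4; lra.
have [X0 X2 v1X vX yX] := energy_dominates d0 d1 xy.
have [_ _ v2X _ zX] := energy_dominates d0 d1 xz.
move: X0 X2 v1X vX yX v2X zX; set X := Num.sqrt _ => X0 X2 v1X vX yX v2X zX.
have small (p : V) : enorm p ^+ 2 <= eta ^+ 4 / 256 * X ^+ 2 -> enorm p <= eta ^+ 2 / 16 * X.
  move=> H; rewrite -ler_sqr ?nnegrE ?enorm_ge0 ?mulr_ge0 ?divr_ge0 ?exprn_ge0 ?(ltW n0) ?(ltW X0)//.
  by apply: (le_trans H); rewrite exprMn expr_div_n -exprM; lra.
have {}v1X := small _ v1X; have {}v2X := small _ v2X.
set w1' := lsubmx w in A1 A3; set w2' := rsubmx w in A2 A3.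
have ww : dot w1' w1' + dot w2' w2' = 1 by rewrite -dot_submx -enorm_sqr w1 expr1n.
have le1 (p : V) : dot p p <= 1 -> enorm p <= 1.
  by move=> H; rewrite -ler_sqr ?nnegrE ?enorm_ge0// enorm_sqr expr1n.
have w1'1 : enorm w1' <= 1 by apply: le1; have := dot_ge0 w2'; lra.
have w2'1 : enorm w2' <= 1 by apply: le1; have := dot_ge0 w1'; lra.
have nX0 : 0 < eta * X by rewrite mulr_gt0.
have n2n : eta ^+ 2 * X <= eta * X.
  by rewrite expr2 -mulrA ger_pMl// ltW.
have nX : eta * X <= X by rewrite ger_pMl// ltW.
set D := dot (relative3 x) w.
have DE : D = - (enorm x.1 * dot (direction x.1) (w1' + w2')) + (dot x.2.1 w1' + dot x.2.2 w2').
  rewrite /D dot_row_mx -/w1' -/w2' -dotZl enorm_directionK dotDr !dotBl; ring.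
have Dlow : 3 / 4 * (eta * X) <= `|D|.
  have C1 : `|dot x.2.1 w1'| <= eta ^+ 2 / 16 * X.
    apply: (le_trans (cauchy_schwarz _ _)).
    by apply: le_trans v1X; rewrite ler_piMr ?enorm_ge0.
  have C2 : `|dot x.2.2 w2'| <= eta ^+ 2 / 16 * X.
    apply: (le_trans (cauchy_schwarz _ _)).
    by apply: le_trans v2X; rewrite ler_piMr ?enorm_ge0.
  have C3 : 7 / 8 * (eta * X) <= `|enorm x.1 * dot (direction x.1) (w1' + w2')|.
    rewrite normrM (ger0_norm (enorm_ge0 _)).
    apply: (@le_trans _ _ (7 / 8 * X * eta)); first by lra.
    by apply: ler_pM => //; [rewrite mulr_ge0// ltW|exact: ltW].
  have := lerB_normD (- (enorm x.1 * dot (direction x.1) (w1' + w2'))) (dot x.2.1 w1' + dot x.2.2 w2').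
  rewrite -DE normrN; have := ler_normD (dot x.2.1 w1') (dot x.2.2 w2'); lra.
have cd := cross_dot_itv w1; rewrite /cross_dot -/w1' -/w2' in_itv/= in cd.
set c := D / (1 + dot w1' w2').
have clow : eta * X / 2 <= `|c|.
  rewrite normrM normfV ler_pdivlMr; last by rewrite normr_gt0; lra.
  rewrite (ger0_norm (x := 1 + _)); last by lra.
  apply: le_trans Dlow.
  apply: (@le_trans _ _ (eta * X / 2 * (3 / 2))); last by lra.
  by rewrite ler_wpM2l//; lra.
have E2X : E <= 2 * X ^+ 2 by rewrite /E -X2; move: (exprn_ge0 2 (ltW X0)); lra.
have E0 : 0 < E := addr_gt0 (addr_gt0 (energy_gt0 _) (energy_gt0 _)) (energy_gt0 _).
have large (p q : V) : enorm p <= eta ^+ 2 / 16 * X -> eta <= enorm q ->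
    (eta ^+ 4 / 32) * E <= energy (p - c *: q).
  move=> pX nq; have H : eta ^+ 2 / 4 * X <= enorm (p - c *: q).
    have : eta ^+ 2 * X / 2 <= `|c| * enorm q.
      rewrite (_ : _ / 2 = eta * X / 2 * eta); last by ring.
      by apply: ler_pM => //; [rewrite divr_ge0// ltW|exact: ltW].
    have := enormB p (p - c *: q); rewrite opprB addrC subrK enormZ.
    have : 0 <= eta ^+ 2 * X by rewrite mulr_ge0 ?sqr_ge0// ltW.
    lra.
  apply: (@le_trans _ _ ((eta ^+ 2 / 4 * X) ^+ 2)).
    rewrite exprMn expr_div_n -exprM.
    apply: (@le_trans _ _ (eta ^+ 4 / 32 * (2 * X ^+ 2))); last by lra.
    by rewrite ler_wpM2l// divr_ge0//; case/andP: n4 => /ltW.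
  rewrite energyE ler_wpDl// ler_sqr ?nnegrE ?enorm_ge0//.
  by rewrite mulr_ge0 ?divr_ge0 ?sqr_ge0 ?(ltW X0).
have L1 : eta ^+ 4 / 32 * E <= energy (collide3 w x).2.1.
  by rewrite collide3E//=; exact: large.
have L2 : eta ^+ 4 / 32 * E <= energy (collide3 w x).2.2.
  by rewrite collide3E//=; exact: large.
have EE : _ = E := collide3_energy_sum w x.
have P1 := energy_ge1 (collide3 w x).1; have P2 := energy_ge1 (collide3 w x).2.1.
have P3 := energy_ge1 (collide3 w x).2.2.
have [S1 [S2 S3]] := energy_share3 P1 P2 P3 EE L1 L2.
split=> //.
move: gamma02; rewrite in_itv/= => /andP[g0 g2].
have s0 : 0 <= spread3 x by exact: sqrtr_ge0.
have sup : spread3 x <= 3 * X.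
  rewrite -ler_sqr ?nnegrE ?mulr_ge0 ?(ltW X0)// exprMn.
  apply: (le_trans (spread_sqr_le x)); rewrite -/E; have := sqr_ge0 X; lra.
have slow : 3 / 4 * X <= spread3 x.
  apply: (@le_trans _ _ (enorm (x.1 - x.2.1))).
    have := lerB_enorm x.1 x.2.1; lra.
  rewrite -ler_sqr ?nnegrE ?enorm_ge0// [leRHS]sqr_sqrtr ?addr_ge0 ?sqr_ge0//.
  by rewrite -addrA lerDl addr_ge0 ?sqr_ge0.
have sgt0 : 0 < spread3 x by apply: lt_le_trans slow; rewrite mulr_gt0.
have -> : speed3 w x = spread3 x `^ gamma * (`|D| / spread3 x) `^ theta.
  rewrite /speed3 -/D powRM ?normr_ge0 ?invr_ge0// -powR_inv1// -powRrM mulN1r.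
  by rewrite mulrCA mulrC -powRD ?(gt_eqF sgt0) ?implybT.
rewrite mulrAC; apply: ler_pM.
- by rewrite mulr_ge0 ?powR_ge0.
- exact: powR_ge0.
- apply: (powR_speed_low gamma02 X0 (ltW E0) E2X); apply: le_trans slow.
  by rewrite mulrC ler_wpM2r// ?(ltW X0)//; lra.
apply: ge0_ler_powR; rewrite ?nnegrE ?divr_ge0 ?(ltW n0)//.
rewrite ler_pdivlMr//; apply: le_trans Dlow.
apply: (@le_trans _ _ (eta / 4 * (3 * X))); last by lra.
by rewrite ler_wpM2l// divr_ge0// ltW.
Qed.

Section pointwise.
Variables (eps beta kappa C c eta : R).
Hypothesis eps_gt0 : 0 < eps.
Hypothesis beta_gt0 : 0 < beta.
Hypothesis kappa_gt0 : 0 < kappa.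
Local Notation Phi := (weight eps beta kappa).
Local Notation h := (weight_ratio eps beta kappa).
Local Notation g := (gain_rate eps kappa).
Hypothesis C_gt0 : 0 < C.
Hypothesis excessP : forall M E, 0 < M -> M <= E <= 3 * M ->
  Phi E - Phi M <= C * (E - M) * h M.
Hypothesis eta01 : 0 < eta < 1.
Hypothesis c_ge0 : 0 <= c.
Local Notation u0 := (8^-1 * (eta / 4) `^ theta).
Hypothesis gapP : 0 < c -> eps = gamma / 2 /\
  forall s E : R, 0 < E -> 0 <= s <= (1 - eta ^+ 4 / 32) * E ->
    c / u0 * h E / (1 + kappa * E `^ eps) <= h E - h s.

Definition slow_partners3 : set (V * (V * V)) :=
  [set x | energy x.2.1 <= eta ^+ 4 / 256 * energy x.1 /\
           energy x.2.2 <= eta ^+ 4 / 256 * energy x.1].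

Definition effective3 w x : R := \1_(@unit_sphere R (d + d)) w *
  (phi_trunc phi (cross_dot w) * \1_(ternary_angles eta (direction x.1)) w).

Let speed_weight3 w x : enorm w = 1 ->
  speed3 w x * (Phi (energy (collide3 w x).1) + Phi (energy (collide3 w x).2.1) +
      Phi (energy (collide3 w x).2.2)) +
    c * (\1_(ternary_angles eta (direction x.1)) w *
      (\1_slow_partners3 x * (Phi (energy x.1) * g (energy x.1)))) <=
  speed3 w x * Phi (energy x.1 + energy x.2.1 + energy x.2.2).
Proof.
move=> w1; have U0 : 0 <= speed3 w x by exact: speed3_ge0.
have e0 (v : V) : 0 <= energy v by exact/ltW/energy_gt0.
have noloss : speed3 w x * (Phi (energy (collide3 w x).1) + Phi (energy (collide3 w x).2.1) +
      Phi (energy (collide3 w x).2.2)) <=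
    speed3 w x * Phi (energy x.1 + energy x.2.1 + energy x.2.2).
  by rewrite ler_wpM2l// -(collide3_energy_sum w) weight_superadd3.
rewrite !indicE.
case: (boolP (w \in _)) => [|_]; last by rewrite mul0r mulr0 addr0.
rewrite inE => wA; rewrite mul1r.
case: (boolP (_ \in _)) => [|_]; last by rewrite mul0r mulr0 addr0.
rewrite inE/= => -[xy xz]; rewrite mul1r.
move: c_ge0; rewrite le_eqVlt => /predU1P[<-|c0]; first by rewrite mul0r addr0.
have [epsE gap] := gapP c0.
have [s1 s2 s3 s4] := collide3_shares eta01 w1 xy xz wA.
have u00 : 0 < u0.
  by rewrite mulr_gt0 ?invr_gt0// powR_gt0// divr_gt0//; case/andP: eta01.
have c8 : 0 < c / u0 by rewrite divr_gt0.
have -> : c * (Phi (energy x.1) * g (energy x.1)) =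
    c / u0 * u0 * (Phi (energy x.1) * g (energy x.1)) by rewrite divfK ?gt_eqF.
apply: (weight_gap3 eps_gt0 beta_gt0 kappa_gt0 c8 gap u00 _ _ _ s1 s2 s3).
- exact: energy_gt0.
- by rewrite -addrA lerDl addr_ge0.
- exact: collide3_energy_sum.
by rewrite epsE.
Qed.

(** As in [pointwise2]; the rate [speed3] is at most [spread3 x ^ gamma], hence
   at most four times the total energy. *)
Lemma pointwise3 w x :
  kernel3 w x * (Phi (energy (collide3 w x).1) + Phi (energy (collide3 w x).2.1) +
      Phi (energy (collide3 w x).2.2)) +
    c * effective3 w x * (\1_slow_partners3 x * (Phi (energy x.1) * g (energy x.1))) <=
  kernel3 w x * (Phi (energy x.1) + Phi (energy x.2.1) + Phi (energy x.2.2)) +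
    12 * C * phi_trunc phi (cross_dot w) *
    ((energy x.2.1 + energy x.2.2) * Phi (energy x.1) +
     (energy x.1 + energy x.2.2) * Phi (energy x.2.1) +
     (energy x.1 + energy x.2.1) * Phi (energy x.2.2)).
Proof.
have e0 (v : V) : 0 < energy v by exact: energy_gt0.
have P0 (v : V) : 0 <= Phi (energy v) by apply: weight_ge0; exact: ltW.
have b0 := phi_trunc_ge0 hb3 (cross_dot w).
rewrite /kernel3 /effective3 indicE.
case: (boolP (w \in _)) => [|_]; last first.
  rewrite !mul0r mulr0 mul0r !add0r mulr_ge0//; first by rewrite !mulr_ge0// ltW.
  by rewrite !addr_ge0 ?mulr_ge0// addr_ge0 ?ltW.
rewrite inE => w1; rewrite !mul1r.
have H1 := ler_wpM2l b0 (speed_weight3 x w1).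
have UE : 0 <= speed3 w x <= 4 * (energy x.1 + energy x.2.1 + energy x.2.2).
  by rewrite speed3_ge0 (le_trans (speed3_le_spread _ _)) ?spread3_le.
have H2 := ler_wpM2l b0 (weight_excess3 C_gt0 excessP (e0 x.1) (e0 x.2.1) (e0 x.2.2) UE).
have := le_trans H1 H2; rewrite (mulrDr (phi_trunc _ _)) (mulrDr (phi_trunc _ _)).
by congr (is_true (_ <= _)); ring.
Qed.

End pointwise.

End ternary_kernel.


(** * Dissipation of the truncated moments *)

Section weight_measurable.
Context {R : realType}.
Variables (eps beta kappa : R).

Lemma measurable_gain_rate : measurable_fun setT (gain_rate eps kappa).
Proof.
rewrite gain_rate.unlock; apply: measurable_funM; first exact: measurable_powR.
apply: (measurableT_comp measurable_invr); apply: measurable_funD => //.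
by apply: measurable_funM => //; exact: measurable_powR.
Qed.

Lemma measurable_weight : measurable_fun setT (weight eps beta kappa).
Proof.
rewrite weight.unlock; apply: measurable_funM => //.
rewrite weight_ratio.unlock; apply: (measurableT_comp (measurable_powR _)).
exact: measurable_gain_rate.
Qed.

End weight_measurable.

Section product_integrals.
Context {d1 d2} {X : measurableType d1} {Y : measurableType d2} {R : realType}.
Variables (m1 : {sigma_finite_measure set X -> \bar R})
  (m2 : {sigma_finite_measure set Y -> \bar R}).

Lemma integral_product (f : X -> R) (g : Y -> R) :
  measurable_fun setT f -> measurable_fun setT g ->
  (forall x, 0 <= f x) -> (forall y, 0 <= g y) ->
  (\int[product_sfm m1 m2]_p (f p.1 * g p.2)%:E =
   (\int[m1]_x (f x)%:E) * (\int[m2]_y (g y)%:E))%E.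
Proof.
move=> mf mg f0 g0; rewrite fubini_tonelli1; last 2 first.
- apply/measurable_EFinP; apply: measurable_funM.
    exact: measurableT_comp mf measurable_fst.
  exact: measurableT_comp mg measurable_snd.
- by move=> p; rewrite lee_fin mulr_ge0.
have g0' : (0 <= \int[m2]_y (g y)%:E)%E by apply: integral_ge0 => y _; rewrite lee_fin.
rewrite -ge0_integralZr//; last 2 first.
- exact/measurable_EFinP.
- by move=> x _; rewrite lee_fin.
apply: eq_integral => x _; rewrite /fubini_F/=; under eq_integral do rewrite EFinM.
rewrite ge0_integralZl ?lee_fin//; first exact/measurable_EFinP.
by move=> y _; rewrite lee_fin.
Qed.

Lemma null_cylinder (M : set X) (N : set Y) : measurable M -> measurable N ->
  m1 M = 0%E -> m2 N = 0%E ->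
  measurable ((fst @^-1` M) `|` (snd @^-1` N) : set (X * Y)) /\
  product_sfm m1 m2 ((fst @^-1` M) `|` (snd @^-1` N)) = 0%E.
Proof.
move=> mM mN M0 N0.
have -> : (fst @^-1` M : set (X * Y)) = M `*` setT.
  by apply/seteqP; split=> p /= => [//|[]].
have -> : (snd @^-1` N : set (X * Y)) = setT `*` N.
  by apply/seteqP; split=> p /= => [//|[]].
have mMT : measurable (M `*` (setT : set Y)) by exact: measurableX.
have mTN : measurable ((setT : set X) `*` N) by exact: measurableX.
split; first exact: measurableU.
apply: null_setU2 => //.
  by transitivity (m1 M * m2 setT)%E; [exact: product_measure1E|rewrite M0 mul0e].
by transitivity (m1 setT * m2 N)%E; [exact: product_measure1E|rewrite N0 mule0].
Qed.

End product_integrals.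

Section swaps.
Context {R : realType} {d : nat}.
Local Notation V := 'rV[R]_d.
Local Notation lambda := (lebesgue_rV d).
Local Notation lambda2 := (product_sfm lambda lambda).
Local Notation lambda3 := (product_sfm lambda lambda2).

Definition swap2 (x : V * V) : V * V := (x.2, x.1).
Definition swap01 (x : V * (V * V)) : V * (V * V) := (x.2.1, (x.1, x.2.2)).
Definition swap12 (x : V * (V * V)) : V * (V * V) := (x.1, swap2 x.2).
Definition swap_blocks (w : 'rV[R]_(d + d)) : 'rV[R]_(d + d) := row_mx (rsubmx w) (lsubmx w).

Lemma swap2_preserves : preserves lambda2 swap2.
Proof.
apply: (euclidean_isometry (euclidean_prod (euclidean_rV d) (euclidean_rV d))) => //.
- by apply: measurable_fun_pair; [exact: measurable_snd|exact: measurable_fst].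
- by case.
by move=> x; rewrite addrC.
Qed.

Lemma swap12_preserves : preserves lambda3 swap12.
Proof.
apply: (preserves_skew (preserves_id _) (fun=> swap2_preserves)).
exact: measurableT_comp swap2_preserves.1 measurable_snd.
Qed.

Lemma swap01_preserves : preserves lambda3 swap01.
Proof.
apply: (euclidean_isometry (euclidean_prod (euclidean_rV d)
  (euclidean_prod (euclidean_rV d) (euclidean_rV d)))) => //.
- apply: measurable_fun_pair; first exact: measurableT_comp measurable_fst measurable_snd.
  apply: measurable_fun_pair; first exact: measurable_fst.
  exact: measurableT_comp measurable_snd measurable_snd.
- by case=> a [].
by move=> x; rewrite /= addrCA.
Qed.

Lemma swap_blocks_preserves : preserves (sphere_measure (d + d)) swap_blocks.
Proof.
apply: isometric_sphere; split.
- by apply: measurable_row_mx; [exact: measurable_rsubmx|exact: measurable_lsubmx].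
- by move=> u v; rewrite /swap_blocks !linearD/= add_row_mx.
- by move=> c v; rewrite /swap_blocks !linearZ/= scale_row_mx.
- by move=> v; rewrite /swap_blocks row_mxKl row_mxKr hsubmxK.
by move=> v; rewrite dot_row_mx2 dot_submx addrC.
Qed.

Lemma unit_sphere_swap w : unit_sphere (swap_blocks w) <-> unit_sphere w.
Proof.
by rewrite /unit_sphere/= /enorm dot_row_mx2 addrC -dot_submx.
Qed.

Lemma collide2_swap w x : collide2 w (swap2 x) = swap2 (collide2 w x).
Proof.
have E p q : dot (pack2 (p, q)) (normal2 w) = - dot (pack2 (q, p)) (normal2 w).
  by rewrite !dot_normal2 /= -(opprB q p) dotNr opprK.
case: x => a b; rewrite /collide2 /reflection E mulrN mulNr !scaleNr.
move: (_ / _) => c; rewrite opprK -scaleNr !pack2_along !pack2K /swap2/=.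
by rewrite !scaleNr opprK.
Qed.

Lemma collide3_swap w x :
  collide3 (swap_blocks w) (swap12 x) = swap12 (collide3 w x).
Proof.
have P p q : dot (pack3 (swap12 p)) (pack3 (swap12 q)) = dot (pack3 p) (pack3 q).
  by rewrite !dot_row_mx2 [X in _ + X = _]addrC.
have Nw : normal3 (swap_blocks w) = pack3 (swap12 (unpack3 (normal3 w))).
  by rewrite /normal3 pack3K /swap_blocks row_mxKl row_mxKr addrC.
have NE : normal3 w = pack3 (unpack3 (normal3 w)) by rewrite unpack3K.
rewrite /collide3 /reflection Nw P P -NE -Nw; move: (_ / _) => e.
rewrite -!scaleNr !pack3_along !pack3K /swap12 /swap2 /swap_blocks/=.
by rewrite row_mxKl row_mxKr (addrC (rsubmx w)).
Qed.

End swaps.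

Section moments.
Context {R : realType} {d : nat}.
Local Notation V := 'rV[R]_d.
Local Notation lambda := (lebesgue_rV d).
Local Notation lambda2 := (product_sfm lambda lambda).
Local Notation lambda3 := (product_sfm lambda lambda2).
Variable h : V -> R.
Hypothesis mh : measurable_fun setT h.
Hypothesis h_ge0 : forall v, 0 <= h v.

Implicit Types a b c : V -> R.

Definition pairing (a : V -> R) : \bar R := (\int[lambda]_v (h v * a v)%:E)%E.

Definition tensor2 (x : V * V) : R := h x.1 * h x.2.
Definition tensor3 (x : V * (V * V)) : R := h x.1 * tensor2 x.2.

Lemma measurable_tensor2 : measurable_fun setT tensor2.
Proof.
apply: measurable_funM; first exact: measurableT_comp mh measurable_fst.
exact: measurableT_comp mh measurable_snd.
Qed.

Lemma measurable_tensor3 : measurable_fun setT tensor3.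
Proof.
apply: measurable_funM; first exact: measurableT_comp mh measurable_fst.
exact: measurableT_comp measurable_tensor2 measurable_snd.
Qed.

Lemma tensor2_ge0 x : 0 <= tensor2 x.
Proof. by rewrite mulr_ge0. Qed.

Lemma tensor3_ge0 x : 0 <= tensor3 x.
Proof. by rewrite mulr_ge0// tensor2_ge0. Qed.

Lemma pairing_ge0 a : (forall v, 0 <= a v) -> (0 <= pairing a)%E.
Proof. by move=> a0; apply: integral_ge0 => v _; rewrite lee_fin mulr_ge0. Qed.

Lemma le_pairing a b : measurable_fun setT a -> measurable_fun setT b ->
  (forall v, 0 <= a v) -> (forall v, a v <= b v) -> (pairing a <= pairing b)%E.
Proof.
move=> ma mb a0 ab; apply: ge0_le_integral => //.
- by move=> v _; rewrite lee_fin mulr_ge0.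
- by apply/measurable_EFinP; exact: measurable_funM.
- by apply/measurable_EFinP; exact: measurable_funM.
by move=> v _; rewrite lee_fin ler_wpM2l.
Qed.

Lemma pairingZ (c : R) a : measurable_fun setT a -> (forall v, 0 <= a v) -> 0 <= c ->
  pairing (fun v => c * a v) = (c%:E * pairing a)%E.
Proof.
move=> ma a0 c0; rewrite -ge0_integralZl ?lee_fin//.
- by apply: eq_integral => v _; rewrite -EFinM; congr (_%:E); ring.
- by apply/measurable_EFinP; exact: measurable_funM.
by move=> v _; rewrite lee_fin mulr_ge0.
Qed.

Lemma pairing2 a b : measurable_fun setT a -> measurable_fun setT b ->
  (forall v, 0 <= a v) -> (forall v, 0 <= b v) ->
  (\int[lambda2]_x (tensor2 x * (a x.1 * b x.2))%:E = pairing a * pairing b)%E.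
Proof.
move=> ma mb a0 b0; rewrite -integral_product//.
- by apply: eq_integral => x _; congr (_%:E); rewrite /tensor2 mulrACA.
- exact: measurable_funM.
- exact: measurable_funM.
- by move=> v; rewrite mulr_ge0.
by move=> v; rewrite mulr_ge0.
Qed.

Lemma pairing3 a b c : measurable_fun setT a -> measurable_fun setT b ->
  measurable_fun setT c ->
  (forall v, 0 <= a v) -> (forall v, 0 <= b v) -> (forall v, 0 <= c v) ->
  (\int[lambda3]_x (tensor3 x * (a x.1 * (b x.2.1 * c x.2.2)))%:E =
   pairing a * (pairing b * pairing c))%E.
Proof.
move=> ma mb mc a0 b0 c0; rewrite -pairing2// -integral_product//.
- by apply: eq_integral => x _; congr (_%:E); rewrite /tensor3 mulrACA.
- exact: measurable_funM.
- apply: measurable_funM; first exact: measurable_tensor2.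
  apply: measurable_funM; first exact: measurableT_comp mb measurable_fst.
  exact: measurableT_comp mc measurable_snd.
- by move=> v; rewrite mulr_ge0.
by move=> x; rewrite !mulr_ge0.
Qed.

Definition sym2 a b (x : V * V) : R := a x.1 * b x.2 + b x.1 * a x.2.
Definition sym3 a b (x : V * (V * V)) : R :=
  (b x.2.1 + b x.2.2) * a x.1 + (b x.1 + b x.2.2) * a x.2.1 + (b x.1 + b x.2.1) * a x.2.2.

Lemma measurable_sym2 a b : measurable_fun setT a -> measurable_fun setT b ->
  measurable_fun setT (sym2 a b).
Proof.
move=> ma mb; have m1 (e : V -> R) : measurable_fun setT e ->
    measurable_fun setT (fun x : V * V => e x.1).
  by move=> me; exact: measurableT_comp me measurable_fst.
have m2 (e : V -> R) : measurable_fun setT e ->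
    measurable_fun setT (fun x : V * V => e x.2).
  by move=> me; exact: measurableT_comp me measurable_snd.
exact: measurable_funD (measurable_funM (m1 _ ma) (m2 _ mb)) (measurable_funM (m1 _ mb) (m2 _ ma)).
Qed.

Lemma measurable_sym3 a b : measurable_fun setT a -> measurable_fun setT b ->
  measurable_fun setT (sym3 a b).
Proof.
move=> ma mb; have m1 (e : V -> R) : measurable_fun setT e ->
    measurable_fun setT (fun x : V * (V * V) => e x.1).
  by move=> me; exact: measurableT_comp me measurable_fst.
have m2 (e : V -> R) : measurable_fun setT e ->
    measurable_fun setT (fun x : V * (V * V) => e x.2.1).
  move=> me; apply: (measurableT_comp me).
  exact: measurableT_comp measurable_fst measurable_snd.
have m3 (e : V -> R) : measurable_fun setT e ->
    measurable_fun setT (fun x : V * (V * V) => e x.2.2).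
  move=> me; apply: (measurableT_comp me).
  exact: measurableT_comp measurable_snd measurable_snd.
exact: measurable_funD (measurable_funD
  (measurable_funM (measurable_funD (m2 _ mb) (m3 _ mb)) (m1 _ ma))
  (measurable_funM (measurable_funD (m1 _ mb) (m3 _ mb)) (m2 _ ma)))
  (measurable_funM (measurable_funD (m1 _ mb) (m2 _ mb)) (m3 _ ma)).
Qed.

Lemma sym2_ge0 a b x : (forall v, 0 <= a v) -> (forall v, 0 <= b v) -> 0 <= sym2 a b x.
Proof. by move=> a0 b0; rewrite addr_ge0 ?mulr_ge0. Qed.

Lemma sym3_ge0 a b x : (forall v, 0 <= a v) -> (forall v, 0 <= b v) -> 0 <= sym3 a b x.
Proof. by move=> a0 b0; rewrite /sym3 !addr_ge0 ?mulr_ge0 ?addr_ge0. Qed.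

Lemma pairing_sym2 a b (A B : R) : measurable_fun setT a -> measurable_fun setT b ->
  (forall v, 0 <= a v) -> (forall v, 0 <= b v) ->
  pairing a = A%:E -> pairing b = B%:E ->
  (\int[lambda2]_x (tensor2 x * sym2 a b x)%:E = (2 * (A * B))%:E)%E.
Proof.
move=> ma mb a0 b0 aA bB.
have mT (e k : V -> R) : measurable_fun setT e -> measurable_fun setT k ->
    measurable_fun setT (fun x : V * V => (tensor2 x * (e x.1 * k x.2))%:E).
  move=> me mk; apply/measurable_EFinP; apply: measurable_funM; first exact: measurable_tensor2.
  apply: measurable_funM; first exact: measurableT_comp me measurable_fst.
  exact: measurableT_comp mk measurable_snd.
under eq_integral do rewrite mulrDr EFinD.
rewrite ge0_integralD//.
- by rewrite !pairing2// aA bB -!EFinM -EFinD; congr (_%:E); ring.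
- by move=> x _; rewrite lee_fin !mulr_ge0.
- exact: mT.
- by move=> x _; rewrite lee_fin !mulr_ge0.
exact: mT.
Qed.

Lemma pairing_sym3 a b (m0 A B : R) : measurable_fun setT a -> measurable_fun setT b ->
  (forall v, 0 <= a v) -> (forall v, 0 <= b v) ->
  pairing (fun=> 1) = m0%:E -> pairing a = A%:E -> pairing b = B%:E ->
  (\int[lambda3]_x (tensor3 x * sym3 a b x)%:E = (6 * (m0 * (A * B)))%:E)%E.
Proof.
move=> ma mb a0 b0 am aA bB; pose o := (fun=> 1) : V -> R.
have mo : measurable_fun setT o by exact: measurable_cst.
have o0 v : 0 <= o v by [].
pose t (e k l : V -> R) (x : V * (V * V)) := tensor3 x * (e x.1 * (k x.2.1 * l x.2.2)).
have mt (e k l : V -> R) : measurable_fun setT e -> measurable_fun setT k ->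
    measurable_fun setT l -> measurable_fun setT (t e k l).
  move=> me mk ml; apply: measurable_funM; first exact: measurable_tensor3.
  apply: measurable_funM; first exact: measurableT_comp me measurable_fst.
  apply: measurable_funM.
    by apply: (measurableT_comp mk); exact: measurableT_comp measurable_fst measurable_snd.
  by apply: (measurableT_comp ml); exact: measurableT_comp measurable_snd measurable_snd.
have t0 e k l x : (forall v, 0 <= e v) -> (forall v, 0 <= k v) -> (forall v, 0 <= l v) ->
    0 <= t e k l x.
  by move=> ? ? ?; rewrite mulr_ge0 ?tensor3_ge0// !mulr_ge0.
pose P (u : V * (V * V) -> R) (r : R) := [/\ measurable_fun setT u, forall x, 0 <= u x &
  (\int[lambda3]_x (u x)%:E = r%:E)%E].
have D u v r s : P u r -> P v s -> P (fun x => u x + v x) (r + s).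
  move=> [mu u0 ur] [mv v0 vs]; split; first exact: measurable_funD.
    by move=> x; rewrite addr_ge0.
  rewrite EFinD -ur -vs -ge0_integralD//.
  - by move=> x _; rewrite lee_fin.
  - exact/measurable_EFinP.
  - by move=> x _; rewrite lee_fin.
  exact/measurable_EFinP.
have I (e k l : V -> R) (r s u : R) : measurable_fun setT e -> measurable_fun setT k ->
    measurable_fun setT l ->
    (forall v, 0 <= e v) -> (forall v, 0 <= k v) -> (forall v, 0 <= l v) ->
    pairing e = r%:E -> pairing k = s%:E -> pairing l = u%:E -> P (t e k l) (r * (s * u)).
  move=> me mk ml e0 k0 l0 er ks lu; split; [exact: mt|by move=> x; exact: t0|].
  by rewrite pairing3// er ks lu -!EFinM.
have -> : 6 * (m0 * (A * B)) = A * (B * m0) + A * (m0 * B) + (B * (A * m0) + m0 * (A * B)) +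
    (B * (m0 * A) + m0 * (B * A)) by ring.
have [_ _ <-] := D _ _ _ _
  (D _ _ _ _ (D _ _ _ _ (I _ _ _ _ _ _ ma mb mo a0 b0 o0 aA bB am)
                         (I _ _ _ _ _ _ ma mo mb a0 o0 b0 aA am bB))
             (D _ _ _ _ (I _ _ _ _ _ _ mb ma mo b0 a0 o0 bB aA am)
                         (I _ _ _ _ _ _ mo ma mb o0 a0 b0 am aA bB)))
  (D _ _ _ _ (I _ _ _ _ _ _ mb mo ma b0 o0 a0 bB am aA)
             (I _ _ _ _ _ _ mo mb ma o0 b0 a0 am bB aA)).
by apply: eq_integral => x _; congr (_%:E); rewrite /t /sym3 /o; ring.
Qed.

End moments.

Lemma powR_energy_sum2 {R : realType} (s x y : R) : 0 <= s <= 2 -> 0 <= x -> 0 <= y ->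
  (x + y) `^ s <= 9 * (x `^ s + y `^ s).
Proof.
move=> /andP[s0 s2] x0 y0.
have big (M : R) : 0 <= M -> x + y <= 3 * M -> (x + y) `^ s <= 9 * M `^ s.
  move=> M0 xyM; apply: (@le_trans _ _ ((3 * M) `^ s)).
    by apply: ge0_ler_powR; rewrite ?nnegrE ?addr_ge0// mulr_ge0.
  rewrite powRM// ler_wpM2r ?powR_ge0//; have -> : 9 = 3 `^ 2 :> R.
    by rewrite powR_mulrn//; ring.
  by apply: ler_powR => //; lra.
have px := powR_ge0 x s; have py := powR_ge0 y s.
have [xy|/ltW yx] := leP x y.
  by apply: (le_trans (big y y0 _)); lra.
by apply: (le_trans (big x x0 _)); lra.
Qed.

Lemma powR_energy_sum3 {R : realType} (s x y z : R) : 0 <= s <= 2 ->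
  0 <= x -> 0 <= y -> 0 <= z ->
  (x + y + z) `^ s <= 9 * (x `^ s + y `^ s + z `^ s).
Proof.
move=> /andP[s0 s2] x0 y0 z0.
have big (M : R) : 0 <= M -> x + y + z <= 3 * M -> (x + y + z) `^ s <= 9 * M `^ s.
  move=> M0 xyM; apply: (@le_trans _ _ ((3 * M) `^ s)).
    by apply: ge0_ler_powR; rewrite ?nnegrE ?addr_ge0// mulr_ge0.
  rewrite powRM// ler_wpM2r ?powR_ge0//; have -> : 9 = 3 `^ 2 :> R.
    by rewrite powR_mulrn//; ring.
  by apply: ler_powR => //; lra.
have px := powR_ge0 x s; have py := powR_ge0 y s; have pz := powR_ge0 z s.
have [xy|/ltW yx] := leP x y.
  have [yz|/ltW zy] := leP y z.
    by apply: (le_trans (big z z0 _)); lra.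
  by apply: (le_trans (big y y0 _)); lra.
have [xz|/ltW zx] := leP x z.
  by apply: (le_trans (big z z0 _)); lra.
by apply: (le_trans (big x x0 _)); lra.
Qed.


Section binary_dissipation.
Context {R : realType} {d : nat}.
Local Notation V := 'rV[R]_d.
Local Notation lambda := (lebesgue_rV d).
Local Notation lambda2 := (product_sfm lambda lambda).
Local Notation sphere := (sphere_sfm d).
Variables (gamma g' : R) (b2 : R -> R).
Hypothesis gamma02 : gamma \in `[0, 2].
Hypothesis gamma_le : gamma <= g'.
Hypothesis g'_le : g' <= 2.
Hypothesis hd : (2 <= d)%N.
Hypothesis hb2 : binary_kernel d b2.
Variables (eps beta kappa C c eta p B : R).
Hypothesis eps_gt0 : 0 < eps.
Hypothesis eps_le1 : eps <= 1.
Hypothesis beta_gt0 : 0 < beta.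
Hypothesis kappa_gt0 : 0 < kappa.
Local Notation Phi := (weight eps beta kappa).
Local Notation hh := (weight_ratio eps beta kappa).
Local Notation g := (gain_rate eps kappa).
Hypothesis C_gt0 : 0 < C.
Hypothesis excessP : forall M E, 0 < M -> M <= E <= 3 * M ->
  Phi E - Phi M <= C * (E - M) * hh M.
Hypothesis eta01 : 0 < eta < 1.
Hypothesis c_ge0 : 0 <= c.
Hypothesis gapP : 0 < c -> eps = gamma / 2 /\
  forall s E : R, 0 < E -> 0 <= s <= (1 - eta ^+ 2 / 8) * E ->
    8 * c * hh E / (1 + kappa * E `^ eps) <= hh E - hh s.
Hypothesis p_ge0 : 0 <= p.
Hypothesis B_ge0 : 0 <= B.
Hypothesis averageB : forall e : V,
  (\int[sphere_measure d]_w (b2_trunc b2 (dot (direction e) w))%:E <= B%:E)%E.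
Hypothesis averagep : forall e : V, enorm e = 1 ->
  (p%:E <= \int[sphere_measure d]_w
     (b2_trunc b2 (dot e w) * b2_angles eta (dot e w))%:E)%E.

Variable f : V -> R.
Hypothesis mf : measurable_fun setT f.
Hypothesis f_ge0 : {ae lambda, forall v, 0 <= f v}.
Local Notation h := (fun v => `|f v|).
Local Notation Psi := (fun v : V => Phi (energy v)).
Variables m0 m2 mg y z : R.
Hypothesis m0E : pairing h (fun=> 1) = m0%:E.
Hypothesis m2E : pairing h energy = m2%:E.
Hypothesis mgE : pairing h (fun v => (energy v `^ (1 + g' / 2))%R) = mg%:E.
Hypothesis yE : pairing h Psi = y%:E.
Hypothesis zE : pairing h (fun v => (Phi (energy v) * g (energy v))%R) = z%:E.

Let mh : measurable_fun setT h. Proof. exact: measurableT_comp. Qed.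
Let h0 v : 0 <= h v. Proof. exact: normr_ge0. Qed.
Let e0 (v : V) : 0 <= energy v. Proof. exact/ltW/energy_gt0. Qed.
Let P0 (v : V) : 0 <= Psi v. Proof. exact: weight_ge0. Qed.
Let mPsi : measurable_fun setT Psi.
Proof. exact: measurableT_comp (measurable_weight _ _ _) (@measurable_energy R d). Qed.
Local Notation F := (tensor2 h).
Let mfst (a : V -> R) : measurable_fun setT a -> measurable_fun setT (fun x : V * V => a x.1).
Proof. by move=> ma; exact: measurableT_comp ma measurable_fst. Qed.
Let msnd (a : V -> R) : measurable_fun setT a -> measurable_fun setT (fun x : V * V => a x.2).
Proof. by move=> ma; exact: measurableT_comp ma measurable_snd. Qed.
Let mcol (a : V * V -> R) : measurable_fun setT a ->
  measurable_fun setT (fun z : V * (V * V) => a (collide2 z.1 z.2)).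
Proof. by move=> ma; exact: measurableT_comp ma measurable_collide2. Qed.
Local Notation k := (kernel2 gamma b2).
Local Notation b w x := (b2_trunc b2 (deflection2 w x)).
Let mk := measurable_kernel2 gamma hb2.
Let mb := measurable_b2_deflection hb2.
Let k0 := kernel2_ge0 gamma hb2.
Let b0 (w : V) (x : V * V) : 0 <= b w x. Proof. exact: (b2_trunc_ge0 hb2). Qed.
Let mF : measurable_fun setT F. Proof. exact: measurable_tensor2. Qed.
Let F0 x : 0 <= F x. Proof. exact: tensor2_ge0. Qed.

Local Notation top := (fun v : V => energy v `^ (1 + g' / 2)).
Local Notation one := (fun _ : V => 1 : R).
Local Notation K := (36 * kappa^-1 `^ beta).

Let g'0 : 0 <= g'.
Proof. by apply: le_trans gamma_le; move: gamma02; rewrite in_itv/= => /andP[]. Qed.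

Let mtop : measurable_fun setT top.
Proof. exact: measurableT_comp (measurable_powR _) (@measurable_energy R d). Qed.

Let K0 : 0 <= K.
Proof. by rewrite mulr_ge0 ?powR_ge0. Qed.

(** A crude bound by moments of order [2 + g'], which makes the gain and the
   loss finite. *)
Let kernel_weight (w : V) (x : V * V) P : P <= Phi (energy x.1 + energy x.2) ->
  k w x * P <= K * b w x * sym2 top one x.
Proof.
move=> PE.
have kE : k w x <= b w x * (4 * (energy x.1 + energy x.2) `^ (g' / 2)).
  rewrite /kernel2 indicE; case: (_ \in _); rewrite ?mul0r ?mul1r.
    rewrite [leLHS]mulrC; apply: (ler_wpM2l (b0 w x)); exact: speed2_le_powR.
  by rewrite !mulr_ge0 ?powR_ge0.
have E0 : 0 < energy x.1 + energy x.2 := addr_gt0 (energy_gt0 _) (energy_gt0 _).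
apply: (le_trans (ler_wpM2l (k0 w x) PE)).
have W0 := weight_le_linear eps beta_gt0 kappa_gt0 (ltW E0).
apply: (le_trans (ler_pM (k0 w x) (weight_ge0 _ _ _ (ltW E0)) kE W0)).
rewrite /sym2 mulr1 mul1r.
have s2 : 0 <= 1 + g' / 2 <= 2 by move: g'_le g'0; lra.
have := powR_energy_sum2 s2 (e0 x.1) (e0 x.2).
have K10 : 0 <= kappa^-1 `^ beta by exact: powR_ge0.
move=> /(ler_wpM2l (mulr_ge0 (b0 w x) (mulr_ge0 (ler0n _ 4) K10))).
rewrite (@powRD _ (energy x.1 + energy x.2) 1) ?(gt_eqF E0) ?implybT// powRr1 ?(ltW E0)//.
by congr (is_true (_ <= _)); ring.
Qed.

Let bounded_collisions (P' : V -> V * V -> R) :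
  measurable_fun setT (fun z : V * (V * V) => P' z.1 z.2) ->
  (forall w x, 0 <= P' w x) -> (forall w x, P' w x <= Phi (energy x.1 + energy x.2)) ->
  (iterated_integral sphere lambda2 (fun w x => k w x * F x * P' w x)%R < +oo)%E.
Proof.
move=> mP' P'0 P'E.
have := @integrated_povzner _ _ _ _ R sphere lambda2 k (fun w x => b w x) (fun _ _ => 0)
  (fun=> 0) P' (sym2 top one) (fun=> 0) F setT K 0 0 B mk mb (@measurable_cst _ _ _ _ _ _)
  (@measurable_cst _ _ _ _ _ _) mP' (measurable_sym2 mtop (@measurable_cst _ _ _ _ _ _))
  (@measurable_cst _ _ _ _ _ _) mF measurableT k0 b0 (fun _ _ => lexx _) (fun _ => lexx _)
  P'0 (fun x => sym2_ge0 x (fun v => powR_ge0 _ _) (fun=> ler01)) (fun=> lexx _) F0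
  (lexx _) K0 (lexx _) B_ge0 _ _ _.
rewrite mul0r mul0e adde0 (_ : iterated_integral _ _ (fun w x => k w x * F x * 0)%R = 0%E); last first.
  rewrite /iterated_integral -[RHS](integral0 sphere setT); apply: eq_integral => w _.
  by under eq_integral do rewrite mulr0; rewrite integral0.
rewrite add0e (pairing_sym2 mh h0 mtop (@measurable_cst _ _ _ _ _ _) _ _ mgE m0E)//; last first.
  by move=> v; exact: powR_ge0.
move=> H; apply: le_lt_trans (H _ _ _) _ => //.
- by move=> x; exact: averageB.
- by move=> x _; apply: integral_ge0 => w _; rewrite lee_fin.
- by move=> w x; rewrite !mul0r mulr0 addr0 add0r; exact: kernel_weight.
by rewrite -EFinM ltry.
Qed.

Let gain := iterated_integral sphere lambda2 (fun w x => k w x * F x * Psi (collide2 w x).1)%R.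
Let loss := iterated_integral sphere lambda2 (fun w x => k w x * F x * Psi x.1)%R.

Let gain_lty : (gain < +oo)%E.
Proof.
apply: bounded_collisions => // [|w x].
  exact: (mcol (mfst mPsi)).
rewrite -(collide2_energy_sum w); apply: weight_homo => //.
by rewrite lerDl.
Qed.

Let loss_lty : (loss < +oo)%E.
Proof.
apply: bounded_collisions => // [|w x].
  exact: measurable_snd_fun (mfst mPsi).
by apply: weight_homo => //; rewrite lerDl.
Qed.

Let mkF : measurable_fun setT (fun z : V * (V * V) => k z.1 z.2 * F z.2).
Proof. by apply: measurable_funM => //; exact: measurable_snd_fun mF. Qed.

Let FS x : F (swap2 x) = F x.
Proof. by rewrite /tensor2 mulrC. Qed.

Let kFP0 w x v : 0 <= k w x * F x * Psi v.
Proof. exact: mulr_ge0 (mulr_ge0 (k0 w x) (F0 x)) (P0 v). Qed.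

(** Exchanging the two particles preserves the kernel and commutes with
   collisions. *)
Let symmetrized (a : V -> V * V -> V * V) :
  measurable_fun setT (fun z : V * (V * V) => a z.1 z.2) ->
  (forall w x, a w (swap2 x) = swap2 (a w x)) ->
  iterated_integral sphere lambda2 (fun w x => k w x * F x * (Psi (a w x).1 + Psi (a w x).2))%R =
  (iterated_integral sphere lambda2 (fun w x => k w x * F x * Psi (a w x).1)%R +
   iterated_integral sphere lambda2 (fun w x => k w x * F x * Psi (a w x).1)%R)%E.
Proof.
move=> ma aS.
have m1 : measurable_fun setT (fun z : V * (V * V) => k z.1 z.2 * F z.2 * Psi (a z.1 z.2).1).
  by apply: measurable_funM => //; exact: measurableT_comp (mfst mPsi) ma.
have m2' : measurable_fun setT (fun z : V * (V * V) => k z.1 z.2 * F z.2 * Psi (a z.1 z.2).2).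
  by apply: measurable_funM => //; exact: measurableT_comp (msnd mPsi) ma.
transitivity (iterated_integral sphere lambda2 (fun w x => k w x * F x * Psi (a w x).1 +
    k w x * F x * Psi (a w x).2)%R).
  by congr iterated_integral; apply/funext => w; apply/funext => x; rewrite mulrDr.
rewrite (iterated_integralD sphere lambda2 m1 m2') => [|w x|w x]; last 2 first.
- exact: kFP0.
- exact: kFP0.
apply: (congr1 (fun t => _ + t)%E); apply: eq_integral => w _.
rewrite -[RHS](preserves_integral (@swap2_preserves R d)); last 2 first.
- by apply/measurable_EFinP; exact: (measurableT_comp m1 (pair1_measurable w)).
- by move=> x; rewrite lee_fin; exact: kFP0.
by apply: eq_integral => x _; rewrite FS aS kernel2_swap.
Qed.

Let gain_sym := symmetrized measurable_collide2 (@collide2_swap R d).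
Let loss_sym := symmetrized (a := fun _ x => x) measurable_snd (fun _ _ => erefl).

(** Integrating [pointwise2] gives a loss over pairs with a slow partner only.
   For other pairs [gain_rate s <= s ^ eps <= s] and
   [energy x.1 <= 64 / eta ^+ 2 * energy x.2], so the loss over all pairs differs
   by a multiple of [m2 * y]. *)
Let povzner2 (G L : \bar R) : gain = G -> loss = L ->
  (G + G + (c * p * (m0 * z))%:E <=
   L + L + ((24 * C * B + 64 * c * p / eta ^+ 2) * (m2 * y))%:E)%E.
Proof.
move=> gE lE; have gS := gain_sym; have lS := loss_sym.
rewrite -/gain gE in gS; rewrite -/loss lE in lS.
have mo : measurable_fun setT one by exact: measurable_cst.
have me := @measurable_energy R d.
have mZ : measurable_fun setT (fun v : V => Phi (energy v) * g (energy v)).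
  apply: measurable_funM => //.
  exact: measurableT_comp (measurable_gain_rate eps kappa) me.
have Z0 (v : V) : 0 <= Phi (energy v) * g (energy v).
  by rewrite mulr_ge0 ?gain_rate_ge0.
have mA : measurable (@slow_partner2 R d eta).
  rewrite -[X in measurable X]setTI; apply: measurable_fun_ler => //; first exact: msnd.
  by apply: measurable_funM => //; exact: mfst.
have C12 : 0 <= 12 * C by rewrite mulr_ge0// ltW.
have ml : measurable_fun setT (fun z : V * (V * V) => effective2 b2 eta z.1 z.2).
  apply: measurable_funM; first exact: measurable_sphere_indic.
  apply: measurable_funM => //; apply: measurableT_comp (measurable_b2_angles eta) _.
  apply: measurable_dot => //; apply: measurableT_comp (@measurable_direction R d) _.
  apply: (measurable_fun_comp2 (@measurable_rVD R d)).
    exact: measurableT_comp measurable_snd measurable_snd.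
  apply: (measurableT_comp (@measurable_rVN R d)).
  exact: measurableT_comp measurable_fst measurable_snd.
have l0 (w : V) x : 0 <= effective2 b2 eta w x.
  exact: mulr_ge0 (ler0n _ _) (mulr_ge0 (b0 w x) (ler0n _ _)).
have := @integrated_povzner _ _ _ _ R sphere lambda2 k (fun w x => b w x) (effective2 b2 eta)
  (fun x => Psi x.1 + Psi x.2) (fun w x => Psi (collide2 w x).1 + Psi (collide2 w x).2)
  (sym2 energy Psi) (fun x => Phi (energy x.1) * g (energy x.1)) F (slow_partner2 eta)
  (12 * C) c p B mk mb ml (measurable_funD (mfst mPsi) (msnd mPsi))
  (measurable_funD (mcol (mfst mPsi)) (mcol (msnd mPsi))) (measurable_sym2 me mPsi)
  (mfst mZ) mF mA k0 b0 l0 (fun x => addr_ge0 (P0 _) (P0 _))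
  (fun w x => addr_ge0 (P0 _) (P0 _)) (fun x => sym2_ge0 x e0 P0) (fun x => Z0 _) F0
  c_ge0 C12 p_ge0 B_ge0 _ _ _.
rewrite gS lS.
rewrite (pairing_sym2 mh h0 me mPsi e0 P0 m2E yE).
set I1 := (\int[lambda2]_x (F x * (\1_(slow_partner2 eta) x * _))%:E)%E.
move=> H; have {}H : (G + G + (c * p)%:E * I1 <=
    L + L + (12 * C * B * (2 * (m2 * y)))%:E)%E.
  rewrite (EFinM (12 * C * B)); apply: H => [x|x Ax|w x].
  - exact: averageB.
  - have x12 : x.2 - x.1 != 0.
      apply: contraTneq Ax => /eqP; rewrite subr_eq0 => /eqP x12.
      rewrite x12 -ltNge.
      rewrite gtr_pMl ?energy_gt0// ltr_pdivrMr// mul1r.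
      by case/andP: eta01 => n0 n1; rewrite (lt_trans (_ : _ < 1)) ?exprn_ilt1 ?ltW ?ltr1n.
    apply: (le_trans (averagep (enorm_direction x12))).
    have mS : measurable (~` @unit_sphere R d) by apply: measurableC; exact: measurable_unit_sphere.
    rewrite le_eqVlt; apply/orP; left; apply/eqP.
    apply: (eq_integral_off_null mS (sphere_carrier _)) => w /contrapT w1.
    by rewrite /effective2 indicE mem_set ?mul1r.
  apply: le_trans (pointwise2 gamma02 hb2 eps_gt0 beta_gt0 kappa_gt0 C_gt0 excessP eta01 c_ge0 gapP w x) _.
  by rewrite /sym2 (mulrC (Psi x.1)).
have gap : ((m0 * z)%:E <= I1 + (64 / eta ^+ 2 * (y * m2))%:E)%E.
  have n0 : 0 < eta ^+ 2 by case/andP: eta01 => ? _; rewrite exprn_gt0.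
  have d0 : 0 <= 64 / eta ^+ 2 by rewrite divr_ge0// ltW.
  have m1A : measurable_fun setT (fun x : V * V => \1_(slow_partner2 eta) x : R).
    exact: measurable_indic.
  have m1AZ := measurable_funM mF (measurable_funM m1A (mfst mZ)).
  have mPe := measurable_funM mF (measurable_funM (mfst mPsi) (msnd me)).
  have := pairing2 mh h0 mZ mo Z0 (fun=> ler01); rewrite zE m0E -EFinM mulrC => <-.
  have := pairing2 mh h0 mPsi me P0 e0; rewrite yE m2E -EFinM (EFinM (64 / _)) => <-.
  rewrite -ge0_integralZl ?lee_fin//; last 2 first.
  - exact/measurable_EFinP.
  - by move=> x _; rewrite lee_fin; exact: mulr_ge0 (F0 x) (mulr_ge0 (P0 _) (e0 _)).
  rewrite /I1 -ge0_integralD//; last 4 first.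
  - by move=> x _; rewrite lee_fin; exact: mulr_ge0 (F0 x) (mulr_ge0 (ler0n _ _) (Z0 _)).
  - exact/measurable_EFinP.
  - move=> x _; rewrite -EFinM lee_fin.
    exact: mulr_ge0 d0 (mulr_ge0 (F0 x) (mulr_ge0 (P0 _) (e0 _))).
  - by apply: measurable_funeM; exact/measurable_EFinP.
  apply: ge0_le_integral => //.
  - move=> x _; rewrite lee_fin; exact: mulr_ge0 (F0 x) (mulr_ge0 (Z0 _) ler01).
  - by apply/measurable_EFinP; exact: measurable_funM mF (measurable_funM (mfst mZ) (measurable_cst _)).
  - apply: emeasurable_funD; first exact/measurable_EFinP.
    by apply: measurable_funeM; exact/measurable_EFinP.
  move=> x _; rewrite -EFinM -EFinD lee_fin mulr1 (mulrCA (64 / eta ^+ 2) (F x)) -mulrDr.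
  apply: ler_wpM2l => //; rewrite indicE; have [Ax|Ax] := pselect (slow_partner2 eta x).
    by rewrite mem_set// mul1r lerDl mulr_ge0// mulr_ge0.
  rewrite memNset// mul0r add0r (mulrCA (64 / eta ^+ 2)); apply: ler_wpM2l => //.
  move/negP: Ax; rewrite -ltNge => Ax.
  apply: (le_trans (gain_rate_le_powR eps kappa_gt0 (energy x.1))).
  apply: (@le_trans _ _ (energy x.1 `^ 1)).
    by apply: ler_powR => //; exact: energy_ge1.
  rewrite powRr1// mulrAC ler_pdivlMr//.
  by move: (ltW Ax); rewrite mulrAC ler_pdivrMr// mulrC (mulrC (energy x.2)).
have cp0 : 0 <= c * p by exact: mulr_ge0.
move: I1 H gap; move: (G + G)%E (L + L)%E => {gS gE lS lE}G {}L I1 H gap.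
apply: (@le_trans _ _ (G + ((c * p)%:E * I1 + (c * p * (64 / eta ^+ 2 * (y * m2)))%:E))%E).
  apply: leeD2l; rewrite EFinM (EFinM (c * p) (64 / _ * _)) -muleDr ?fin_num_adde_defl//.
  exact: lee_wpmul2l.
rewrite addeA; apply: (le_trans (leeD2r _ H)).
rewrite -addeA -EFinD; apply: leeD2l; rewrite lee_fin le_eqVlt; apply/orP; left; apply/eqP.
by field; case/andP: eta01 => /gt_eqF ->.
Qed.

Let gain_loss : exists G L : \bar R, [/\ gain = G, loss = L, (0 <= G < +oo)%E,
  (0 <= L < +oo)%E & (G + G + (c * p * (m0 * z))%:E <=
    L + L + ((24 * C * B + 64 * c * p / eta ^+ 2) * (m2 * y))%:E)%E].
Proof.
exists gain, loss; split; [by []|by []| | |exact: povzner2].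
  apply/andP; split; last exact: gain_lty.
  apply: integral_ge0 => w _; apply: integral_ge0 => x _; rewrite lee_fin; exact: kFP0.
apply/andP; split; last exact: loss_lty.
apply: integral_ge0 => w _; apply: integral_ge0 => x _; rewrite lee_fin; exact: kFP0.
Qed.

(** The factor 2 of [r] comes from symmetrizing the weight over the two
   particles. *)
Lemma binary_dissipation : exists (J : V -> \bar R) (r : R),
  [/\ lambda.-integrable setT J, (\int[lambda]_v J v = r%:E)%E,
    {ae lambda, forall v, (Q2 gamma b2 f v * Psi v)%:E = J v} &
    2 * r + c * p * (m0 * z) <= (24 * C * B + 64 * c * p / eta ^+ 2) * (m2 * y)].
Proof.
pose M : set V := [set v | f v < 0].
have mM : measurable M.
  by rewrite -[X in measurable X]setTI; apply: measurable_fun_ltr.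
have M0 : lambda M = 0%E.
  case: f_ge0 => N [mN N0 fN]; apply/eqP; rewrite -measure_le0 -N0.
  apply: le_measure; rewrite ?inE// => v /= fv; apply: fN => /=.
  by apply/negP; rewrite -ltNge.
have [mN N0] := null_cylinder mM mM M0 M0.
have mS : measurable (~` @unit_sphere R d) by apply: measurableC; exact: measurable_unit_sphere.
have T'E (w : V) (x : V * V) : ~ (~` @unit_sphere R d) w ->
    (x.1 + dot w (x.2 - x.1) *: w, x.2 - dot w (x.2 - x.1) *: w) = collide2 w x.
  by move=> /contrapT w1; rewrite collide2E.
have k'E (w : V) (x : V * V) : ~ (~` @unit_sphere R d) w -> B2 gamma b2 (x.2 - x.1) w = k w x.
  move=> /contrapT w1; rewrite /kernel2 indicE mem_set// mul1r /B2.
  congr (_ * _); apply/esym/b2_truncE; rewrite in_itv/= -ler_norml.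
  apply: (le_trans (cauchy_schwarz _ _)); rewrite w1 mulr1; exact: enorm_direction_le1.
have F'E x : ~ ((fst @^-1` M) `|` (snd @^-1` M)) x -> f x.1 * f x.2 = F x.
  move=> Mx; rewrite /tensor2 !ger0_norm// leNgt; apply/negP => fx; apply: Mx; first by right.
  by left.
have [G [L [gE lE /andP[g_ge0 goo] /andP[l_ge0 loo] povzner]]] := gain_loss.
have [J [J1 J2 J3]] := @weak_form _ _ _ _ _ _ R sphere lambda lambda
  (@collide2 R d) (fun w x => (x.1 + dot w (x.2 - x.1) *: w, x.2 - dot w (x.2 - x.1) *: w))
  k (fun w x => B2 gamma b2 (x.2 - x.1) w) F (fun x => f x.1 * f x.2) Psi
  (~` @unit_sphere R d) ((fst @^-1` M) `|` (snd @^-1` M)) (@measurable_collide2 R d) mk mF mPsi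
  (@collide2_preserves R d) (@collide2K R d) (kernel2_collide gamma hb2) k0 F0
  (fun v => weight_gt0 eps beta kappa_gt0 (energy_gt0 v)) mS (sphere_carrier _) mN N0 T'E k'E F'E
  G L gE lE goo loo.
clear gE lE; have gf : G \is a fin_num by rewrite ge0_fin_numE.
have lf : L \is a fin_num by rewrite ge0_fin_numE.
exists J, (fine G - fine L); split=> //; first by rewrite J2 EFinB !fineK.
move: povzner; rewrite -{1 2}(fineK gf) -{1 2}(fineK lf) -!EFinD lee_fin.
move: (c * p * (m0 * z)) ((24 * C * B + 64 * c * p / eta ^+ 2) * (m2 * y)) => u v; lra.
Qed.

End binary_dissipation.


Section ternary_symmetries.
Context {R : realType} {d : nat}.
Local Notation V := 'rV[R]_d.
Implicit Types (w : 'rV[R]_(d + d)) (x : V * (V * V)).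

Lemma spread3_swap01 x : spread3 (swap01 x) = spread3 x.
Proof.
rewrite /spread3 /triple_norm /= -(enormN (x.2.1 - x.1)) opprB.
by congr Num.sqrt; rewrite -!addrA; congr (_ + _); rewrite addrC.
Qed.

Lemma spread3_swap12 x : spread3 (swap12 x) = spread3 x.
Proof.
rewrite /spread3 /triple_norm /= -(enormN (x.2.2 - x.2.1)) opprB.
by congr Num.sqrt; congr (_ + _); rewrite addrC.
Qed.

Lemma relative3_swap w x : dot (relative3 (swap12 x)) (swap_blocks w) = dot (relative3 x) w.
Proof. by rewrite dot_row_mx2 dot_row_mx addrC. Qed.

Lemma cross_dot_swap w : cross_dot (swap_blocks w) = cross_dot w.
Proof. by rewrite /cross_dot row_mxKl row_mxKr dotC. Qed.

Lemma kernel3_swap gamma theta phi w x :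
  kernel3 gamma theta phi (swap_blocks w) (swap12 x) = kernel3 gamma theta phi w x.
Proof.
rewrite /kernel3 /speed3 spread3_swap12 relative3_swap cross_dot_swap; congr (_ * _).
congr ((nat_of_bool _)%:R).
by apply/idP/idP; rewrite !inE => /unit_sphere_swap.
Qed.

End ternary_symmetries.

Lemma le_mulDr {R : realType} (K u v w : R) : 0 <= K -> 0 <= v -> 0 <= w ->
  u <= v * K \/ u <= w * K -> u <= K * (v + w).
Proof.
move=> K0 v0 w0 H; have := mulr_ge0 v0 K0; have := mulr_ge0 w0 K0.
by rewrite (mulrC K) mulrDl; case: H; lra.
Qed.

Section ternary_dissipation.
Context {R : realType} {d : nat}.
Local Notation V := 'rV[R]_d.
Local Notation X := (V * (V * V))%type.
Local Notation S := 'rV[R]_(d + d).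
Local Notation lambda := (lebesgue_rV d).
Local Notation lambda2 := (product_sfm lambda lambda).
Local Notation lambda3 := (product_sfm lambda lambda2).
Local Notation sphere := (sphere_sfm (d + d)).
Variables (gamma g' theta : R) (phi : R -> R).
Hypothesis gamma02 : gamma \in `[0, 2].
Hypothesis gamma_le : gamma <= g'.
Hypothesis g'_le : g' <= 2.
Hypothesis theta_ge0 : 0 <= theta.
Hypothesis hb3 : ternary_kernel d theta phi.
Variables (eps beta kappa C c eta p B : R).
Hypothesis eps_gt0 : 0 < eps.
Hypothesis eps_le1 : eps <= 1.
Hypothesis beta_gt0 : 0 < beta.
Hypothesis kappa_gt0 : 0 < kappa.
Local Notation Phi := (weight eps beta kappa).
Local Notation hh := (weight_ratio eps beta kappa).
Local Notation g := (gain_rate eps kappa).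
Hypothesis C_gt0 : 0 < C.
Hypothesis excessP : forall M E, 0 < M -> M <= E <= 3 * M ->
  Phi E - Phi M <= C * (E - M) * hh M.
Hypothesis eta01 : 0 < eta < 1.
Hypothesis c_ge0 : 0 <= c.
Local Notation u0 := (8^-1 * (eta / 4) `^ theta).
Hypothesis gapP : 0 < c -> eps = gamma / 2 /\
  forall s E : R, 0 < E -> 0 <= s <= (1 - eta ^+ 4 / 32) * E ->
    c / u0 * hh E / (1 + kappa * E `^ eps) <= hh E - hh s.
Hypothesis p_ge0 : 0 <= p.
Hypothesis B_ge0 : 0 <= B.
Hypothesis averageB :
  (\int[sphere_measure (d + d)]_w (phi_trunc phi (cross_dot w))%:E <= B%:E)%E.
Hypothesis averagep : forall e : V, enorm e = 1 ->
  (p%:E <= \int[sphere_measure (d + d)]_w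
     (phi_trunc phi (cross_dot w) * \1_(ternary_angles eta e) w)%:E)%E.

Variable f : V -> R.
Hypothesis mf : measurable_fun setT f.
Hypothesis f_ge0 : {ae lambda, forall v, 0 <= f v}.
Local Notation h := (fun v => `|f v|).
Local Notation Psi := (fun v : V => Phi (energy v)).
Variables m0 m2 mg y z : R.
Hypothesis m0E : pairing h (fun=> 1) = m0%:E.
Hypothesis m2E : pairing h energy = m2%:E.
Hypothesis mgE : pairing h (fun v => (energy v `^ (1 + g' / 2))%R) = mg%:E.
Hypothesis yE : pairing h Psi = y%:E.
Hypothesis zE : pairing h (fun v => (Phi (energy v) * g (energy v))%R) = z%:E.

Let mh : measurable_fun setT h. Proof. exact: measurableT_comp. Qed.
Let h0 v : 0 <= h v. Proof. exact: normr_ge0. Qed.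
Let e0 (v : V) : 0 <= energy v. Proof. exact/ltW/energy_gt0. Qed.
Let P0 (v : V) : 0 <= Psi v. Proof. exact: weight_ge0. Qed.
Let mPsi : measurable_fun setT Psi.
Proof. exact: measurableT_comp (measurable_weight _ _ _) (@measurable_energy R d). Qed.
Local Notation F := (tensor3 h).
Let m1 (a : V -> R) : measurable_fun setT a -> measurable_fun setT (fun x : X => a x.1).
Proof. by move=> ma; exact: measurableT_comp ma measurable_fst. Qed.
Let m21 (a : V -> R) : measurable_fun setT a -> measurable_fun setT (fun x : X => a x.2.1).
Proof.
move=> ma; apply: (measurableT_comp ma); exact: measurableT_comp measurable_fst measurable_snd.
Qed.
Let m22 (a : V -> R) : measurable_fun setT a -> measurable_fun setT (fun x : X => a x.2.2).
Proof.
move=> ma; apply: (measurableT_comp ma); exact: measurableT_comp measurable_snd measurable_snd.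
Qed.
Let mcol (a : X -> R) : measurable_fun setT a ->
  measurable_fun setT (fun z : S * X => a (collide3 z.1 z.2)).
Proof. by move=> ma; exact: measurableT_comp ma measurable_collide3. Qed.
Local Notation k := (kernel3 gamma theta phi).
Local Notation b := (fun (w : S) (x : X) => phi_trunc phi (cross_dot w)).
Let mk := measurable_kernel3 gamma hb3.
Let mb : measurable_fun setT (fun z : S * X => b z.1 z.2).
Proof. exact: measurable_phi_cross hb3 _ _. Qed.
Let k0 (w : S) (x : X) : 0 <= k w x. Proof. exact: (kernel3_ge0 gamma hb3). Qed.
Let b0 (w : S) (x : X) : 0 <= b w x. Proof. exact: (phi_trunc_ge0 hb3). Qed.
Let mF : measurable_fun setT F. Proof. exact: measurable_tensor3. Qed.
Let F0 x : 0 <= F x. Proof. exact: tensor3_ge0. Qed.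

Local Notation top := (fun v : V => energy v `^ (1 + g' / 2)).
Local Notation one := (fun _ : V => 1 : R).
Local Notation K := (36 * kappa^-1 `^ beta).
Local Notation total x := (energy x.1 + energy x.2.1 + energy x.2.2).

Let g'0 : 0 <= g'.
Proof. by apply: le_trans gamma_le; move: gamma02; rewrite in_itv/= => /andP[]. Qed.

Let mtop : measurable_fun setT top.
Proof. exact: measurableT_comp (measurable_powR _) (@measurable_energy R d). Qed.

Let K0 : 0 <= K.
Proof. by rewrite mulr_ge0 ?powR_ge0. Qed.

Let total_gt0 (x : X) : 0 < total x.
Proof. exact: addr_gt0 (addr_gt0 (energy_gt0 _) (energy_gt0 _)) (energy_gt0 _). Qed.

(** A crude bound by moments of order [2 + g'], which makes the gain and the
   loss finite. *)
Let kernel_weight (w : S) (x : X) P : P <= Phi (total x) ->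
  k w x * P <= K * b w x * sym3 top one x.
Proof.
move=> PE.
have kE : k w x <= b w x * (4 * total x `^ (g' / 2)).
  rewrite /kernel3 indicE; case: (boolP (w \in _)) => [|_]; rewrite ?mul0r ?mul1r; last first.
    exact: mulr_ge0 (b0 w x) (mulr_ge0 (ler0n _ _) (powR_ge0 _ _)).
  rewrite inE => w1; rewrite [leLHS]mulrC; apply: (ler_wpM2l (b0 w x)).
  apply: (le_trans (speed3_le_spread gamma theta_ge0 x w1)).
  exact: spread3_le_powR.
have E0 := total_gt0 x.
apply: (le_trans (ler_wpM2l (k0 w x) PE)).
have W0 := weight_le_linear eps beta_gt0 kappa_gt0 (ltW E0).
apply: (le_trans (ler_pM (k0 w x) (weight_ge0 _ _ _ (ltW E0)) kE W0)).
have s2 : 0 <= 1 + g' / 2 <= 2 by move: g'_le g'0; lra.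
have := powR_energy_sum3 s2 (e0 x.1) (e0 x.2.1) (e0 x.2.2).
have K10 : 0 <= kappa^-1 `^ beta by exact: powR_ge0.
have T0 v : 0 <= top v by exact: powR_ge0.
have s3 : top x.1 + top x.2.1 + top x.2.2 <= sym3 top one x.
  by rewrite /sym3; have := T0 x.1; have := T0 x.2.1; have := T0 x.2.2; lra.
move=> H; have {}H := le_trans H (ler_wpM2l (ler0n _ 9) s3); move: H.
move=> /(ler_wpM2l (mulr_ge0 (b0 w x) (mulr_ge0 (ler0n _ 4) K10))).
rewrite (@powRD _ (total x) 1) ?(gt_eqF E0) ?implybT// powRr1 ?(ltW E0)//.
by congr (is_true (_ <= _)); ring.
Qed.

Let bounded_collisions (P' : S -> X -> R) :
  measurable_fun setT (fun z : S * X => P' z.1 z.2) ->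
  (forall w x, 0 <= P' w x) -> (forall w x, P' w x <= Phi (total x)) ->
  (iterated_integral sphere lambda3 (fun w x => k w x * F x * P' w x)%R < +oo)%E.
Proof.
move=> mP' P'0 P'E.
have := @integrated_povzner _ _ _ _ R sphere lambda3 k b (fun _ _ => 0)
  (fun=> 0) P' (sym3 top one) (fun=> 0) F setT K 0 0 B mk mb (@measurable_cst _ _ _ _ _ _)
  (@measurable_cst _ _ _ _ _ _) mP' (measurable_sym3 mtop (@measurable_cst _ _ _ _ _ _))
  (@measurable_cst _ _ _ _ _ _) mF measurableT k0 b0 (fun _ _ => lexx _) (fun _ => lexx _)
  P'0 (fun x => sym3_ge0 x (fun v => powR_ge0 _ _) (fun=> ler01)) (fun=> lexx _) F0
  (lexx _) K0 (lexx _) B_ge0 _ _ _.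
rewrite mul0r mul0e adde0 (_ : iterated_integral _ _ (fun w x => k w x * F x * 0)%R = 0%E); last first.
  rewrite /iterated_integral -[RHS](integral0 sphere setT); apply: eq_integral => w _.
  by under eq_integral do rewrite mulr0; rewrite integral0.
rewrite add0e (pairing_sym3 mh h0 mtop (@measurable_cst _ _ _ _ _ _) _ _ m0E mgE m0E)//; last first.
  by move=> v; exact: powR_ge0.
move=> H; apply: le_lt_trans (H _ _ _) _ => //.
- by move=> x _; apply: integral_ge0 => w _; rewrite lee_fin.
- by move=> w x; rewrite !mul0r mulr0 addr0 add0r; exact: kernel_weight.
by rewrite -EFinM ltry.
Qed.

Let kFP0 w x v : 0 <= k w x * F x * Psi v.
Proof. exact: mulr_ge0 (mulr_ge0 (k0 w x) (F0 x)) (P0 v). Qed.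

Local Notation observe a := (iterated_integral sphere lambda3
  (fun (w : S) (x : X) => k w x * F x * Psi (a w x))%R).

Let coordinate_le (x : X) : [/\ Psi x.1 <= Phi (total x), Psi x.2.1 <= Phi (total x) &
  Psi x.2.2 <= Phi (total x)].
Proof.
split; apply: weight_homo => //.
- by rewrite -addrA lerDl addr_ge0.
- by rewrite addrAC lerDr addr_ge0.
by rewrite lerDr addr_ge0.
Qed.

Let observe_lty (a : S -> X -> V) :
  measurable_fun setT (fun z : S * X => Psi (a z.1 z.2)) ->
  (forall w x, Psi (a w x) <= Phi (total x)) -> (0 <= observe a < +oo)%E.
Proof.
move=> ma aE; rewrite bounded_collisions// andbT.
apply: integral_ge0 => w _; apply: integral_ge0 => x _.
by rewrite lee_fin; exact: kFP0.
Qed.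

Let FS01 x : F (swap01 x) = F x.
Proof. by rewrite /tensor3 /tensor2 /= mulrCA. Qed.

Let FS12 x : F (swap12 x) = F x.
Proof. by rewrite /tensor3 /tensor2 /= (mulrC (`|f x.2.2|)). Qed.

Let mkF : measurable_fun setT (fun z : S * X => k z.1 z.2 * F z.2).
Proof. by apply: measurable_funM => //; exact: measurable_snd_fun mF. Qed.

Let mobs (a : S -> X -> V) : measurable_fun setT (fun z : S * X => Psi (a z.1 z.2)) ->
  measurable_fun setT (fun z : S * X => k z.1 z.2 * F z.2 * Psi (a z.1 z.2)).
Proof. by move=> ma; apply: measurable_funM. Qed.

Let observe_swap (a : S -> X -> X) :
  measurable_fun setT (fun z : S * X => a z.1 z.2) ->
  (forall w x, a (swap_blocks w) (swap12 x) = swap12 (a w x)) ->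
  observe (fun w x => (a w x).2.2) = observe (fun w x => (a w x).2.1).
Proof.
move=> ma aS; have ma1 := mobs (a := fun w x => (a w x).2.1) (measurableT_comp (m21 mPsi) ma).
have ma1E : measurable_fun setT (fun z : S * X =>
    (k z.1 z.2 * F z.2 * Psi (a z.1 z.2).2.1)%:E) by exact/measurable_EFinP.
rewrite /iterated_integral.
rewrite -[RHS](preserves_integral (@swap_blocks_preserves R d)); last 2 first.
- apply: (measurable_fun_fubini_tonelli_F (m2 := lambda3) _ ma1E).
  by move=> w; rewrite lee_fin; exact: kFP0.
- by move=> w; apply: integral_ge0 => x _; rewrite lee_fin; exact: kFP0.
apply: eq_integral => w _.
rewrite -[RHS](preserves_integral (@swap12_preserves R d)); last 2 first.
- by apply/measurable_EFinP; exact: (measurableT_comp ma1 (pair1_measurable _)).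
- by move=> x; rewrite lee_fin; exact: kFP0.
by apply: eq_integral => x _; rewrite FS12 aS kernel3_swap.
Qed.

Let symmetrized (a : S -> X -> X) :
  measurable_fun setT (fun z : S * X => a z.1 z.2) ->
  (forall w x, a (swap_blocks w) (swap12 x) = swap12 (a w x)) ->
  iterated_integral sphere lambda3 (fun w x => k w x * F x *
    (Psi (a w x).1 + Psi (a w x).2.1 + Psi (a w x).2.2))%R =
  (observe (fun w x => (a w x).1) + (observe (fun w x => (a w x).2.1) +
   observe (fun w x => (a w x).2.1)))%E.
Proof.
move=> ma aS.
have o1 := mobs (a := fun w x => (a w x).1) (measurableT_comp (m1 mPsi) ma).
have o2 := mobs (a := fun w x => (a w x).2.1) (measurableT_comp (m21 mPsi) ma).
have o3 := mobs (a := fun w x => (a w x).2.2) (measurableT_comp (m22 mPsi) ma).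
rewrite -{2}(observe_swap ma aS) addeA.
rewrite -(iterated_integralD sphere lambda3 o1 o2) => [|w x|w x]; last 2 first.
- exact: kFP0.
- exact: kFP0.
rewrite -(iterated_integralD sphere lambda3 (measurable_funD o1 o2) o3) => [|w x|w x]; last 2 first.
- exact: addr_ge0 (kFP0 w x _) (kFP0 w x _).
- exact: kFP0.
by congr iterated_integral; apply/funext => w; apply/funext => x; rewrite !mulrDr.
Qed.

Let gain1 := observe (fun w x => (collide3 w x).1).
Let gain2 := observe (fun w x => (collide3 w x).2.1).
Let loss1 := observe (fun _ x => x.1).
Let loss2 := observe (fun _ x => x.2.1).

Let gain_sym := symmetrized measurable_collide3 (@collide3_swap R d).
Let loss_sym := symmetrized (a := fun _ x => x) measurable_snd (fun _ _ => erefl).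

(** As for binary collisions: when a partner is not slow, its energy is at least
   [eta ^+ 4 / 256 * energy x.1]. *)
Let povzner3 (G1 G2 L1 L2 : \bar R) :
  gain1 = G1 -> gain2 = G2 -> loss1 = L1 -> loss2 = L2 ->
  (G1 + (G2 + G2) + (c * p * (m0 * (m0 * z)))%:E <= L1 + (L2 + L2) +
    ((72 * C * B + 1536 * c * p / eta ^+ 4) * (m0 * (m2 * y)))%:E)%E.
Proof.
move=> g1E g2E l1E l2E; have gS := gain_sym; have lS := loss_sym.
rewrite -/gain1 -/gain2 g1E g2E in gS; rewrite -/loss1 -/loss2 l1E l2E in lS.
have mo : measurable_fun setT one by exact: measurable_cst.
have me := @measurable_energy R d.
have mZ : measurable_fun setT (fun v : V => Phi (energy v) * g (energy v)).
  apply: measurable_funM => //.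
  exact: measurableT_comp (measurable_gain_rate eps kappa) me.
have Z0 (v : V) : 0 <= Phi (energy v) * g (energy v).
  by rewrite mulr_ge0 ?gain_rate_ge0.
have mA : measurable (@slow_partners3 R d eta).
  rewrite -[X in measurable X]setTI setTI; apply: measurableI.
    rewrite -[X in measurable X]setTI; apply: measurable_fun_ler => //; first exact: m21.
    by apply: measurable_funM => //; exact: m1.
  rewrite -[X in measurable X]setTI; apply: measurable_fun_ler => //; first exact: m22.
  by apply: measurable_funM => //; exact: m1.
have C12 : 0 <= 12 * C by rewrite mulr_ge0// ltW.
have ml : measurable_fun setT (fun z : S * X => effective3 phi eta z.1 z.2).
  apply: measurable_funM; first exact: measurable_sphere_indic.
  apply: measurable_funM => //.
  have mD : measurable_fun setT (fun z : S * X =>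
      dot (direction z.2.1) (lsubmx z.1 + rsubmx z.1)).
    apply: measurable_dot.
      apply: measurableT_comp (@measurable_direction R d) _.
      exact: measurableT_comp measurable_fst measurable_snd.
    apply: (measurable_fun_comp2 (@measurable_rVD R d)).
      exact: measurableT_comp (@measurable_lsubmx R d d) measurable_fst.
    exact: measurableT_comp (@measurable_rsubmx R d d) measurable_fst.
  have mle (u : S * X -> R) : measurable_fun setT u -> measurable [set z | eta <= u z].
    by move=> mu; rewrite -[X in measurable X]setTI; apply: measurable_fun_ler.
  have mset : measurable ([set z : S * X | eta <= enorm (lsubmx z.1)] `&`
      ([set z | eta <= enorm (rsubmx z.1)] `&`
       [set z | eta <= `|dot (direction z.2.1) (lsubmx z.1 + rsubmx z.1)|])).
    apply: measurableI.
      apply: mle; apply: measurableT_comp (@measurable_enorm R d) _.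
      exact: measurableT_comp (@measurable_lsubmx R d d) measurable_fst.
    apply: measurableI.
      apply: mle; apply: measurableT_comp (@measurable_enorm R d) _.
      exact: measurableT_comp (@measurable_rsubmx R d d) measurable_fst.
    by apply: mle; exact: measurableT_comp.
  apply: eq_measurable_fun (measurable_indic mset) => q _ /=.
  congr ((nat_of_bool _)%:R); apply/idP/idP; rewrite !inE/=.
    by move=> [? []].
  by move=> [? ? ?].
have l0 (w : S) (x : X) : 0 <= effective3 phi eta w x.
  exact: mulr_ge0 (ler0n _ _) (mulr_ge0 (b0 w x) (ler0n _ _)).
have := @integrated_povzner _ _ _ _ R sphere lambda3 k b (effective3 phi eta)
  (fun x => Psi x.1 + Psi x.2.1 + Psi x.2.2)
  (fun w x => Psi (collide3 w x).1 + Psi (collide3 w x).2.1 + Psi (collide3 w x).2.2)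
  (sym3 Psi energy) (fun x => Phi (energy x.1) * g (energy x.1)) F (slow_partners3 eta)
  (12 * C) c p B mk mb ml (measurable_funD (measurable_funD (m1 mPsi) (m21 mPsi)) (m22 mPsi))
  (measurable_funD (measurable_funD (mcol (m1 mPsi)) (mcol (m21 mPsi))) (mcol (m22 mPsi)))
  (measurable_sym3 mPsi me)
  (m1 mZ) mF mA k0 b0 l0 (fun x => addr_ge0 (addr_ge0 (P0 _) (P0 _)) (P0 _))
  (fun w x => addr_ge0 (addr_ge0 (P0 _) (P0 _)) (P0 _))
  (fun x => sym3_ge0 x P0 e0) (fun x => Z0 _) F0
  c_ge0 C12 p_ge0 B_ge0 _ _ _.
rewrite gS lS.
have sPe := pairing_sym3 mh h0 mPsi me P0 e0 m0E yE m2E; rewrite sPe.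
set I1 := (\int[lambda3]_x (F x * (\1_(slow_partners3 eta) x * _))%:E)%E.
move=> H; have {}H : (G1 + (G2 + G2) + (c * p)%:E * I1 <=
    L1 + (L2 + L2) + (12 * C * B * (6 * (m0 * (y * m2))))%:E)%E.
  rewrite (EFinM (12 * C * B)); apply: H => [x|x Ax|w x].
  - exact: averageB.
  - have x10 : x.1 != 0.
      apply/eqP => x10; case: Ax => + _.
      rewrite x10 {2}/energy dot0l addr0 mulr1 => H.
      have := le_trans (energy_ge1 x.2.1) H; rewrite leNgt => /negP; apply.
      rewrite ltr_pdivrMr ?ltr0n// mul1r.
      by case/andP: eta01 => n0 n1; rewrite (lt_trans (_ : _ < 1)) ?exprn_ilt1 ?ltW ?ltr1n.
    apply: (le_trans (averagep (enorm_direction x10))).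
    have mS : measurable (~` @unit_sphere R (d + d)).
      by apply: measurableC; exact: measurable_unit_sphere.
    rewrite le_eqVlt; apply/orP; left; apply/eqP.
    apply: (eq_integral_off_null mS (sphere_carrier _)) => w /contrapT w1.
    by rewrite /effective3 [in RHS]indicE mem_set ?mul1r.
  exact: (pointwise3 gamma02 theta_ge0 hb3 eps_gt0 beta_gt0 kappa_gt0 C_gt0 excessP eta01 c_ge0 gapP w x).
have gap : ((m0 * (m0 * z))%:E <= I1 + (256 / eta ^+ 4 * (6 * (m0 * (y * m2))))%:E)%E.
  have n0 : 0 < eta ^+ 4 by case/andP: eta01 => ? _; rewrite exprn_gt0.
  have d0 : 0 <= 256 / eta ^+ 4 := divr_ge0 (ler0n _ _) (ltW n0).
  have m1A : measurable_fun setT (fun x : X => \1_(slow_partners3 eta) x : R).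
    exact: measurable_indic.
  have m1AZ := measurable_funM mF (measurable_funM m1A (m1 mZ)).
  have mPe := measurable_funM mF (measurable_sym3 mPsi me).
  have sP0 x : 0 <= F x * sym3 Psi energy x.
    exact: mulr_ge0 (F0 x) (sym3_ge0 x P0 e0).
  have := pairing3 mh h0 mZ mo mo Z0 (fun=> ler01) (fun=> ler01).
  rewrite zE m0E -!EFinM (_ : z * (m0 * m0) = m0 * (m0 * z)); last by ring.
  move=> <-; rewrite (EFinM (256 / _)) -sPe.
  rewrite -ge0_integralZl ?lee_fin//; last 2 first.
  - exact/measurable_EFinP.
  - by move=> x _; rewrite lee_fin.
  rewrite /I1 -(ge0_integralD _ measurableT); last 4 first.
  - by move=> x _; rewrite lee_fin; exact: mulr_ge0 (F0 x) (mulr_ge0 (ler0n _ _) (Z0 _)).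
  - exact/measurable_EFinP.
  - by move=> x _; rewrite -EFinM lee_fin; exact: mulr_ge0 d0 (sP0 x).
  - by apply: measurable_funeM; exact/measurable_EFinP.
  apply: ge0_le_integral => //.
  - move=> x _; rewrite lee_fin; exact: mulr_ge0 (F0 x) (mulr_ge0 (Z0 _) (mulr_ge0 ler01 ler01)).
  - by apply/measurable_EFinP; exact: measurable_funM mF (measurable_funM (m1 mZ) (measurable_cst _)).
  - apply: emeasurable_funD; first exact/measurable_EFinP.
    by apply: measurable_funeM; exact/measurable_EFinP.
  move=> x _; rewrite -EFinM -EFinD lee_fin !mulr1 (mulrCA (256 / eta ^+ 4) (F x)) -mulrDr.
  apply: (ler_wpM2l (F0 x)); rewrite indicE.
  have s0 := sym3_ge0 x P0 e0.
  have [Ax|Ax] := pselect (slow_partners3 eta x).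
    by rewrite mem_set// mul1r lerDl mulr_ge0.
  rewrite memNset// mul0r add0r.
  apply: (@le_trans _ _ (256 / eta ^+ 4 * ((energy x.2.1 + energy x.2.2) * Phi (energy x.1)))); last first.
    apply: (ler_wpM2l d0); rewrite /sym3.
    do 2! (apply: ler_wpDr; first exact: mulr_ge0 (addr_ge0 (e0 _) (e0 _)) (P0 _)).
    exact: lexx.
  rewrite mulrA [leRHS]mulrC; apply: (ler_wpM2l (P0 _)).
  apply: (le_trans (gain_rate_le_powR eps kappa_gt0 (energy x.1))).
  apply: (@le_trans _ _ (energy x.1 `^ 1)).
    by apply: ler_powR => //; exact: energy_ge1.
  rewrite powRr1// mulrAC ler_pdivlMr//.
  have {}Ax : eta ^+ 4 / 256 * energy x.1 < energy x.2.1 \/ eta ^+ 4 / 256 * energy x.1 < energy x.2.2.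
    apply/orP; rewrite !ltNge -negb_and; apply/negP => /andP[Ay Az].
    by apply: Ax; split.
  rewrite mulrC; apply: (le_mulDr (ler0n _ 256) (e0 _) (e0 _)).
  by case: Ax => /ltW; rewrite mulrAC ler_pdivrMr ?ltr0n//; [left|right].
have cp0 : 0 <= c * p by exact: mulr_ge0.
move: I1 H gap; move: (G1 + (G2 + G2))%E (L1 + (L2 + L2))%E.
move=> {gS g1E g2E lS l1E l2E} G L I1 H gap.
apply: (@le_trans _ _ (G + ((c * p)%:E * I1 +
    (c * p * (256 / eta ^+ 4 * (6 * (m0 * (y * m2)))))%:E))%E).
  apply: leeD2l; rewrite EFinM (EFinM (c * p) (256 / _ * _)) -muleDr ?fin_num_adde_defl//.
  exact: lee_wpmul2l.
rewrite addeA; apply: (le_trans (leeD2r _ H)).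
rewrite -addeA -EFinD; apply: leeD2l.
rewrite lee_fin le_eqVlt; apply/orP; left; apply/eqP.
by field; case/andP: eta01 => /gt_eqF ->.
Qed.

Let gain1_fin : (0 <= gain1 < +oo)%E.
Proof.
apply: observe_lty => [|w x]; first exact: (mcol (m1 mPsi)).
by rewrite -(collide3_energy_sum w); case: (coordinate_le (collide3 w x)).
Qed.

Let gain2_fin : (0 <= gain2 < +oo)%E.
Proof.
apply: observe_lty => [|w x]; first exact: (mcol (m21 mPsi)).
by rewrite -(collide3_energy_sum w); case: (coordinate_le (collide3 w x)).
Qed.

Let loss1_fin : (0 <= loss1 < +oo)%E.
Proof.
apply: observe_lty => [|w x]; first exact: measurable_snd_fun (m1 mPsi).
by case: (coordinate_le x).
Qed.

Let loss2_fin : (0 <= loss2 < +oo)%E.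
Proof.
apply: observe_lty => [|w x]; first exact: measurable_snd_fun (m21 mPsi).
by case: (coordinate_le x).
Qed.

(** The second integral of [Q3] is the first one with [v] and [v1] exchanged. *)
Let k1 (w : S) (x : X) := k w (swap01 x).
Let T1 (w : S) (x : X) := swap01 (collide3 w (swap01 x)).

Let mswap01 : measurable_fun setT (fun z : S * X => (z.1, swap01 z.2)).
Proof.
apply: measurable_fun_pair => //; exact: measurableT_comp (@swap01_preserves R d).1 measurable_snd.
Qed.

Let mT1 : measurable_fun setT (fun z : S * X => T1 z.1 z.2).
Proof.
apply: (measurableT_comp (@swap01_preserves R d).1).
exact: (measurableT_comp (@measurable_collide3 R d) mswap01).
Qed.

Let mk1 : measurable_fun setT (fun z : S * X => k1 z.1 z.2).
Proof. exact: (measurableT_comp mk mswap01). Qed.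

Let swap01K : involutive (@swap01 R d).
Proof. by case=> a []. Qed.

Let observe1 (a : S -> X -> X) :
  measurable_fun setT (fun z : S * X => a z.1 z.2) ->
  iterated_integral sphere lambda3 (fun w x => k1 w x * F x * Psi (a w (swap01 x)).2.1)%R =
  observe (fun w x => (a w x).2.1).
Proof.
move=> ma; have ma1 := mobs (a := fun w x => (a w x).2.1) (measurableT_comp (m21 mPsi) ma).
apply: eq_integral => w _.
rewrite -[RHS](preserves_integral (@swap01_preserves R d)); last 2 first.
- by apply/measurable_EFinP; exact: (measurableT_comp ma1 (pair1_measurable _)).
- by move=> x; rewrite lee_fin; exact: kFP0.
by apply: eq_integral => x _; rewrite FS01.
Qed.

(** The two integrals of [Q3], the second one counted twice, are the three terms
   of the weight symmetrized over the particles. *)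
Lemma ternary_dissipation : exists (J : V -> \bar R) (r : R),
  [/\ lambda.-integrable setT J, (\int[lambda]_v J v = r%:E)%E,
    {ae lambda, forall v, (Q3 gamma theta phi f v * Psi v)%:E = J v} &
    r + c * p * (m0 * (m0 * z)) <=
      (72 * C * B + 1536 * c * p / eta ^+ 4) * (m0 * (m2 * y))].
Proof.
pose M : set V := [set v | f v < 0].
have mM : measurable M.
  by rewrite -[X in measurable X]setTI; apply: measurable_fun_ltr.
have M0 : lambda M = 0%E.
  case: f_ge0 => N [mN N0 fN]; apply/eqP; rewrite -measure_le0 -N0.
  apply: le_measure; rewrite ?inE// => v /= fv; apply: fN => /=.
  by apply/negP; rewrite -ltNge.
have [mN2 N20] := null_cylinder mM mM M0 M0.
have [mN N0] := null_cylinder mM mN2 M0 N20.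
have mS : measurable (~` @unit_sphere R (d + d)).
  by apply: measurableC; exact: measurable_unit_sphere.
have B3E (w : S) (x : X) (v0 v1 v2 : V) : enorm w = 1 ->
    triple_norm v0 v1 v2 = spread3 x ->
    B3 gamma theta phi v0 v1 v2 (relative3 x) w = k w x.
  move=> w1 tE; rewrite /kernel3 indicE mem_set// mul1r (phi_truncE phi w1) /B3 /b3 tE mulrA.
  congr (_ * _); rewrite /speed3 -mulrA -powRM ?enorm_ge0//; congr (_ * _ `^ _).
  by rewrite -[in RHS](enorm_directionK (relative3 x)) dotZl normrM (ger0_norm (enorm_ge0 _)).
have kE (w : S) (x : X) : ~ (~` @unit_sphere R (d + d)) w ->
    B3 gamma theta phi x.1 x.2.1 x.2.2 (relative3 x) w = k w x.
  by move=> /contrapT w1; exact: B3E.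
have k1E (w : S) (x : X) : ~ (~` @unit_sphere R (d + d)) w ->
    B3 gamma theta phi x.1 x.2.1 x.2.2 (relative3 (swap01 x)) w = k1 w x.
  by move=> /contrapT w1; apply: B3E => //; rewrite spread3_swap01.
pose cf (w : S) (x : X) := dot (relative3 x) w / (1 + dot (lsubmx w) (rsubmx w)).
have TE (w : S) (x : X) : ~ (~` @unit_sphere R (d + d)) w ->
    (x.1 + cf w x *: (lsubmx w + rsubmx w),
     (x.2.1 - cf w x *: lsubmx w, x.2.2 - cf w x *: rsubmx w)) = collide3 w x.
  by move=> /contrapT w1; rewrite collide3E.
have T1E (w : S) (x : X) : ~ (~` @unit_sphere R (d + d)) w ->
    (x.1 - cf w (swap01 x) *: lsubmx w,
     (x.2.1 + cf w (swap01 x) *: (lsubmx w + rsubmx w),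
      x.2.2 - cf w (swap01 x) *: rsubmx w)) = T1 w x.
  by move=> /contrapT w1; rewrite /T1 collide3E.
have FE (x : X) : ~ ((fst @^-1` M) `|` (snd @^-1` ((fst @^-1` M) `|` (snd @^-1` M)))) x ->
    f x.1 * f x.2.1 * f x.2.2 = F x.
  move=> Mx; rewrite /tensor3 /tensor2 mulrA !ger0_norm// leNgt; apply/negP => fx; apply: Mx.
  - by right; right.
  - by right; left.
  by left.
have P1 (v : V) : 0 < Psi v by apply: weight_gt0 => //; exact: energy_gt0.
have TP w : preserves lambda3 (T1 w).
  apply: (preserves_comp (@swap01_preserves R d)).
  exact: (preserves_comp (collide3_preserves w) (@swap01_preserves R d)).
have TK w x : T1 w (T1 w x) = x by rewrite /T1 swap01K collide3K swap01K.
have kT1 w x : k1 w (T1 w x) = k1 w x by rewrite /k1 /T1 swap01K kernel3_collide.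
have gain2E : iterated_integral sphere lambda3 (fun w x => k1 w x * F x * Psi (T1 w x).1)%R = gain2.
  exact: (observe1 (@measurable_collide3 R d)).
have loss2E : iterated_integral sphere lambda3 (fun w x => k1 w x * F x * Psi x.1)%R = loss2.
  exact: (observe1 (a := fun _ x => x) measurable_snd).
have [G1 g1E] := ex_intro (fun r => gain1 = r) gain1 erefl.
have [G2 g2E] := ex_intro (fun r => gain2 = r) gain2 erefl.
have [L1 l1E] := ex_intro (fun r => loss1 = r) loss1 erefl.
have [L2 l2E] := ex_intro (fun r => loss2 = r) loss2 erefl.
have povzner := povzner3 g1E g2E l1E l2E.
have := gain1_fin; have := gain2_fin; have := loss1_fin; have := loss2_fin.
rewrite g1E g2E l1E l2E => /andP[l20 l2oo] /andP[l10 l1oo] /andP[g20 g2oo] /andP[g10 g1oo].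
have [Ja [Ja1 Ja2 Ja3]] := @weak_form _ _ _ _ _ _ R sphere lambda lambda2
  (@collide3 R d) (fun w x => (x.1 + cf w x *: (lsubmx w + rsubmx w),
     (x.2.1 - cf w x *: lsubmx w, x.2.2 - cf w x *: rsubmx w)))
  k (fun w x => B3 gamma theta phi x.1 x.2.1 x.2.2 (relative3 x) w)
  F (fun x => f x.1 * f x.2.1 * f x.2.2) Psi
  (~` @unit_sphere R (d + d)) _ (@measurable_collide3 R d) mk mF mPsi
  (@collide3_preserves R d) (@collide3K R d) (kernel3_collide gamma theta phi) k0 F0
  P1 mS (sphere_carrier _) mN N0 TE kE FE G1 L1 g1E l1E g1oo l1oo.
have [Jb [Jb1 Jb2 Jb3]] := @weak_form _ _ _ _ _ _ R sphere lambda lambda2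
  T1 (fun w x => (x.1 - cf w (swap01 x) *: lsubmx w,
     (x.2.1 + cf w (swap01 x) *: (lsubmx w + rsubmx w),
      x.2.2 - cf w (swap01 x) *: rsubmx w)))
  k1 (fun w x => B3 gamma theta phi x.1 x.2.1 x.2.2 (relative3 (swap01 x)) w)
  F (fun x => f x.1 * f x.2.1 * f x.2.2) Psi
  (~` @unit_sphere R (d + d)) _ mT1 mk1 mF mPsi TP TK kT1 (fun w x => k0 w _) F0
  P1 mS (sphere_carrier _) mN N0 T1E k1E FE G2 L2 (etrans gain2E g2E) (etrans loss2E l2E) g2oo l2oo.
clear gain2E loss2E g1E g2E l1E l2E.
have Jc1 : lambda.-integrable setT (fun v => 2%:E * Jb v)%E by exact: integrableZl.
exists (fun v => Ja v + 2%:E * Jb v)%E, (fine G1 - fine L1 + 2 * (fine G2 - fine L2)).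
have fin (a : \bar R) : (0 <= a)%E -> (a < +oo)%E -> a \is a fin_num by move=> a0 aoo; rewrite ge0_fin_numE.
have fg1 := fin _ g10 g1oo; have fg2 := fin _ g20 g2oo.
have fl1 := fin _ l10 l1oo; have fl2 := fin _ l20 l2oo.
split.
- exact: integrableD.
- rewrite integralD// integralZl// Jb2 (EFinD (fine G1 - fine L1)) (EFinM 2) !EFinB !fineK//.
  by congr (_ + _)%E; exact: Ja2.
- apply: filterS2 Ja3 Jb3 => v <- <-; rewrite -EFinM -EFinD; congr (_%:E).
  by rewrite /Q3 mulrDl mulrA.
move: povzner; rewrite -{1}(fineK fg1) -{1 2}(fineK fg2) -{1}(fineK fl1) -{1 2}(fineK fl2).
rewrite -!EFinD lee_fin.
move: (c * p * (m0 * (m0 * z))) ((72 * C * B + 1536 * c * p / eta ^+ 4) * (m0 * (m2 * y))).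
move=> u v; lra.
Qed.

End ternary_dissipation.


Section moment_dissipation.
Context {R : realType} {d : nat}.
Local Notation V := 'rV[R]_d.
Local Notation lambda := (lebesgue_rV d).
Variables (b2 : R -> R) (theta : R) (phi : R -> R).
Hypothesis hd : (2 <= d)%N.
Hypothesis hb2 : binary_kernel d b2.
Hypothesis theta_ge0 : 0 <= theta.
Hypothesis hb3 : ternary_kernel d theta phi.

Definition truncated_power (gamma q kappa : R) (v : V) : R :=
  weight (gamma / 2) ((q - 2) / gamma) kappa (energy v).

(** Here [r] is the integral of [Q f] against the truncated weight. The
   parameter [l] is that of Young's inequality, to be chosen as a function of
   time, and [A] and [c] are fixed before [kappa], so that the inequality survives
   the limit. *)
Definition dissipates (gamma q m0 m2 A c gamma2 gamma3 : R) :=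
  forall (kappa : R) (f : V -> R), 0 < kappa ->
  measurable_fun setT f -> {ae lambda, forall v, 0 <= f v} ->
  let h := fun v => `|f v| in
  pairing h (fun=> 1) = m0%:E -> pairing h energy = m2%:E ->
  (pairing h (fun v => (energy v `^ (1 + Num.max gamma2 gamma3 / 2))%R) < +oo)%E ->
  exists (J : V -> \bar R) (r y : R),
  [/\ pairing h (truncated_power gamma q kappa) = y%:E,
    lambda.-integrable setT J, (\int[lambda]_v J v = r%:E)%E,
    {ae lambda, forall v,
      (Q gamma2 b2 gamma3 theta phi f v * truncated_power gamma q kappa v)%:E = J v} &
    forall l, 0 <= l -> r <= (A - c * l) * y + c * l `^ ((q - 2) / gamma + 1) * m2].

(** Both operators contribute to [A]. To [c] contribute those whose exponent is
   [gamma]; another one is used with [c2 = 0] or [c3 = 0]. *)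
Let dissipates_of (gamma q m0 m2 gamma2 gamma3 C c2 eta2 p2 B2 c3 eta3 p3 B3 : R) :
  2 < q -> 0 < gamma <= 2 -> 0 < m0 ->
  gamma2 \in `[0, 2] -> gamma3 \in `[0, 2] ->
  0 < C -> 0 <= c2 -> 0 < eta2 < 1 -> 0 <= p2 -> 0 <= B2 ->
  0 <= c3 -> 0 < eta3 < 1 -> 0 <= p3 -> 0 <= B3 ->
  let eps := gamma / 2 in let beta := (q - 2) / gamma in
  (forall kappa M E : R, 0 < kappa -> 0 < M -> M <= E <= 3 * M ->
    weight eps beta kappa E - weight eps beta kappa M <=
      C * (E - M) * weight_ratio eps beta kappa M) ->
  (0 < c2 -> eps = gamma2 / 2 /\
    forall kappa s E : R, 0 < kappa -> 0 < E -> 0 <= s <= (1 - eta2 ^+ 2 / 8) * E ->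
    8 * c2 * weight_ratio eps beta kappa E / (1 + kappa * E `^ eps) <=
      weight_ratio eps beta kappa E - weight_ratio eps beta kappa s) ->
  (0 < c3 -> eps = gamma3 / 2 /\
    forall kappa s E : R, 0 < kappa -> 0 < E -> 0 <= s <= (1 - eta3 ^+ 4 / 32) * E ->
    c3 / (8^-1 * (eta3 / 4) `^ theta) * weight_ratio eps beta kappa E / (1 + kappa * E `^ eps) <=
      weight_ratio eps beta kappa E - weight_ratio eps beta kappa s) ->
  (forall e : V,
    (\int[sphere_measure d]_w (b2_trunc b2 (dot (direction e) w))%:E <= B2%:E)%E) ->
  (forall e : V, enorm e = 1 -> (p2%:E <= \int[sphere_measure d]_w
     (b2_trunc b2 (dot e w) * b2_angles eta2 (dot e w))%:E)%E) ->
  (\int[sphere_measure (d + d)]_w (phi_trunc phi (cross_dot w))%:E <= B3%:E)%E ->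
  (forall e : V, enorm e = 1 -> (p3%:E <= \int[sphere_measure (d + d)]_w
     (phi_trunc phi (cross_dot w) * \1_(ternary_angles eta3 e) w)%:E)%E) ->
  dissipates gamma q m0 m2
    ((12 * C * B2 + 32 * c2 * p2 / eta2 ^+ 2) * m2 +
     (72 * C * B3 + 1536 * c3 * p3 / eta3 ^+ 4) * m0 * m2)
    (c2 * p2 / 2 * m0 + c3 * p3 * m0 ^+ 2) gamma2 gamma3.
Proof.
move=> q2 /andP[gam0 gam2] m0_gt0 g2 g3 C0 c20 eta2P p20 B20 c30 eta3P p30 B30 eps beta.
move=> excess gap2 gap3 avB2 avp2 avB3 avp3 kappa f k0 mf f0 h m0E m2E mgoo.
have eps0 : 0 < eps by rewrite divr_gt0.
have eps1 : eps <= 1 by rewrite /eps ler_pdivrMr// mul1r.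
have beta0 : 0 < beta by rewrite divr_gt0// subr_gt0.
set Psi := truncated_power gamma q kappa.
have mh : measurable_fun setT h by exact: measurableT_comp.
have h0 v : 0 <= h v by exact: normr_ge0.
have e0 (v : V) : 0 <= energy v by exact/ltW/energy_gt0.
have me := @measurable_energy R d.
have mPsi : measurable_fun setT Psi.
  exact: measurableT_comp (measurable_weight _ _ _) me.
have Psi0 v : 0 <= Psi v by exact: weight_ge0.
have mg : measurable_fun setT (fun v : V => gain_rate eps kappa (energy v)).
  exact: measurableT_comp (measurable_gain_rate _ _) me.
have gr0 (v : V) : 0 <= gain_rate eps kappa (energy v) by exact: gain_rate_ge0.
have finite (a : V -> R) : (forall v, 0 <= a v) -> (pairing h a < +oo)%E ->
    exists r, pairing h a = r%:E.
  move=> a0 aoo; exists (fine (pairing h a)); rewrite fineK// ge0_fin_numE//.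
  exact: pairing_ge0.
have [y yE] : exists y, pairing h Psi = y%:E.
  apply: finite => //.
  apply: (@le_lt_trans _ _ (pairing h (fun v => kappa^-1 `^ beta * energy v))).
    apply: le_pairing => //; first exact: measurable_funM.
    by move=> v; exact: weight_le_linear.
  by rewrite pairingZ ?powR_ge0// m2E -EFinM ltry.
have [z zE] : exists z, pairing h (fun v => Psi v * gain_rate eps kappa (energy v)) = z%:E.
  apply: finite => [v|]; first exact: mulr_ge0.
  apply: (@le_lt_trans _ _ (pairing h (fun v => kappa^-1 * Psi v))).
    apply: le_pairing => //.
    - exact: measurable_funM.
    - exact: measurable_funM.
    - by move=> v; exact: mulr_ge0.
    by move=> v; rewrite mulrC ler_wpM2r// gain_rate_le.
  by rewrite pairingZ ?invr_ge0 ?(ltW k0)// yE -EFinM ltry.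
have [mgr mgE] : exists r, pairing h (fun v => (energy v `^ (1 + Num.max gamma2 gamma3 / 2))%R) = r%:E.
  by apply: finite => // v; exact: powR_ge0.
have g'2 : Num.max gamma2 gamma3 <= 2.
  by move: g2 g3; rewrite !in_itv/= ge_max => /andP[_ ->] /andP[_ ->].
have gapk2 : 0 < c2 -> eps = gamma2 / 2 /\
    forall s E : R, 0 < E -> 0 <= s <= (1 - eta2 ^+ 2 / 8) * E ->
    8 * c2 * weight_ratio eps beta kappa E / (1 + kappa * E `^ eps) <=
      weight_ratio eps beta kappa E - weight_ratio eps beta kappa s.
  by move=> /gap2[-> G]; split=> // s E; exact: G.
have gapk3 : 0 < c3 -> eps = gamma3 / 2 /\
    forall s E : R, 0 < E -> 0 <= s <= (1 - eta3 ^+ 4 / 32) * E ->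
    c3 / (8^-1 * (eta3 / 4) `^ theta) * weight_ratio eps beta kappa E / (1 + kappa * E `^ eps) <=
      weight_ratio eps beta kappa E - weight_ratio eps beta kappa s.
  by move=> /gap3[-> G]; split=> // s E; exact: G.
have le2 : gamma2 <= Num.max gamma2 gamma3 by rewrite le_max lexx.
have le3 : gamma3 <= Num.max gamma2 gamma3 by rewrite le_max lexx orbT.
have exk M E : 0 < M -> M <= E <= 3 * M ->
    weight eps beta kappa E - weight eps beta kappa M <=
      C * (E - M) * weight_ratio eps beta kappa M by exact: excess.
have [J2 [r2 [J2i J2r J2E ineq2]]] := binary_dissipation g2 le2 g'2
  hb2 eps0 eps1 beta0 k0 C0 exk eta2P c20 gapk2 p20 B20 avB2 avp2 mf f0 m0E m2E mgE yE zE.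
have [J3 [r3 [J3i J3r J3E ineq3]]] := ternary_dissipation g3 le3 g'2 theta_ge0
  hb3 eps0 eps1 beta0 k0 C0 exk eta3P c30 gapk3 p30 B30 avB3 avp3 mf f0 m0E m2E mgE yE zE.
exists (fun v => J2 v + J3 v)%E, (r2 + r3), y; split=> //.
- exact: integrableD.
- by rewrite integralD// J2r J3r -EFinD.
- apply: filterS2 J2E J3E => v E2 E3.
  by rewrite -E2 -E3 -EFinD -mulrDl.
move=> l l0.
have young : l * y <= z + l `^ (beta + 1) * m2.
  rewrite -lee_fin EFinD (EFinM l y) -yE -zE EFinM -m2E -!pairingZ ?powR_ge0//.
  rewrite -ge0_integralD//.
  - apply: ge0_le_integral => //.
    + by move=> v _; rewrite lee_fin mulr_ge0// mulr_ge0// powR_ge0.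
    + apply/measurable_EFinP; apply: measurable_funM => //; exact: measurable_funM.
    + apply: emeasurable_funD; apply/measurable_EFinP; apply: measurable_funM => //;
        exact: measurable_funM.
    + move=> v _; rewrite -EFinD lee_fin -mulrDr ler_wpM2l//.
      exact: weight_gain_young.
  - by move=> v _; rewrite lee_fin mulr_ge0// mulr_ge0.
  - by apply/measurable_EFinP; apply: measurable_funM => //; exact: measurable_funM.
  - by move=> v _; rewrite lee_fin mulr_ge0// mulr_ge0// powR_ge0.
  - by apply/measurable_EFinP; apply: measurable_funM => //; exact: measurable_funM.
have ct0 : 0 <= c2 * p2 / 2 * m0 + c3 * p3 * m0 ^+ 2.
  have m00 := ltW m0_gt0.
  by apply: addr_ge0; apply: mulr_ge0 => //; rewrite ?sqr_ge0//; 
    [apply: divr_ge0 => //; exact: mulr_ge0|exact: mulr_ge0].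
have := ler_wpM2l ct0 young.
move: ineq2 ineq3; clear; move: (l `^ _) => L.
move: (C * B2) (C * B3) => a b.
lra.
Qed.

Let half_exponent (gamma q : R) : 0 < gamma -> gamma / 2 * ((q - 2) / gamma) = (q - 2) / 2.
Proof. by move=> g0; field; rewrite gt_eqF. Qed.

Let rate_ge0 (C B2 c2 p2 e2 B3 c3 p3 e3 m0 m2 : R) :
  [/\ 0 <= C, 0 <= B2, 0 <= c2, 0 <= p2 & 0 <= e2] ->
  [/\ 0 <= B3, 0 <= c3, 0 <= p3 & 0 <= e3] -> 0 <= m0 -> 0 <= m2 ->
  0 <= (12 * C * B2 + 32 * c2 * p2 / e2) * m2 + (72 * C * B3 + 1536 * c3 * p3 / e3) * m0 * m2.
Proof.
move=> [C0 B20 c20 p20 e20] [B30 c30 p30 e30] m00 m20.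
have L (a : nat) (u v : R) : 0 <= u -> 0 <= v -> 0 <= a%:R * u * v.
  by move=> u0 v0; apply: mulr_ge0 v0; apply: mulr_ge0 u0; exact: ler0n.
have D (u v : R) : 0 <= u -> 0 <= v -> 0 <= u / v by exact: divr_ge0.
apply: addr_ge0; first by apply: (mulr_ge0 _ m20); apply: addr_ge0 (D _ _ (L _ _ _ c20 p20) e20); exact: L.
apply: (mulr_ge0 _ m20); apply: (mulr_ge0 _ m00).
by apply: addr_ge0 (D _ _ (L _ _ _ c30 p30) e30); exact: L.
Qed.

(** Ternary collisions enter through [A] only, and their estimate is uniform in
   [gamma3]. *)
Lemma binary_moment_dissipation (gamma q m0 m2 : R) :
  2 < q -> 0 < gamma <= 2 -> 0 < m0 -> 0 <= m2 ->
  exists2 A : R, 0 <= A & exists2 c : R, 0 < c &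
  forall gamma3, gamma3 \in `[0, 2] -> dissipates gamma q m0 m2 A c gamma gamma3.
Proof.
move=> q2 gamP m00 m20; have /andP[gam0 gam2] := gamP.
have [C C0 excess] : exists2 C : R, 0 < C & _ := @weight_excess R ((q - 2) / 2) ltac:(lra).
have [eta2 eta2P [p2 p20 avp2]] := b2_trunc_average_gt0 hd hb2.
have [B2 avB2] := b2_trunc_average_lty hd hb2.
have [eta3 eta3P [p3 p30 avp3]] := phi_trunc_average_gt0 hd theta_ge0 hb3.
have [B3 avB3] := phi_trunc_average_lty hd theta_ge0 hb3.
have eps0 : 0 < gamma / 2 by rewrite divr_gt0.
have beta0 : 0 < (q - 2) / gamma by rewrite divr_gt0// subr_gt0.
have [e0 e1] := andP eta2P.
have ee : 0 < eta2 ^+ 2 / 8 < 1.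
  have : 0 < eta2 ^+ 2 by rewrite exprn_gt0.
  have : eta2 ^+ 2 < 1 by rewrite expr_lt1// ltW.
  lra.
have [c' c'0 gap] := weight_gap eps0 beta0 ee.
have B20 : 0 <= Num.max 0 B2 by rewrite le_max lexx.
have B30 : 0 <= Num.max 0 B3 by rewrite le_max lexx.
exists ((12 * C * Num.max 0 B2 + 32 * (c' / 8) * p2 / eta2 ^+ 2) * m2 +
     (72 * C * Num.max 0 B3 + 1536 * 0 * p3 / eta3 ^+ 4) * m0 * m2).
  apply: rate_ge0 => //; [split=> //|split=> //|exact: ltW].
  - exact: ltW.
  - by apply: divr_ge0; [exact: ltW|exact: ler0n].
  - exact: ltW.
  - exact: sqr_ge0.
  - exact: ltW.
  - by rewrite exprn_even_ge0.
exists (c' / 8 * p2 / 2 * m0 + 0 * p3 * m0 ^+ 2).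
  rewrite mul0r mul0r addr0 mulr_gt0// divr_gt0// mulr_gt0//; lra.
move=> gamma3 g3; apply: (@dissipates_of gamma q m0 m2 gamma gamma3 C) => //.
- by rewrite in_itv/= (ltW gam0) gam2.
- by apply: divr_ge0; [exact: ltW|exact: ler0n].
- exact: ltW.
- exact: ltW.
- by move=> kappa M E k0; apply: excess => //; rewrite half_exponent.
- move=> _; split=> // kappa s E k0.
  rewrite (_ : 8 * (c' / 8) = c'); last by field.
  exact: gap.
- by rewrite ltxx.
- move=> e; apply: le_trans (avB2 e) _; by rewrite lee_fin le_max lexx orbT.
- by apply: le_trans avB3 _; rewrite lee_fin le_max lexx orbT.
Qed.

(** Binary collisions enter through [A] only, and their estimate is uniform in
   [gamma2]. *)
Lemma ternary_moment_dissipation (gamma q m0 m2 : R) :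
  2 < q -> 0 < gamma <= 2 -> 0 < m0 -> 0 <= m2 ->
  exists2 A : R, 0 <= A & exists2 c : R, 0 < c &
  forall gamma2, gamma2 \in `[0, 2] -> dissipates gamma q m0 m2 A c gamma2 gamma.
Proof.
move=> q2 gamP m00 m20; have /andP[gam0 gam2] := gamP.
have [C C0 excess] : exists2 C : R, 0 < C & _ := @weight_excess R ((q - 2) / 2) ltac:(lra).
have [eta2 eta2P [p2 p20 avp2]] := b2_trunc_average_gt0 hd hb2.
have [B2 avB2] := b2_trunc_average_lty hd hb2.
have [eta3 eta3P [p3 p30 avp3]] := phi_trunc_average_gt0 hd theta_ge0 hb3.
have [B3 avB3] := phi_trunc_average_lty hd theta_ge0 hb3.
have eps0 : 0 < gamma / 2 by rewrite divr_gt0.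
have beta0 : 0 < (q - 2) / gamma by rewrite divr_gt0// subr_gt0.
have [e0 e1] := andP eta3P.
have ee : 0 < eta3 ^+ 4 / 32 < 1.
  have : 0 < eta3 ^+ 4 by rewrite exprn_gt0.
  have : eta3 ^+ 4 < 1 by rewrite expr_lt1// ltW.
  lra.
have [c' c'0 gap] := weight_gap eps0 beta0 ee.
set u0 := 8^-1 * (eta3 / 4) `^ theta.
have u00 : 0 < u0 by rewrite mulr_gt0 ?invr_gt0// powR_gt0// divr_gt0.
have B20 : 0 <= Num.max 0 B2 by rewrite le_max lexx.
have B30 : 0 <= Num.max 0 B3 by rewrite le_max lexx.
exists ((12 * C * Num.max 0 B2 + 32 * 0 * p2 / eta2 ^+ 2) * m2 +
     (72 * C * Num.max 0 B3 + 1536 * (c' * u0) * p3 / eta3 ^+ 4) * m0 * m2).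
  apply: rate_ge0 => //; [split=> //|split=> //|exact: ltW].
  - exact: ltW.
  - exact: ltW.
  - exact: sqr_ge0.
  - by apply: mulr_ge0; exact: ltW.
  - exact: ltW.
  - by rewrite exprn_even_ge0.
exists (0 * p2 / 2 * m0 + c' * u0 * p3 * m0 ^+ 2).
  rewrite mul0r mul0r mul0r add0r mulr_gt0 ?exprn_gt0// mulr_gt0// mulr_gt0//.
move=> gamma2 g2; apply: (@dissipates_of gamma q m0 m2 gamma2 gamma C) => //.
- by rewrite in_itv/= (ltW gam0) gam2.
- exact: ltW.
- by apply: mulr_ge0; exact: ltW.
- exact: ltW.
- by move=> kappa M E k0; apply: excess => //; rewrite half_exponent.
- by rewrite ltxx.
- move=> _; split=> // kappa s E k0.
  rewrite -/u0 mulfK ?gt_eqF//.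
  exact: gap.
- move=> e; apply: le_trans (avB2 e) _; by rewrite lee_fin le_max lexx orbT.
- by apply: le_trans avB3 _; rewrite lee_fin le_max lexx orbT.
Qed.

End moment_dissipation.


(** * A differential inequality *)
Section differential_inequality.
Context {R : realType}.

Let nonincreasing_cc (a b : R) (G dG : R -> R) : a < b ->
  {in `]a, b[, forall x : R, is_derive x 1 G (dG x)} ->
  {in `]a, b[, forall x, dG x <= 0} ->
  {within `[a, b], continuous G} -> G b <= G a.
Proof.
move=> ab GE dG0 cG.
have Gd x : x \in `]a, b[ -> derivable G x 1 by move=> /GE[].
have d0 x : x \in `]a, b[ -> derive1 G x <= 0.
  by move=> xab; have xd := GE _ xab; rewrite derive1E derive_val dG0.
by apply: (ler0_derive1_le_cc Gd d0 cG); rewrite ?in_itv/= ?lexx ?(ltW ab).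
Qed.

Variables (T A c beta m2 : R) (y dy : R -> R).
Hypothesis A_ge0 : 0 <= A.
Hypothesis c_gt0 : 0 < c.
Hypothesis beta_gt0 : 0 < beta.
Hypothesis m2_ge0 : 0 <= m2.
Hypothesis y_ge0 : {in `[0, T], forall t, 0 <= y t}.
Hypothesis y_continuous : {within `[0, T], continuous y}.
Hypothesis y_derive : {in `]0, T[, forall t : R, is_derive t 1 y (dy t)}.
Hypothesis y_ineq : {in `]0, T[, forall t (l : R), 0 <= l ->
  dy t <= (A - c * l) * y t + c * l `^ (beta + 1) * m2}.

Let sub_oo (a b : R) : 0 <= a -> b <= T -> {subset `]a, b[ <= `]0, T[}.
Proof.
move=> a0 bT x; rewrite !in_itv/= => /andP[ax xb].
by rewrite (le_lt_trans a0 ax) (lt_le_trans xb bT).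
Qed.

Let y_within (a b : R) : 0 <= a -> b <= T -> {within `[a, b], continuous y}.
Proof.
move=> a0 bT; apply: continuous_subspaceW y_continuous => x/=; rewrite !in_itv/=.
by move=> /andP[ax xb]; rewrite (le_trans a0 ax) (le_trans xb bT).
Qed.

Definition generation_bound := c * ((A + beta + 1) / c) `^ (beta + 1) * m2.

Definition propagation_bound := c * ((A + 1) / c) `^ (beta + 1) * m2.

(** With [l = (A + 1) / c] the inequality reads [y' <= - y + N], where [N] is the
   propagation bound. *)
Lemma propagation t : t \in `[0, T] -> y t <= Num.max (y 0) propagation_bound.
Proof.
rewrite in_itv/= => /andP[]; rewrite le_eqVlt => /predU1P[<- _|t0 tT].
  by rewrite le_max lexx.
set N := propagation_bound.
pose G := (fun s => expR s * (y s - N)).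
have : G t <= G 0.
  apply: (@nonincreasing_cc 0 t G
    (fun s => expR s *: (dy s - 0) + (y s - N) *: expR s)) => //.
  - move=> s st; have yd := y_derive (sub_oo (lexx _) tT st).
    exact: is_deriveM.
  - move=> s st; have := y_ineq (sub_oo (lexx _) tT st).
    move=> /(_ ((A + 1) / c)) H.
    rewrite subr0 /GRing.scale/= [X in _ + X]mulrC -mulrDr pmulr_rle0 ?expR_gt0//.
    have : dy s <= (A - c * ((A + 1) / c)) * y s + N.
      by apply: H; rewrite divr_ge0 ?addr_ge0 ?(ltW c_gt0).
    by rewrite (mulrC c) divfK ?gt_eqF//; lra.
  - have cy := y_within (lexx _) tT.
    move=> s; apply: cvgM; last by apply: cvgB; [exact: cy|exact: cvg_cst].
    apply: continuous_subspaceT; exact: continuous_expR.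
rewrite /G expR0 mul1r => H.
have e1 : 1 <= expR t by rewrite -expR0 ler_expR ltW.
have [yN|Ny] := leP (y t) N; first by rewrite le_max yN orbT.
rewrite le_max; apply/orP; left.
have : y t - N <= expR t * (y t - N) by rewrite ler_peMl// subr_ge0 ltW.
lra.
Qed.

Variable Y : R.
Hypothesis y_bounded : {in `[0, T], forall t, y t <= Y}.

(** With [l = (A + beta + 1) / (c * (s - t0))], the function
   [(s - t0) ^ (beta + 1) * y s - N * (s - t0)] is nonincreasing on
   [t0, t0 + 1]. It tends to 0 at [t0] because [y] is bounded. *)
Let generation_from (t0 t : R) : 0 <= t0 -> t0 < t -> t <= T -> t <= t0 + 1 ->
  y t <= generation_bound * (t - t0) `^ (- beta).
Proof.
move=> t00 t0t tT t1; set N := generation_bound; set M := (A + beta + 1) / c.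
have M0 : 0 <= M by rewrite divr_ge0 ?(ltW c_gt0)// !addr_ge0// ltW.
have cM : c * M = A + beta + 1 by rewrite mulrC divfK ?gt_eqF.
pose G := (fun s => (s - t0) `^ (beta + 1) * y s - N * (s - t0)).
  (* Starting at [t0 + e] avoids differentiating the power at 0. *)
have Gle e : 0 < e -> e < t - t0 -> G t <= G (t0 + e).
  move=> e0 et; have te : t0 + e < t by lra.
  have t0e : 0 <= t0 + e by rewrite addr_ge0// ltW.
  apply: (@nonincreasing_cc _ t G (fun s => (s - t0) `^ (beta + 1) *: dy s +
      y s *: ((beta + 1) * (s - t0) `^ (beta + 1 - 1) * 1) - N * 1)) => //.
  - move=> s st; have yd := y_derive (sub_oo t0e tT st).
    have st0 : 0 < s - t0 by move: st; rewrite in_itv/= => /andP[+ _]; lra.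
    have d1 : is_derive s 1 (fun s => s - t0) 1.
      by rewrite -[X in is_derive _ _ _ X](subr0 1); exact: is_deriveB.
    have d2 := is_derive1_powR (beta + 1) st0.
    have d3 := @is_derive1_comp R (fun s => s `^ (beta + 1)) (fun s => s - t0) s _ _ d2 d1.
    apply: is_deriveB; exact: is_deriveM.
  - move=> s st; have := y_ineq (sub_oo t0e tT st).
    have ys : 0 <= y s.
      apply: y_ge0; have := sub_oo t0e tT st.
      by rewrite !in_itv/= => /andP[a b]; rewrite !ltW.
    move: st; rewrite in_itv/= => /andP[s1 s2].
    set tau := s - t0; have tau0 : 0 < tau by rewrite /tau; lra.
    have tau1 : tau <= 1 by rewrite /tau; lra.
    move=> /(_ (M / tau)) H; have {}H := H (divr_ge0 M0 (ltW tau0)).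
    rewrite addrK !mulr1 /GRing.scale/=.
    have p0 : 0 < tau `^ beta by exact: powR_gt0.
    have pE : tau `^ (beta + 1) = tau * tau `^ beta.
      by rewrite powRD ?(gt_eqF tau0) ?implybT// powRr1 ?(ltW tau0)// mulrC.
    have NE : tau `^ (beta + 1) * (c * (M / tau) `^ (beta + 1) * m2) = N.
      rewrite powRM ?invr_ge0 ?(ltW tau0)// /N /generation_bound -/M.
      have inv : tau `^ (beta + 1) * tau^-1 `^ (beta + 1) = 1.
        by rewrite -powRM ?invr_ge0 ?(ltW tau0)// divff ?gt_eqF// powR1.
      move: inv; move: (tau `^ (beta + 1)) (tau^-1 `^ _) (M `^ _) => a1 a2 a3 inv.
      by rewrite -[RHS]mul1r -inv; ring.
    have : tau `^ (beta + 1) * dy s <=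
        tau `^ (beta + 1) * ((A - c * (M / tau)) * y s) + N.
      by rewrite -NE -mulrDr ler_wpM2l// powR_ge0.
    rewrite pE; set L := _ * dy s.
    have -> : tau * tau `^ beta * ((A - c * (M / tau)) * y s) =
        tau `^ beta * y s * (tau * A - c * M).
      by field; rewrite gt_eqF.
    rewrite cM.
    have : tau `^ beta * y s * (tau * A) <= tau `^ beta * y s * A.
      by rewrite ler_wpM2l ?mulr_ge0 ?(ltW p0)// ler_piMl.
    lra.
  - have cy := y_within t0e tT.
    have cid : {within `[t0 + e, t], continuous (fun s => s - t0)}.
      by apply: continuous_subspaceT => s; apply: cvgB; [exact: cvg_id|exact: cvg_cst].
    apply/subspace_continuousP => s st.
    have st0 : 0 < s - t0 by move: st; rewrite /= in_itv/= => /andP[+ _]; lra.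
    apply: cvgB; last first.
      by apply: cvgM; [exact: cvg_cst|exact: (subspace_continuousP _ _).1 cid s st].
    apply: cvgM; last exact: (subspace_continuousP _ _).1 cy s st.
    apply: cvg_within_filter.
    apply: (@cvg_comp _ _ _ (fun s => s - t0) (fun s => s `^ (beta + 1)) _ (nbhs (s - t0))).
      by apply: cvgB; [exact: cvg_id|exact: cvg_cst].
    have [dd _] := is_derive1_powR (beta + 1) st0.
    have cc : {for s - t0, continuous (fun s => s `^ (beta + 1))}.
      by apply: differentiable_continuous; apply/derivable1_diffP.
    exact: cc.
have GY e : 0 < e -> e < t - t0 -> G t <= e * Y.
  move=> e0 et; apply: le_trans (Gle _ e0 et) _; rewrite /G addrAC subrr add0r.
  have N0 : 0 <= N by rewrite !mulr_ge0 ?powR_ge0// ltW.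
  have : e `^ (beta + 1) * y (t0 + e) <= e * Y.
    have yY : 0 <= y (t0 + e) <= Y.
      have i : t0 + e \in `[0, T] by rewrite in_itv/=; apply/andP; split; lra.
      by rewrite y_ge0// y_bounded.
    move/andP: yY => [y0 yY]; apply: ler_pM => //; first exact: powR_ge0.
    rewrite powRD ?(gt_eqF e0) ?implybT// powRr1 ?(ltW e0)// ler_piMl ?(ltW e0)//.
    have e1 : e <= 1 by lra.
    have : e `^ beta <= 1 `^ beta.
      by apply: ge0_ler_powR; rewrite ?nnegrE ?(ltW e0) ?(ltW beta_gt0).
    by rewrite powR1.
  have : 0 <= N * e by rewrite mulr_ge0 ?(ltW e0).
  lra.
have Y0 : 0 <= Y.
  have i : t \in `[0, T] by rewrite in_itv/= tT (le_trans t00 (ltW t0t)).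
  exact: le_trans (y_ge0 i) (y_bounded i).
have G0 : G t <= 0.
  rewrite leNgt; apply/negP => Gt0.
  have Y1 : 0 < 2 * (Y + 1) by lra.
  pose e := Num.min ((t - t0) / 2) (G t / (2 * (Y + 1))).
  have e0 : 0 < e by rewrite lt_min divr_gt0 ?subr_gt0//= divr_gt0.
  have et : e < t - t0.
    by apply: (@le_lt_trans _ _ ((t - t0) / 2)); [rewrite ge_min lexx|lra].
  have := GY e e0 et.
  have : e * Y <= G t / (2 * (Y + 1)) * Y by rewrite ler_wpM2r// ge_min lexx orbT.
  have : G t / (2 * (Y + 1)) * Y <= G t / 2.
    rewrite -mulrA ler_wpM2l ?(ltW Gt0)// mulrC ler_pdivrMr//; lra.
  lra.
have tau0 : 0 < t - t0 by rewrite subr_gt0.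
rewrite powRN ler_pdivlMr ?powR_gt0//.
move: G0; rewrite /G powRD ?(gt_eqF tau0) ?implybT// powRr1 ?(ltW tau0)//.
rewrite -mulrA (mulrC N) mulrCA -mulrBr pmulr_rle0// subr_le0 mulrC.
by rewrite mulrC.
Qed.

(** From [t = 1] on, the estimate is started at [t - 1] instead of 0. *)
Lemma generation t : t \in `]0, T] -> y t <= generation_bound * Num.max 1 (t `^ (- beta)).
Proof.
rewrite in_itv/= => /andP[t0 tT].
have N0 : 0 <= generation_bound by rewrite !mulr_ge0 ?powR_ge0// ltW.
have [t1|t1] := leP t 1.
  apply: (@le_trans _ _ (generation_bound * (t - 0) `^ (- beta))).
    by apply: generation_from => //; rewrite add0r.
  by rewrite subr0 ler_wpM2l// le_max lexx orbT.
apply: (@le_trans _ _ (generation_bound * (t - (t - 1)) `^ (- beta))).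
  by apply: generation_from => //; lra.
by rewrite opprB addrC subrK powR1 ler_wpM2l// le_max lexx.
Qed.

End differential_inequality.


(** * Weighted integrals along curves in a weighted L^1 space *)
Section weighted_integral.
Context {R : realType} {d : nat}.
Local Notation V := 'rV[R]_d.
Local Notation lambda := (lebesgue_rV d).
Implicit Types (u w : V -> R).

Lemma bracket_sqr (v : V) : bracket v `^ 2 = energy v.
Proof.
rewrite /bracket -energyE powR_mulrn ?sqrtr_ge0// sqr_sqrtr//.
exact/ltW/energy_gt0.
Qed.

Lemma bracket_powR (v : V) (s : R) : bracket v `^ s = energy v `^ (s / 2).
Proof.
rewrite -bracket_sqr -powRrM; congr (_ `^ _).
by rewrite mulrCA divff ?pnatr_eq0// mulr1.
Qed.

Lemma L1norm_pairing (q : R) u :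
  L1norm q u = pairing (fun v => `|u v|) (fun v => energy v `^ (q / 2)).
Proof. by apply: eq_integral => v _; rewrite bracket_powR. Qed.

Lemma measurable_bracket_powR (s : R) : measurable_fun setT (fun v : V => bracket v `^ s).
Proof.
under eq_fun do rewrite bracket_powR.
by apply: (measurableT_comp (measurable_powR _)); exact: measurable_energy.
Qed.

Lemma moment_L1norm (s : R) u : measurable_fun setT u -> {ae lambda, forall v, 0 <= u v} ->
  moment s u = L1norm s u.
Proof.
move=> mu u0; have mb := measurable_bracket_powR s; apply: ae_eq_integral => //.
- by apply/measurable_EFinP; exact: measurable_funM.
- by apply/measurable_EFinP; apply: measurable_funM => //; exact: measurableT_comp.
- by apply: filterS u0 => v uv _; rewrite ger0_norm.
Qed.

Variables (w : V -> R) (K : R).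
Hypothesis mw : measurable_fun setT w.
Hypothesis w_ge0 : forall v, 0 <= w v.
Hypothesis w_le : forall v, w v <= K * energy v.
Hypothesis K_gt0 : 0 < K.

Definition weighted u : R := \int[lambda]_v (u v * w v).

Let weighted_bound u : measurable_fun setT u ->
  (\int[lambda]_v `|(u v * w v)%:E| <= K%:E * L1norm 2 u)%E.
Proof.
move=> mu; rewrite /L1norm /moment -ge0_integralZl//; last first.
- by rewrite lee_fin ltW.
- by move=> v _; rewrite lee_fin mulr_ge0// powR_ge0.
- apply/measurable_EFinP; apply: measurable_funM; first exact: measurableT_comp.
  under eq_fun do rewrite bracket_sqr; exact: measurable_energy.
apply: ge0_le_integral => //.
- apply/measurable_EFinP; apply: measurableT_comp => //; exact: measurable_funM.
- apply: measurable_funeM; apply/measurable_EFinP; apply: measurable_funM; first exact: measurableT_comp.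
  under eq_fun do rewrite bracket_sqr; exact: measurable_energy.
- move=> v _; rewrite bracket_sqr -EFinM lee_fin normrM (ger0_norm (w_ge0 v)).
  by rewrite mulrCA ler_wpM2l.
Qed.

Lemma weighted_integrable u : L1 2 u -> lambda.-integrable setT (fun v => (u v * w v)%:E).
Proof.
move=> [mu uoo]; apply/integrableP; split.
  by apply/measurable_EFinP; exact: measurable_funM.
apply: le_lt_trans (weighted_bound mu) _.
by rewrite lte_mul_pinfty// ?lee_fin ?(ltW K_gt0)// lte_fin.
Qed.

Lemma weighted_le u : measurable_fun setT u ->
  (`|weighted u|%:E <= K%:E * L1norm 2 u)%E.
Proof.
move=> mu; have L0 : (0 <= L1norm 2 u)%E.
  by apply: integral_ge0 => v _; rewrite lee_fin mulr_ge0// powR_ge0.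
have [uoo|] := ltP (L1norm 2 u) +oo%E; last first.
  by rewrite leye_eq => /eqP ->; rewrite gt0_muley ?leey// lte_fin.
apply: le_trans (weighted_bound mu).
have := weighted_integrable (conj mu uoo) => /[dup] ui /integrable_fin_num; rewrite /weighted /Rintegral.
move=> /(_ measurableT) fi; rewrite -fine_abse// fineK ?abse_fin_num//.
by apply: le_abse_integral => //; apply/measurable_EFinP; exact: measurable_funM.
Qed.

Lemma weightedB u1 u2 : L1 2 u1 -> L1 2 u2 ->
  weighted (fun v => u1 v - u2 v) = weighted u1 - weighted u2.
Proof.
move=> i1 i2; rewrite -RintegralB//; [|exact: weighted_integrable..].
by apply: eq_Rintegral => v _; rewrite mulrBl.
Qed.

Lemma weighted_quotient (a : R) u1 u2 u3 : L1 2 u1 -> L1 2 u2 -> L1 2 u3 ->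
  weighted (fun v => a * (u1 v - u2 v) - u3 v) = a * (weighted u1 - weighted u2) - weighted u3.
Proof.
move=> /weighted_integrable i1 /weighted_integrable i2 /weighted_integrable i3.
have i12 : lambda.-integrable setT (EFin \o (fun v => u1 v * w v - u2 v * w v)).
  by rewrite /comp; under eq_fun do rewrite EFinB; exact: integrableB.
have ia : lambda.-integrable setT (EFin \o (fun v => a * (u1 v * w v - u2 v * w v))).
  by rewrite /comp; under eq_fun do rewrite EFinM; exact: integrableZl.
rewrite -RintegralB// -RintegralZl// -RintegralB//.
by apply: eq_Rintegral => v _; ring.
Qed.

Let weighted_cvg0 (F : set_system R) (u : R -> V -> R) : Filter F ->
  (\forall s \near F, measurable_fun setT (u s)) ->
  L1norm 2 (u s) @[s --> F] --> 0%E -> weighted (u s) @[s --> F] --> (0 : R).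
Proof.
move=> FF mu u0; apply/norm_cvg0P.
have : (`|weighted (u s)|%:E @[s --> F] --> 0)%E.
  apply: (@squeeze_cvge _ _ _ _ (cst 0%E) _ (fun s => K%:E * L1norm 2 (u s))%E).
  - by apply: filterS mu => s ms; rewrite lee_fin normr_ge0/= weighted_le.
  - exact: cvg_cst.
  - by rewrite -[X in _ --> X](mule0 K%:E); exact: cvgeZl.
by move/fine_cvg.
Qed.

Lemma weighted_continuous (A : set R) (f : R -> V -> R) :
  L1_continuous 2 A f -> {within A, continuous (fun t => weighted (f t))}.
Proof.
move=> cf; apply/subspace_continuousP => t At; have [ft ct] := cf t At.
apply/subr_cvg0.
apply: (@cvg_trans _ (weighted (fun v => f s v - f t v) @[s --> within A (nbhs t)])).
  apply: near_eq_cvg; near=> s.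
  have As : A s by near: s; exact: withinT.
  by rewrite weightedB//; have [] := cf s As.
apply: weighted_cvg0 ct; near=> s.
have As : A s by near: s; exact: withinT.
by apply: measurable_funB; [have [[]] := cf s As|have []:= ft].
Unshelve. all: end_near. Qed.

Lemma weighted_derive (A : set R) (f g : R -> V -> R) (t : R) :
  L1_derivative 2 A f g -> A t -> nbhs t A ->
  is_derive t 1 (fun s => weighted (f s)) (weighted (g t)).
Proof.
move=> dfg At nA; have [ft gt cg] := dfg t At.
have sub : t^' `=>` within A t^'.
  by move=> P /= wP; apply: filterS2 (nbhs_dnbhs nA) wP => s As; exact.
have {}cg := cvg_trans (cvg_app _ sub) cg.
have tA : \forall s \near t^', A s by exact: nbhs_dnbhs.
have H : (s - t)^-1 * (weighted (f s) - weighted (f t)) @[s --> t^'] --> weighted (g t).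
  apply/subr_cvg0.
  apply: (@cvg_trans _ (weighted (fun v => (s - t)^-1 * (f s v - f t v) - g t v)
     @[s --> t^'])).
    apply: near_eq_cvg; near=> s.
    have As : A s by near: s.
    have [fs _ _] := dfg s As.
    by rewrite weighted_quotient.
  apply: weighted_cvg0 cg; near=> s.
  have As : A s by near: s.
  have [[ms _] _ _] := dfg s As.
  apply: measurable_funB; last by case: gt.
  by apply: measurable_funM => //; apply: measurable_funB => //; case: ft.
have sh : (fun h : R => h *: (1 : R) + t) @ 0^' `=>` t^'.
  move=> P tP; have /nbhs0P : \forall s \near t, s != t -> P s := tP.
  change ((\forall h \near (0 : R), t + h != t -> P (t + h)) ->
     \forall h \near (0 : R), h != 0 -> P (h *: (1 : R) + t)).
  apply: filterS => h Ph h0; rewrite [h *: _]mulr1 addrC; apply: Ph.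
  by rewrite -subr_eq0 addrAC subrr add0r.
have D : (fun h => h^-1 *: (((fun s => weighted (f s)) \o shift t) (h *: (1 : R)) -
    weighted (f t))) @ 0^' --> weighted (g t).
  apply: cvg_trans (cvg_trans (cvg_app _ sh) H).
  apply: near_eq_cvg; near=> h => /=; by rewrite [h *: _]mulr1 addrK.
split; first by apply/cvg_ex; exists (weighted (g t)).
exact/cvg_lim.
Unshelve. all: end_near. Qed.

Lemma pairing_weighted u : L1 2 u -> {ae lambda, forall v, 0 <= u v} ->
  pairing (fun v => `|u v|) w = (weighted u)%:E.
Proof.
move=> iu u0; have i := weighted_integrable iu.
rewrite /weighted /Rintegral fineK; last exact: integrable_fin_num.
apply: ae_eq_integral => //; [|exact: measurable_int i|].
  by apply/measurable_EFinP; apply: measurable_funM => //; apply: measurableT_comp => //; case: iu.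
by apply: filterS u0 => v uv _; rewrite ger0_norm.
Qed.

Lemma eq_weighted_ae u1 u2 : measurable_fun setT u1 -> measurable_fun setT u2 ->
  {ae lambda, forall v, u1 v = u2 v} -> weighted u1 = weighted u2.
Proof.
move=> m1 m2 e; congr fine; apply: ae_eq_integral => //.
- by apply/measurable_EFinP; exact: measurable_funM.
- by apply/measurable_EFinP; exact: measurable_funM.
- by apply: filterS e => v -> _.
Qed.

End weighted_integral.

Section truncation_limit.
Context {R : realType} {d : nat}.
Local Notation V := 'rV[R]_d.
Local Notation lambda := (lebesgue_rV d).
Variables (gamma q : R).
Hypothesis gamma_gt0 : 0 < gamma.
Local Notation w := (truncated_power gamma q).

Lemma truncated_power_cvg (v : V) :
  w n.+1%:R^-1 v @[n --> \oo] --> bracket v `^ q.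
Proof.
set s := energy v; have s0 : 0 < s := energy_gt0 v.
set eps := gamma / 2; set beta := (q - 2) / gamma.
have se0 : 0 < s `^ eps by exact: powR_gt0.
have -> : bracket v `^ q = s * (s `^ eps) `^ beta.
  rewrite bracket_powR -/s -powRrM -{2}(powRr1 (ltW s0)) -powRD ?(gt_eqF s0) ?implybT//.
  by congr (_ `^ _); rewrite /eps /beta; field; rewrite gt_eqF.
rewrite /truncated_power -/s weight.unlock weight_ratio.unlock.
apply: cvgM; first exact: cvg_cst.
have gc : gain_rate eps n.+1%:R^-1 s @[n --> \oo] --> s `^ eps.
  rewrite gain_rate.unlock -[X in _ --> X]divr1; apply: cvgM; first exact: cvg_cst.
  apply: cvgV; first exact: oner_neq0.
  rewrite -[X in _ --> X]addr0; apply: cvgD; first exact: cvg_cst.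
  rewrite -[X in _ --> X](mul0r (s `^ eps)); apply: cvgM; last exact: cvg_cst.
  exact: cvg_harmonic.
have cc : {for s `^ eps, continuous (fun x => x `^ beta)}.
  have [dd _] := is_derive1_powR beta se0.
  by apply: differentiable_continuous; apply/derivable1_diffP.
exact: (cvg_comp _ _ gc cc).
Qed.

(** Fatou's lemma along [kappa = 1 / (n + 1)]. *)
Lemma moment_le_truncated (u : V -> R) (B : R) : measurable_fun setT u ->
  {ae lambda, forall v, 0 <= u v} ->
  (forall kappa : R, 0 < kappa -> (pairing (fun v => `|u v|%R) (w kappa) <= B%:E)%E) ->
  (moment q u <= B%:E)%E.
Proof.
move=> mu u0 wB.
have mau : measurable_fun setT (fun v => `|u v|) by exact: measurableT_comp.
rewrite moment_L1norm// /L1norm /moment.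
pose g n (v : V) : \bar R := (`|u v| * w n.+1%:R^-1 v)%:E.
have mw k : measurable_fun setT (fun v : V => w k v).
  exact: measurableT_comp (measurable_weight _ _ _) (@measurable_energy R d).
have w0 k (v : V) : 0 <= w k v by apply: weight_ge0; exact/ltW/energy_gt0.
have mg n : measurable_fun setT (g n) by apply/measurable_EFinP; exact: measurable_funM.
have g0 n v : setT v -> (0 <= g n v)%E by rewrite lee_fin mulr_ge0.
have gE v : limn_einf (g ^~ v) = (`|u v| * bracket v `^ q)%:E.
  have gc : (g n v @[n --> \oo] --> (`|u v|%R * bracket v `^ q)%:E)%E.
    apply: cvg_EFin; first exact: nearW.
    by apply: cvgM; [exact: cvg_cst|exact: truncated_power_cvg].
  by rewrite is_cvg_limn_einfE; [exact/cvg_lim|apply/cvg_ex; eexists; exact: gc].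
under eq_integral do rewrite -gE.
apply: le_trans (fatou lambda measurableT mg g0) _.
rewrite limn_einf_lim; apply: lime_le; first exact: is_cvg_einfs.
apply: nearW => n; apply: (@le_trans _ _ (\int[lambda]_v g n v)%E).
  by apply: ereal_inf_lbound; exists n => /=.
by apply: wB; rewrite invr_gt0 ltr0n.
Qed.

End truncation_limit.


(** * Moments of solutions *)
Lemma ae_meets_interval {R : realType} (P : set R) (a b : R) :
  {ae @lebesgue_measure R, forall t, P t} -> a < b -> exists2 t, a < t < b & P t.
Proof.
move=> [N [mN N0 PN]] ab; apply: contrapT => noP.
have abN : `]a, b[%classic `<=` N.
  move=> t /=; rewrite in_itv/= => tab; apply: PN => Pt; apply: noP; by exists t.
have : (lebesgue_measure (`]a, b[%classic : set R) <= 0)%E.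
  by rewrite -N0; apply: le_measure => //; rewrite inE//; exact: measurable_itv.
by rewrite lebesgue_measure_itv/= lte_fin ab -EFinB lee_fin subr_le0 leNgt ab.
Qed.

Section solution_moments.
Context {R : realType} {d : nat}.
Local Notation V := 'rV[R]_d.
Local Notation lambda := (lebesgue_rV d).
Variables (gamma2 : R) (b2 : R -> R) (gamma3 theta : R) (phi : R -> R).
Variables (T : R) (f0 : V -> R) (f : R -> V -> R).
Hypothesis T_gt0 : 0 < T.
Hypothesis hf0 : initial_datum f0.
Hypothesis hf : is_solution gamma2 b2 gamma3 theta phi T f0 f.
Local Notation m0 := (fine (moment 0 f0)).
Local Notation m2 := (fine (moment 2 f0)).

Let f_L1 t : t \in `[0, T] -> L1 2 (f t).
Proof. by move=> tT; have [] := solution_continuous hf tT. Qed.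

Let integral_moment (u : V -> R) (k : R) (w : V -> R) : (forall v, bracket v `^ k = w v) ->
  moment k u = (\int[lambda]_v (u v * w v)%:E)%E.
Proof. by move=> bw; apply: eq_integral => v _; rewrite bw. Qed.

Lemma mass_gt0 : 0 < m0.
Proof.
rewrite (integral_moment _ (w := fun=> 1)); last by move=> v; rewrite powRr0.
by under eq_integral do rewrite mulr1; exact: initial_mass_gt0 hf0.
Qed.

Lemma energy_moment_ge0 : 0 <= m2.
Proof.
apply: fine_ge0; have [mf0 _] := initial_L1 hf0.
rewrite (moment_L1norm _ mf0 (initial_ge0 hf0)).
by apply: integral_ge0 => v _; rewrite lee_fin mulr_ge0// powR_ge0.
Qed.

Let one_le (v : V) : 1 <= 1 * energy v :> R. Proof. by rewrite mul1r energy_ge1. Qed.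
Let energy_le (v : V) : energy v <= 1 * energy v. Proof. by rewrite mul1r. Qed.
Let energy_ge0 (v : V) : 0 <= energy v. Proof. exact/ltW/energy_gt0. Qed.
Let me := @measurable_energy R d.

Lemma pairing_mass t : t \in `[0, T] -> pairing (fun v => `|f t v|) (fun=> 1) = m0%:E.
Proof.
move=> tT; rewrite (pairing_weighted (K := 1) (w := fun=> 1))//; last 2 first.
- exact: f_L1.
- exact: solution_ge0 hf _ tT.
congr (_%:E); rewrite (integral_moment _ (w := fun=> 1)); last by move=> v; rewrite powRr0.
under eq_integral do rewrite mulr1.
rewrite -[RHS](solution_mass hf tT).
by apply: eq_Rintegral => v _; rewrite mulr1.
Qed.

Let weighted_energy (u : V -> R) : L1 2 u ->
  weighted energy u = (\int[lambda]_v u v) + \int[lambda]_v (u v * enorm v ^+ 2).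
Proof.
move=> iu.
have i1 : lambda.-integrable setT (EFin \o u).
  have := weighted_integrable (measurable_cst (1 : R)) (fun=> ler01) one_le ltr01 iu.
  by under eq_fun do rewrite mulr1.
have i2 : lambda.-integrable setT (fun v => (u v * enorm v ^+ 2)%:E).
  apply: (weighted_integrable (K := 1)) iu => //.
  - by apply: measurable_funX; exact: measurable_enorm.
  - by move=> v; exact: sqr_ge0.
  - by move=> v; rewrite mul1r energyE lerDr.
rewrite -RintegralD//; apply: eq_Rintegral => v _.
by rewrite energyE mulrDr mulr1.
Qed.

Lemma pairing_energy t : t \in `[0, T] -> pairing (fun v => `|f t v|) energy = m2%:E.
Proof.
move=> tT; rewrite (pairing_weighted (K := 1) (w := energy))//; last 2 first.
- exact: f_L1.
- exact: solution_ge0 hf _ tT.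
congr (_%:E); rewrite weighted_energy; last exact: f_L1.
rewrite (solution_mass hf tT) (solution_energy hf tT) -weighted_energy; last exact: initial_L1 hf0.
by rewrite (integral_moment _ (w := energy))//; exact: bracket_sqr.
Qed.

Variables (gamma q A c : R).
Hypothesis gamma_gt0 : 0 < gamma.
Hypothesis q_gt2 : 2 < q.
Hypothesis A_ge0 : 0 <= A.
Hypothesis c_gt0 : 0 < c.
Hypothesis hA : @dissipates R d b2 theta phi gamma q m0 m2 A c gamma2 gamma3.
Local Notation beta := ((q - 2) / gamma).

Let beta_gt0 : 0 < beta. Proof. by rewrite divr_gt0// subr_gt0. Qed.

Section truncated.
Variable kappa : R.
Hypothesis kappa_gt0 : 0 < kappa.
Local Notation w := (@truncated_power R d gamma q kappa).
Local Notation y := (fun t => weighted w (f t)).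

Let mw : measurable_fun setT w.
Proof. exact: measurableT_comp (measurable_weight _ _ _) me. Qed.
Let w_ge0 v : 0 <= w v. Proof. exact: weight_ge0. Qed.
Let K_gt0 : 0 < kappa^-1 `^ beta. Proof. by rewrite powR_gt0// invr_gt0. Qed.
Let w_le v : w v <= kappa^-1 `^ beta * energy v.
Proof. exact: weight_le_linear. Qed.

Let y_pairing t : t \in `[0, T] -> pairing (fun v => `|f t v|) w = (y t)%:E.
Proof.
move=> tT; apply: (pairing_weighted mw w_ge0 w_le) => //; first exact: f_L1.
exact: solution_ge0 hf _ tT.
Qed.

Let y_ge0 : {in `[0, T], forall t, 0 <= y t}.
Proof. by move=> t tT; rewrite -lee_fin -y_pairing// pairing_ge0. Qed.

Let y_le : {in `[0, T], forall t, y t <= kappa^-1 `^ beta * m2}.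
Proof.
move=> t tT.
have mh : measurable_fun setT (fun v => `|f t v|).
  by apply: measurableT_comp => //; have [] := f_L1 tT.
rewrite -lee_fin -y_pairing// EFinM -(pairing_energy tT) -pairingZ//; last exact: ltW.
by apply: le_pairing => //; exact: measurable_funM.
Qed.

Let y_continuous : {within `[0, T], continuous y}.
Proof. exact: (weighted_continuous mw w_ge0 w_le K_gt0 (solution_continuous hf)). Qed.

(** Almost every [f t] has a finite moment of order [2 + max gamma2 gamma3], so that
   the collision operators split into gain and loss. The inequality extends to
   all times because both sides are continuous. *)
Let y_ineq : exists dy : R -> R,
  {in `]0, T[, forall t : R, is_derive t 1 y (dy t)} /\
  {in `]0, T[, forall t (l : R), 0 <= l ->
    dy t <= (A - c * l) * y t + c * l `^ (beta + 1) * m2}.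
Proof.
have [f' [df cf' fQ]] := solution_equation hf.
have oo_oc t : t \in `]0, T[ -> t \in `]0, T].
  by rewrite !in_itv/= => /andP[-> /ltW].
have oo_cc t : t \in `]0, T[ -> t \in `[0, T].
  by rewrite !in_itv/= => /andP[/ltW -> /ltW].
exists (fun t => weighted w (f' t)); split.
  move=> t tT; apply: (weighted_derive mw w_ge0 w_le K_gt0 df); first exact: oo_oc.
  apply: (@filterS _ _ _ `]0, T[%classic); first by move=> s; exact: oo_oc.
  by apply: open_nbhs_nbhs; split => //; exact: interval_open.
have good : {ae lebesgue_measure, forall t, t \in `]0, T[ -> forall l : R, 0 <= l ->
    weighted w (f' t) <= (A - c * l) * y t + c * l `^ (beta + 1) * m2}.
  have [[s [_ sf]] _] := solution_locally_integrable hf.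
  have FF := ae_filter_ringOfSetsType (@lebesgue_measure R).
  apply: filterS sf => t /[swap] tT /(_ tT)[[mf ft] _] l l0.
  have f_ge0 := solution_ge0 hf (oo_cc _ tT).
  have foo : (pairing (fun v => `|f t v|%R)
      (fun v => (energy v `^ (1 + Num.max gamma2 gamma3 / 2))%R) < +oo)%E.
    move: ft; rewrite L1norm_pairing (_ : (2 + _) / 2 = 1 + Num.max gamma2 gamma3 / 2)//.
    by rewrite mulrDl divff ?pnatr_eq0.
  have [J [r [z [zE iJ Jr QJ ineq]]]] :=
    hA kappa_gt0 mf f_ge0 (pairing_mass (oo_cc _ tT)) (pairing_energy (oo_cc _ tT)) foo.
  have -> : weighted w (f' t) = r.
    rewrite /weighted /Rintegral -[RHS]/(fine r%:E) -Jr; congr fine.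
    have [[mf' _] _] := cf' t (oo_oc _ tT).
    apply: ae_eq_integral => //; [|exact: measurable_int iJ|].
      by apply/measurable_EFinP; exact: measurable_funM.
    by apply: filterS2 QJ (fQ t (oo_oc _ tT)) => v <- ->.
  have -> : weighted w (f t) = z by apply: EFin_inj; rewrite -zE y_pairing ?oo_cc.
  exact: ineq.
move=> t tT l l0; rewrite leNgt; apply/negP => bad.
have interior_t : (`]0, T[%classic : set R)° t.
  by apply: open_nbhs_nbhs; split => //; exact: interval_open.
pose D s := weighted w (f' s) - ((A - c * l) * y s + c * l `^ (beta + 1) * m2).
have Dc : D s @[s --> t] --> D t.
  have cy : y s @[s --> t] --> y t.
    have i : (`[0, T]%classic : set R)° t by apply: interiorS interior_t => s; exact: oo_cc.
    rewrite -(within_interior i).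
    by have /subspace_continuousP := y_continuous; apply; exact: oo_cc.
  have cdy : weighted w (f' s) @[s --> t] --> weighted w (f' t).
    have i : (`]0, T]%classic : set R)° t by apply: interiorS interior_t => s; exact: oo_oc.
    rewrite -(within_interior i).
    have /subspace_continuousP := weighted_continuous mw w_ge0 w_le K_gt0 cf'; apply.
    exact: oo_oc.
  apply: cvgB => //; apply: cvgD; last exact: cvg_cst.
  by apply: cvgM => //; exact: cvg_cst.
have Dt : 0 < D t by rewrite subr_gt0.
have Dpos : \forall s \near t, 0 < D s by exact: (cvgr_gt _ Dc _ Dt).
have /nbhs_ballP[e /= e0 He] : \forall s \near t, 0 < D s /\ s \in `]0, T[.
  by apply: filterS2 Dpos (interior_t) => s.
have [s /andP[ts st] Ps] := ae_meets_interval (a := t - e) (b := t + e) good ltac:(lra).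
have [Ds sT] : 0 < D s /\ s \in `]0, T[.
  by apply: He; rewrite /ball/= distrC ltr_norml; apply/andP; split; lra.
by have := Ps sT l l0; rewrite leNgt -subr_gt0 Ds.
Qed.

Lemma truncated_generation t : t \in `]0, T] ->
  (pairing (fun v => `|f t v|%R) w <=
    (generation_bound A c beta m2 * Num.max 1 (t `^ (- beta)))%:E)%E.
Proof.
move=> tT; have [dy [dyE ineq]] := y_ineq.
rewrite y_pairing; last by move: tT; rewrite !in_itv/= => /andP[/ltW -> ->].
rewrite lee_fin; exact: (@generation R T A c beta m2 y dy A_ge0 c_gt0 beta_gt0 energy_moment_ge0 y_ge0
  y_continuous dyE ineq _ y_le _ tT).
Qed.

Lemma truncated_propagation t : t \in `[0, T] -> (moment q f0 < +oo)%E ->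
  (pairing (fun v => `|f t v|%R) w <=
    (Num.max (fine (moment q f0)) (propagation_bound A c beta m2))%:E)%E.
Proof.
move=> tT mq; have [dy [dyE ineq]] := y_ineq.
rewrite y_pairing// lee_fin.
apply: le_trans (@propagation R T A c beta m2 y dy A_ge0 c_gt0 y_continuous dyE ineq _ tT) _.
have [mf0 f0oo] := initial_L1 hf0.
rewrite ge_max !le_max; apply/andP; split; last by rewrite lexx orbT.
apply/orP; left.
have i0 : 0 \in `[0, T] by rewrite in_itv/= lexx ltW.
rewrite (eq_weighted_ae mw _ mf0); last exact: solution_initial hf.
  have f00 := initial_ge0 hf0.
  rewrite moment_L1norm// -lee_fin -(pairing_weighted mw w_ge0 w_le)//.
  move: mq; rewrite moment_L1norm// => mq.
  rewrite fineK; last first.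
    rewrite ge0_fin_numE//.
    by apply: integral_ge0 => v _; rewrite lee_fin mulr_ge0// powR_ge0.
  rewrite L1norm_pairing; have mh : measurable_fun setT (fun v => `|f0 v|) by exact: measurableT_comp.
  apply: (le_pairing mh) => //.
    by apply: (measurableT_comp (measurable_powR _)); exact: measurable_energy.
  move=> v; apply: le_trans (weight_le_powR _ _ _ _) _ => //.
    exact: energy_gt0.
  by rewrite (_ : 1 + _ = q / 2)//; field; rewrite gt_eqF.
by have [] := f_L1 i0.
Qed.

End truncated.

Lemma moment_generation t : t \in `]0, T] ->
  (moment q (f t) <= (generation_bound A c beta m2 * Num.max 1 (t `^ (- beta)))%:E)%E.
Proof.
move=> tT.
have tT' : t \in `[0, T] by move: tT; rewrite !in_itv/= => /andP[/ltW -> ->].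
apply: (moment_le_truncated gamma_gt0).
- by have [] := f_L1 tT'.
- exact: solution_ge0 hf _ tT'.
- by move=> kappa k0; exact: truncated_generation.
Qed.

Lemma moment_propagation t : t \in `[0, T] -> (moment q f0 < +oo)%E ->
  (moment q (f t) <= (Num.max (fine (moment q f0)) (propagation_bound A c beta m2))%:E)%E.
Proof.
move=> tT mq; apply: (moment_le_truncated gamma_gt0).
- by have [] := f_L1 tT.
- exact: solution_ge0 hf _ tT.
- by move=> kappa k0; exact: truncated_propagation.
Qed.

End solution_moments.


(** * Choice of the constants *)
Section constants.
Context {R : realType} {d : nat}.
Local Notation V := 'rV[R]_d.
Variables (b2 : R -> R) (theta : R) (phi : R -> R).
Hypothesis hd : (2 <= d)%N.
Hypothesis hb2 : binary_kernel d b2.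
Hypothesis theta_ge0 : 0 <= theta.
Hypothesis hb3 : ternary_kernel d theta phi.

Definition generates (gamma2 gamma3 gamma q m0 m2 K : R) :=
  forall (T : R) (f0 : V -> R) (f : R -> V -> R), initial_datum f0 ->
  is_solution gamma2 b2 gamma3 theta phi T f0 f ->
  fine (moment 0 f0) = m0 -> fine (moment 2 f0) = m2 ->
  forall t, t \in `]0, T] ->
  (moment q (f t) <= (K * Num.max 1 (t `^ ((2 - q) / gamma)))%:E)%E.

Let dissipates_generates (gamma2 gamma3 gamma q m0 m2 A c : R) :
  0 < gamma -> 2 < q -> 0 <= A -> 0 < c ->
  @dissipates R d b2 theta phi gamma q m0 m2 A c gamma2 gamma3 ->
  generates gamma2 gamma3 gamma q m0 m2 (1 + `|generation_bound A c ((q - 2) / gamma) m2|).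
Proof.
move=> gam0 q2 A0 c0 D T f0 f hf0 hf e0 e2 t tT; move: D; rewrite -e0 -e2 => D.
apply: le_trans (moment_generation hf0 hf gam0 q2 A0 c0 D tT) _.
rewrite lee_fin -mulNr opprB ler_wpM2r ?le_max ?ler01//.
by apply: le_trans (ler_norm _) _; rewrite lerDr.
Qed.

(** The constant has to exist for all values of the parameters, those of no
   solution included, before it can be chosen as a function of them. *)
Lemma binary_generation (p : R * R * R * R) : exists K : R, 0 < K /\
  let: (q, gamma2, m0, m2) := p in 2 < q -> 0 < gamma2 <= 2 ->
  forall gamma3, gamma3 \in `[0, 2] -> generates gamma2 gamma3 gamma2 q m0 m2 K.
Proof.
case: p => [[[q gamma2] m0] m2].
have [[q2 g2 m00 m20]|no] := pselect [/\ 2 < q, 0 < gamma2 <= 2, 0 < m0 & 0 <= m2]; last first.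
  exists 1; split=> // q2 g2 gamma3 g3 T f0 f hf0 hf e0 e2; exfalso; apply: no; split=> //.
    by rewrite -e0; exact: mass_gt0.
  by rewrite -e2; exact: energy_moment_ge0.
have [A A0 [c c0 D]] := binary_moment_dissipation hd hb2 theta_ge0 hb3 q2 g2 m00 m20.
exists (1 + `|generation_bound A c ((q - 2) / gamma2) m2|).
split=> [|_ _ gamma3 g3]; first by rewrite ltr_pwDl.
by apply: dissipates_generates (D _ g3) => //; case/andP: g2.
Qed.

Lemma ternary_generation (p : R * R * R * R) : exists K : R, 0 < K /\
  let: (q, gamma3, m0, m2) := p in 2 < q -> 0 < gamma3 <= 2 ->
  forall gamma2, gamma2 \in `[0, 2] -> generates gamma2 gamma3 gamma3 q m0 m2 K.
Proof.
case: p => [[[q gamma3] m0] m2].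
have [[q2 g3 m00 m20]|no] := pselect [/\ 2 < q, 0 < gamma3 <= 2, 0 < m0 & 0 <= m2]; last first.
  exists 1; split=> // q2 g2 gamma2 g3 T f0 f hf0 hf e0 e2; exfalso; apply: no; split=> //.
    by rewrite -e0; exact: mass_gt0.
  by rewrite -e2; exact: energy_moment_ge0.
have [A A0 [c c0 D]] := ternary_moment_dissipation hd hb2 theta_ge0 hb3 q2 g3 m00 m20.
exists (1 + `|generation_bound A c ((q - 2) / gamma3) m2|).
split=> [|_ _ gamma2 g2]; first by rewrite ltr_pwDl.
by apply: dissipates_generates (D _ g2) => //; case/andP: g3.
Qed.

(** The dissipation comes from the collisions with the larger exponent. *)
Lemma propagation_constant (p : R * R * R * R * R * R) : exists M : R, 0 < M /\
  let: (q, gamma2, gamma3, m0, m2, mq) := p in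
  2 < q -> gamma2 \in `[0, 2] -> gamma3 \in `[0, 2] -> 0 < Num.max gamma2 gamma3 ->
  forall (T : R) (f0 : V -> R) (f : R -> V -> R), 0 < T -> initial_datum f0 ->
  is_solution gamma2 b2 gamma3 theta phi T f0 f ->
  fine (moment 0 f0) = m0 -> fine (moment 2 f0) = m2 -> fine (moment q f0) = mq ->
  (moment q f0 < +oo)%E ->
  forall t, t \in `[0, T] -> (moment q (f t) <= M%:E)%E.
Proof.
case: p => [[[[[q gamma2] gamma3] m0] m2] mq].
have [[q2 g2 g3 mg m00]|no] := pselect [/\ 2 < q, gamma2 \in `[0, 2], gamma3 \in `[0, 2],
    0 < Num.max gamma2 gamma3 & 0 < m0 /\ 0 <= m2]; last first.
  exists 1; split=> // q2 g2 g3 mg T f0 f T0 hf0 hf e0 e2; exfalso; apply: no; split=> //.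
  split; first by rewrite -e0; exact: mass_gt0.
  by rewrite -e2; exact: energy_moment_ge0.
case: m00 => m00 m20.
have [gamma [A [c [gam0 A0 c0 D]]]] : exists gamma A c : R, [/\ 0 < gamma, 0 <= A, 0 < c &
    @dissipates R d b2 theta phi gamma q m0 m2 A c gamma2 gamma3].
  move: (g2) (g3); rewrite !in_itv/= => /andP[_ g22] /andP[_ g32].
  have [g32'|g23] := leP gamma3 gamma2.
    have gP : 0 < gamma2 <= 2 by rewrite g22 andbT; move: mg; rewrite max_l.
    have [A A0 [c c0 D]] := binary_moment_dissipation hd hb2 theta_ge0 hb3 q2 gP m00 m20.
    by exists gamma2, A, c; split=> //; [case/andP: gP|exact: D].
  have gP : 0 < gamma3 <= 2 by rewrite g32 andbT; move: mg; rewrite max_r// ltW.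
  have [A A0 [c c0 D]] := ternary_moment_dissipation hd hb2 theta_ge0 hb3 q2 gP m00 m20.
  by exists gamma3, A, c; split=> //; [case/andP: gP|exact: D].
exists (Num.max 1 (Num.max mq (propagation_bound A c ((q - 2) / gamma) m2))).
split=> [|_ _ _ _ T f0 f T0 hf0 hf e0 e2 eq fq t tT]; first by rewrite lt_max ltr01.
move: D; rewrite -e0 -e2 => D.
apply: le_trans (moment_propagation T0 hf0 hf gam0 q2 A0 c0 D tT fq) _.
by rewrite eq lee_fin le_max lexx orbT.
Qed.

End constants.

Theorem theorem2p6 (R : realType) (d : nat) (b2 : R -> R) (theta3 : R)
    (phi : R -> R) (hd : (2 <= d)%N) (hb2 : binary_kernel d b2)
    (htheta3 : 0 <= theta3) (hb3 : ternary_kernel d theta3 phi) :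
  (exists K2 K3 : R -> R -> R -> R -> R,
    (forall q gamma m0 m2, 0 < K2 q gamma m0 m2 /\ 0 < K3 q gamma m0 m2) /\
    forall (gamma2 gamma3 : R), gamma2 \in `[0, 2] -> gamma3 \in `[0, 2] ->
      0 < Num.max gamma2 gamma3 ->
    forall (T : R) (f0 : 'rV[R]_d -> R) (f : R -> 'rV[R]_d -> R), 0 < T ->
      initial_datum f0 ->
      is_solution gamma2 b2 gamma3 theta3 phi T f0 f ->
    forall q : R, 2 < q ->
    let m0 := fine (moment 0 f0) in
    let m2 := fine (moment 2 f0) in
    let K_2 := K2 q gamma2 m0 m2 in
    let K_3 := K3 q gamma3 m0 m2 in
    [/\ 0 < gamma2 -> forall t, t \in `]0, T] ->
          (moment q (f t) <=
            (K_2 * Num.max 1 (t `^ ((2 - q) / gamma2)))%:E)%E,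
        0 < gamma3 -> forall t, t \in `]0, T] ->
          (moment q (f t) <=
            (K_3 * Num.max 1 (t `^ ((2 - q) / gamma3)))%:E)%E &
        0 < gamma2 -> 0 < gamma3 -> forall t, t \in `]0, T] ->
          (moment q (f t) <=
            (Num.max K_2 K_3 *
             Num.max 1 (Num.min (t `^ ((2 - q) / gamma2))
                                (t `^ ((2 - q) / gamma3))))%:E)%E]) /\
  (exists M : R -> R -> R -> R -> R -> R -> R,
    (forall q gamma2 gamma3 m0 m2 mq, 0 < M q gamma2 gamma3 m0 m2 mq) /\
    forall (gamma2 gamma3 : R), gamma2 \in `[0, 2] -> gamma3 \in `[0, 2] ->
      0 < Num.max gamma2 gamma3 ->
    forall (T : R) (f0 : 'rV[R]_d -> R) (f : R -> 'rV[R]_d -> R), 0 < T ->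
      initial_datum f0 ->
      is_solution gamma2 b2 gamma3 theta3 phi T f0 f ->
    forall q : R, 2 < q -> (moment q f0 < +oo)%E ->
      (ereal_sup [set moment q (f t) | t in `[0%R, T]] <=
        (M q gamma2 gamma3 (fine (moment 0 f0)) (fine (moment 2 f0))
           (fine (moment q f0)))%:E)%E).
Proof.
split.
  have [K2 hK2] := choice (binary_generation hd hb2 htheta3 hb3).
  have [K3 hK3] := choice (ternary_generation hd hb2 htheta3 hb3).
  exists (fun q gamma m0 m2 => K2 (q, gamma, m0, m2)), (fun q gamma m0 m2 => K3 (q, gamma, m0, m2)).
  split=> [q gamma m0 m2|]; first by split; [exact: (hK2 _).1|exact: (hK3 _).1].
  move=> gamma2 gamma3 g2 g3 _ T f0 f T0 hf0 hf q q2 m0 m2 K_2 K_3.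
  have bound2 : 0 < gamma2 -> forall t, t \in `]0, T] ->
      (moment q (f t) <= (K_2 * Num.max 1 (t `^ ((2 - q) / gamma2)))%:E)%E.
    move=> g20; have gP : 0 < gamma2 <= 2 by move: g2; rewrite in_itv/= g20 => /andP[_ ->].
    exact: ((hK2 (q, gamma2, m0, m2)).2 q2 gP _ g3 T f0 f hf0 hf erefl erefl).
  have bound3 : 0 < gamma3 -> forall t, t \in `]0, T] ->
      (moment q (f t) <= (K_3 * Num.max 1 (t `^ ((2 - q) / gamma3)))%:E)%E.
    move=> g30; have gP : 0 < gamma3 <= 2 by move: g3; rewrite in_itv/= g30 => /andP[_ ->].
    exact: ((hK3 (q, gamma3, m0, m2)).2 q2 gP _ g2 T f0 f hf0 hf erefl erefl).
  split=> // g20 g30 t tT.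
  have max1 (x : R) : 0 <= Num.max 1 x by rewrite le_max ler01.
  have [xy|yx] := leP (t `^ ((2 - q) / gamma2)) (t `^ ((2 - q) / gamma3)).
    apply: le_trans (bound2 g20 t tT) _.
    by rewrite lee_fin ler_wpM2r// le_max lexx.
  apply: le_trans (bound3 g30 t tT) _.
  by rewrite lee_fin ler_wpM2r// le_max lexx orbT.
have [M hM] := choice (propagation_constant hd hb2 htheta3 hb3).
exists (fun q gamma2 gamma3 m0 m2 mq => M (q, gamma2, gamma3, m0, m2, mq)).
split=> [q gamma2 gamma3 m0 m2 mq|]; first exact: (hM _).1.
move=> gamma2 gamma3 g2 g3 g0 T f0 f T0 hf0 hf q q2 fq.
apply: ge_ereal_sup => _ [t tT <-].
exact: ((hM (q, gamma2, gamma3, _, _, _)).2 q2 g2 g3 g0 T f0 f T0 hf0 hf erefl erefl erefl fq t tT).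
Qed.
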